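(* Let $f : X \to Y$ be a morphism of schemes. Then $f$ has the Henselian lifting property if and only if $f$ is weakly étale.
   Context: A morphism of schemes $f : X \to Y$ is weakly étale if $f$ is flat and its diagonal $\Delta_f : X \to X \times_Y X$ is flat. A morphism of schemes $f : X \to Y$ has the Henselian lifting property if for every Henselian pair $(A, I)$ and all morphisms $a : \mathrm{Spec}(A/I) \to X$ and $b : \mathrm{Spec}(A) \to Y$ such that $f \circ a = b \circ i$, where $i : \mathrm{Spec}(A/I) \to \mathrm{Spec}(A)$ is the canonical closed immersion, there exists a unique morphism $c : \mathrm{Spec}(A) \to X$ with $f \circ c = b$ and $c \circ i = a$. *)

(* Defs.v *)
From HB Require Import structures.
From mathcomp Require Import all_boot all_order all_algebra.
From mathcomp Require Import all_classical topology_structure.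
From mathcomp Require Import ring.

Set Implicit Arguments.
Unset Strict Implicit.
Unset Printing Implicit Defensive.

Import GRing.Theory.
Local Open Scope classical_set_scope.
Local Open Scope ring_scope.

(* Rings are commutative with unit and may be zero ([comPzRingType]), since   *)
(* sections of a structure sheaf over the empty set form the zero ring.       *)

Lemma sval_inj (T : Type) (P : T -> Prop) (x y : {z | P z}) :
  sval x = sval y -> x = y.
Proof. by case: x y => [x px] [y py] /= e; apply: eq_exist. Qed.

Record ideal (A : comPzRingType) := Ideal {
  ideal_set :> A -> Prop;
  ideal0 : ideal_set 0;
  idealD : forall x y, ideal_set x -> ideal_set y -> ideal_set (x + y);
  idealMl : forall a x, ideal_set x -> ideal_set (a * x) }.

Lemma ideal_ext (A : comPzRingType) (I J : ideal A) :
  I `<=` J -> J `<=` I -> I = J.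
Proof.
case: I J => [I i0 iD iM] [J j0 jD jM] /= IJ JI.
have e : I = J by apply/seteqP.
subst J; congr Ideal; exact: Prop_irrelevance.
Qed.

Section IdealTheory.
Context (A : comPzRingType) (I : ideal A).

Lemma idealMr a x : I x -> I (x * a).
Proof. by rewrite mulrC; apply: idealMl. Qed.

Lemma idealN x : I x -> I (- x).
Proof. by rewrite -mulN1r; apply: idealMl. Qed.

End IdealTheory.

Definition prime_ideal (A : comPzRingType) (I : ideal A) : Prop :=
  ~ I 1 /\ forall a b, I (a * b) -> I a \/ I b.

Definition maximal_ideal (A : comPzRingType) (I : ideal A) : Prop :=
  ~ I 1 /\ forall J : ideal A, I `<=` J -> ~ J 1 -> J `<=` I.

Definition local_ring (A : comPzRingType) : Prop :=
  exists! m : ideal A, maximal_ideal m.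

(* Only meant for local rings, where [m] and [n] are unique. *)
Definition local_hom (A B : comPzRingType) (phi : {rmorphism A -> B}) : Prop :=
  forall (m : ideal A) (n : ideal B),
    maximal_ideal m -> maximal_ideal n -> forall a, m a -> n (phi a).

Definition jacobson_radical (A : comPzRingType) : set A :=
  [set x | forall m : ideal A, maximal_ideal m -> m x].

Lemma nonunits_maximal (A : comPzRingType) (m : ideal A) :
    ~ m 1 -> (forall x, ~ m x -> exists y, x * y = 1) ->
  maximal_ideal m /\ (forall n : ideal A, maximal_ideal n -> m = n).
Proof.
move=> m1 mU.
have sub (J : ideal A) : ~ J 1 -> J `<=` m.
  move=> J1 x Jx; apply: contrapT => /mU[y xy1]; apply: J1.
  by rewrite -xy1; apply: idealMr.
split=> [|n [n1 nmax]]; first by split=> // J _; apply: sub.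
by apply: ideal_ext; [apply: nmax => //; apply: sub | apply: sub].
Qed.

Section IdealPreimage.
Context (A B : comPzRingType) (phi : {rmorphism A -> B}) (I : ideal B).

Definition ideal_preimage : ideal A.
Proof.
refine (@Ideal A [set a | I (phi a)] _ _ _) => /=.
- by rewrite rmorph0; apply: ideal0.
- by move=> x y; rewrite rmorphD; apply: idealD.
- by move=> a x; rewrite rmorphM; apply: idealMl.
Defined.

End IdealPreimage.

Record setoid_ring := SetoidRing {
  sr_car :> Type;
  sr_eq : sr_car -> sr_car -> Prop;
  sr_refl : forall x, sr_eq x x;
  sr_sym : forall x y, sr_eq x y -> sr_eq y x;
  sr_trans : forall x y z, sr_eq x y -> sr_eq y z -> sr_eq x z;
  sr_zero : sr_car;
  sr_one : sr_car;
  sr_opp : sr_car -> sr_car;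
  sr_add : sr_car -> sr_car -> sr_car;
  sr_mul : sr_car -> sr_car -> sr_car;
  sr_opp_congr : forall x x', sr_eq x x' -> sr_eq (sr_opp x) (sr_opp x');
  sr_add_congr : forall x x' y y',
    sr_eq x x' -> sr_eq y y' -> sr_eq (sr_add x y) (sr_add x' y');
  sr_mul_congr : forall x x' y y',
    sr_eq x x' -> sr_eq y y' -> sr_eq (sr_mul x y) (sr_mul x' y');
  sr_addA : forall x y z,
    sr_eq (sr_add x (sr_add y z)) (sr_add (sr_add x y) z);
  sr_addC : forall x y, sr_eq (sr_add x y) (sr_add y x);
  sr_add0 : forall x, sr_eq (sr_add sr_zero x) x;
  sr_addN : forall x, sr_eq (sr_add (sr_opp x) x) sr_zero;
  sr_mulA : forall x y z,
    sr_eq (sr_mul x (sr_mul y z)) (sr_mul (sr_mul x y) z);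
  sr_mulC : forall x y, sr_eq (sr_mul x y) (sr_mul y x);
  sr_mul1 : forall x, sr_eq (sr_mul sr_one x) x;
  sr_mulDl : forall x y z,
    sr_eq (sr_mul (sr_add x y) z) (sr_add (sr_mul x z) (sr_mul y z)) }.

(* The set of equivalence classes of [S]. *)
Definition quo (S : setoid_ring) : Type :=
  {P : set S | exists x, P = sr_eq x}.

HB.instance Definition _ (S : setoid_ring) := gen_eqMixin (quo S).
HB.instance Definition _ (S : setoid_ring) := gen_choiceMixin (quo S).

Section Quotient.
Context (S : setoid_ring).

Definition class (x : S) : quo S := exist _ (sr_eq x) (ex_intro _ x erefl).

Definition repr (c : quo S) : S := projT1 (cid (svalP c)).

Lemma classP (x y : S) : class x = class y <-> sr_eq x y.
Proof.
split=> [/(congr1 sval) /= ->|xy]; first exact: sr_refl.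
apply: sval_inj => /=; apply/seteqP; split=> z /= h.
- exact: sr_trans (sr_sym xy) h.
- exact: sr_trans xy h.
Qed.

Lemma reprK c : class (repr c) = c.
Proof. by apply: sval_inj; rewrite /= /repr; case: cid. Qed.

Lemma repr_class x : sr_eq (repr (class x)) x.
Proof. by apply/classP; rewrite reprK. Qed.

Lemma quo_ind (P : quo S -> Prop) : (forall x, P (class x)) -> forall c, P c.
Proof. by move=> h c; rewrite -(reprK c). Qed.

Definition quo_opp c := class (sr_opp (repr c)).
Definition quo_add c d := class (sr_add (repr c) (repr d)).
Definition quo_mul c d := class (sr_mul (repr c) (repr d)).

Lemma quo_oppE x : quo_opp (class x) = class (sr_opp x).
Proof. by apply/classP/sr_opp_congr/repr_class. Qed.

Lemma quo_addE x y : quo_add (class x) (class y) = class (sr_add x y).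
Proof. by apply/classP/sr_add_congr; apply: repr_class. Qed.

Lemma quo_mulE x y : quo_mul (class x) (class y) = class (sr_mul x y).
Proof. by apply/classP/sr_mul_congr; apply: repr_class. Qed.

Fact quo_addA : associative quo_add.
Proof.
elim/quo_ind=> x; elim/quo_ind=> y; elim/quo_ind=> z.
by rewrite !quo_addE; apply/classP/sr_addA.
Qed.

Fact quo_addC : commutative quo_add.
Proof.
by elim/quo_ind=> x; elim/quo_ind=> y; rewrite !quo_addE; apply/classP/sr_addC.
Qed.

Fact quo_add0 : left_id (class (sr_zero S)) quo_add.
Proof. by elim/quo_ind=> x; rewrite quo_addE; apply/classP/sr_add0. Qed.

Fact quo_addN : left_inverse (class (sr_zero S)) quo_opp quo_add.
Proof.
by elim/quo_ind=> x; rewrite quo_oppE quo_addE; apply/classP/sr_addN.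
Qed.

HB.instance Definition _ :=
  GRing.isZmodule.Build (quo S) quo_addA quo_addC quo_add0 quo_addN.

Fact quo_mulA : associative quo_mul.
Proof.
elim/quo_ind=> x; elim/quo_ind=> y; elim/quo_ind=> z.
by rewrite !quo_mulE; apply/classP/sr_mulA.
Qed.

Fact quo_mulC : commutative quo_mul.
Proof.
by elim/quo_ind=> x; elim/quo_ind=> y; rewrite !quo_mulE; apply/classP/sr_mulC.
Qed.

Fact quo_mul1 : left_id (class (sr_one S)) quo_mul.
Proof. by elim/quo_ind=> x; rewrite quo_mulE; apply/classP/sr_mul1. Qed.

Fact quo_mulDl : left_distributive quo_mul quo_add.
Proof.
elim/quo_ind=> x; elim/quo_ind=> y; elim/quo_ind=> z.
by rewrite quo_addE !quo_mulE quo_addE; apply/classP/sr_mulDl.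
Qed.

HB.instance Definition _ := GRing.Zmodule_isComPzRing.Build (quo S)
  quo_mulA quo_mulC quo_mul1 quo_mulDl.

Lemma class0 : class (sr_zero S) = 0. Proof. by []. Qed.
Lemma class1 : class (sr_one S) = 1. Proof. by []. Qed.
Lemma classN x : class (sr_opp x) = - class x.
Proof. by rewrite -quo_oppE. Qed.
Lemma classD x y : class (sr_add x y) = class x + class y.
Proof. by rewrite -quo_addE. Qed.
Lemma classM x y : class (sr_mul x y) = class x * class y.
Proof. by rewrite -quo_mulE. Qed.

End Quotient.

Section QuotientLift.
Context (S : setoid_ring) (R : comPzRingType) (h : S -> R).
Hypothesis h_congr : forall x y, sr_eq x y -> h x = h y.
Hypothesis h1 : h (sr_one S) = 1.
Hypothesis hN : forall x, h (sr_opp x) = - h x.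
Hypothesis hD : forall x y, h (sr_add x y) = h x + h y.
Hypothesis hM : forall x y, h (sr_mul x y) = h x * h y.

Definition quo_lift_fun (c : quo S) : R := h (repr c).

Lemma quo_lift_funE x : quo_lift_fun (class x) = h x.
Proof. exact/h_congr/repr_class. Qed.

Fact quo_lift_zmod : zmod_morphism quo_lift_fun.
Proof.
elim/quo_ind=> x; elim/quo_ind=> y.
by rewrite -classN -classD !quo_lift_funE hD hN.
Qed.

Fact quo_lift_monoid : monoid_morphism quo_lift_fun.
Proof.
split; first by rewrite -class1 quo_lift_funE.
by elim/quo_ind=> x; elim/quo_ind=> y; rewrite -classM !quo_lift_funE hM.
Qed.

HB.instance Definition _ := GRing.isZmodMorphism.Build (quo S) R
  quo_lift_fun quo_lift_zmod.
HB.instance Definition _ := GRing.isMonoidMorphism.Build (quo S) R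
  quo_lift_fun quo_lift_monoid.

Definition quo_lift : {rmorphism quo S -> R} := quo_lift_fun.

Lemma quo_liftE x : quo_lift (class x) = h x.
Proof. exact: quo_lift_funE. Qed.

End QuotientLift.

Section QuotientRing.
Context (A : comPzRingType) (I : ideal A).

Lemma ideal_subr_eq a b : a = b -> I (a - b).
Proof. by move=> ->; rewrite subrr; apply: ideal0. Qed.

Definition quotient_setoid : setoid_ring.
Proof.
refine (@SetoidRing A (fun x y => I (x - y)) _ _ _ 0 1 -%R +%R *%R
  _ _ _ _ _ _ _ _ _ _ _); try by move=> *; apply: ideal_subr_eq; ring.
- by move=> x y xy; rewrite -opprB; apply: idealN.
- by move=> x y z xy yz; rewrite -(subrKA y); apply: idealD.
- by move=> x x' xx'; rewrite -opprD; apply: idealN.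
- by move=> x x' y y' xx' yy'; rewrite opprD addrACA; apply: idealD.
- move=> x x' y y' xx' yy'.
  have -> : x * y - x' * y' = y * (x - x') + x' * (y - y') by ring.
  by apply: idealD; apply: idealMl.
Defined.

Definition quotient_ring : comPzRingType := quo quotient_setoid.

Definition quotient_proj_fun (a : A) : quotient_ring :=
  @class quotient_setoid a.

Fact quotient_proj_zmod : zmod_morphism quotient_proj_fun.
Proof. by move=> a b; rewrite /quotient_proj_fun -classN -classD. Qed.

Fact quotient_proj_monoid : monoid_morphism quotient_proj_fun.
Proof. by split=> // a b; rewrite /quotient_proj_fun -classM. Qed.

HB.instance Definition _ := GRing.isZmodMorphism.Build A quotient_ring
  quotient_proj_fun quotient_proj_zmod.
HB.instance Definition _ := GRing.isMonoidMorphism.Build A quotient_ring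
  quotient_proj_fun quotient_proj_monoid.

Definition quotient_proj : {rmorphism A -> quotient_ring} := quotient_proj_fun.

End QuotientRing.

(* [{poly A}] requires a nonzero ring, so a polynomial over a possibly zero   *)
(* ring is given by its coefficient sequence.                                 *)
Section Polynomials.
Context (A : comPzRingType).
Implicit Types f g : nat -> A.

Definition is_poly f : Prop := exists d, forall n, (d < n)%N -> f n = 0.

Definition monic_poly f : Prop :=
  exists d, f d = 1 /\ forall n, (d < n)%N -> f n = 0.

Definition poly_mul f g : nat -> A :=
  fun n => \sum_(i < n.+1) f i * g (n - i)%N.

Definition poly_add f g : nat -> A := fun n => f n + g n.

Definition poly_one : nat -> A := fun n => if n is 0 then 1 else 0.

Definition poly_comaximal f g : Prop :=
  exists u v, [/\ is_poly u, is_poly v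
                & poly_add (poly_mul u f) (poly_mul v g) = poly_one].

End Polynomials.

(* [I] lies in the Jacobson radical, and factorizations modulo [I] of monic   *)
(* polynomials into monic comaximal factors lift to monic factorizations.     *)
Definition henselian_pair (A : comPzRingType) (I : ideal A) : Prop :=
  I `<=` @jacobson_radical A /\
  forall (f : nat -> A) (g0 h0 : nat -> quotient_ring I),
    monic_poly f -> monic_poly g0 -> monic_poly h0 ->
    quotient_proj I \o f = poly_mul g0 h0 -> poly_comaximal g0 h0 ->
    exists g h : nat -> A,
      [/\ monic_poly g, monic_poly h, f = poly_mul g h,
          quotient_proj I \o g = g0 & quotient_proj I \o h = h0].

(* A sequence [:: (m1, n1); ...; (mk, nk)] stands for the element             *)
(* m1 (x) n1 + ... + mk (x) nk of M (x)_A N; [tensor_eq] is equality in       *)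
(* M (x)_A N, i.e. the additive congruence generated by the tensor relations. *)
Inductive tensor_eq (A : comPzRingType) (M N : lmodType A) :
    seq (M * N) -> seq (M * N) -> Prop :=
| tensor_refl s : tensor_eq s s
| tensor_sym s t : tensor_eq s t -> tensor_eq t s
| tensor_trans s t u : tensor_eq s t -> tensor_eq t u -> tensor_eq s u
| tensor_cat s s' t t' :
    tensor_eq s s' -> tensor_eq t t' -> tensor_eq (s ++ t) (s' ++ t')
| tensor_catC s t : tensor_eq (s ++ t) (t ++ s)
| tensor_0l n : tensor_eq [:: (0, n)] [::]
| tensor_Dl m m' n : tensor_eq [:: (m + m', n)] [:: (m, n); (m', n)]
| tensor_Dr m n n' : tensor_eq [:: (m, n + n')] [:: (m, n); (m, n')]
| tensor_Z a m n : tensor_eq [:: (a *: m, n)] [:: (m, a *: n)].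

Definition tensor_map (A : comPzRingType) (M N N' : lmodType A)
    (g : {linear N -> N'}) (s : seq (M * N)) : seq (M * N') :=
  [seq (mn.1, g mn.2) | mn <- s].

(* Tensoring with [M] preserves exactness of N1 -> N2 -> N3.                   *)
Definition flat_module (A : comPzRingType) (M : lmodType A) : Prop :=
  forall (N1 N2 N3 : lmodType A)
         (g : {linear N1 -> N2}) (h : {linear N2 -> N3}),
    (forall y, h y = 0 <-> exists x, g x = y) ->
    forall t : seq (M * N2),
      tensor_eq (tensor_map h t) [::] <->
      exists s : seq (M * N1), tensor_eq (tensor_map g s) t.

Definition scalar_restriction (A B : comPzRingType) (phi : {rmorphism A -> B})
  : Type := B.

Section ScalarRestriction.
Context (A B : comPzRingType) (phi : {rmorphism A -> B}).

HB.instance Definition _ := GRing.Zmodule.on (scalar_restriction phi).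

Definition restriction_scale (a : A) (b : scalar_restriction phi)
  : scalar_restriction phi := phi a * (b : B).

Fact restriction_scaleA a b v :
  restriction_scale a (restriction_scale b v) = restriction_scale (a * b) v.
Proof. by rewrite /restriction_scale rmorphM mulrA. Qed.

Fact restriction_scale1 : left_id 1 restriction_scale.
Proof. by move=> v; rewrite /restriction_scale rmorph1 mul1r. Qed.

Fact restriction_scaleDr : right_distributive restriction_scale +%R.
Proof. by move=> a u v; apply: mulrDr. Qed.

Fact restriction_scaleDl v :
  {morph restriction_scale^~ v : a b / a + b >-> a + b}.
Proof. by move=> a b; rewrite /restriction_scale rmorphD; apply: mulrDl. Qed.

HB.instance Definition _ :=
  GRing.Zmodule_isLmodule.Build A (scalar_restriction phi)
    restriction_scaleA restriction_scale1
    restriction_scaleDr restriction_scaleDl.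

End ScalarRestriction.

Definition flat_hom (A B : comPzRingType) (phi : {rmorphism A -> B}) : Prop :=
  flat_module (scalar_restriction phi).

Record opens (X : topologicalType) := Opens {
  opens_set :> X -> Prop;
  opens_open : open (opens_set : set X) }.

Lemma opens_nbhs (X : topologicalType) (U : opens X) x : U x -> nbhs x U.
Proof. by move=> Ux; apply: open_nbhs_nbhs; split=> //; apply: opens_open. Qed.

Definition opensT (X : topologicalType) : opens X := Opens (@openT X).

Definition opensI (X : topologicalType) (U V : opens X) : opens X :=
  Opens (openI (opens_open U) (opens_open V)).

Lemma opensI_l (X : topologicalType) (U V : opens X) : opensI U V `<=` U.
Proof. by move=> x []. Qed.

Lemma opensI_r (X : topologicalType) (U V : opens X) : opensI U V `<=` V.
Proof. by move=> x []. Qed.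

Definition opens_preimage (X Y : topologicalType) (f : X -> Y)
    (cf : continuous f) (V : opens Y) : opens X :=
  Opens ((continuousP f).1 cf _ (opens_open V)).

(* [sec_separated] and [sec_glue] are the sheaf axioms for open coverings.    *)
Record ringed_space := RingedSpace {
  rs_space :> topologicalType;
  sec : opens rs_space -> comPzRingType;
  res : forall U V : opens rs_space, V `<=` U -> {rmorphism sec U -> sec V};
  res_id : forall (U : opens rs_space) (UU : U `<=` U) (s : sec U), res UU s = s;
  res_comp : forall (U V W : opens rs_space)
      (VU : V `<=` U) (WV : W `<=` V) (WU : W `<=` U)
    (s : sec U), res WV (res VU s) = res WU s;
  sec_separated : forall (U : opens rs_space) (J : Type)
      (V : J -> opens rs_space) (VU : forall j, V j `<=` U),
    U `<=` \bigcup_j V j ->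
    forall s t : sec U, (forall j, res (VU j) s = res (VU j) t) -> s = t;
  sec_glue : forall (U : opens rs_space) (J : Type)
      (V : J -> opens rs_space) (VU : forall j, V j `<=` U),
    U `<=` \bigcup_j V j ->
    forall s : forall j, sec (V j),
      (forall i j (Wi : opensI (V i) (V j) `<=` V i)
                  (Wj : opensI (V i) (V j) `<=` V j),
         res Wi (s i) = res Wj (s j)) ->
      exists t : sec U, forall j, res (VU j) t = s j }.

Arguments sec : clear implicits.

Lemma res_irr (X : ringed_space) (U V : opens X) (h h' : V `<=` U)
  (s : sec X U) : res h s = res h' s.
Proof. by rewrite (Prop_irrelevance h h'). Qed.

Lemma res_res (X : ringed_space) (U V W : opens X) (VU : V `<=` U)
    (WV : W `<=` V) (s : sec X U) :
  res WV (res VU s) = res (fun x Wx => VU x (WV x Wx)) s.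
Proof. exact: res_comp. Qed.

Section Stalk.
Context (X : ringed_space) (x : X).

Record pregerm := PreGerm {
  pg_dom : opens X;
  pg_mem : pg_dom x;
  pg_sec : sec X pg_dom }.

(* Germs, i.e. the colimit of the sections over the neighbourhoods of [x].    *)
Definition pregerm_eq (s t : pregerm) : Prop :=
  exists (W : opens X) (Ws : W `<=` pg_dom s) (Wt : W `<=` pg_dom t),
    W x /\ res Ws (pg_sec s) = res Wt (pg_sec t).

Definition pregerm_op2 (op : forall U, sec X U -> sec X U -> sec X U)
    (s t : pregerm) : pregerm :=
  @PreGerm (opensI (pg_dom s) (pg_dom t)) (conj (pg_mem s) (pg_mem t))
    (op _ (res (@opensI_l _ (pg_dom s) (pg_dom t)) (pg_sec s))
          (res (@opensI_r _ (pg_dom s) (pg_dom t)) (pg_sec t))).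

Lemma pregerm_eq_refl s : pregerm_eq s s.
Proof.
exists (pg_dom s), (@subset_refl _ _), (@subset_refl _ _).
by split=> //; apply: pg_mem.
Qed.

Lemma pregerm_eq_sym s t : pregerm_eq s t -> pregerm_eq t s.
Proof. by move=> [W [Ws [Wt [Wx e]]]]; exists W, Wt, Ws. Qed.

Lemma pregerm_eq_trans s t u :
  pregerm_eq s t -> pregerm_eq t u -> pregerm_eq s u.
Proof.
move=> [W [Ws [Wt [Wx e]]]] [W' [Wt' [Wu [Wx' e']]]].
pose V := opensI W W'.
have VW : V `<=` W by move=> y [].
have VW' : V `<=` W' by move=> y [].
have Vs : V `<=` pg_dom s by move=> y [/Ws].
have Vu : V `<=` pg_dom u by move=> y [_ /Wu].
exists V, Vs, Vu; split=> //.
have Vt : V `<=` pg_dom t by move=> y [/Wt].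
rewrite -(res_comp Ws VW Vs) e (res_comp Wt VW Vt).
by rewrite -(res_comp Wt' VW' Vt) e' (res_comp Wu VW' Vu).
Qed.

Lemma pregerm_op2_congr op
    (op_res : forall (U V : opens X) (VU : V `<=` U) (a b : sec X U),
      res VU (op U a b) = op V (res VU a) (res VU b)) s s' t t' :
  pregerm_eq s s' -> pregerm_eq t t' ->
  pregerm_eq (pregerm_op2 op s t) (pregerm_op2 op s' t').
Proof.
move=> [W [Ws [Wt [Wx e]]]] [W' [Ws' [Wt' [Wx' e']]]].
have h : opensI W W' `<=` opensI (pg_dom s) (pg_dom t).
  by move=> y [wy wy']; split; [exact: (Ws _ wy)|exact: (Ws' _ wy')].
have h' : opensI W W' `<=` opensI (pg_dom s') (pg_dom t').
  by move=> y [wy wy']; split; [exact: (Wt _ wy)|exact: (Wt' _ wy')].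
have VW : opensI W W' `<=` W by move=> y [].
have VW' : opensI W W' `<=` W' by move=> y [].
exists (opensI W W'), h, h'; split=> //=.
rewrite !op_res !res_res; congr op.
- have := congr1 (res VW) e; rewrite !res_res => e2.
  by rewrite (res_irr _ (fun y h => Ws y (VW y h))) e2; apply: res_irr.
- have := congr1 (res VW') e'; rewrite !res_res => e2.
  by rewrite (res_irr _ (fun y h => Ws' y (VW' y h))) e2; apply: res_irr.
Qed.

Lemma pregerm_eqI s t (st : pg_dom s `<=` pg_dom t) :
  res st (pg_sec t) = pg_sec s -> pregerm_eq s t.
Proof.
move=> e; exists (pg_dom s), (@subset_refl _ _), st.
by split; [apply: pg_mem | rewrite res_id e].
Qed.

Lemma assoc_sub (U V W : opens X) :
  opensI U (opensI V W) `<=` opensI (opensI U V) W.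
Proof. by move=> y [? []]. Qed.

Lemma comm_sub (U V : opens X) : opensI U V `<=` opensI V U.
Proof. by move=> y []. Qed.

Lemma dist_sub (U V W : opens X) :
  opensI (opensI U V) W `<=` opensI (opensI U W) (opensI V W).
Proof. by move=> y [[]]. Qed.

Definition stalk_setoid : setoid_ring.
Proof.
refine (@SetoidRing pregerm pregerm_eq pregerm_eq_refl pregerm_eq_sym
  pregerm_eq_trans (@PreGerm (opensT X) I 0) (@PreGerm (opensT X) I 1)
  (fun s => @PreGerm (pg_dom s) (pg_mem s) (- pg_sec s))
  (pregerm_op2 (fun U a b => a + b)) (pregerm_op2 (fun U a b => a * b))
  _ _ _ _ _ _ _ _ _ _ _).
- move=> s s' [W [Ws [Wt [Wx e]]]]; exists W, Ws, Wt; split=> //=.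
  by rewrite !rmorphN e.
- by apply: pregerm_op2_congr => U V VU a b; rewrite rmorphD.
- by apply: pregerm_op2_congr => U V VU a b; rewrite rmorphM.
- move=> s t u.
  unshelve eapply pregerm_eqI; first exact: assoc_sub.
  by rewrite /= !rmorphD /= !res_res addrA; congr (_ + _ + _); apply: res_irr.
- move=> s t; unshelve eapply pregerm_eqI; first exact: comm_sub.
  by rewrite /= !rmorphD /= !res_res addrC; congr (_ + _); apply: res_irr.
- move=> s; unshelve eapply pregerm_eqI; first exact: opensI_r.
  by rewrite /= rmorph0 add0r; apply: res_irr.
- move=> s; apply: (@pregerm_eqI _ (@PreGerm (opensT X) I 0)
                      (@subsetT _ _)) => /=.
  by rewrite rmorph0 rmorphN (res_irr _ (@opensI_r _ _ _)) addNr.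
- move=> s t u.
  unshelve eapply pregerm_eqI; first exact: assoc_sub.
  by rewrite /= !rmorphM /= !res_res mulrA; congr (_ * _ * _); apply: res_irr.
- move=> s t; unshelve eapply pregerm_eqI; first exact: comm_sub.
  by rewrite /= !rmorphM /= !res_res mulrC; congr (_ * _); apply: res_irr.
- move=> s; unshelve eapply pregerm_eqI; first exact: opensI_r.
  by rewrite /= rmorph1 mul1r; apply: res_irr.
- move=> s t u.
  unshelve eapply pregerm_eqI; first exact: dist_sub.
  rewrite /= !rmorphM !rmorphD !rmorphM /= !res_res mulrDl.
  by congr (_ * _ + _ * _); apply: res_irr.
Defined.

Definition stalk : comPzRingType := quo stalk_setoid.

Definition germ (U : opens X) (Ux : U x) (s : sec X U) : stalk :=
  @class stalk_setoid (@PreGerm U Ux s).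

Lemma germ_eq (U V : opens X) (Ux : U x) (Vx : V x)
    (s : sec X U) (t : sec X V) :
  germ Ux s = germ Vx t <->
  exists (W : opens X) (WU : W `<=` U) (WV : W `<=` V),
    W x /\ res WU s = res WV t.
Proof. exact: classP. Qed.

Lemma germ_ind (P : stalk -> Prop) :
  (forall U Ux s, P (@germ U Ux s)) -> forall a, P a.
Proof. by move=> h; elim/quo_ind=> -[]. Qed.

Lemma germ_res (U V : opens X) (VU : V `<=` U) (Ux : U x) (Vx : V x)
  (s : sec X U) : germ Vx (res VU s) = germ Ux s.
Proof.
apply/germ_eq; exists V, (@subset_refl _ _), VU; split=> //.
by rewrite res_id.
Qed.

Lemma germ_mul (U : opens X) (Ux : U x) (s t : sec X U) :
  germ Ux s * germ Ux t = germ Ux (s * t).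
Proof.
rewrite /germ -classM; apply/classP.
unshelve eapply pregerm_eqI; first exact: opensI_l.
by rewrite /= rmorphM; congr (_ * _); apply: res_irr.
Qed.

Lemma germ_one (U : opens X) (Ux : U x) : germ Ux 1 = 1.
Proof.
rewrite -class1; apply/classP.
unshelve eapply pregerm_eqI; first exact: subsetT.
by rewrite /= rmorph1.
Qed.

End Stalk.

(* Leibniz equality of morphisms is the intended one: with proof irrelevance  *)
(* and function extensionality it means equality of the underlying maps and   *)
(* of the maps on sections.                                                   *)
Record rs_mor (X Y : ringed_space) := RsMor {
  rs_fun :> X -> Y;
  rs_cts : continuous rs_fun;
  rs_sharp : forall V : opens Y,
    {rmorphism sec Y V -> sec X (opens_preimage rs_cts V)};
  rs_sharp_res : forall (V W : opens Y) (WV : W `<=` V)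
      (WV' : opens_preimage rs_cts W `<=` opens_preimage rs_cts V)
      (s : sec Y V),
    rs_sharp W (res WV s) = res WV' (rs_sharp V s) }.

Arguments rs_cts {X Y} r.

Lemma rs_sharpR (X Y : ringed_space) (f : rs_mor X Y) (V W : opens Y)
    (WV : W `<=` V) (s : sec Y V) :
  rs_sharp f W (res WV s) =
  @res X (opens_preimage (rs_cts f) V) (opens_preimage (rs_cts f) W)
    (fun x Wx => WV (f x) Wx) (rs_sharp f V s).
Proof. exact: rs_sharp_res. Qed.

Section StalkMap.
Context (X Y : ringed_space) (f : rs_mor X Y) (x : X).

Definition pregerm_map (s : pregerm (f x)) : stalk x :=
  @germ X x (opens_preimage (rs_cts f) (pg_dom s)) (pg_mem s)
    (rs_sharp f _ (pg_sec s)).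

Fact pregerm_map_congr s t : pregerm_eq s t -> pregerm_map s = pregerm_map t.
Proof.
move=> [W [Ws [Wt [Wx e]]]]; apply/germ_eq.
have Ws' : opens_preimage (rs_cts f) W `<=` opens_preimage (rs_cts f) (pg_dom s).
  by move=> y; apply: Ws.
have Wt' : opens_preimage (rs_cts f) W `<=` opens_preimage (rs_cts f) (pg_dom t).
  by move=> y; apply: Wt.
exists (opens_preimage (rs_cts f) W), Ws', Wt'; split=> //.
by rewrite -!rs_sharp_res e.
Qed.

Fact pregerm_map1 : pregerm_map (sr_one (stalk_setoid (f x))) = 1.
Proof. by rewrite /pregerm_map /= rmorph1 germ_one. Qed.

Fact pregerm_mapN s :
  pregerm_map (sr_opp (s : stalk_setoid (f x))) = - pregerm_map s.
Proof. by rewrite /pregerm_map /= rmorphN /germ -classN. Qed.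

Fact pregerm_mapD s t :
  pregerm_map (sr_add (s : stalk_setoid (f x)) t) =
  pregerm_map s + pregerm_map t.
Proof.
rewrite -[sr_add _ _]/(pregerm_op2 (fun U a b => a + b) s t).
rewrite /pregerm_map /= rmorphD /germ -classD; apply/classP.
unshelve eapply pregerm_eqI; first by move=> y.
by rewrite /= !rs_sharpR rmorphD /= !res_res; congr (_ + _); apply: res_irr.
Qed.

Fact pregerm_mapM s t :
  pregerm_map (sr_mul (s : stalk_setoid (f x)) t) =
  pregerm_map s * pregerm_map t.
Proof.
rewrite -[sr_mul _ _]/(pregerm_op2 (fun U a b => a * b) s t).
rewrite /pregerm_map /= rmorphM /germ -classM; apply/classP.
unshelve eapply pregerm_eqI; first by move=> y.
by rewrite /= !rs_sharpR rmorphM /= !res_res; congr (_ * _); apply: res_irr.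
Qed.

Definition stalk_map : {rmorphism stalk (f x) -> stalk x} :=
  @quo_lift (stalk_setoid (f x)) _ pregerm_map pregerm_map_congr
    pregerm_map1 pregerm_mapN pregerm_mapD pregerm_mapM.

Lemma stalk_map_germ (V : opens Y) (Vfx : V (f x)) (s : sec Y V) :
  stalk_map (germ Vfx s) =
  @germ X x (opens_preimage (rs_cts f) V) Vfx (rs_sharp f V s).
Proof. by rewrite /stalk_map quo_liftE. Qed.

End StalkMap.

Section RsId.
Context (X : ringed_space).

Lemma id_continuous : continuous (fun x : X => x).
Proof. by move=> x U. Qed.

Lemma id_sub (V : opens X) : opens_preimage id_continuous V `<=` V.
Proof. by []. Qed.

Fact rs_id_res (V W : opens X) (WV : W `<=` V)
    (WV' : opens_preimage id_continuous W `<=` opens_preimage id_continuous V)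
    (s : sec X V) :
  res (@id_sub W) (res WV s) = res WV' (res (@id_sub V) s).
Proof. by rewrite !res_res; apply: res_irr. Qed.

Definition rs_id : rs_mor X X :=
  @RsMor X X (fun x => x) id_continuous (fun V => res (@id_sub V)) rs_id_res.

End RsId.

Section RsComp.
Context (X Y Z : ringed_space) (g : rs_mor Y Z) (f : rs_mor X Y).

Lemma comp_continuous : continuous (fun x => g (f x)).
Proof. by move=> x; apply: continuous_comp; apply: rs_cts. Qed.

(* (g \o f)^-1 V and f^-1 (g^-1 V) have the same points, but their proofs of  *)
(* openness differ.                                                           *)
Lemma comp_sub (V : opens Z) :
  opens_preimage comp_continuous V `<=`
  opens_preimage (rs_cts f) (opens_preimage (rs_cts g) V).
Proof. by []. Qed.

Definition rs_comp_sharp (V : opens Z) :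
    {rmorphism sec Z V -> sec X (opens_preimage comp_continuous V)} :=
  res (@comp_sub V) \o (rs_sharp f (opens_preimage (rs_cts g) V)
                        \o rs_sharp g V).

Fact rs_comp_res (V W : opens Z) (WV : W `<=` V)
    (WV' : opens_preimage comp_continuous W `<=`
           opens_preimage comp_continuous V) (s : sec Z V) :
  rs_comp_sharp W (res WV s) = res WV' (rs_comp_sharp V s).
Proof.
by rewrite /rs_comp_sharp /= !rs_sharpR !res_res; apply: res_irr.
Qed.

Definition rs_comp : rs_mor X Z :=
  @RsMor X Z (fun x => g (f x)) comp_continuous rs_comp_sharp rs_comp_res.

Lemma stalk_map_comp x (a : stalk (g (f x))) :
  stalk_map rs_comp x a = stalk_map f x (stalk_map g (f x) a).
Proof.
elim/germ_ind: a => U Ux s.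
rewrite (@stalk_map_germ _ _ rs_comp x U Ux s) !stalk_map_germ.
exact: germ_res.
Qed.

End RsComp.

Record lrs := Lrs {
  lrs_rs :> ringed_space;
  lrs_local : forall x : lrs_rs, local_ring (stalk x) }.

Record mor (X Y : lrs) := Mor {
  mor_rs :> rs_mor X Y;
  mor_local : forall x, local_hom (stalk_map mor_rs x) }.

Definition mor_id (X : lrs) : mor X X.
Proof.
refine (@Mor X X (rs_id X) _) => x m n mm nn a.
have [k [_ ku]] := lrs_local x.
have -> : m = n by rewrite -(ku m mm) (ku n nn).
elim/germ_ind: a => U Ux s; rewrite (@stalk_map_germ _ _ (rs_id X) x U Ux s).
by rewrite germ_res.
Defined.

Definition mor_comp (X Y Z : lrs) (g : mor Y Z) (f : mor X Y) : mor X Z.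
Proof.
refine (@Mor X Z (rs_comp g f) _) => x m n mm nn a ma.
have [k [kk _]] := lrs_local (f x).
rewrite stalk_map_comp; apply: (mor_local kk nn).
exact: (mor_local mm kk).
Defined.

Definition flat (X Y : lrs) (f : mor X Y) : Prop :=
  forall x, flat_hom (stalk_map f x).

(* [f] is an isomorphism onto the open subspace of [Y] carried by its range.  *)
Definition open_immersion (X Y : lrs) (f : mor X Y) : Prop :=
  [/\ injective f,
      forall U : set X, open U -> open (f @` U)
    & forall V : opens Y, V `<=` range f -> bijective (rs_sharp f V)].

Record spec (A : comPzRingType) := SpecPoint {
  spec_ideal :> ideal A;
  spec_prime : prime_ideal spec_ideal }.

HB.instance Definition _ (A : comPzRingType) := gen_eqMixin (spec A).
HB.instance Definition _ (A : comPzRingType) := gen_choiceMixin (spec A).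

Section Zariski.
Context (A : comPzRingType).

(* The closed sets are the V(E) = {p | E \subset p}. *)
Definition zariski_open : set_system (spec A) :=
  [set U : set (spec A) | exists E : set A, U = [set p : spec A | ~ E `<=` p]].

Fact zariski_openT : zariski_open setT.
Proof.
exists setT; apply/seteqP; split=> // p _ h.
by case: (spec_prime p) => p1 _; apply: p1; apply: h.
Qed.

Lemma not_subset_ex (E P : set A) :
  ~ E `<=` P -> exists x, E x /\ ~ P x.
Proof. by move=> /existsNP[x /not_implyP[Ex nPx]]; exists x. Qed.

Fact zariski_openI (U V : set (spec A)) :
  zariski_open U -> zariski_open V -> zariski_open (U `&` V).
Proof.
move=> [E ->] [F ->].
exists [set x | exists e f, [/\ E e, F f & x = e * f]].
apply/seteqP; split=> [p [/not_subset_ex[e [Ee ne]]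
    /not_subset_ex[f [Ff nf]]] h|p /not_subset_ex[x [[e [f [Ee Ff ->]] nef]]]].
- have : p (e * f) by apply: h; exists e, f.
  by case/(spec_prime p).2.
- split=> h; apply: nef.
  + by apply: idealMr; apply: h.
  + by apply: idealMl; apply: h.
Qed.

Fact zariski_open_bigU (J : Type) (U : J -> set (spec A)) :
  (forall j, zariski_open (U j)) -> zariski_open (\bigcup_j U j).
Proof.
move=> Uo; pose E j := projT1 (cid (Uo j)).
have UE j : U j = [set p : spec A | ~ E j `<=` p] by rewrite /E; case: cid.
exists (\bigcup_j E j); apply/seteqP; split=> p.
- move=> [j _]; rewrite UE => /not_subset_ex[x [Ex nx]] h.
  by apply: nx; apply: h; exists j.
- move=> /not_subset_ex[x [[j _ Ex] nx]]; exists j => //.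
  by rewrite UE => h; apply/nx/h.
Qed.

HB.instance Definition _ := isOpenTopological.Build (spec A)
  zariski_openT zariski_openI zariski_open_bigU.

Fact basic_open_open (f : A) : open [set p : spec A | ~ p f].
Proof.
exists [set f]; apply/seteqP; split=> p /= h; first by move=> /(_ f erefl).
by move=> pf; apply: h => x ->.
Qed.

Definition basic_open (f : A) : opens (spec A) := Opens (basic_open_open f).

End Zariski.

Section Localization.
Context (A : comPzRingType) (p : spec A).

Record prefrac := PreFrac {
  numer : A;
  denom : A;
  denomP : ~ p denom }.

Fact prime_one : ~ p 1. Proof. exact: (spec_prime p).1. Qed.

Fact prime_mul a b : ~ p a -> ~ p b -> ~ p (a * b).
Proof. by move=> na nb /(spec_prime p).2[]. Qed.

Definition prefrac_eq (x y : prefrac) : Prop :=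
  exists u, ~ p u /\ u * (numer x * denom y) = u * (numer y * denom x).

Lemma prefrac_eqW x y :
  numer x * denom y = numer y * denom x -> prefrac_eq x y.
Proof. by move=> e; exists 1; split; [exact: prime_one | rewrite e]. Qed.

Definition localization_setoid : setoid_ring.
Proof.
refine (@SetoidRing prefrac prefrac_eq _ _ _
  (@PreFrac 0 1 prime_one) (@PreFrac 1 1 prime_one)
  (fun x => @PreFrac (- numer x) (denom x) (@denomP x))
  (fun x y => @PreFrac (numer x * denom y + numer y * denom x)
                (denom x * denom y) (prime_mul (@denomP x) (@denomP y)))
  (fun x y => @PreFrac (numer x * numer y) (denom x * denom y)
                (prime_mul (@denomP x) (@denomP y)))
  _ _ _ _ _ _ _ _ _ _ _);
  try by move=> *; apply: prefrac_eqW => /=; ring.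
- by move=> x y [u [nu e]]; exists u.
- move=> x y z [u [nu e]] [v [nv e']]; exists (u * v * denom y); split.
    exact: prime_mul (prime_mul nu nv) (@denomP y).
  have -> : u * v * denom y * (numer x * denom z) =
    v * denom z * (u * (numer x * denom y)) by ring.
  rewrite e; have -> : v * denom z * (u * (numer y * denom x)) =
    u * denom x * (v * (numer y * denom z)) by ring.
  by rewrite e'; ring.
- move=> x y [u [nu e]]; exists u; split=> //=.
  by rewrite !mulNr !mulrN e.
- move=> x x' y y' [u [nu e]] [v [nv e']]; exists (u * v); split=> /=.
    exact: prime_mul.
  transitivity (v * denom y * denom y' * (u * (numer x * denom x')) +
    u * denom x * denom x' * (v * (numer y * denom y'))); first by ring.
  by rewrite e e'; ring.
- move=> x x' y y' [u [nu e]] [v [nv e']]; exists (u * v); split=> /=.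
    exact: prime_mul.
  transitivity ((u * (numer x * denom x')) * (v * (numer y * denom y'))).
    by ring.
  by rewrite e e'; ring.
Defined.

Definition localization : comPzRingType := quo localization_setoid.

Definition frac (a f : A) (nf : ~ p f) : localization :=
  @class localization_setoid (@PreFrac a f nf).

Lemma frac_ind (P : localization -> Prop) :
  (forall a f nf, P (@frac a f nf)) -> forall z, P z.
Proof. by move=> h; elim/quo_ind=> -[]. Qed.

Lemma frac_eq a f nf b g ng : @frac a f nf = @frac b g ng <->
  exists u, ~ p u /\ u * (a * g) = u * (b * f).
Proof. exact: classP. Qed.

Lemma frac_eqW a f nf b g ng : a * g = b * f -> @frac a f nf = @frac b g ng.
Proof.
by move=> e; apply/frac_eq; exists 1; rewrite e; split=> //; apply: prime_one.
Qed.

Lemma frac0 f nf : @frac 0 f nf = 0.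
Proof. by rewrite -class0; apply: frac_eqW; rewrite !mul0r. Qed.

Lemma frac1 f nf : @frac f f nf = 1.
Proof. by rewrite -class1; apply: frac_eqW; rewrite mulrC. Qed.

Lemma fracN a f nf : - @frac a f nf = @frac (- a) f nf.
Proof. by rewrite /frac -classN. Qed.

Lemma fracD a f nf b g ng : @frac a f nf + @frac b g ng =
  @frac (a * g + b * f) (f * g) (prime_mul nf ng).
Proof. by rewrite /frac -classD. Qed.

Lemma fracM a f nf b g ng : @frac a f nf * @frac b g ng =
  @frac (a * b) (f * g) (prime_mul nf ng).
Proof. by rewrite /frac -classM. Qed.

(* The ideal pA_p. *)
Definition localization_max : ideal localization.
Proof.
refine (@Ideal localization
  [set z | exists a f (nf : ~ p f), p a /\ z = frac a nf] _ _ _) => /=.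
- exists 0, 1, prime_one; split; first exact: ideal0.
  by rewrite frac0.
- move=> _ _ [a [f [nf [pa ->]]]] [b [g [ng [pb ->]]]].
  exists (a * g + b * f), (f * g), (prime_mul nf ng).
  by split; [apply: idealD; apply: idealMr | rewrite fracD].
- move=> z _ [a [f [nf [pa ->]]]]; elim/frac_ind: z => b g ng.
  exists (b * a), (g * f), (prime_mul ng nf).
  by split; [apply: idealMl | rewrite fracM].
Defined.

Lemma localization_maxE a f nf : localization_max (@frac a f nf) <-> p a.
Proof.
split=> [[b [g [ng [pb /frac_eq[u [nu e]]]]]]|pa]; last by exists a, f, nf.
have : p (u * (a * g)) by rewrite e; apply/idealMl/idealMr.
by case/(spec_prime p).2 => // /(spec_prime p).2[].
Qed.

Lemma localization_max1 : ~ localization_max 1.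
Proof.
by rewrite -(frac1 prime_one) => /localization_maxE; apply: prime_one.
Qed.

End Localization.

Section LocalizationMap.
Context (A B : comPzRingType) (phi : {rmorphism A -> B}) (q : spec B).

Fact preimage_prime : prime_ideal (ideal_preimage phi q).
Proof.
split=> [|a b] /=; first by rewrite rmorph1; apply: prime_one.
by rewrite rmorphM; apply: (spec_prime q).2.
Qed.

Definition spec_preimage : spec A := SpecPoint preimage_prime.

Definition prefrac_map (x : prefrac spec_preimage) : localization q :=
  @frac B q (phi (numer x)) (phi (denom x)) (@denomP _ _ x).

Fact prefrac_map_congr x y : prefrac_eq x y -> prefrac_map x = prefrac_map y.
Proof.
move=> [u [nu e]]; apply/frac_eq; exists (phi u); split=> //.
by rewrite -!rmorphM e.
Qed.

Fact prefrac_map1 :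
  prefrac_map (sr_one (localization_setoid spec_preimage)) = 1.
Proof. by rewrite -class1; apply: frac_eqW; rewrite /= !rmorph1. Qed.

Fact prefrac_mapN x :
  prefrac_map (sr_opp (x : localization_setoid spec_preimage)) =
  - prefrac_map x.
Proof. by rewrite fracN; apply: frac_eqW; rewrite /= rmorphN. Qed.

Fact prefrac_mapD x y :
  prefrac_map (sr_add (x : localization_setoid spec_preimage) y) =
  prefrac_map x + prefrac_map y.
Proof. by rewrite fracD; apply: frac_eqW; rewrite /= !(rmorphD, rmorphM). Qed.

Fact prefrac_mapM x y :
  prefrac_map (sr_mul (x : localization_setoid spec_preimage) y) =
  prefrac_map x * prefrac_map y.
Proof. by rewrite fracM; apply: frac_eqW; rewrite /= !rmorphM. Qed.

Definition localization_map :
    {rmorphism localization spec_preimage -> localization q} :=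
  @quo_lift (localization_setoid spec_preimage) _ prefrac_map
    prefrac_map_congr prefrac_map1 prefrac_mapN prefrac_mapD prefrac_mapM.

Lemma localization_map_frac a f (nf : ~ spec_preimage f) :
  localization_map (frac a nf) = @frac B q (phi a) (phi f) nf.
Proof. by rewrite /localization_map quo_liftE. Qed.

End LocalizationMap.

Section StructureSheaf.
Context (A : comPzRingType).
Implicit Types U V W : opens (spec A).

Definition locally_fraction U (s : forall p : spec A, U p -> localization p)
    : Prop :=
  forall p, U p -> exists V a f, V p /\
    forall q (Uq : U q), V q -> exists nf : ~ q f, s q Uq = frac a nf.

(* Sections over [U]: families of elements of the local rings A_p, p in U,    *)
(* that are given locally by a single fraction a / f.                         *)
Definition spec_sec U : Type :=
  {s : forall p : spec A, U p -> localization p | locally_fraction s}.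

HB.instance Definition _ U := gen_eqMixin (spec_sec U).
HB.instance Definition _ U := gen_choiceMixin (spec_sec U).

Lemma spec_sec_ext U (s t : spec_sec U) :
  (forall p Up, sval s p Up = sval t p Up) -> s = t.
Proof.
move=> e; apply: sval_inj; apply: functional_extensionality_dep => p.
by apply: functional_extensionality_dep => Up.
Qed.

Section Ring.
Context (U : opens (spec A)).
Implicit Types s t : spec_sec U.

Fact spec_sec0_frac :
  @locally_fraction U (fun p _ => 0).
Proof.
move=> p Up; exists (opensT _), 0, 1; split=> // q Uq _.
by exists (@prime_one _ q); rewrite frac0.
Qed.

Fact spec_sec1_frac :
  @locally_fraction U (fun p _ => 1).
Proof.
move=> p Up; exists (opensT _), 1, 1; split=> // q Uq _.
by exists (@prime_one _ q); rewrite frac1.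
Qed.

Fact spec_secN_frac s : @locally_fraction U (fun p Up => - sval s p Up).
Proof.
move=> p Up; have [V [a [f [Vp h]]]] := svalP s p Up.
exists V, (- a), f; split=> // q Uq Vq; have [nf ->] := h q Uq Vq.
by exists nf; rewrite fracN.
Qed.

Fact spec_secD_frac s t :
  @locally_fraction U (fun p Up => sval s p Up + sval t p Up).
Proof.
move=> p Up; have [V [a [f [Vp h]]]] := svalP s p Up.
have [W [b [g [Wp k]]]] := svalP t p Up.
exists (opensI V W), (a * g + b * f), (f * g); split=> // q Uq [Vq Wq].
have [nf ->] := h q Uq Vq; have [ng ->] := k q Uq Wq.
by exists (prime_mul nf ng); rewrite fracD.
Qed.

Fact spec_secM_frac s t :
  @locally_fraction U (fun p Up => sval s p Up * sval t p Up).
Proof.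
move=> p Up; have [V [a [f [Vp h]]]] := svalP s p Up.
have [W [b [g [Wp k]]]] := svalP t p Up.
exists (opensI V W), (a * b), (f * g); split=> // q Uq [Vq Wq].
have [nf ->] := h q Uq Vq; have [ng ->] := k q Uq Wq.
by exists (prime_mul nf ng); rewrite fracM.
Qed.

Definition spec_sec0 : spec_sec U := exist _ _ spec_sec0_frac.
Definition spec_sec1 : spec_sec U := exist _ _ spec_sec1_frac.
Definition spec_secN s : spec_sec U := exist _ _ (spec_secN_frac s).
Definition spec_secD s t : spec_sec U := exist _ _ (spec_secD_frac s t).
Definition spec_secM s t : spec_sec U := exist _ _ (spec_secM_frac s t).

Fact spec_sec_addA : associative spec_secD.
Proof. by move=> s t u; apply: spec_sec_ext => p Up /=; rewrite addrA. Qed.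
Fact spec_sec_addC : commutative spec_secD.
Proof. by move=> s t; apply: spec_sec_ext => p Up /=; rewrite addrC. Qed.
Fact spec_sec_add0 : left_id spec_sec0 spec_secD.
Proof. by move=> s; apply: spec_sec_ext => p Up /=; rewrite add0r. Qed.
Fact spec_sec_addN : left_inverse spec_sec0 spec_secN spec_secD.
Proof. by move=> s; apply: spec_sec_ext => p Up /=; rewrite addNr. Qed.

HB.instance Definition _ := GRing.isZmodule.Build (spec_sec U)
  spec_sec_addA spec_sec_addC spec_sec_add0 spec_sec_addN.

Fact spec_sec_mulA : associative spec_secM.
Proof. by move=> s t u; apply: spec_sec_ext => p Up /=; rewrite mulrA. Qed.
Fact spec_sec_mulC : commutative spec_secM.
Proof. by move=> s t; apply: spec_sec_ext => p Up /=; rewrite mulrC. Qed.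
Fact spec_sec_mul1 : left_id spec_sec1 spec_secM.
Proof. by move=> s; apply: spec_sec_ext => p Up /=; rewrite mul1r. Qed.
Fact spec_sec_mulDl : left_distributive spec_secM spec_secD.
Proof. by move=> s t u; apply: spec_sec_ext => p Up /=; rewrite mulrDl. Qed.

HB.instance Definition _ := GRing.Zmodule_isComPzRing.Build (spec_sec U)
  spec_sec_mulA spec_sec_mulC spec_sec_mul1 spec_sec_mulDl.

End Ring.

Section Restriction.
Context (U V : opens (spec A)) (VU : V `<=` U).

Fact spec_res_frac (s : spec_sec U) :
  @locally_fraction V (fun p Vp => sval s p (VU Vp)).
Proof.
move=> p Vp; have [W [a [f [Wp h]]]] := svalP s p (VU Vp).
by exists W, a, f; split=> // q Vq; apply: h.
Qed.

Definition spec_res_fun (s : spec_sec U) : spec_sec V :=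
  exist _ _ (spec_res_frac s).

Fact spec_res_zmod : zmod_morphism spec_res_fun.
Proof. by move=> s t; apply: spec_sec_ext. Qed.

Fact spec_res_monoid : monoid_morphism spec_res_fun.
Proof. by split=> [|s t]; apply: spec_sec_ext. Qed.

HB.instance Definition _ := GRing.isZmodMorphism.Build _ _
  spec_res_fun spec_res_zmod.
HB.instance Definition _ := GRing.isMonoidMorphism.Build _ _
  spec_res_fun spec_res_monoid.

Definition spec_res : {rmorphism spec_sec U -> spec_sec V} := spec_res_fun.

End Restriction.

Lemma sval_irr U (s : spec_sec U) p (h h' : U p) : sval s p h = sval s p h'.
Proof. by rewrite (Prop_irrelevance h h'). Qed.

Fact spec_res_id U (UU : U `<=` U) (s : spec_sec U) : spec_res UU s = s.
Proof. by apply: spec_sec_ext => p Up; exact: (sval_irr s). Qed.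

Fact spec_res_comp U V W (VU : V `<=` U) (WV : W `<=` V) (WU : W `<=` U)
  (s : spec_sec U) : spec_res WV (spec_res VU s) = spec_res WU s.
Proof. by apply: spec_sec_ext => p Up; exact: (sval_irr s). Qed.

Fact spec_separated U (J : Type) (V : J -> opens (spec A))
    (VU : forall j, V j `<=` U) : U `<=` \bigcup_j V j ->
  forall s t : spec_sec U,
    (forall j, spec_res (VU j) s = spec_res (VU j) t) -> s = t.
Proof.
move=> cov s t e; apply: spec_sec_ext => p Up; have [j _ Vp] := cov p Up.
have := congr1 (fun r => sval r p Vp) (e j) => /=.
by rewrite (sval_irr s _ Up) (sval_irr t _ Up).
Qed.

Fact spec_glue U (J : Type) (V : J -> opens (spec A))
    (VU : forall j, V j `<=` U) : U `<=` \bigcup_j V j ->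
  forall s : forall j, spec_sec (V j),
    (forall i j (Wi : opensI (V i) (V j) `<=` V i)
                (Wj : opensI (V i) (V j) `<=` V j),
       spec_res Wi (s i) = spec_res Wj (s j)) ->
    exists t : spec_sec U, forall j, spec_res (VU j) t = s j.
Proof.
move=> cov s compat.
have covj p (Up : U p) : exists j, V j p by have [j _] := cov p Up; exists j.
pose j p Up := projT1 (cid (covj p Up)).
have jP p Up : V (j p Up) p by rewrite /j; case: cid.
have sE i k p (Vi : V i p) (Vk : V k p) : sval (s i) p Vi = sval (s k) p Vk.
  have := compat i k (@opensI_l _ _ _) (@opensI_r _ _ _).
  move=> /(congr1 (fun r => sval r p (conj Vi Vk))) /=.
  by rewrite (sval_irr _ _ Vi) (sval_irr _ _ Vk).
have tP : @locally_fraction U (fun p Up => sval (s (j p Up)) p (jP p Up)).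
  move=> p Up; have [W [a [f [Wp h]]]] := svalP (s (j p Up)) p (jP p Up).
  exists (opensI W (V (j p Up))), a, f.
  split=> [|q Uq [Wq Vq]]; first by split=> //; apply: jP.
  by have [nf e] := h q Vq Wq; exists nf; rewrite -e; apply: sE.
by exists (exist _ _ tP) => k; apply: spec_sec_ext => p Vp; apply: sE.
Qed.

Definition spec_rs : ringed_space :=
  @RingedSpace (spec A) (fun U => spec_sec U) spec_res
    spec_res_id spec_res_comp spec_separated spec_glue.

End StructureSheaf.

Section SpecStalk.
Context (A : comPzRingType) (p : spec_rs A).

Definition pregerm_val (s : pregerm p) : localization (p : spec A) :=
  sval (pg_sec s : spec_sec _) p (pg_mem s).

Fact pregerm_val_congr s t : pregerm_eq s t -> pregerm_val s = pregerm_val t.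
Proof.
move=> [W [Ws [Wt [Wp /(congr1 (fun r : spec_sec W => sval r p Wp)) /=]]]].
by rewrite (sval_irr _ _ (pg_mem s)) (sval_irr _ _ (pg_mem t)).
Qed.

Fact pregerm_val1 : pregerm_val (sr_one (stalk_setoid p)) = 1.
Proof. by []. Qed.

Fact pregerm_valN s :
  pregerm_val (sr_opp (s : stalk_setoid p)) = - pregerm_val s.
Proof. by []. Qed.

Fact pregerm_valD s t :
  pregerm_val (sr_add (s : stalk_setoid p) t) = pregerm_val s + pregerm_val t.
Proof.
by congr (_ + _); [exact: (@sval_irr A (pg_dom s) (pg_sec s) p)
                  |exact: (@sval_irr A (pg_dom t) (pg_sec t) p)].
Qed.

Fact pregerm_valM s t :
  pregerm_val (sr_mul (s : stalk_setoid p) t) = pregerm_val s * pregerm_val t.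
Proof.
by congr (_ * _); [exact: (@sval_irr A (pg_dom s) (pg_sec s) p)
                  |exact: (@sval_irr A (pg_dom t) (pg_sec t) p)].
Qed.

Definition stalk_val : {rmorphism stalk p -> localization (p : spec A)} :=
  @quo_lift (stalk_setoid p) _ pregerm_val pregerm_val_congr
    pregerm_val1 pregerm_valN pregerm_valD pregerm_valM.

Lemma stalk_val_germ (U : opens (spec A)) (Up : U p) (s : spec_sec U) :
  stalk_val (@germ (spec_rs A) p U Up s) = sval s p Up.
Proof. by rewrite /stalk_val quo_liftE. Qed.

Definition spec_stalk_max : ideal (stalk p) :=
  ideal_preimage stalk_val (localization_max (p : spec A)).

Lemma spec_stalk_maxE x :
  spec_stalk_max x = localization_max (p : spec A) (stalk_val x).
Proof. by []. Qed.

Lemma spec_stalk_maximal : maximal_ideal spec_stalk_max /\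
  forall n : ideal (stalk p), maximal_ideal n -> spec_stalk_max = n.
Proof.
apply: nonunits_maximal.
  by rewrite spec_stalk_maxE rmorph1; apply: localization_max1.
elim/germ_ind=> U Up s; rewrite spec_stalk_maxE stalk_val_germ => nx.
have [V [a [f [Vp h]]]] := svalP (s : spec_sec U) p Up.
have [nf e] := h p Up Vp; move: nx; rewrite e => nx.
have na : ~ (p : spec A) a by move=> pa; apply: nx; apply/localization_maxE.
pose W : opens (spec A) := opensI (opensI U V) (basic_open a).
have WU : W `<=` U by move=> q [[]].
have tP : @locally_fraction A W (fun q Wq => @frac A q f a Wq.2).
  by move=> q Wq; exists W, f, a; split=> // r Wr _; exists Wr.2.
pose t : spec_sec W := exist _ _ tP.
have Wp : W p by split.
exists (@germ (spec_rs A) p W Wp t).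
rewrite -(@germ_res (spec_rs A) p U W WU Up Wp s) germ_mul.
rewrite -(@germ_one (spec_rs A) p W Wp); congr germ.
apply: spec_sec_ext => q Wq /=.
have [nfq ->] := h q (WU q Wq) Wq.1.2.
rewrite fracM -(frac1 (@prime_one _ q)); apply: frac_eqW.
by rewrite mulr1 mul1r mulrC.
Qed.

Lemma spec_stalk_local : local_ring (stalk p).
Proof. by exists spec_stalk_max; apply: spec_stalk_maximal. Qed.

End SpecStalk.

Definition spec_lrs (A : comPzRingType) : lrs := Lrs (@spec_stalk_local A).

Section SpecMap.
Context (A B : comPzRingType) (phi : {rmorphism A -> B}).

Definition spec_fun : spec_rs B -> spec_rs A := spec_preimage phi.

Fact spec_fun_continuous : continuous spec_fun.
Proof.
apply/continuousP => _ [E ->]; exists (phi @` E).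
apply/seteqP; split=> q /= h k; apply: h => a Ea.
- by apply: k; exists a.
- by case: Ea => b Eb <-; apply: k.
Qed.

Section Sharp.
Context (V : opens (spec A)).
Let V' : opens (spec B) := opens_preimage spec_fun_continuous V.

Fact spec_sharp_frac (s : spec_sec V) : @locally_fraction B V'
  (fun q Vq => localization_map phi q (sval s (spec_preimage phi q) Vq)).
Proof.
move=> q Vq; have [W [a [f [Wq h]]]] := svalP s _ Vq.
exists (opens_preimage spec_fun_continuous W), (phi a), (phi f).
split=> // r Vr Wr; have [nf ->] := h _ Vr Wr.
by exists nf; rewrite localization_map_frac.
Qed.

Definition spec_sharp_fun (s : spec_sec V) : spec_sec V' :=
  exist _ _ (spec_sharp_frac s).

Fact spec_sharp_zmod : zmod_morphism spec_sharp_fun.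
Proof. by move=> s t; apply: spec_sec_ext => q Vq; exact: rmorphB. Qed.

Fact spec_sharp_monoid : monoid_morphism spec_sharp_fun.
Proof.
by split=> [|s t]; apply: spec_sec_ext => q Vq;
  [exact: rmorph1 | exact: rmorphM].
Qed.

HB.instance Definition _ := GRing.isZmodMorphism.Build _ _
  spec_sharp_fun spec_sharp_zmod.
HB.instance Definition _ := GRing.isMonoidMorphism.Build _ _
  spec_sharp_fun spec_sharp_monoid.

Definition spec_sharp : {rmorphism spec_sec V -> spec_sec V'} :=
  spec_sharp_fun.

End Sharp.

Fact spec_sharp_res (V W : opens (spec_rs A)) (WV : W `<=` V)
    (WV' : opens_preimage spec_fun_continuous W `<=`
           opens_preimage spec_fun_continuous V) (s : sec (spec_rs A) V) :
  spec_sharp W (@res (spec_rs A) _ _ WV s) =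
  @res (spec_rs B) _ _ WV' (spec_sharp V s).
Proof.
apply: spec_sec_ext => q Wq.
exact: (congr1 (localization_map phi q) (sval_irr (s : spec_sec V) _ _)).
Qed.

Definition spec_map_rs : rs_mor (spec_rs B) (spec_rs A) :=
  @RsMor (spec_rs B) (spec_rs A) spec_fun spec_fun_continuous spec_sharp
    spec_sharp_res.

Fact spec_map_local (q : spec_rs B) : local_hom (stalk_map spec_map_rs q).
Proof.
move=> m n mm nn a.
have [_ /(_ m mm) <-] := spec_stalk_maximal (spec_map_rs q).
have [_ /(_ n nn) <-] := spec_stalk_maximal q.
elim/germ_ind: a => U Uq s; rewrite stalk_map_germ.
rewrite !spec_stalk_maxE !stalk_val_germ.
change (localization_max (spec_preimage phi q)
          (sval (s : spec_sec U) (spec_preimage phi q) Uq) ->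
        localization_max (q : spec B)
          (localization_map phi q
            (sval (s : spec_sec U) (spec_preimage phi q) Uq))).
elim/frac_ind: (sval (s : spec_sec U) (spec_preimage phi q) Uq) => a f nf.
move=> /localization_maxE pa.
by rewrite localization_map_frac; apply/localization_maxE.
Qed.

Definition spec_map : mor (spec_lrs B) (spec_lrs A) :=
  @Mor (spec_lrs B) (spec_lrs A) spec_map_rs spec_map_local.

End SpecMap.

(* [range j] is an affine open neighbourhood of [x].                          *)
Record scheme := Scheme {
  scheme_lrs :> lrs;
  scheme_affine : forall x : scheme_lrs,
    exists (A : comPzRingType) (j : mor (spec_lrs A) scheme_lrs),
      open_immersion j /\ range j x }.

Fact spec_affine (A : comPzRingType) (x : spec_lrs A) :
  exists (B : comPzRingType) (j : mor (spec_lrs B) (spec_lrs A)),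
    open_immersion j /\ range j x.
Proof.
exists A, (mor_id (spec_lrs A)); split; last by exists x.
split=> [//|U oU|V _].
- suff -> : mor_id (spec_lrs A) @` U = U by [].
  by apply/seteqP; split=> y; [case=> z Uz <- | exists y].
- exists (@res (spec_rs A) (opens_preimage (@id_continuous (spec_rs A)) V) V
            (@subset_refl _ V)) => s.
  + exact: (etrans (res_res _ _ _) (res_id _ _)).
  + exact: (etrans (res_res _ _ _) (res_id _ _)).
Qed.

Definition Spec (A : comPzRingType) : scheme :=
  Scheme (@spec_affine A).

Definition is_fiber_product (X X' Y P : scheme) (f : mor X Y) (f' : mor X' Y)
    (pr : mor P X) (pr' : mor P X') : Prop :=
  mor_comp f pr = mor_comp f' pr' /\
  forall (T : scheme) (a : mor T X) (a' : mor T X'),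
    mor_comp f a = mor_comp f' a' ->
    exists! h : mor T P, mor_comp pr h = a /\ mor_comp pr' h = a'.

(* [P] is X x_Y X, which is unique up to a unique isomorphism, and [diag] is  *)
(* the diagonal of [f].                                                       *)
Definition weakly_etale (X Y : scheme) (f : mor X Y) : Prop :=
  flat f /\
  exists (P : scheme) (pr1 pr2 : mor P X) (diag : mor X P),
    [/\ is_fiber_product f f pr1 pr2,
        mor_comp pr1 diag = mor_id X,
        mor_comp pr2 diag = mor_id X
      & flat diag].

Definition henselian_lifting_property (X Y : scheme) (f : mor X Y) : Prop :=
  forall (A : comPzRingType) (I : ideal A), henselian_pair I ->
  let i : mor (Spec (quotient_ring I)) (Spec A) :=
    spec_map (quotient_proj I) in
  forall (a : mor (Spec (quotient_ring I)) X)
         (b : mor (Spec A) Y),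
    mor_comp f a = mor_comp b i ->
    exists! c : mor (Spec A) X, mor_comp f c = b /\ mor_comp c i = a.

(* Main.v *)
From HB Require Import structures.
From mathcomp Require Import all_boot all_order all_algebra.
From mathcomp Require Import all_classical topology_structure.
From mathcomp Require Import ring.
Require Import Defs.

Set Implicit Arguments.
Unset Strict Implicit.
Unset Printing Implicit Defensive.

Import GRing.Theory.
Local Open Scope classical_set_scope.
Local Open Scope ring_scope.

(** Flatness is handled by the equational criterion ([aflat]). On charts a weakly étale morphism
    becomes a ring map R -> B that is [wet]: flat, and such that each b in B has some t in B (x)_R B
    that multiplies out to 1 and satisfies (b (x) 1) t = (1 (x) b) t ([weakly_etale_charts]). A ring
    is [good] if every monic polynomial of positive degree has a root in it. Adjoining roots freely,
    again and again, embeds a nonzero ring in a good one that is integral and faithfully flat over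
    it ([gc_flat], [gc_contracted], [gc_intalg]). A good local ring is henselian along each proper
    ideal, because over it monic polynomials split into linear factors, which two comaximal factors
    share out between them ([good_henselian]).

    Lifting implies weakly étale. Let B be a chart over R, and let B' be the local ring of a good
    extension of B at a prime. B' is a quotient of a good local ring Q that is flat over R, so the
    lifting property lifts B -> B' to an R-algebra map B -> Q. A linear relation over R between
    elements of B is therefore trivial in Q, hence in B', hence in B near the prime, by flatness of
    the extension ([hlp_flat]). The diagonal inherits the lifting property, its existence part from
    uniqueness for f, so it is flat as well ([hlp_weakly_etale]); the fibre product is constructed
    for this purpose ([fp_is_fiber_product]).

    Weakly étale implies lifting. Two lifts together give a map on B (x)_R B that sends t to a unit,
    so they agree ([local_uniq], [global_uniq]). For existence over the pair (A, I), let S be the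
    good extension of A and J = I S. By uniqueness over S (x)_A S and faithfully flat descent
    ([descent]) a lift over S is enough. Write S_q for the local ring at a prime q. If q contains J,
    a weakly étale local algebra over the good local ring S_q is S_q itself ([wet_local_bij], a case
    of Olivier's theorem), so there is exactly one lift over S_q. For a prime p inside q it
    restricts to S_p. The restriction does not depend on q, as V(p + J) is connected
    ([henselian_connected], [res_const]): a disconnection would give a monic polynomial over A that
    is X^M (X - 1)^M modulo I and whose value at some element u of S lies in the prime p, and
    lifting the factorization would force a power of u or of u - 1 into p + J. The resulting germs
    spread out to neighbourhoods and glue ([germ_spread], [lift_good]).

    The case of Olivier's theorem is reduced to good domains D ([domain_wet_surj]). Such a domain is
    normal; through an embedding of D / s into a product of valuation rings modulo s, this keeps the
    idempotents of the generic fibre of B inside B ([domain_split]). As B is local, the generic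
    fibre is a field; it is algebraic over the fraction field of D, which is good, and so equal to
    it. *)

Lemma nz_ring (B : comPzRingType) : (1 : B) <> 0 ->
  exists B' : comNzRingType, (B' : comPzRingType) = B.
Proof.
case: B => B c /= h; pose B0 := GRing.ComPzRing.Pack c.
have h' : (1 : B0) != 0 by apply/eqP.
by exists (HB.pack_for comNzRingType B c (GRing.PzSemiRing_isNonZero.Build B0 h')).
Qed.

Definition mk_rmorph (A B : comPzRingType) (f : A -> B)
    (fz : zmod_morphism f) (fm : monoid_morphism f) : {rmorphism A -> B} :=
  HB.pack f (GRing.isZmodMorphism.Build A B f fz)
            (GRing.isMonoidMorphism.Build A B f fm).

Lemma rmorph_ext (A B : comPzRingType) (f g : {rmorphism A -> B}) :
  f =1 g -> f = g.
Proof.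
case: f g => [f [[fa] [fm]]] [g [[ga] [gm]]] /= /funext e; subst g.
by rewrite (Prop_irrelevance fa ga) (Prop_irrelevance fm gm).
Qed.

Lemma big_sumT (V : nmodType) (I J : finType) (F : I + J -> V) :
  \sum_k F k = \sum_i F (inl i) + \sum_j F (inr j).
Proof.
rewrite (bigID (fun k : I + J => if k is inl _ then true else false)) /=.
congr (_ + _).
- rewrite (reindex_omap (inl : I -> I + J) (fun k => if k is inl i then Some i else None)); last by case.
  by apply: eq_bigl => i; rewrite /= eqxx.
- rewrite (reindex_omap (inr : J -> I + J) (fun k => if k is inr i then Some i else None)); last by case.
  by apply: eq_bigl => i; rewrite /= eqxx.
Qed.

Lemma big_sigT (V : nmodType) (I : finType) (T : I -> finType) (F : {i : I & T i} -> V) :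
  \sum_p F p = \sum_i \sum_(j : T i) F (existT _ i j).
Proof.
rewrite (sig_big_dep (fun=> true) (fun _ _ => true) (fun i j => F (existT _ i j))).
by apply: eq_bigr => -[].
Qed.

(** * Ideals, units and primes *)

Section Ideals.
Context (A : comPzRingType).
Implicit Types (I J c m : ideal A) (x y z : A).

Definition isunit x := exists y, x * y = 1.

Lemma isunitM x y : isunit x -> isunit y -> isunit (x * y).
Proof. by move=> [x' e] [y' e']; exists (x' * y'); rewrite mulrACA e e' mulr1. Qed.

Lemma isunit1 : isunit (1 : A). Proof. by exists 1; rewrite mulr1. Qed.

Lemma isunitMl x y : isunit (x * y) -> isunit x.
Proof. by move=> [z e]; exists (y * z); rewrite mulrA. Qed.

Lemma unit_cancel u x y : isunit u -> x * u = y * u -> x = y.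
Proof.
by move=> [v uv] e; rewrite -[x]mulr1 -[y]mulr1 -uv !mulrA e.
Qed.

Lemma idealB I x y : I x -> I y -> I (x - y).
Proof. by move=> Ix Iy; apply: idealD => //; apply: idealN. Qed.

Lemma ideal_sum I (T : Type) (r : seq T) (P : pred T) (F : T -> A) :
  (forall i, P i -> I (F i)) -> I (\sum_(i <- r | P i) F i).
Proof. by move=> h; apply: big_ind => //; [exact: ideal0|exact: idealD]. Qed.

Lemma ideal_unit I x : isunit x -> I x -> I 1.
Proof. by move=> [y <-]; apply: idealMr. Qed.

Lemma idealBD I x y : I (x - y) -> I y -> I x.
Proof. by move=> h k; rewrite -(subrK y x); apply: idealD. Qed.

Definition ideal_gen2 I x : ideal A.
Proof.
refine (@Ideal A [set z | exists j y, I j /\ z = j + y * x] _ _ _) => /=.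
- by exists 0, 0; split; [exact: ideal0|rewrite mul0r addr0].
- move=> _ _ [j [y [Ij ->]]] [k [z [Ik ->]]]; exists (j + k), (y + z).
  by split; [exact: idealD|ring].
- move=> a _ [j [y [Ij ->]]]; exists (a * j), (a * y).
  by split; [exact: idealMl|ring].
Defined.

(** Zorn's lemma: the union of a nonempty chain of ideals that contain [c] and miss [M] is again
    such an ideal, and the empty chain is bounded by [c]. *)
Lemma zorn_ideal c (M : A -> Prop) : (forall x, M x -> ~ c x) ->
  exists J, [/\ c `<=` J, forall x, M x -> ~ J x &
    forall K : ideal A, J `<=` K -> (forall x, M x -> ~ K x) -> K `<=` J].
Proof.
move=> cM; pose T := {J : ideal A | c `<=` J /\ forall x, M x -> ~ J x}.
pose t0 : T := exist _ c (conj (@subset_refl _ c) cM).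
pose R : rel T := fun s t => `[< sval s `<=` sval t >].
have Rr t : R t t by apply/asboolP.
have Rt r s t : R r s -> R s t -> R r t.
  move=> /asboolP h /asboolP k; apply/asboolP; exact: subset_trans h k.
have ch (F : set T) : total_on F (fun s t => R s t) ->
    exists t, forall s, F s -> R s t.
  move=> tF; have [[s0 Fs0]|nF] := pselect (exists s, F s); last first.
    by exists t0 => s Fs; case: nF; exists s.
  have U0 : (fun x => exists s, F s /\ sval s x) 0.
    by exists s0; split => //; exact: ideal0.
  have UD x y : (exists s, F s /\ sval s x) -> (exists s, F s /\ sval s y) ->
      exists s, F s /\ sval s (x + y).
    move=> [s [Fs sx]] [t [Ft ty]].
    have [/asboolP st|/asboolP ts] := tF s t Fs Ft.
    - by exists t; split=> //; apply: idealD => //; apply: st.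
    - by exists s; split=> //; apply: idealD => //; apply: ts.
  have UM a x : (exists s, F s /\ sval s x) -> exists s, F s /\ sval s (a * x).
    by move=> [s [Fs sx]]; exists s; split=> //; apply: idealMl.
  pose U := Ideal U0 UD UM.
  have UT : c `<=` U /\ forall x, M x -> ~ U x.
    split=> [x cx|x Mx [s [Fs sx]]]; last exact: (svalP s).2 _ Mx sx.
    by exists s0; split=> //; apply: (svalP s0).1.
  exists (exist _ U UT) => s Fs; apply/asboolP => x sx; by exists s.
have [[J [cJ JM]] Jm] := ZL_preorder t0 Rr Rt ch.
exists J; split=> // K JK KM.
have cK : c `<=` K by apply: subset_trans JK.
by have /asboolP := Jm (exist _ K (conj cK KM)) (asboolT JK).
Qed.

(** An ideal [J] maximal among those that miss [M] is prime: if [a] and [b] lie outside [J], then J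
    + (a) and J + (b) both meet [M], and the product of the two common elements lies in J + (ab). *)
Lemma krull c (M : A -> Prop) : M 1 -> (forall x y, M x -> M y -> M (x * y)) ->
  (forall x, M x -> ~ c x) ->
  exists p : spec A, c `<=` p /\ forall x, M x -> ~ p x.
Proof.
move=> M1 MM /zorn_ideal[J [cJ JM Jm]].
suff Jp : prime_ideal J by exists (SpecPoint Jp).
split=> [|a b Jab]; first exact: JM.
apply: contrapT => /not_orP[na nb].
have meet x : ~ J x -> exists j y, J j /\ M (j + y * x).
  move=> nx; apply: contrapT => h; apply: nx; apply: (Jm (ideal_gen2 J x)).
  - by move=> z Jz; exists z, 0; rewrite mul0r addr0.
  - by move=> z Mz [j [y [Jj e]]]; apply: h; exists j, y; rewrite -e.
  - by exists 0, 1; rewrite mul1r add0r; split=> //; exact: ideal0.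
have [j [y [Jj My]]] := meet _ na; have [k [z [Jk Mz]]] := meet _ nb.
apply: (JM _ (MM _ _ My Mz)).
have -> : (j + y * a) * (k + z * b) =
  (k + z * b) * j + y * a * k + y * z * (a * b) by ring.
by apply: idealD; [apply: idealD|]; apply: idealMl.
Qed.

(** This is how quasi-compactness of the spectrum is used: a property of elements that is stable
    under sums and multiples, and that some element outside each prime has, holds for 1. *)
Lemma ideal_one c : (forall p : spec A, c `<=` p -> False) -> c 1.
Proof.
move=> h; apply: contrapT => nc.
have [x y -> ->|x ->//|p [cp _]] := @krull c (fun x => x = 1) erefl.
- by rewrite mulr1.
- exact: h cp.
Qed.

Lemma maxideal_exists c : ~ c 1 -> exists m, maximal_ideal m /\ c `<=` m.
Proof.
move=> c1; have [x ->//|m [cm m1 mm]] := @zorn_ideal c (fun x => x = 1).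
exists m; split=> //; split; first exact: m1.
by move=> J mJ J1; apply: mm => // x ->.
Qed.

Lemma maxideal_inv m x : maximal_ideal m -> ~ m x -> exists y, m (1 - y * x).
Proof.
move=> [m1 mm] nx; have [[j [y [mj e]]]|h] := pselect (ideal_gen2 m x 1).
  by exists y; rewrite e addrK.
case: nx; apply: (mm _ _ h).
- by move=> z mz; exists z, 0; rewrite mul0r addr0.
- by exists 0, 1; rewrite mul1r add0r; split=> //; exact: ideal0.
Qed.

Lemma maxideal_prime m : maximal_ideal m -> prime_ideal m.
Proof.
move=> mm; split=> [|a b mab]; first exact: mm.1.
have [ma|na] := pselect (m a); [by left|right].
have [y my] := maxideal_inv mm na.
have -> : b = b * (1 - y * a) + y * (a * b) by ring.
by apply: idealD; apply: idealMl.
Qed.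

Definition ideal_zero : ideal A.
Proof.
refine (@Ideal A [set z | z = 0] _ _ _) => //=.
- by move=> x y -> ->; rewrite addr0.
- by move=> a x ->; rewrite mulr0.
Defined.

Definition principal x : ideal A := ideal_gen2 ideal_zero x.

Lemma principalP x z : principal x z <-> exists y, z = y * x.
Proof.
split=> [[j [y [-> ->]]]|[y ->]]; first by exists y; rewrite add0r.
by exists 0, y; rewrite add0r.
Qed.

Lemma unit_of_max x : (forall m, maximal_ideal m -> ~ m x) -> isunit x.
Proof.
move=> h; apply: contrapT => nu.
have [/principalP[y e]|m [mm xm]] := @maxideal_exists (principal x).
  by apply: nu; exists y; rewrite mulrC.
by apply: (h m mm); apply: xm; apply/principalP; exists 1; rewrite mul1r.
Qed.

Lemma unit_of_primes x : (forall p : spec A, ~ p x) -> isunit x.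
Proof.
by move=> h; apply: unit_of_max => m /maxideal_prime mp; apply: (h (SpecPoint mp)).
Qed.

(** [krull] for the powers of [x]; the analogue of [ideal_one] on the basic open set of [x]. *)
Lemma nilp_of_primes c x : (forall p : spec A, c `<=` p -> p x) ->
  exists n, c (x ^+ n).
Proof.
move=> h; apply: contrapT => nn.
have [||y [n ->] cn|p [cp pM]] := @krull c (fun y => exists n, y = x ^+ n).
- by exists 0%N.
- by move=> _ _ [n ->] [k ->]; exists (n + k)%N; rewrite exprD.
- by apply: nn; exists n.
- by apply: (pM x); [exists 1%N|exact: h].
Qed.

Lemma primeX (p : spec A) x n : p (x ^+ n) -> p x.
Proof.
elim: n => [|n IH]; first by rewrite expr0 => /prime_one.
by rewrite exprS => /(spec_prime p).2[].
Qed.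

Lemma primeXn (p : spec A) x n : ~ p x -> ~ p (x ^+ n).
Proof. by move=> h /primeX. Qed.

Lemma jac_unit x : @jacobson_radical A x -> isunit (1 + x).
Proof.
move=> jx; apply: unit_of_max => m mm mx.
by apply: mm.1; rewrite -(addrK x 1); apply: idealB => //; apply: jx.
Qed.

Lemma unit_jac x : (forall a, isunit (1 + a * x)) -> @jacobson_radical A x.
Proof.
move=> h m mm; apply: contrapT => nx; have [y my] := maxideal_inv mm nx.
apply: mm.1; apply: ideal_unit my; rewrite -mulNr; exact: h.
Qed.

(** The maximal ideal is given, together with the property that proofs need of it: elements outside
    are units. *)
Definition is_local m := ~ m 1 /\ forall x, ~ m x -> isunit x.

Lemma is_local_max m : is_local m -> maximal_ideal m.
Proof. by move=> [h k]; case: (nonunits_maximal h k). Qed.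

Lemma is_local_uniq m n : is_local m -> maximal_ideal n -> n = m.
Proof. by move=> [h k] nn; have [_ /(_ n nn)] := nonunits_maximal h k. Qed.

Lemma is_local_ring m : is_local m -> local_ring A.
Proof. by move=> [h k]; exists m; apply: nonunits_maximal. Qed.

Lemma local_ringP : local_ring A -> exists m, is_local m.
Proof.
move=> [m [mm mu]]; exists m; split=> [|x nx]; first exact: mm.1.
by apply: unit_of_max => n nn nx'; apply: nx; rewrite (mu n nn).
Qed.

Lemma is_local_sub m I : is_local m -> ~ I 1 -> I `<=` m.
Proof.
move=> [_ h] I1 x Ix; apply: contrapT => /h ux; exact: I1 (ideal_unit ux Ix).
Qed.

Lemma spec_ext (p q : spec A) : (forall x, p x <-> q x) -> p = q.
Proof.
case: p q => [p pp] [q qq] /= e.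
have pq : p = q by apply: ideal_ext => x /e.
by subst q; rewrite (Prop_irrelevance pp qq).
Qed.

End Ideals.

Lemma isunit_rmorph (A B : comPzRingType) (f : {rmorphism A -> B}) x :
  isunit x -> isunit (f x).
Proof. by move=> [y e]; exists (f y); rewrite -rmorphM e rmorph1. Qed.

(** * Quotients and localizations *)

Section QuotientLemmas.
Context (A : comPzRingType) (I : ideal A).

Lemma qproj_eq0 x : quotient_proj I x = 0 <-> I x.
Proof.
have -> : 0 = quotient_proj I 0 by rewrite rmorph0.
by split=> [/classP/=|Ix]; [rewrite subr0|apply/classP; rewrite /= subr0].
Qed.

Lemma qproj_surj (z : quotient_ring I) : exists x, z = quotient_proj I x.
Proof. by elim/quo_ind: z => x; exists x. Qed.

Lemma qproj_lift (C : comPzRingType) (f : {rmorphism A -> C}) :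
  (forall x, I x -> f x = 0) ->
  exists g : {rmorphism quotient_ring I -> C},
    forall x, g (quotient_proj I x) = f x.
Proof.
move=> h; have hc (x y : quotient_setoid I) : sr_eq x y -> f x = f y.
  by move=> /= /h e; apply/eqP; rewrite -subr_eq0 -rmorphB e.
exists (@quo_lift (quotient_setoid I) C f hc (rmorph1 f) (rmorphN f)
          (rmorphD f) (rmorphM f)) => x.
exact: (@quo_liftE (quotient_setoid I) C f hc).
Qed.

End QuotientLemmas.

Section IsLoc.
Context (A L : comPzRingType) (M : A -> Prop) (psi : {rmorphism A -> L}).

(** Localizations are characterised instead of constructed, so that [localization p], fraction
    fields, rings A[1/g] and the identity map are treated alike. *)
Definition is_loc := [/\ forall u, M u -> isunit (psi u),
  forall z, exists a u, M u /\ z * psi u = psi a &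
  forall a, psi a = 0 -> exists u, M u /\ u * a = 0].

(** A fraction a / u must go to [f a] divided by [f u]. One presentation of each element is chosen;
    two of them agree after multiplication by an element of [M], which [f] turns into a unit. *)
Lemma loc_lift (C : comPzRingType) (f : {rmorphism A -> C}) : is_loc ->
  (forall u, M u -> isunit (f u)) ->
  exists g : {rmorphism L -> C}, forall a, g (psi a) = f a.
Proof.
move=> [lu ls lk] fu.
have ex z : exists c, exists a u, [/\ M u, z * psi u = psi a & c * f u = f a].
  have [a [u [Mu e]]] := ls z; have [v fv] := fu u Mu.
  by exists (f a * v), a, u; split=> //; rewrite -mulrA [v * _]mulrC fv mulr1.
have uniq z c a u : M u -> z * psi u = psi a -> c * f u = f a ->
  forall c' a' u', M u' -> z * psi u' = psi a' -> c' * f u' = f a' -> c = c'.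
  move=> Mu e e1 c' a' u' Mu' e' e1'.
  have [v [Mv]] : exists v, M v /\ v * (a * u' - a' * u) = 0.
    by apply: lk; rewrite rmorphB !rmorphM -e -e' mulrAC subrr.
  move=> /(congr1 f); rewrite rmorphM rmorph0 rmorphB !rmorphM -e1 -e1' => h.
  apply: (unit_cancel (isunitM (fu _ Mv) (isunitM (fu _ Mu) (fu _ Mu')))).
  by apply/eqP; rewrite -subr_eq0 -h; apply/eqP; ring.
pose g z := projT1 (cid (ex z)).
have gP z : exists a u, [/\ M u, z * psi u = psi a & g z * f u = f a].
  by rewrite /g; case: cid.
have gE z c a u : M u -> z * psi u = psi a -> c * f u = f a -> g z = c.
  move=> Mu e e1; have [a' [u' [Mu' e' e1']]] := gP z.
  exact: uniq e' e1' _ _ _ Mu e e1.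
have gpsi x : g (psi x) = f x.
  have [b [u [Mu _]]] := ls 0.
  by apply: (gE _ _ (x * u) u Mu); rewrite rmorphM.
have gB : zmod_morphism g.
  move=> x y; have [a [u [Mu e e1]]] := gP x; have [b [v [Mv e' e1']]] := gP y.
  have [w [t [Mt e'' e1'']]] := gP (x - y).
  have [s [Ms]] : exists s, M s /\ s * (w * (u * v) - (a * v - b * u) * t) = 0.
    by apply: lk; rewrite !(rmorphM, rmorphB) -e -e' -e''; ring.
  move=> /(congr1 f); rewrite !(rmorphM, rmorphB, rmorph0) -e1 -e1' -e1'' => h.
  apply: (@unit_cancel _ (f s * (f t * (f u * f v)))).
    by apply: isunitM; [exact: fu|apply: isunitM; [exact: fu|apply: isunitM; exact: fu]].
  by apply/eqP; rewrite -subr_eq0 -h; apply/eqP; ring.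
have gM : monoid_morphism g.
  split=> [|x y]; first by rewrite -(rmorph1 psi) gpsi rmorph1.
  have [a [u [Mu e e1]]] := gP x; have [b [v [Mv e' e1']]] := gP y.
  have [w [t [Mt e'' e1'']]] := gP (x * y).
  have [s [Ms]] : exists s, M s /\ s * (w * (u * v) - (a * b) * t) = 0.
    by apply: lk; rewrite !(rmorphM, rmorphB) -e -e' -e''; ring.
  move=> /(congr1 f); rewrite !(rmorphM, rmorphB, rmorph0) -e1 -e1' -e1'' => h.
  apply: (@unit_cancel _ (f s * (f t * (f u * f v)))).
    by apply: isunitM; [exact: fu|apply: isunitM; [exact: fu|apply: isunitM; exact: fu]].
  by apply/eqP; rewrite -subr_eq0 -h; apply/eqP; ring.
by exists (mk_rmorph gB gM).
Qed.

Lemma loc_uniq (C : comPzRingType) (g h : {rmorphism L -> C}) : is_loc ->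
  (forall a, g (psi a) = h (psi a)) -> g = h.
Proof.
move=> [lu ls _] e; apply: rmorph_ext => z; have [a [u [Mu ez]]] := ls z.
apply: (@unit_cancel _ (g (psi u))); first by apply: isunit_rmorph; apply: lu.
by rewrite -rmorphM ez e (e u) -rmorphM ez.
Qed.

End IsLoc.

Section MLoc.
Context (A : comPzRingType) (M : A -> Prop).
Hypothesis M1 : M 1.
Hypothesis MM : forall x y, M x -> M y -> M (x * y).

Let pf := {x : A * A | M x.2}.
Let pf_eq (x y : pf) := exists u, M u /\
  u * ((sval x).1 * (sval y).2) = u * ((sval y).1 * (sval x).2).

Let pf_eqW (x y : pf) :
  (sval x).1 * (sval y).2 = (sval y).1 * (sval x).2 -> pf_eq x y.
Proof. by move=> e; exists 1; rewrite e. Qed.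

Let mk a u (h : M u) : pf := exist (fun x => M x.2) (a, u) h.

Definition mloc_setoid : setoid_ring.
Proof.
refine (@SetoidRing pf pf_eq _ _ _ (mk 0 M1) (mk 1 M1)
  (fun x => mk (- (sval x).1) (svalP x))
  (fun x y => mk ((sval x).1 * (sval y).2 + (sval y).1 * (sval x).2)
                 (MM (svalP x) (svalP y)))
  (fun x y => mk ((sval x).1 * (sval y).1) (MM (svalP x) (svalP y)))
  _ _ _ _ _ _ _ _ _ _ _);
  try by move=> *; apply: pf_eqW => /=; ring.
- by move=> x y [u [nu e]]; exists u.
- move=> [[a u] ?] [[b v] h] [[c w] ?] [s [Ms /= e]] [t [Mt /= e']].
  exists (s * t * v); split; first exact: MM (MM Ms Mt) h.
  rewrite /=; transitivity (t * w * (s * (a * v))); first by ring.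
  rewrite e; transitivity (s * u * (t * (b * w))); first by ring.
  by rewrite e'; ring.
- move=> [[a u] ?] [[b v] h] [s [Ms /= e]].
  by exists s; split=> //=; rewrite !mulNr !mulrN e.
- move=> [[a u] ?] [[a' u'] ?] [[b v] h] [[b' v'] ?] [s [Ms /= e]] [t [Mt /= e']].
  exists (s * t); split=> /=; first exact: MM.
  transitivity (t * v * v' * (s * (a * u')) + s * u * u' * (t * (b * v'))).
    by ring.
  by rewrite e e'; ring.
- move=> [[a u] ?] [[a' u'] ?] [[b v] h] [[b' v'] ?] [s [Ms /= e]] [t [Mt /= e']].
  exists (s * t); split=> /=; first exact: MM.
  transitivity ((s * (a * u')) * (t * (b * v'))); first by ring.
  by rewrite e e'; ring.
Defined.

Lemma mloc_exists : exists (L : comPzRingType) (psi : {rmorphism A -> L}),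
  is_loc M psi.
Proof.
pose f a : quo mloc_setoid := @class mloc_setoid (mk a M1).
have fz : zmod_morphism f.
  move=> a b; rewrite /f -classN -classD; apply/classP; apply: pf_eqW => /=.
  by ring.
have fm : monoid_morphism f.
  split=> // a b; rewrite /f -classM; apply/classP; apply: pf_eqW => /=.
  by ring.
exists (quo mloc_setoid), (mk_rmorph fz fm); split=> [u Mu|z|a].
- exists (@class mloc_setoid (mk 1 Mu)); rewrite /= /f -classM -class1.
  by apply/classP; apply: pf_eqW => /=; ring.
- elim/quo_ind: z => -[[a u] /= Mu]; exists a, u; split=> //.
  by rewrite /= /f -classM; apply/classP; apply: pf_eqW => /=; ring.
- rewrite /= /f -class0 => /classP[u [Mu /= e]]; exists u; split=> //.
  by move: e; rewrite mul0r mulr0 mulr1.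
Qed.

End MLoc.

Section LocMap.
Context (A : comPzRingType) (p : spec A).

Fact locmap_zmod : zmod_morphism (fun a => frac a (@prime_one A p)).
Proof. by move=> a b; rewrite fracN fracD; apply: frac_eqW; ring. Qed.

Fact locmap_monoid : monoid_morphism (fun a => frac a (@prime_one A p)).
Proof. by split=> [|a b]; [exact: frac1|rewrite fracM; apply: frac_eqW; ring]. Qed.

(** The map is taken out of an opaque proof so that simplification does not unfold it to classes of
    fractions; its values are reached through [locmapE]. *)
Fact locmap_key :
  {f : {rmorphism A -> localization p} | f =1 (fun a => frac a (@prime_one A p))}.
Proof. by exists (mk_rmorph locmap_zmod locmap_monoid). Qed.

Definition locmap : {rmorphism A -> localization p} := sval locmap_key.

Lemma locmapE a : locmap a = frac a (@prime_one A p).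
Proof. exact: (svalP locmap_key). Qed.

Lemma locmap_frac a u (nu : ~ p u) : frac a nu * locmap u = locmap a.
Proof. by rewrite !locmapE fracM; apply: frac_eqW; ring. Qed.

Lemma locmap_unit u : ~ p u -> isunit (locmap u).
Proof.
move=> nu; exists (frac 1 nu); rewrite mulrC locmap_frac locmapE; exact: frac1.
Qed.

Lemma frac_unique a u (nu : ~ p u) z : z * locmap u = locmap a -> z = frac a nu.
Proof.
by move=> e; apply: (unit_cancel (locmap_unit nu)); rewrite e locmap_frac.
Qed.

Lemma locmap_eq0 a : locmap a = 0 -> exists u, ~ p u /\ u * a = 0.
Proof.
rewrite locmapE -(frac0 (@prime_one A p)) => /frac_eq[u [nu e]]; exists u; split=> //.
by move: e; rewrite mulr1 mul0r mulr0.
Qed.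

Lemma locmap_loc : is_loc (fun u => ~ p u) locmap.
Proof.
split=> [u|z|a]; [exact: locmap_unit| |exact: locmap_eq0].
by elim/frac_ind: z => a u nu; exists a, u; split=> //; apply: locmap_frac.
Qed.

Lemma localization_is_local : is_local (localization_max p).
Proof.
split=> [|z]; first exact: localization_max1.
elim/frac_ind: z => a u nu h.
have na : ~ p a by move=> pa; apply: h; apply/localization_maxE.
by exists (frac u na); rewrite fracM -(frac1 (@prime_one A p)); apply: frac_eqW; ring.
Qed.

Lemma localization_max_locmap a : localization_max p (locmap a) <-> p a.
Proof. by rewrite locmapE; exact: localization_maxE. Qed.

End LocMap.

(** * The equational criterion of flatness *)

Section Flat.
Context (A : comPzRingType) (M : lmodType A).

(** The equational criterion, relative to the elements that satisfy [P]; when [P] is an ideal of an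
    algebra, it expresses flatness of that ideal. *)
Definition eqflat (P : M -> Prop) := forall (I : finType) (a : I -> A) (m : I -> M),
  (forall i, P (m i)) -> \sum_i a i *: m i = 0 ->
  exists (J : finType) (c : I -> J -> A) (m' : J -> M),
    [/\ forall j, P (m' j), forall i, m i = \sum_j c i j *: m' j
      & forall j, \sum_i a i * c i j = 0].

Lemma sum_delta (I : finType) (m : I -> M) i : \sum_j (i == j)%:R *: m j = m i.
Proof.
rewrite (bigD1 i) //= eqxx scale1r big1 ?addr0 // => j /negbTE.
by rewrite eq_sym => ->; rewrite scale0r.
Qed.

(** The relations are trivialised one at a time: after the first, the others become relations
    between the new elements [m']. *)
Lemma eqflat_multi P : eqflat P -> forall (K : eqType) (ks : seq K)
    (I : finType) (a : K -> I -> A) (m : I -> M),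
  (forall i, P (m i)) -> (forall k, k \in ks -> \sum_i a k i *: m i = 0) ->
  exists (J : finType) (c : I -> J -> A) (m' : J -> M),
    [/\ forall j, P (m' j), forall i, m i = \sum_j c i j *: m' j
      & forall k, k \in ks -> forall j, \sum_i a k i * c i j = 0].
Proof.
move=> fM K; elim=> [|k ks IH] I a m Pm r.
  exists I, (fun i j => (i == j)%:R), m; split=> // i.
  by rewrite sum_delta.
have [J [c [m' [Pm' mE ck]]]] := fM I (a k) m Pm (r k (mem_head _ _)).
have r' k' : k' \in ks -> \sum_j (\sum_i a k' i * c i j) *: m' j = 0.
  move=> k's; transitivity (\sum_i a k' i *: m i); last first.
    by apply: r; rewrite inE k's orbT.
  under eq_bigr do rewrite scaler_suml.
  rewrite exchange_big /=.
  apply: eq_bigr => i _; rewrite mE scaler_sumr.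
  by apply: eq_bigr => j _; rewrite scalerA.
have [L [d [m'' [Pm'' m'E dk]]]] := IH J _ m' Pm' r'.
have comp k' l : \sum_i a k' i * (\sum_j c i j * d j l) =
    \sum_j (\sum_i a k' i * c i j) * d j l.
  under [RHS]eq_bigr do rewrite mulr_suml; rewrite exchange_big /=.
  by apply: eq_bigr => i _; rewrite mulr_sumr; apply: eq_bigr => j _; rewrite mulrA.
exists L, (fun i l => \sum_j c i j * d j l), m''; split=> // [i|k' + l].
  rewrite mE; under [RHS]eq_bigr do rewrite scaler_suml; rewrite exchange_big /=.
  apply: eq_bigr => j _; rewrite m'E scaler_sumr.
  by apply: eq_bigr => l _; rewrite scalerA.
rewrite inE comp => /predU1P[->|k's]; last exact: dk.
by apply: big1 => j _; rewrite ck mul0r.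
Qed.

End Flat.

Section TensorGroup.
Context (A : comPzRingType) (M N : lmodType A).

(** Turns [tensor_eq] into equality in an abelian group, so that tensors can be computed with big
    sums. *)
Definition tg : Type := {P : set (seq (M * N)) | exists s, P = tensor_eq s}.
HB.instance Definition _ := gen_eqMixin tg.
HB.instance Definition _ := gen_choiceMixin tg.

Definition tgc (s : seq (M * N)) : tg := exist _ (tensor_eq s) (ex_intro _ s erefl).

Lemma tgcP s t : tgc s = tgc t <-> tensor_eq s t.
Proof.
split=> [/(congr1 sval) /= ->|st]; first exact: tensor_refl.
apply: sval_inj => /=; apply/seteqP; split=> u /= h.
- exact: tensor_trans (tensor_sym st) h.
- exact: tensor_trans st h.
Qed.

Definition tgr (c : tg) : seq (M * N) := projT1 (cid (svalP c)).
Lemma tgrK c : tgc (tgr c) = c.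
Proof. by apply: sval_inj; rewrite /= /tgr; case: cid. Qed.
Lemma tg_ind (P : tg -> Prop) : (forall s, P (tgc s)) -> forall c, P c.
Proof. by move=> h c; rewrite -(tgrK c). Qed.

Definition tneg (s : seq (M * N)) := [seq (- x.1, x.2) | x <- s].

Lemma tensor_cancel1 (x : M * N) : tensor_eq [:: (- x.1, x.2); x] [::].
Proof.
case: x => m n /=; apply: tensor_trans (tensor_0l _ n).
by rewrite -(addNr m); apply: tensor_sym; apply: tensor_Dl.
Qed.

Lemma tensor_negl s : tensor_eq (tneg s ++ s) [::].
Proof.
elim: s => [|x s IH] /=; first exact: tensor_refl.
apply: (@tensor_trans _ _ _ _ ([:: (- x.1, x.2); x] ++ (tneg s ++ s))).
  rewrite -cat1s -[X in tensor_eq _ X]/([:: (- x.1, x.2)] ++ (x :: tneg s ++ s)).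
  apply: tensor_cat; first exact: tensor_refl.
  rewrite -[x :: s]cat1s -[x :: _ ++ _]cat1s !catA.
  apply: tensor_cat; [exact: tensor_catC|exact: tensor_refl].
rewrite -[[::]]/([::] ++ [::]); apply: tensor_cat => //; exact: tensor_cancel1.
Qed.

Lemma tneg_congr s t : tensor_eq s t -> tensor_eq (tneg s) (tneg t).
Proof.
move=> st; apply: (@tensor_trans _ _ _ _ (tneg s ++ (t ++ tneg t))).
  rewrite -[X in tensor_eq X _]cats0; apply: tensor_cat; first exact: tensor_refl.
  apply: tensor_sym; apply: tensor_trans (tensor_catC _ _) _; exact: tensor_negl.
rewrite catA -[X in tensor_eq _ X]cat0s; apply: tensor_cat; last exact: tensor_refl.
apply: tensor_trans (tensor_negl s); apply: tensor_cat; first exact: tensor_refl.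
exact: tensor_sym.
Qed.

Definition tg_add c d := tgc (tgr c ++ tgr d).
Definition tg_opp c := tgc (tneg (tgr c)).

Lemma tgr_class s : tensor_eq (tgr (tgc s)) s. Proof. by apply/tgcP; rewrite tgrK. Qed.
Lemma tg_addE s t : tg_add (tgc s) (tgc t) = tgc (s ++ t).
Proof. by apply/tgcP/tensor_cat; apply: tgr_class. Qed.
Lemma tg_oppE s : tg_opp (tgc s) = tgc (tneg s).
Proof. by apply/tgcP/tneg_congr/tgr_class. Qed.

Fact tg_addA : associative tg_add.
Proof.
by elim/tg_ind=> s; elim/tg_ind=> t; elim/tg_ind=> u; rewrite !tg_addE catA.
Qed.
Fact tg_addC : commutative tg_add.
Proof.
by elim/tg_ind=> s; elim/tg_ind=> t; rewrite !tg_addE; apply/tgcP/tensor_catC.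
Qed.
Fact tg_add0 : left_id (tgc [::]) tg_add.
Proof. by elim/tg_ind=> s; rewrite tg_addE. Qed.
Fact tg_addN : left_inverse (tgc [::]) tg_opp tg_add.
Proof. by elim/tg_ind=> s; rewrite tg_oppE tg_addE; apply/tgcP/tensor_negl. Qed.

HB.instance Definition _ := GRing.isZmodule.Build tg tg_addA tg_addC tg_add0 tg_addN.

Definition pure (m : M) (n : N) : tg := tgc [:: (m, n)].

Lemma pureDl n : {morph pure^~ n : m m' / m + m'}.
Proof. by move=> m m'; rewrite [RHS]tg_addE; apply/tgcP/tensor_Dl. Qed.
Lemma pureDr m : {morph pure m : n n' / n + n'}.
Proof. by move=> n n'; rewrite [RHS]tg_addE; apply/tgcP/tensor_Dr. Qed.
Lemma pureZ a m n : pure (a *: m) n = pure m (a *: n).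
Proof. by apply/tgcP/tensor_Z. Qed.
Lemma pure0l n : pure 0 n = 0. Proof. by apply/tgcP/tensor_0l. Qed.
Lemma pure0r m : pure m 0 = 0.
Proof. by rewrite -(scale0r (0 : N)) -pureZ scale0r pure0l. Qed.
Lemma pure_suml n (I : Type) (r : seq I) (F : I -> M) :
  pure (\sum_(i <- r) F i) n = \sum_(i <- r) pure (F i) n.
Proof. by apply: (big_morph (pure^~ n)); [exact: pureDl|exact: pure0l]. Qed.
Lemma pure_sumr m (I : Type) (r : seq I) (F : I -> N) :
  pure m (\sum_(i <- r) F i) = \sum_(i <- r) pure m (F i).
Proof. by apply: (big_morph (pure m)); [exact: pureDr|exact: pure0r]. Qed.

Lemma tgc_sum s : tgc s = \sum_(x <- s) pure x.1 x.2.
Proof.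
elim: s => [|[m n] s IH]; first by rewrite big_nil.
by rewrite big_cons -IH -cat1s -tg_addE.
Qed.

Lemma tensor_eqP s t : tensor_eq s t <->
  \sum_(x <- s) pure x.1 x.2 = \sum_(x <- t) pure x.1 x.2.
Proof. by rewrite -!tgc_sum tgcP. Qed.

Lemma tensor_balanced (G : zmodType) (b : M -> N -> G) :
  (forall n, {morph b^~ n : m m' / m + m'}) -> (forall m, {morph b m : n n' / n + n'}) ->
  (forall a m n, b (a *: m) n = b m (a *: n)) ->
  forall s t, tensor_eq s t -> \sum_(x <- s) b x.1 x.2 = \sum_(x <- t) b x.1 x.2.
Proof.
move=> bl br bz s t; elim=> //= {s t}.
- by move=> s t u _ -> _ ->.
- by move=> s s' t t' _ e _ e'; rewrite !big_cat e e'.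
- by move=> s t; rewrite !big_cat /= addrC.
- move=> n; rewrite big_seq1 big_nil /=; apply: (addrI (b 0 n)).
  by rewrite -bl !addr0.
- by move=> m m' n; rewrite !big_cons !big_nil /= !addr0 bl.
- by move=> m n n'; rewrite !big_cons !big_nil /= !addr0 br.
- by move=> a m n; rewrite !big_seq1 /= bz.
Qed.

Let rp (J : finType) (m' : J -> M) (x : (J -> A) * N) : M * N :=
  (\sum_j x.1 j *: m' j, x.2).

(** The explicit form of equality of tensors when [M] is flat: all left factors are combinations of
    common elements [m' j], and on both sides [m' j] is paired with the same element of [N]. *)
Let tr s t := exists (J : finType) (m' : J -> M) (Ls Lt : seq ((J -> A) * N)),
  [/\ s = map (rp m') Ls, t = map (rp m') Lt &
      forall j, \sum_(x <- Ls) x.1 j *: x.2 = \sum_(x <- Lt) x.1 j *: x.2].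

Let exl (J J' : finType) (x : (J -> A) * N) : ((J + J')%type -> A) * N :=
  (fun k => if k is inl j then x.1 j else 0, x.2).
Let exr (J J' : finType) (x : (J' -> A) * N) : ((J + J')%type -> A) * N :=
  (fun k => if k is inr j then x.1 j else 0, x.2).
Let jn (J J' : finType) (m : J -> M) (m' : J' -> M) (k : (J + J')%type) : M :=
  match k with inl j => m j | inr j => m' j end.

Let rp_exl (J J' : finType) (m : J -> M) (m' : J' -> M) x :
  rp (jn m m') (@exl J J' x) = rp m x.
Proof.
rewrite /rp big_sumT /= [X in _ + X]big1 ?addr0 // => i _; exact: scale0r.
Qed.
Let rp_exr (J J' : finType) (m : J -> M) (m' : J' -> M) x :
  rp (jn m m') (@exr J J' x) = rp m' x.
Proof.
rewrite /rp big_sumT /= [X in X + _]big1 ?add0r // => i _; exact: scale0r.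
Qed.

Let rep s : exists (J : finType) (m' : J -> M) (L : seq ((J -> A) * N)), s = map (rp m') L.
Proof.
elim: s => [|[m n] s [J [m' [L ->]]]]; first by exists 'I_0, (fun=> 0), [::].
exists ('I_1 + J)%type, (jn (fun=> m) m'), (exl _ (fun=> 1, n) :: map (@exr 'I_1 J) L).
rewrite map_cons; congr cons.
  by rewrite rp_exl /rp /= big_ord1 scale1r.
by rewrite -map_comp; apply: eq_map => x; rewrite /= rp_exr.
Qed.

(** By induction on the generation of [tensor_eq]. Flatness enters in transitivity only, where the
    two expressions of the middle tensor have to be merged. *)
Lemma tensor_tr (fM : eqflat (fun _ : M => True)) s t : tensor_eq s t -> tr s t.
Proof.
elim=> {s t} //=.
- move=> s; have [J [m' [L sE]]] := rep s; exists J, m', L, L; split=> //.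
- move=> s t _ [J [m' [Ls [Lt [sE tE e]]]]]; exists J, m', Lt, Ls; split=> //.
- move=> s t u _ [J [m1 [Ls [Lt [sE tE e]]]]] _ [K [m2 [Lt' [Lu [tE' uE e']]]]].
  pose x0 : (J -> A) * N := (fun=> 0, 0); pose y0 : (K -> A) * N := (fun=> 0, 0).
  have szt : size Lt = size Lt'.
    by rewrite -(size_map (rp m1)) -(size_map (rp m2)) -tE -tE'.
  (* Each term of the middle tensor has one left factor, expressed through [m1] and through [m2];
     this is a linear relation between the two families. Trivialising all of them expresses both
     families through a common [m3]. *)
  pose a (i : nat) (k : (J + K)%type) := match k with
    inl j => (nth x0 Lt i).1 j | inr j => - (nth y0 Lt' i).1 j end.
  have nE i : (i < size Lt)%N -> rp m1 (nth x0 Lt i) = rp m2 (nth y0 Lt' i).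
    move=> lt; rewrite -(nth_map x0 (0, 0) (rp m1)) //.
    by rewrite -(nth_map y0 (0, 0) (rp m2)) -?szt // -tE -tE'.
  have rel i : i \in iota 0 (size Lt) -> \sum_k a i k *: jn m1 m2 k = 0.
    rewrite mem_iota add0n => /andP[_ /nE[e1 _]].
    rewrite big_sumT /= e1 -big_split big1 //= => j _.
    by rewrite scaleNr addrN.
  have [L [c [m3 [_ jE cE]]]] := eqflat_multi fM (fun=> I) rel.
  exists L, m3, [seq (fun l => \sum_j x.1 j * c (inl j) l, x.2) | x <- Ls],
    [seq (fun l => \sum_j x.1 j * c (inr j) l, x.2) | x <- Lu]; split.
  + rewrite sE -map_comp; apply: eq_map => x; rewrite /rp /=; congr (_, _).
    under [RHS]eq_bigr do rewrite scaler_suml; rewrite exchange_big /=.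
    apply: eq_bigr => j _; rewrite -[m1 j]/(jn m1 m2 (inl j)) jE scaler_sumr.
    by apply: eq_bigr => l _; rewrite scalerA.
  + rewrite uE -map_comp; apply: eq_map => x; rewrite /rp /=; congr (_, _).
    under [RHS]eq_bigr do rewrite scaler_suml; rewrite exchange_big /=.
    apply: eq_bigr => j _; rewrite -[m2 j]/(jn m1 m2 (inr j)) jE scaler_sumr.
    by apply: eq_bigr => l _; rewrite scalerA.
  + move=> l; rewrite !big_map /=.
    have sw (Q : finType) (Lx : seq ((Q -> A) * N)) (d : Q -> A) :
        \sum_(x <- Lx) (\sum_j x.1 j * d j) *: x.2 =
        \sum_j d j *: \sum_(x <- Lx) x.1 j *: x.2.
      under eq_bigr do rewrite scaler_suml; rewrite exchange_big /=.
      apply: eq_bigr => j _; rewrite scaler_sumr.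
      by apply: eq_bigr => x _; rewrite scalerA mulrC.
    rewrite !sw; under eq_bigr do rewrite e; under [RHS]eq_bigr do rewrite -e'.
    rewrite -!sw (big_nth x0) [RHS](big_nth y0) -szt !big_mkord.
    apply: eq_bigr => i _; have [_ /= <-] := nE i (ltn_ord i); congr (_ *: _).
    have := cE i _ l; rewrite mem_iota add0n ltn_ord => /(_ isT).
    rewrite big_sumT /= => /eqP; rewrite addr_eq0 => /eqP ->.
    by rewrite -sumrN; apply: eq_bigr => j _; rewrite mulNr opprK.
- move=> s s' t t' _ [J [m1 [Ls [Ls' [sE sE' e]]]]] _ [K [m2 [Lt [Lt' [tE tE' e']]]]].
  exists (J + K)%type, (jn m1 m2), (map (@exl J K) Ls ++ map (@exr J K) Lt),
    (map (@exl J K) Ls' ++ map (@exr J K) Lt').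
  have E (L1 : seq ((J -> A) * N)) (L2 : seq ((K -> A) * N)) :
      map (rp m1) L1 ++ map (rp m2) L2 =
      map (rp (jn m1 m2)) (map (@exl J K) L1 ++ map (@exr J K) L2).
    by rewrite map_cat -!map_comp; congr cat; apply: eq_map => x; rewrite /= ?rp_exl ?rp_exr.
  split=> [||[j|j]]; rewrite ?sE ?sE' ?tE ?tE' ?E //.
  + rewrite !big_cat !big_map /= e; congr (_ + _).
    by rewrite !big1 // => x _; rewrite scale0r.
  + rewrite !big_cat !big_map /= e'; congr (_ + _).
    by rewrite !big1 // => x _; rewrite scale0r.
- move=> s t; have [J [m' [L]]] := rep (s ++ t).
  move=> e; pose L1 := take (size s) L; pose L2 := drop (size s) L.
  have sE : s = map (rp m') L1 by rewrite map_take -e take_size_cat.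
  have tE : t = map (rp m') L2 by rewrite map_drop -e drop_size_cat.
  exists J, m', (L1 ++ L2), (L2 ++ L1).
  by rewrite !map_cat -sE -tE; split=> // j; rewrite !big_cat /= addrC.
- move=> n; exists 'I_0, (fun=> 0), [:: (fun=> 0, n)], [::]; split=> //.
  + by rewrite /= /rp big_ord0.
  + by case.
- move=> m m' n; exists bool, (fun b => if b then m else m'), [:: (fun=> 1, n)],
    [:: (fun b : bool => b%:R, n); (fun b : bool => (~~ b)%:R, n)]; split.
  + by rewrite /= /rp big_bool /= !scale1r.
  + by rewrite /= /rp !big_bool /= !scale1r !scale0r addr0 add0r.
  + by case; rewrite !big_cons !big_nil /= !addr0 !scale1r scale0r ?addr0 ?add0r.
- move=> m n n'; exists 'I_1, (fun=> m), [:: (fun=> 1, n + n')],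
    [:: (fun=> 1, n); (fun=> 1, n')]; split.
  + by rewrite /= /rp !big_ord1 !scale1r.
  + by rewrite /= /rp !big_ord1 !scale1r.
  + by move=> j; rewrite !big_cons !big_nil /= !addr0 !scale1r.
- move=> a m n; exists 'I_1, (fun=> m), [:: (fun=> a, n)], [:: (fun=> 1, a *: n)]; split.
  + by rewrite /= /rp !big_ord1.
  + by rewrite /= /rp !big_ord1 !scale1r.
  + by move=> j; rewrite !big_cons !big_nil /= !addr0 !scale1r.
Qed.

End TensorGroup.

Section Vanish.
Context (A : comPzRingType) (M N : lmodType A).

(** Comparison with the empty sum by [tensor_tr]; what remains is to match the entries of the list
    with the indices. *)
Lemma pure_vanish (I : finType) (m : I -> M) (n : I -> N) :
  eqflat (fun _ : M => True) -> \sum_i pure (m i) (n i) = 0 ->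
  exists (J : finType) (c : I -> J -> A) (m' : J -> M),
    (forall i, m i = \sum_j c i j *: m' j) /\ forall j, \sum_i c i j *: n i = 0.
Proof.
move=> fM e; pose s := [seq (m i, n i) | i <- index_enum I].
have /(tensor_tr fM)[J [m' [Ls [Lt [sE tE cE]]]]] : tensor_eq s [::].
  by apply/tensor_eqP; rewrite big_nil big_map.
have Lt0 : Lt = [::] by case: Lt tE {cE}.
pose x0 : (J -> A) * N := (fun=> 0, 0).
have sz : size Ls = size (index_enum I).
  by have := congr1 size sE; rewrite /s !size_map.
pose r i := nth x0 Ls (index i (index_enum I)).
have rE i : (m i, n i) = (\sum_j (r i).1 j *: m' j, (r i).2).
  have := congr1 (fun s => nth (0, 0) s (index i (index_enum I))) sE.
  rewrite (nth_map i) ?index_mem ?mem_index_enum // nth_index ?mem_index_enum // => ->.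
  by rewrite (nth_map x0) // sz index_mem mem_index_enum.
have LsE : Ls = map r (index_enum I).
  apply: (@eq_from_nth _ x0) => [|k]; first by rewrite size_map.
  rewrite sz => kI; have [i ik] : exists i, index i (index_enum I) = k.
    have i0 : I by case: (index_enum I) kI.
    by exists (nth i0 (index_enum I) k); rewrite index_uniq // index_enum_uniq.
  by rewrite (nth_map i) // -ik nth_index ?mem_index_enum // /r.
exists J, (fun i => (r i).1), m'; split=> [i|j]; first by have [] := rE i.
have := cE j; rewrite Lt0 big_nil LsE big_map => e0; rewrite -[RHS]e0.
by apply: eq_bigr => i _; have [_ ->] := rE i.
Qed.

End Vanish.

Section Ker.
Context (A : comPzRingType) (U V : lmodType A) (h : {linear U -> V}).

Definition kerp : {pred U} := fun v => h v == 0.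

Fact ker_closed : submod_closed kerp.
Proof.
split=> [|a u v]; rewrite !unfold_in ?linear0 ?eqxx // => /eqP hu /eqP hv.
by rewrite linearP hu hv scaler0 addr0.
Qed.

HB.instance Definition _ := GRing.isSubmodClosed.Build A U kerp ker_closed.

Record lker := Lker { lkv :> U; lkvP : lkv \in kerp }.
HB.instance Definition _ := [isSub for lkv].
HB.instance Definition _ := [Choice of lker by <:].
HB.instance Definition _ := [SubChoice_isSubLmodule of lker by <:].

Lemma lkerP (y : U) : h y = 0 <-> exists x : lker, (val : {linear lker -> U}) x = y.
Proof.
split=> [hy|[x <-]]; last by apply/eqP; exact: (lkvP x).
by have ky : y \in kerp; [apply/eqP|exists (Lker ky)].
Qed.

End Ker.

Section FlatModule.
Context (A : comPzRingType) (M : lmodType A).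

(** A tensor killed by [h] is trivialised by [pure_vanish]. The combinations of its right factors
    that occur there are killed by [h], so they lift through [g]. *)
Lemma eqflat_module : eqflat (fun _ : M => True) -> flat_module M.
Proof.
move=> fM N1 N2 N3 g h ex t; split=> [ht|[s st]]; last first.
  apply/tensor_eqP; rewrite big_nil big_map.
  have := @tensor_balanced A M N2 (tg M N3) (fun m n => pure m (h n)) _ _ _ _ _ st.
  rewrite big_map /= => <- //.
  - apply: big1 => x _; have -> : h (g x.2) = 0 by apply/ex; exists x.2.
    exact: pure0r.
  - by move=> n m m'; exact: pureDl.
  - by move=> m n n'; rewrite linearD; exact: pureDr.
  - by move=> a m n; rewrite linearZ; exact: pureZ.
move/tensor_eqP: ht; rewrite big_nil big_map big_tnth => /(pure_vanish fM).
move=> [J [c [m' [/= mE cE]]]].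
have /choice[x gx] j : exists x, g x = \sum_i c i j *: (tnth (in_tuple t) i).2.
  apply/ex; rewrite linear_sum -[RHS](cE j).
  by apply: eq_bigr => i _; rewrite linearZ.
exists [seq (m' j, x j) | j <- index_enum J]; apply/tensor_eqP.
rewrite !big_map [RHS]big_tnth /=.
under eq_bigr do rewrite gx pure_sumr; rewrite exchange_big /=.
apply: eq_bigr => i _; rewrite mE pure_suml.
by apply: eq_bigr => j _; rewrite pureZ.
Qed.

(** The relation says that the tensor of the [m i] with the standard basis [d i] of A^I dies under
    the linear form with coefficients [a i]. Exactness moves this tensor into the kernel of the
    form, and the coordinates of the new right factors are the coefficients sought. *)
Lemma flat_module_eq : flat_module M -> eqflat (fun _ : M => True).
Proof.
move=> fM I a m _ am.
pose h0 (v : {ffun I -> A^o}) : A^o := \sum_i a i * v i.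
have h0l : linear h0.
  move=> b u v; rewrite /h0 scaler_sumr -big_split; apply: eq_bigr => i _ /=.
  by rewrite !ffunE /GRing.scale /=; ring.
pose h : {linear {ffun I -> A^o} -> A^o} := HB.pack h0 (GRing.isLinear.Build _ _ _ _ h0 h0l).
pose d (i : I) : {ffun I -> A^o} := [ffun k => (k == i)%:R].
have hd i : h (d i) = a i.
  rewrite /= /h0 (bigD1 i) //= ffunE eqxx mulr1 big1 ?addr0 // => k /negbTE ki.
  by rewrite ffunE ki mulr0.
have ht : tensor_eq (tensor_map h [seq (m i, d i) | i <- index_enum I]) [::].
  apply/tensor_eqP; rewrite big_nil !big_map /=.
  transitivity (\sum_i pure (a i *: m i) (1 : A^o)).
    apply: eq_bigr => i _; rewrite pureZ -[h0 _]/(h (d i)) hd.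
    by congr pure; rewrite /GRing.scale /= mulr1.
  by rewrite -pure_suml am pure0l.
have [/(_ ht)[s st] _] := fM _ _ _ _ h (@lkerP A _ _ h) [seq (m i, d i) | i <- index_enum I].
have co i : m i = \sum_(x <- s) (val x.2) i *: x.1.
  have := @tensor_balanced A M {ffun I -> A^o} M (fun m v => v i *: m) _ _ _ _ _ st.
  rewrite !big_map /= => ->.
  - rewrite (bigD1 i) //= ffunE eqxx scale1r big1 ?addr0 // => k /negbTE ki.
    by rewrite ffunE eq_sym ki scale0r.
  - by move=> v u u'; rewrite scalerDr.
  - by move=> u v v'; rewrite ffunE scalerDl.
  - by move=> b u v; rewrite ffunE scalerA mulrC.
exists 'I_(size s), (fun i k => val (tnth (in_tuple s) k).2 i),
  (fun k => (tnth (in_tuple s) k).1); split=> // [i|k].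
  by rewrite co big_tnth.
by have /eqP := lkvP (tnth (in_tuple s) k).2.
Qed.

End FlatModule.

(** * Tensor products of rings *)

Section Pushout.
Context (B C : comPzRingType) (Rel : B -> C -> Prop).

(** [Rel r s] imposes r (x) 1 = 1 (x) s. A relation, in place of two maps from a base ring, also
    serves for stalks over two points of a base that are not definitionally equal ([fpRel]). *)
Definition po_balanced (G : zmodType) (f : B -> C -> G) : Prop :=
  [/\ forall y, {morph f^~ y : x x' / x + x'}, forall x, {morph f x : y y' / y + y'}
    & forall r s, Rel r s -> forall x y, f (r * x) y = f x (s * y)].

(* Equality in the tensor product, expressed through all the balanced maps.   *)
Definition po_eq (s t : seq (B * C)) := forall (G : zmodType) (f : B -> C -> G),
  po_balanced f -> \sum_(x <- s) f x.1 x.2 = \sum_(x <- t) f x.1 x.2.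

Definition po_mul (s t : seq (B * C)) := [seq (x.1 * y.1, x.2 * y.2) | x <- s, y <- t].

Lemma po_sum_mul (G : zmodType) (f : B -> C -> G) s t :
  \sum_(x <- po_mul s t) f x.1 x.2 =
  \sum_(x <- s) \sum_(y <- t) f (x.1 * y.1) (x.2 * y.2).
Proof.
rewrite /po_mul big_flatten big_map /=; apply: eq_bigr => x _.
by rewrite big_map.
Qed.

Lemma po_balancedN (G : zmodType) (f : B -> C -> G) x y :
  po_balanced f -> f (- x) y = - f x y.
Proof.
move=> [fl _ _]; have f0 : f 0 y = 0 by apply: (addrI (f 0 y)); rewrite -fl !addr0.
by apply/eqP; rewrite -addr_eq0 -fl addNr f0.
Qed.

Definition po_setoid : setoid_ring.
Proof.
refine (@SetoidRing (seq (B * C)) po_eq _ _ _ [::] [:: (1, 1)]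
  (fun s => [seq (- x.1, x.2) | x <- s]) cat po_mul _ _ _ _ _ _ _ _ _ _ _).
- by [].
- by move=> s t e G f fb; rewrite e.
- by move=> s t u e e' G f fb; rewrite e // e'.
- move=> s t e G f fb; rewrite !big_map /=.
  under eq_bigr do rewrite po_balancedN //; under [RHS]eq_bigr do rewrite po_balancedN //.
  by rewrite !sumrN e.
- by move=> s s' t t' e e' G f fb; rewrite !big_cat /= e // e'.
- move=> s s' t t' e e' G f fb; have [fl fr fR] := fb; rewrite !po_sum_mul.
  transitivity (\sum_(x <- s') \sum_(y <- t) f (x.1 * y.1) (x.2 * y.2)).
    apply: (e G (fun u v => \sum_(y <- t) f (u * y.1) (v * y.2))); split.
    + by move=> y u v /=; rewrite -big_split; apply: eq_bigr => z _; rewrite mulrDl fl.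
    + by move=> y u v /=; rewrite -big_split; apply: eq_bigr => z _; rewrite mulrDl fr.
    + by move=> r q h x y /=; apply: eq_bigr => z _; rewrite -!mulrA (fR _ _ h).
  apply: eq_bigr => x _; apply: (e' G (fun u v => f (x.1 * u) (x.2 * v))); split.
  + by move=> y u v /=; rewrite mulrDr fl.
  + by move=> y u v /=; rewrite mulrDr fr.
  + by move=> r q h u v /=; rewrite mulrCA (fR _ _ h) mulrCA.
- by move=> s t u G f _; rewrite catA.
- by move=> s t G f _; rewrite !big_cat /= addrC.
- by [].
- move=> s G f fb; rewrite big_cat big_map big_nil /= -big_split big1 // => x _ /=.
  by rewrite po_balancedN // addNr.
- move=> s t u G f _; rewrite !po_sum_mul.
  rewrite (po_sum_mul (fun x y => \sum_(z <- u) f (x * z.1) (y * z.2))).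
  apply: eq_bigr => x _; rewrite (po_sum_mul (fun u v => f (x.1 * u) (x.2 * v))).
  by apply: eq_bigr => y _; apply: eq_bigr => z _; rewrite /= !mulrA.
- move=> s t G f _; rewrite !po_sum_mul exchange_big /=.
  by apply: eq_bigr => x _; apply: eq_bigr => y _; congr f; apply: mulrC.
- move=> s G f _; rewrite po_sum_mul big_seq1.
  by apply: eq_bigr => x _; rewrite !mul1r.
- by move=> s t u G f _; rewrite big_cat !po_sum_mul big_cat.
Defined.

Definition po : comPzRingType := quo po_setoid.
Let cl s : po := @class po_setoid s.

Lemma po_classP s t : cl s = cl t <-> po_eq s t. Proof. exact: classP. Qed.

Fact po1_zmod : zmod_morphism (fun b => cl [:: (b, 1)]).
Proof.
move=> b b'; rewrite /cl -classN -classD; apply/classP => G f fb /=.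
by have [fl _ _] := fb; rewrite !big_cons !big_nil !addr0 /= fl.
Qed.
Fact po1_monoid : monoid_morphism (fun b => cl [:: (b, 1)]).
Proof.
split=> // b b'; rewrite /cl -classM; apply/classP => G f fb /=.
by rewrite !big_seq1 /= mulr1.
Qed.
(* The maps are opaque to keep [simpl] from exposing classes of sequences.    *)
Fact po1_key : {f : {rmorphism B -> po} | f =1 (fun b => cl [:: (b, 1)])}.
Proof. by exists (mk_rmorph po1_zmod po1_monoid). Qed.
Definition po1 : {rmorphism B -> po} := sval po1_key.
Let po1E : po1 =1 (fun b => cl [:: (b, 1)]) := svalP po1_key.

Fact po2_zmod : zmod_morphism (fun c => cl [:: (1, c)]).
Proof.
move=> b b'; rewrite /cl -classN -classD; apply/classP => G f fb /=.
rewrite !big_cons !big_nil !addr0 /= po_balancedN //; have [_ fr _] := fb.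
have f0 : f 1 0 = 0 by apply: (addrI (f 1 0)); rewrite -fr !addr0.
rewrite fr; congr (_ + _); apply/eqP.
by rewrite -addr_eq0 -fr addNr f0.
Qed.
Fact po2_monoid : monoid_morphism (fun c => cl [:: (1, c)]).
Proof.
split=> // b b'; rewrite /cl -classM; apply/classP => G f fb /=.
by rewrite !big_seq1 /= mulr1.
Qed.
Fact po2_key : {f : {rmorphism C -> po} | f =1 (fun c => cl [:: (1, c)])}.
Proof. by exists (mk_rmorph po2_zmod po2_monoid). Qed.
Definition po2 : {rmorphism C -> po} := sval po2_key.
Let po2E : po2 =1 (fun c => cl [:: (1, c)]) := svalP po2_key.

Lemma po_rel r s : Rel r s -> po1 r = po2 s.
Proof.
move=> h; rewrite po1E po2E; apply/po_classP => G f [_ _ fR]; rewrite !big_seq1 /=.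
by rewrite -[r]mulr1 (fR _ _ h) mulr1.
Qed.

Lemma po_class_sum s : cl s = \sum_(x <- s) po1 x.1 * po2 x.2.
Proof.
elim: s => [|x s IH]; first by rewrite big_nil /cl -class0.
rewrite big_cons -IH po1E po2E /cl -classM -classD; apply/classP => G f _ /=.
by rewrite !big_cons /= mulr1 mul1r.
Qed.

Lemma po_gen (z : po) : exists s : seq (B * C), z = \sum_(x <- s) po1 x.1 * po2 x.2.
Proof. by elim/quo_ind: z => s; exists s; rewrite -po_class_sum. Qed.

Lemma po_genI (z : po) : exists (I : finType) (b : I -> B) (c : I -> C),
  z = \sum_i po1 (b i) * po2 (c i).
Proof.
have [s ->] := po_gen z; rewrite big_tnth.
by exists 'I_(size s), (fun i => (tnth (in_tuple s) i).1),
  (fun i => (tnth (in_tuple s) i).2).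
Qed.

Lemma po_ind (P : po -> Prop) : (forall b, P (po1 b)) -> (forall c, P (po2 c)) ->
  (forall x y, P x -> P y -> P (x + y)) -> (forall x y, P x -> P y -> P (x * y)) ->
  forall z, P z.
Proof.
move=> h1 h2 hD hM z; have [s ->] := po_gen z.
apply: big_ind => //; first by rewrite -(rmorph0 po1).
by move=> i _; apply: hM.
Qed.

Lemma po_lift (D : comPzRingType) (f : {rmorphism B -> D}) (g : {rmorphism C -> D}) :
  (forall r s, Rel r s -> f r = g s) ->
  exists h : {rmorphism po -> D}, (forall b, h (po1 b) = f b) /\ forall c, h (po2 c) = g c.
Proof.
move=> fg; pose h (s : po_setoid) := \sum_(x <- (s : seq (B * C))) f x.1 * g x.2.
have hc (s t : po_setoid) : sr_eq s t -> h s = h t.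
  move=> e; apply: (e D (fun x y => f x * g y)); split.
  - by move=> y x x'; rewrite rmorphD mulrDl.
  - by move=> x y y'; rewrite rmorphD mulrDr.
  - by move=> r q /fg rq x y; rewrite !rmorphM rq; ring.
have h1 : h (sr_one po_setoid) = 1 by rewrite /h big_seq1 /= !rmorph1 mulr1.
have hN s : h (sr_opp s) = - h s.
  by rewrite /h big_map -sumrN; apply: eq_bigr => x _; rewrite /= rmorphN mulNr.
have hD s t : h (sr_add s t) = h s + h t by rewrite /h big_cat.
have hM s t : h (sr_mul s t) = h s * h t.
  rewrite /h [LHS](po_sum_mul (fun x y => f x * g y)) mulr_suml.
  apply: eq_bigr => x _; rewrite mulr_sumr; apply: eq_bigr => y _.
  by rewrite !rmorphM mulrACA.
exists (@quo_lift po_setoid D h hc h1 hN hD hM); split=> [b|c].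
- by rewrite ?po1E ?po2E [LHS](@quo_liftE po_setoid D h hc) /h big_seq1 /= rmorph1 mulr1.
- by rewrite ?po1E ?po2E [LHS](@quo_liftE po_setoid D h hc) /h big_seq1 /= rmorph1 mul1r.
Qed.

Lemma po_uniq (D : comPzRingType) (f g : {rmorphism po -> D}) :
  (forall b, f (po1 b) = g (po1 b)) -> (forall c, f (po2 c) = g (po2 c)) -> f =1 g.
Proof.
move=> e1 e2; apply: po_ind => // x y ex ey.
- by rewrite !rmorphD ex ey.
- by rewrite !rmorphM ex ey.
Qed.

End Pushout.

(** * Flat and weakly étale ring maps *)

Section Algebra.
Context (A B : comPzRingType) (phi : {rmorphism A -> B}).

Definition aflat_on (P : B -> Prop) := @eqflat A (scalar_restriction phi) P.
Definition aflat := aflat_on (fun=> True).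

Lemma aflatP : aflat <-> flat_hom phi.
Proof. by split; [exact: eqflat_module|exact: flat_module_eq]. Qed.

Lemma aflatE : aflat <-> forall (I : finType) (a : I -> A) (b : I -> B),
  \sum_i phi (a i) * b i = 0 ->
  exists (J : finType) (c : I -> J -> A) (b' : J -> B),
    (forall i, b i = \sum_j phi (c i j) * b' j) /\ forall j, \sum_i a i * c i j = 0.
Proof.
split=> h I a b.
- by move=> /(h I a b (fun=> Logic.I))[J [c [b' [_ e e']]]]; exists J, c, b'.
- by move=> _ /h[J [c [b' [e e']]]]; exists J, c, b'.
Qed.

Definition tens_rel (C : comPzRingType) (psi : {rmorphism A -> C}) (b : B) (c : C) : Prop :=
  exists a, b = phi a /\ c = psi a.

Definition tens (C : comPzRingType) (psi : {rmorphism A -> C}) := po (tens_rel psi).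

Lemma tens_comm (C : comPzRingType) (psi : {rmorphism A -> C}) a :
  po1 (tens_rel psi) (phi a) = po2 (tens_rel psi) (psi a).
Proof. by apply: po_rel; exists a. Qed.

Lemma tens_lift (C : comPzRingType) (psi : {rmorphism A -> C}) (D : comPzRingType)
    (f : {rmorphism B -> D}) (g : {rmorphism C -> D}) :
  (forall a, f (phi a) = g (psi a)) ->
  exists h : {rmorphism tens psi -> D}, (forall b, h (po1 (tens_rel psi) b) = f b) /\
    forall c, h (po2 (tens_rel psi) c) = g c.
Proof. by move=> e; apply: po_lift => _ _ [a [-> ->]]. Qed.

(** Among the balanced maps that define equality in [tens] is the one to the tensor product of
    modules, where [pure_vanish] applies. *)
Lemma tens_vanish (C : comPzRingType) (psi : {rmorphism A -> C}) (I : finType)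
    (b : I -> B) (c : I -> C) : aflat ->
  \sum_i po1 (tens_rel psi) (b i) * po2 (tens_rel psi) (c i) = 0 ->
  exists (J : finType) (r : I -> J -> A) (b' : J -> B),
    (forall i, b i = \sum_j phi (r i j) * b' j) /\ forall j, \sum_i psi (r i j) * c i = 0.
Proof.
move=> fB e; pose s := [seq (b i, c i) | i <- index_enum I].
have se : po_eq (tens_rel psi) s [::].
  by apply/po_classP; rewrite po_class_sum big_map e.
apply: (@pure_vanish A (scalar_restriction phi) (scalar_restriction psi) I b c fB).
have := se (tg (scalar_restriction phi) (scalar_restriction psi)) 
  (fun x y => @pure A (scalar_restriction phi) (scalar_restriction psi) x y).
rewrite big_nil big_map; apply; split.
- by move=> y x x'; exact: pureDl.
- by move=> x y y'; exact: pureDr.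
- move=> _ _ [a [-> ->]] x y.
  exact: (@pureZ A (scalar_restriction phi) (scalar_restriction psi) a x y).
Qed.

Lemma tens_mu_ex : exists mu : {rmorphism tens phi -> B},
  (forall b, mu (po1 (tens_rel phi) b) = b) /\ forall b, mu (po2 (tens_rel phi) b) = b.
Proof. by apply: (tens_lift (f := idfun) (g := idfun)). Qed.

Definition tens_mu : {rmorphism tens phi -> B} := projT1 (cid tens_mu_ex).

Lemma tens_mu1 b : tens_mu (po1 (tens_rel phi) b) = b.
Proof. by rewrite /tens_mu; case: cid => mu []. Qed.

Lemma tens_mu2 b : tens_mu (po2 (tens_rel phi) b) = b.
Proof. by rewrite /tens_mu; case: cid => mu []. Qed.

Lemma tens_mu_diag (D : comPzRingType) (h : {rmorphism tens phi -> D}) t :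
  (forall b, h (po1 (tens_rel phi) b) = h (po2 (tens_rel phi) b)) ->
  h t = h (po1 (tens_rel phi) (tens_mu t)).
Proof.
move=> e; apply: (po_uniq (f := h) (g := h \o (po1 (tens_rel phi) \o tens_mu))) => b /=.
- by rewrite tens_mu1.
- by rewrite tens_mu2 e.
Qed.

(* [b] is annihilated, in the sense of b (x) 1 = 1 (x) b, by an element of    *)
(* B (x)_A B lying over 1; for all [b] this says that B (x)_A B -> B is flat. *)
Definition pure_at (b : B) := exists t : tens phi, tens_mu t = 1 /\
  po1 (tens_rel phi) b * t = po2 (tens_rel phi) b * t.

Lemma pure_at_phi a : pure_at (phi a).
Proof.
exists 1; split; first by rewrite rmorph1.
by rewrite !mulr1 tens_comm.
Qed.

(** Witnesses are multiplied. With [pure_at_phi] and [pure_atM], the elements that have a witness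
    form a subalgebra, so it is enough to look at generators. *)
Lemma pure_atD x y : pure_at x -> pure_at y -> pure_at (x + y).
Proof.
move=> [t [t1 e]] [u [u1 e']]; exists (t * u); split.
  by rewrite rmorphM t1 u1 mulr1.
by rewrite !rmorphD !mulrDl !mulrA e [X in _ + X = _]mulrAC e' [X in _ + X = _]mulrAC.
Qed.

Lemma pure_atM x y : pure_at x -> pure_at y -> pure_at (x * y).
Proof.
move=> [t [t1 e]] [u [u1 e']]; exists (t * u); split.
  by rewrite rmorphM t1 u1 mulr1.
by rewrite !rmorphM mulrACA e e' mulrACA.
Qed.

Lemma pure_atV x y : isunit y -> pure_at y -> pure_at (x * y) -> pure_at x.
Proof.
move=> uy [t [t1 e]] [u [u1 e']]; exists (t * u); split.
  by rewrite rmorphM t1 u1 mulr1.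
apply: (@unit_cancel _ (po1 (tens_rel phi) y)); first exact: isunit_rmorph.
transitivity (po1 (tens_rel phi) (x * y) * u * t); first by rewrite rmorphM; ring.
rewrite e' rmorphM; transitivity (po2 (tens_rel phi) x * u * (po2 (tens_rel phi) y * t)).
  by ring.
by rewrite -e; ring.
Qed.

Definition wet := aflat /\ forall b, pure_at b.

End Algebra.

Lemma pure_at_map (A B A' B' : comPzRingType) (phi : {rmorphism A -> B})
    (phi' : {rmorphism A' -> B'}) (f : {rmorphism A -> A'}) (g : {rmorphism B -> B'}) b :
  (forall a, g (phi a) = phi' (f a)) -> pure_at phi b -> pure_at phi' (g b).
Proof.
move=> e [t [t1 tb]].
have [h [h1 h2]] := @tens_lift A B phi B phi _
  (po1 (tens_rel phi' phi') \o g) (po2 (tens_rel phi' phi') \o g)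
  (fun a => etrans (congr1 _ (e a)) (etrans (tens_comm phi' phi' (f a))
     (congr1 _ (esym (e a))))).
have hmu x : tens_mu phi' (h x) = g (tens_mu phi x).
  apply: (po_uniq (f := tens_mu phi' \o h) (g := g \o tens_mu phi)) => y /=; first by rewrite h1 /= !tens_mu1.
  by rewrite h2 /= !tens_mu2.
exists (h t); split; first by rewrite hmu t1 rmorph1.
by have := congr1 h tb; rewrite !rmorphM h1 h2.
Qed.

Definition mset (A : comPzRingType) (M : A -> Prop) :=
  M 1 /\ forall x y, M x -> M y -> M (x * y).

Lemma mset_prime (A : comPzRingType) (p : spec A) : mset (fun u => ~ p u).
Proof. by split=> [|x y]; [exact: prime_one|exact: prime_mul]. Qed.

Lemma mset_one (A : comPzRingType) : mset (fun u : A => u = 1).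
Proof. by split=> // x y -> ->; rewrite mulr1. Qed.

Lemma mset_prod (A : comPzRingType) (M : A -> Prop) (I : Type) (r : seq I) (P : pred I)
  (F : I -> A) : mset M -> (forall i, M (F i)) -> M (\prod_(i <- r | P i) F i).
Proof. by move=> [h k] MF; apply: big_ind. Qed.

Lemma is_loc_id (A : comPzRingType) : is_loc (fun u : A => u = 1) (idfun : {rmorphism A -> A}).
Proof.
split=> [u ->|z|a a0]; first by exists 1; rewrite /= mulr1.
- by exists z, 1; rewrite /= mulr1.
- by exists 1; rewrite mul1r.
Qed.

Lemma loc_common (A L : comPzRingType) (M : A -> Prop) (psi : {rmorphism A -> L})
  (I : finType) (z : I -> L) : mset M -> is_loc M psi ->
  exists u (b : I -> A), M u /\ forall i, z i * psi u = psi (b i).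
Proof.
move=> MM [_ ls _].
have /choice[x xP] i : exists x : A * A, M x.2 /\ z i * psi x.2 = psi x.1.
  by have [a [u [Mu e]]] := ls (z i); exists (a, u).
exists (\prod_i (x i).2), (fun i => (x i).1 * \prod_(j | j != i) (x j).2).
split=> [|i]; first by apply: mset_prod => // i; have [] := xP i.
by rewrite (bigD1 i) //= !rmorphM mulrA (xP i).2.
Qed.

Section FlatLemmas.

Lemma aflat_comp (A B C : comPzRingType) (phi : {rmorphism A -> B})
    (psi : {rmorphism B -> C}) (chi : {rmorphism A -> C}) :
  (forall a, chi a = psi (phi a)) -> aflat phi -> aflat psi -> aflat chi.
Proof.
move=> e /aflatE fphi /aflatE fpsi; apply/aflatE => I a c rel.
have [|J [b [c' [cE bE]]]] := fpsi I (phi \o a) c.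
  by rewrite -[RHS]rel; apply: eq_bigr => i _; rewrite e.
pose X := {K : finType & ((I -> K -> A) * (K -> B))%type}.
have /choice[x xP] j : exists x : X,
    (forall i, b i j = \sum_k phi ((projT2 x).1 i k) * (projT2 x).2 k) /\
    forall k, \sum_i a i * (projT2 x).1 i k = 0.
  by have [K [r [b' [h1 h2]]]] := fphi I a (b^~ j) (bE j); exists (existT _ K (r, b')).
exists {j : J & projT1 (x j)}, (fun i k => (projT2 (x (tag k))).1 i (tagged k)),
  (fun k => psi ((projT2 (x (tag k))).2 (tagged k)) * c' (tag k)).
split=> [i|[j k]]; last exact: (xP j).2.
rewrite cE big_sigT /=.
apply: eq_bigr => j _; rewrite (xP j).1 rmorph_sum mulr_suml.
by apply: eq_bigr => k _; rewrite e rmorphM mulrA.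
Qed.

Lemma aflat_loc (A L : comPzRingType) (M : A -> Prop) (psi : {rmorphism A -> L}) :
  mset M -> is_loc M psi -> aflat psi.
Proof.
move=> MM lM; have [lu ls lk] := lM; apply/aflatE => I a z rel.
have [u [b [Mu zE]]] := loc_common z MM lM.
have [v [Mv vE]] : exists v, M v /\ v * \sum_i a i * b i = 0.
  apply: lk; rewrite rmorph_sum -[RHS](mul0r (psi u)) -[X in _ = X * _]rel mulr_suml.
  by apply: eq_bigr => i _; rewrite rmorphM -zE mulrA.
have [w wE] := lu _ (MM.2 _ _ Mu Mv).
exists 'I_1, (fun i _ => v * b i), (fun=> w); split=> [i|_].
  rewrite big_ord1 rmorphM -zE -[LHS]mulr1 -wE rmorphM; ring.
by rewrite -[RHS]vE mulr_sumr; apply: eq_bigr => i _; ring.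
Qed.

(** Coefficients in the localization come from [A] after multiplication by a common denominator,
    which is a unit there. *)
Lemma aflat_descend (A A' B : comPzRingType) (M : A -> Prop) (f : {rmorphism A -> A'})
    (phi : {rmorphism A -> B}) (phi' : {rmorphism A' -> B}) :
  (forall a, phi a = phi' (f a)) -> mset M -> is_loc M f -> aflat phi -> aflat phi'.
Proof.
move=> e MM lM /aflatE fphi; have [lu _ _] := lM; apply/aflatE => I a' b rel.
have [n [a [Mn aE]]] := loc_common a' MM lM.
have [|J [c [b' [bE cE]]]] := fphi I a b.
  rewrite -[RHS](mulr0 (phi n)) -[X in _ = _ * X]rel mulr_sumr; apply: eq_bigr => i _.
  by rewrite !e -aE rmorphM; ring.
exists J, (fun i j => f (c i j)), b'; split=> [i|j].
  by rewrite bE; apply: eq_bigr => j _; rewrite e.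
apply: (unit_cancel (lu _ Mn)); rewrite mul0r -[RHS](rmorph0 f) -(cE j) rmorph_sum.
by rewrite mulr_suml; apply: eq_bigr => i _; rewrite rmorphM -aE; ring.
Qed.

Lemma aflat_field (L B : comPzRingType) (phi : {rmorphism L -> B}) :
  (forall x : L, x <> 0 -> isunit x) -> aflat phi.
Proof.
move=> fL; apply/aflatE => I a b rel.
have [[k ak]|h] := pselect (exists k, a k <> 0); last first.
  exists I, (fun i j => (i == j)%:R), b; split=> [i|j].
    exact: esym (@sum_delta L (scalar_restriction phi) I b i).
  apply: big1 => i _; suff -> : a i = 0 by rewrite mul0r.
  by apply: contrapT => ai; apply: h; exists i.
have [v av] := fL _ ak.
(* The relation is solved for [b k]: row [k] carries the coefficients - a_j / a_k, and column [k] is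
   zero because [b k] does not occur on the right. *)
exists I, (fun i j => if j == k then 0 else if i == k then - (a j * v) else (i == j)%:R), b.
split=> [i|j].
  have [->|ik] := eqVneq i k.
    apply: (@unit_cancel _ (phi (a k))); first by apply: isunit_rmorph; exists v.
    have := rel; rewrite (bigD1 k) //= mulrC => /eqP; rewrite addr_eq0 => /eqP ->.
    rewrite [in RHS](bigD1 k) //= eqxx rmorph0 mul0r add0r mulr_suml -sumrN.
    apply: eq_bigr => j /negbTE ->; rewrite rmorphN !rmorphM.
    by rewrite -[LHS]mulr1 -(rmorph1 phi) -av rmorphM; ring.
  rewrite (bigD1 i) //= (negbTE ik) eqxx rmorph1 mul1r big1 ?addr0 // => j ji.
  by case: eqP => _; rewrite ?rmorph0 ?mul0r // eq_sym (negbTE ji) rmorph0 mul0r.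
have [_|jk] := eqVneq j k; first by apply: big1 => i _; rewrite mulr0.
rewrite (bigD1 k) //= eqxx (bigD1 j) //= ?(negbTE jk) ?eqxx big1 => [|i].
  by rewrite mulr1 addr0 mulrN mulrCA av mulr1 addNr.
by move=> /andP[/negbTE -> /negbTE ->]; rewrite mulr0.
Qed.

Lemma aflat_ann (A B : comPzRingType) (phi : {rmorphism A -> B}) a b :
  aflat phi -> phi a * b = 0 -> exists (J : finType) (c : J -> A) (b' : J -> B),
    b = \sum_j phi (c j) * b' j /\ forall j, a * c j = 0.
Proof.
move=> /aflatE f rel; have [|J [c [b' [bE cE]]]] := f 'I_1 (fun=> a) (fun=> b).
  by rewrite big_ord1.
by exists J, (c ord0), b'; split=> [//|j]; rewrite -[RHS](cE j) big_ord1.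
Qed.

Lemma aflat_torsion (A B : comPzRingType) (phi : {rmorphism A -> B}) a b :
  aflat phi -> (forall x, a * x = 0 -> x = 0) -> phi a * b = 0 -> b = 0.
Proof.
move=> f h /(aflat_ann f)[J [c [b' [-> cE]]]].
by apply: big1 => j _; rewrite (h _ (cE j)) rmorph0 mul0r.
Qed.

End FlatLemmas.

Section BaseChange.
Context (A B C : comPzRingType) (phi : {rmorphism A -> B}) (psi : {rmorphism A -> C}).
Local Notation i1 := (po1 (tens_rel phi psi)).
Local Notation i2 := (po2 (tens_rel phi psi)).

(** Expanding the unknowns into pure tensors turns a relation over [C] into the vanishing of a
    single tensor, which [tens_vanish] trivialises over [A]. *)
Lemma aflat_base : aflat phi -> aflat i2.
Proof.
move=> f; apply/aflatE => K s c rel.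
have /choice[l lP] k : exists l : seq (B * C), c k = \sum_(x <- l) i1 x.1 * i2 x.2.
  exact: po_gen.
pose T k : finType := 'I_(size (l k)); pose t k (i : T k) := tnth (in_tuple (l k)) i.
have cE k : c k = \sum_(i : T k) i1 (t k i).1 * i2 (t k i).2 by rewrite lP big_tnth.
pose I : finType := {k : K & T k}.
have [|J [r [b' [bE rE]]]] := @tens_vanish A B phi C psi I (fun q => (t _ (tagged q)).1)
    (fun q => s (tag q) * (t _ (tagged q)).2) f.
  rewrite -[RHS]rel big_sigT /=.
  apply: eq_bigr => k _; rewrite cE mulr_sumr; apply: eq_bigr => i _.
  by rewrite rmorphM; ring.
exists J, (fun k j => \sum_(i : T k) psi (r (existT _ k i) j) * (t k i).2), (fun j => i1 (b' j)).
split=> [k|j].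
  rewrite cE; under [RHS]eq_bigr do rewrite rmorph_sum mulr_suml.
  rewrite exchange_big /=; apply: eq_bigr => i _.
  have /= -> := bE (existT _ k i); rewrite rmorph_sum mulr_suml.
  by apply: eq_bigr => j _; rewrite !rmorphM -tens_comm; ring.
rewrite -[RHS](rE j) big_sigT /=.
apply: eq_bigr => k _; rewrite mulr_sumr; apply: eq_bigr => i _; ring.
Qed.

Lemma wet_base : wet phi -> wet i2.
Proof.
move=> [f p]; split; first exact: aflat_base.
apply: po_ind => [b|c|x y|x y].
- by apply: (pure_at_map (f := psi)) (p b) => a; exact: tens_comm.
- exact: pure_at_phi.
- exact: pure_atD.
- exact: pure_atM.
Qed.

(* For example [psi : A -> A / s A]. *)
Lemma tens_divisible s b w : aflat phi ->
  (forall d u, psi d = psi s * u -> exists d', d = s * d') ->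
  i1 b = i2 (psi s) * w -> exists b', b = phi s * b'.
Proof.
move=> f h; have [I [b0 [c0 ->]]] := po_genI w => e.
(* b (x) 1 minus the multiple of [psi s] is a vanishing tensor. In its trivialisation the
   coefficients of [b] have images divisible by [psi s], hence are divisible by [s]. *)
pose bb (k : ('I_1 + I)%type) := if k is inr i then b0 i else b.
pose cc (k : ('I_1 + I)%type) := if k is inr i then - (psi s * c0 i) else 1.
have [|J [r [b' [bE rE]]]] := @tens_vanish A B phi C psi _ bb cc f.
  rewrite big_sumT big_ord1 /= rmorph1 mulr1 e mulr_sumr -big_split big1 //= => i _.
  by rewrite rmorphN rmorphM; ring.
have /choice[d dE] j : exists d', r (inl ord0) j = s * d'.
  apply: (h _ (\sum_i psi (r (inr i) j) * c0 i)).
  have := rE j; rewrite big_sumT big_ord1 /= mulr1 => /eqP; rewrite addr_eq0 => /eqP ->.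
  by rewrite mulr_sumr -sumrN; apply: eq_bigr => i _; ring.
exists (\sum_j phi (d j) * b' j); rewrite -[LHS]/(bb (inl ord0)) bE mulr_sumr.
by apply: eq_bigr => j _; rewrite dE rmorphM mulrA.
Qed.

End BaseChange.

(** Descent for elements: trivialising b (x) 1 - 1 (x) b presents [b] as a fraction r / s of
    elements of [A], locally on the spectrum of [B]. *)
Lemma tens_equalizer (A B : comPzRingType) (phi : {rmorphism A -> B}) b : aflat phi ->
  po1 (tens_rel phi phi) b = po2 (tens_rel phi phi) b ->
  exists (J : finType) (r s : J -> A) (b' : J -> B),
    1 = \sum_j phi (s j) * b' j /\ forall j, phi (r j) = phi (s j) * b.
Proof.
move=> f e; pose bb (k : bool) := if k then b else -1.
pose cc (k : bool) := if k then 1 else b.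
have [|J [r [b' [bE rE]]]] := @tens_vanish A B phi B phi _ bb cc f.
  by rewrite big_bool /= rmorphN !rmorph1 mulr1 e mulN1r addrN.
exists J, (r true), (fun j => - r false j), b'; split=> [|j].
  have := bE false => /= /(congr1 -%R); rewrite opprK => ->; rewrite -sumrN.
  by apply: eq_bigr => j _; rewrite rmorphN mulNr.
have := rE j; rewrite big_bool /= mulr1 => /eqP; rewrite addr_eq0 => /eqP ->.
by rewrite rmorphN mulNr.
Qed.

Lemma wet_loc (A B A' B' : comPzRingType) (phi : {rmorphism A -> B})
    (M : B -> Prop) (psi : {rmorphism B -> B'}) (N : A -> Prop) (f : {rmorphism A -> A'})
    (phi' : {rmorphism A' -> B'}) :
  (forall a, psi (phi a) = phi' (f a)) -> mset M -> is_loc M psi ->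
  mset N -> is_loc N f -> wet phi -> wet phi'.
Proof.
move=> e MM lM NN lN [fl pu]; split.
  apply: (@aflat_descend _ _ _ N f (psi \o phi)) => //.
  by apply: (@aflat_comp _ _ _ phi psi) => //; exact: aflat_loc MM lM.
have [lu ls _] := lM; move=> z; have [b [u [Mu zE]]] := ls z.
apply: (@pure_atV _ _ phi' z (psi u)); first exact: lu.
- by apply: (pure_at_map e).
- by rewrite zE; apply: (pure_at_map e).
Qed.

(* A [B]-module that is flat over [A] is flat over [B]. *)
Lemma pure_flat (A B N : comPzRingType) (phi : {rmorphism A -> B})
    (psi : {rmorphism B -> N}) (chi : {rmorphism A -> N}) (P : N -> Prop) h n :
  (forall a, chi a = psi (phi a)) -> aflat phi -> pure_at phi h ->
  (forall b x, P x -> P (psi b * x)) -> aflat_on chi P ->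
  P n -> psi h * n = 0 ->
  exists (K : finType) (c : K -> B) (n' : K -> N), [/\ forall k, h * c k = 0,
    forall k, P (n' k) & n = \sum_k psi (c k) * n' k].
Proof.
move=> e f [t [t1 ht]] PM fP Pn hn.
have [I [u [v tE]]] := po_genI t.
have [th [th1 th2]] := @tens_lift A B phi B phi _ (po1 (tens_rel phi chi))
  (po2 (tens_rel phi chi) \o psi)
  (fun a => etrans (tens_comm phi chi a) (congr1 _ (e a))).
(* Write t as the sum of u_i (x) v_i. It takes [h] from the left factor to the right one, where it
   kills [n]; so the tensor of the h u_i with the v_i n vanishes in B (x)_A N. *)
have [|J [r [b' [bE rE]]]] := @tens_vanish A B phi N chi I (fun i => h * u i)
    (fun i => psi (v i) * n) f.
  have := congr1 (fun z => th z * po2 (tens_rel phi chi) n) ht.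
  rewrite /= [in RHS]rmorphM th2 /= mulrAC -rmorphM hn rmorph0 mul0r => r0.
  rewrite -[RHS]r0 tE mulr_sumr rmorph_sum mulr_suml; apply: eq_bigr => i _.
  by rewrite !rmorphM th1 th2 th1 /=; ring.
(* Flatness over [A] of the elements in [P] trivialises the relations between the v_i n, all at
   once. *)
have [K [c [n' [Pn' nE cE]]]] := @eqflat_multi A (scalar_restriction chi) P fP J (enum J) I
   (fun j i => r i j) (fun i => psi (v i) * n) (fun i => PM _ _ Pn)
   (fun j _ => rE j).
exists K, (fun k => \sum_i u i * phi (c i k)), n'; split=> // [k|].
  rewrite mulr_sumr; under eq_bigr do rewrite mulrA bE mulr_suml.
  rewrite exchange_big /= big1 // => j _.
  transitivity (b' j * phi (\sum_i r i j * c i k)).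
    by rewrite rmorph_sum mulr_sumr; apply: eq_bigr => i _; rewrite rmorphM; ring.
  by rewrite cE ?mem_enum // rmorph0 mulr0.
(* [t] multiplies out to 1, so [n] is the sum of the u_i v_i n. *)
have mE : n = \sum_i psi (u i) * (psi (v i) * n).
  rewrite -[LHS]mul1r -(rmorph1 psi) -t1 tE rmorph_sum rmorph_sum mulr_suml.
  by apply: eq_bigr => i _; rewrite rmorphM tens_mu1 tens_mu2 rmorphM mulrA.
rewrite {1}mE; under eq_bigr => i _ do rewrite (nE i) mulr_sumr.
rewrite exchange_big /=; apply: eq_bigr => k _; rewrite rmorph_sum mulr_suml.
apply: eq_bigr => i _; rewrite rmorphM -e -mulrA; congr (_ * _).
Qed.

(** * Adjoining a variable or a root *)

Lemma surj_lift (P F G : comPzRingType) (s : {rmorphism P -> F}) (f : {rmorphism P -> G}) :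
  (forall z, exists p, z = s p) -> (forall p, s p = 0 -> f p = 0) ->
  exists g : {rmorphism F -> G}, forall p, g (s p) = f p.
Proof.
move=> ss sf; pose r z := projT1 (cid (ss z)).
have rK z : s (r z) = z by rewrite /r; case: cid.
have E p q : s p = s q -> f p = f q.
  by move=> e; apply/eqP; rewrite -subr_eq0 -rmorphB sf // rmorphB e subrr.
have gz : zmod_morphism (f \o r).
  by move=> x y; rewrite /= -rmorphB; apply: E; rewrite rmorphB !rK.
have gm : monoid_morphism (f \o r).
  split=> [|x y] /=; first by rewrite -(rmorph1 f); apply: E; rewrite rK rmorph1.
  by rewrite -rmorphM; apply: E; rewrite rmorphM !rK.
by exists (mk_rmorph gz gm) => p; apply: E; rewrite rK.
Qed.

Lemma zero_ring_rmorph (A G : comPzRingType) : (1 : G) = 0 -> {rmorphism A -> G}.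
Proof.
move=> e; have z (x : G) : x = 0 by rewrite -[x]mulr1 e mulr0.
apply: (@mk_rmorph A G (fun=> 0)) => [x y|]; first by rewrite subrr.
by split=> [|x y]; [rewrite e|rewrite mulr0].
Qed.

Lemma zero_ring_eq (G : comPzRingType) (x y : G) : (1 : G) = 0 -> x = y.
Proof. by move=> e; rewrite -[x]mulr1 -[y]mulr1 e !mulr0. Qed.

Lemma poly_lift (F : comNzRingType) (G : comPzRingType) (f : {rmorphism F -> G}) (x : G) :
  exists g : {rmorphism {poly F} -> G}, (forall a, g a%:P = f a) /\ g 'X = x.
Proof.
have [e|ne] := pselect ((1 : G) = 0).
  by exists (zero_ring_rmorph _ e); split=> [a|]; exact: (zero_ring_eq _ _ e).
have [G' eG] := nz_ring ne; subst G.
have cf : commr_rmorph f x by move=> a; apply: mulrC.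
by exists (horner_morph cf); split=> [a|]; [exact: horner_morphC|exact: horner_morphX].
Qed.

(* Monic polynomials in Horner form: x^n + c_0 x^(n-1) + ... + c_(n-1).       *)
Fixpoint mh (A : comPzRingType) (c : nat -> A) (x : A) n : A :=
  if n is k.+1 then mh c x k * x + c k else 1.

(** Such rings are called absolutely integrally closed. The degree is [n.+1], since the constant
    polynomial 1 has no root in a nonzero ring. *)
Definition good (A : comPzRingType) := forall n (c : nat -> A), exists x, mh c x n.+1 = 0.

Lemma mh_rmorph (A B : comPzRingType) (f : {rmorphism A -> B}) c x n :
  f (mh c x n) = mh (f \o c) (f x) n.
Proof. by elim: n => [|n IH] /=; rewrite ?rmorph1 // rmorphD rmorphM IH. Qed.

Lemma mh_eq (A : comPzRingType) (c d : nat -> A) x n :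
  (forall i, (i < n)%N -> c i = d i) -> mh c x n = mh d x n.
Proof.
elim: n => [//|n IH] h /=; rewrite IH => [|i lt]; last exact/h/ltnW.
by rewrite h.
Qed.

Section PolyHorner.
Context (F : comNzRingType) (c : nat -> F).

Definition mhp n : {poly F} := mh (fun i => (c i)%:P) 'X n.

Lemma mhp_monic n : mhp n \is monic /\ size (mhp n) = n.+1.
Proof.
rewrite /mhp; elim: n => [|n [IH1 IH2]] /=; first by rewrite monic1 size_poly1.
have sz : size (mhp n * 'X + (c n)%:P) = n.+2.
  by rewrite size_MXaddC /mhp IH2 -size_poly_eq0 IH2.
split=> //; rewrite -/(mhp n) monicE lead_coefE sz coefD coefMX coefC /= addr0.
by move/monicP: IH1; rewrite lead_coefE -/(mhp n) IH2 /= => ->.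
Qed.

Lemma mhp_horner (B : comPzRingType) (g : {rmorphism {poly F} -> B}) n :
  g (mhp n) = mh (fun i => g (c i)%:P) (g 'X) n.
Proof. exact: mh_rmorph. Qed.

End PolyHorner.

Definition ext_mem (A B : comPzRingType) (f : {rmorphism A -> B}) (I : A -> Prop) (z : B) :=
  exists (J : finType) (a : J -> A) (b : J -> B), (forall j, I (a j)) /\ z = \sum_j f (a j) * b j.

(* Ideals are contracted from [B]. *)
Definition contracted (A B : comPzRingType) (f : {rmorphism A -> B}) :=
  forall (I : ideal A) a, ext_mem f I (f a) -> I a.

Definition finite_alg (A B : comPzRingType) (f : {rmorphism A -> B}) :=
  exists (K : finType) (w : K -> B), forall z, exists a : K -> A, z = \sum_k f (a k) * w k.

(** F[X] modulo a monic polynomial of degree n + 1 is free on 1, X, ..., X^n. Coordinates in this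
    basis give flatness and finiteness, and the coordinate at 1 gives contraction of ideals. *)
Lemma adjoin_root (F : comNzRingType) n (c : nat -> F) :
  exists (F' : comNzRingType) (i : {rmorphism F -> F'}) (x : F'),
    [/\ mh (i \o c) x n.+1 = 0,
      forall (G : comPzRingType) (f : {rmorphism F -> G}) (y : G), mh (f \o c) y n.+1 = 0 ->
        exists g : {rmorphism F' -> G}, (forall a, g (i a) = f a) /\ g x = y,
      aflat i, finite_alg i & contracted i].
Proof.
pose h := mhp c n.+1; have [mh_ sh] := mhp_monic c n.+1.
have hE : mk_monic h = h by rewrite /mk_monic sh mh_.
pose s : {rmorphism {poly F} -> {poly %/ h}} := in_qpoly h.
pose i : {rmorphism F -> {poly %/ h}} := s \o polyC.
have sE (z : {poly %/ h}) : s (z : {poly F}) = z.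
  by apply: val_inj; apply: in_qpoly_small; exact: size_mk_monic.
have iM a (z : {poly %/ h}) : i a * z = s (a *: (z : {poly F})).
  by rewrite -[i a]/(s a%:P) -{1}(sE z) -rmorphM mul_polyC.
have iMc a (z : {poly %/ h}) k : (i a * z : {poly F})`_k = a * (z : {poly F})`_k.
  rewrite iM -coefZ; suff -> : (s (a *: (z : {poly F})) : {poly F}) = a *: (z : {poly F}) by [].
  apply: in_qpoly_small.
  exact: leq_ltn_trans (size_scale_leq _ _) (size_mk_monic z).
have sumc (J : finType) (z : J -> {poly %/ h}) k :
    ((\sum_j z j : {poly %/ h}) : {poly F})`_k = \sum_j (z j : {poly F})`_k.
  by rewrite poly_of_qpoly_sum coef_sum.
have basis (z : {poly %/ h}) :
    z = \sum_(k < n.+1) i (z : {poly F})`_k * s 'X^k.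
  rewrite -{1}(sE z) -{1}[val z]coefK poly_def rmorph_sum.
  have lez : (size (z : {poly F}) <= n.+1)%N.
    have := size_mk_monic z; rewrite [leqRHS](_ : _ = n.+2) ?ltnS //.
    by rewrite hE.
  rewrite (big_ord_widen n.+1 (fun k => s ((z : {poly F})`_k *: 'X^k))) // big_mkcond.
  apply: eq_bigr => k _; rewrite -mul_polyC rmorphM; case: ltnP => // le.
  by rewrite nth_default // (rmorph0 i) mul0r.
exists {poly %/ h}, i, (s 'X); split.
- transitivity (s h); first by rewrite /h mhp_horner.
  by apply: val_inj; rewrite /= hE Pdiv.RingMonic.rmodpp.
- move=> G f y fy; have [g [gC gX]] := poly_lift f y.
  have [|p sp|g' g'E] := @surj_lift _ _ _ s g.
  + by move=> z; exists (polyn z); rewrite sE.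
  + have := Pdiv.RingMonic.rdivp_eq mh_ p.
    have -> : Pdiv.Ring.rmodp p h = 0.
      by have := congr1 val sp; rewrite /= hE.
    rewrite addr0 => ->; rewrite rmorphM /h mhp_horner gX.
    rewrite (_ : mh _ y n.+1 = 0) ?mulr0 // -[RHS]fy; apply: mh_eq => j _.
    exact: gC.
  by exists g'; split=> [a|]; rewrite g'E ?gC.
- apply/aflatE => I a z rel.
  exists 'I_n.+1, (fun q (k : 'I_n.+1) => (z q : {poly F})`_k), (fun k : 'I_n.+1 => s 'X^k); split=> [q|k].
    exact: basis.
  have := congr1 (fun u : {poly %/ h} => (u : {poly F})`_k) rel.
  rewrite sumc coef0 => r0; rewrite -[RHS]r0.
  by apply: eq_bigr => q _; rewrite iMc.
- exists 'I_n.+1, (fun k : 'I_n.+1 => s 'X^k) => z.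
  by exists (fun k : 'I_n.+1 => (z : {poly F})`_k); exact: basis.
- move=> I b [J [a [z [aI e]]]].
  have := congr1 (fun u : {poly %/ h} => (u : {poly F})`_0) e.
  have -> : (i b : {poly F})`_0 = b.
    by have := iMc b 1 0; rewrite mulr1 => ->; rewrite coef1 mulr1.
  rewrite sumc => ->; apply: ideal_sum => j _; rewrite iMc; exact: idealMr.
Qed.

Lemma adjoin_var (F : comNzRingType) : aflat (polyC : {rmorphism F -> {poly F}}).
Proof.
apply/aflatE => I a z rel; pose N := \max_q size (z q).
exists 'I_N, (fun q (k : 'I_N) => (z q)`_k), (fun k : 'I_N => 'X^k); split=> [q|k].
  rewrite -[LHS]coefK poly_def (big_ord_widen N (fun k => (z q)`_k *: 'X^k)); last first.
    exact: leq_bigmax.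
  rewrite big_mkcond; apply: eq_bigr => k _; rewrite mul_polyC; case: ltnP => // le.
  by rewrite nth_default // scale0r.
have := congr1 (fun u : {poly F} => u`_k) rel; rewrite coef_sum coef0 => r0; rewrite -[RHS]r0.
by apply: eq_bigr => q _; rewrite coefCM.
Qed.

Lemma aflat_id (A : comPzRingType) : aflat (idfun : {rmorphism A -> A}).
Proof. exact: aflat_loc (@mset_one A) (is_loc_id A). Qed.

Lemma finite_comp (A B C : comPzRingType) (f : {rmorphism A -> B}) (g : {rmorphism B -> C})
    (h : {rmorphism A -> C}) : (forall a, h a = g (f a)) ->
  finite_alg f -> finite_alg g -> finite_alg h.
Proof.
move=> e [K [w wP]] [L [v vP]].
exists (K * L)%type, (fun q => g (w q.1) * v q.2) => z.
have [b ->] := vP z; have /choice[a aE] l : exists a, b l = \sum_k f (a k) * w k by exact: wP.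
exists (fun q => a q.2 q.1); under eq_bigr do rewrite aE rmorph_sum mulr_suml.
rewrite exchange_big /= pair_bigA /=; apply: eq_bigr => -[k l] _ /=.
by rewrite e rmorphM mulrA.
Qed.

Lemma contracted_comp (A B C : comPzRingType) (f : {rmorphism A -> B}) (g : {rmorphism B -> C})
    (h : {rmorphism A -> C}) : (forall a, h a = g (f a)) ->
  contracted f -> contracted g -> contracted h.
Proof.
move=> e cf cg I a [J [x [b [xI hE]]]].
have E0 : ext_mem f I 0.
  by exists 'I_0, (fun=> 0), (fun=> 0); rewrite big_ord0; split=> //; case.
have ED u v : ext_mem f I u -> ext_mem f I v -> ext_mem f I (u + v).
  move=> [J1 [a1 [b1 [h1 ->]]]] [J2 [a2 [b2 [h2 ->]]]].
  exists (J1 + J2)%type, (fun k => match k with inl j => a1 j | inr j => a2 j end),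
    (fun k => match k with inl j => b1 j | inr j => b2 j end).
  by rewrite big_sumT; split=> // -[].
have EM c u : ext_mem f I u -> ext_mem f I (c * u).
  move=> [J1 [a1 [b1 [h1 ->]]]]; exists J1, a1, (fun j => c * b1 j); split=> //.
  by rewrite mulr_sumr; apply: eq_bigr => j _; rewrite mulrCA.
apply: cf; apply: (cg (Ideal E0 ED EM)); exists J, (f \o x), b; split=> [j|] /=.
- by exists 'I_1, (fun=> x j), (fun=> 1); rewrite big_ord1 mulr1.
- by rewrite -e hE; apply: eq_bigr => j _; rewrite e.
Qed.

(** * The free algebra closed under roots *)

Inductive gt (B V : Type) := Cst (b : B) | Var (v : V) | Opp (u : gt B V)
  | Add (u v : gt B V) | Mul (u v : gt B V) | Rt (n : nat) (c : nat -> gt B V).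
Arguments Cst {B V}. Arguments Var {B V}. Arguments Rt {B V}.

HB.instance Definition _ (B V : Type) := gen_eqMixin (gt B V).
HB.instance Definition _ (B V : Type) := gen_choiceMixin (gt B V).

Section GoodClosure.
Context (B : comPzRingType) (V : Type).
Local Notation T := (gt B V).

Fixpoint tmh (c : nat -> T) (x : T) n : T :=
  if n is k.+1 then Add (Mul (tmh c x k) x) (c k) else Cst 1.

Inductive geq : T -> T -> Prop :=
| geq_refl u : geq u u
| geq_sym u v : geq u v -> geq v u
| geq_trans u v w : geq u v -> geq v w -> geq u w
| geq_opp u v : geq u v -> geq (Opp u) (Opp v)
| geq_add u u' v v' : geq u u' -> geq v v' -> geq (Add u v) (Add u' v')
| geq_mul u u' v v' : geq u u' -> geq v v' -> geq (Mul u v) (Mul u' v')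
| geq_addA u v w : geq (Add u (Add v w)) (Add (Add u v) w)
| geq_addC u v : geq (Add u v) (Add v u)
| geq_add0 u : geq (Add (Cst 0) u) u
| geq_addN u : geq (Add (Opp u) u) (Cst 0)
| geq_mulA u v w : geq (Mul u (Mul v w)) (Mul (Mul u v) w)
| geq_mulC u v : geq (Mul u v) (Mul v u)
| geq_mul1 u : geq (Mul (Cst 1) u) u
| geq_mulDl u v w : geq (Mul (Add u v) w) (Add (Mul u w) (Mul v w))
| geq_cstD a b : geq (Cst (a + b)) (Add (Cst a) (Cst b))
| geq_cstN a : geq (Cst (- a)) (Opp (Cst a))
| geq_cstM a b : geq (Cst (a * b)) (Mul (Cst a) (Cst b))
| geq_rt n c : geq (tmh c (Rt n c) n.+1) (Cst 0).

Definition gc_setoid : setoid_ring :=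
  @SetoidRing T geq geq_refl geq_sym geq_trans (Cst 0) (Cst 1) (@Opp B V) (@Add B V) (@Mul B V)
    geq_opp geq_add geq_mul geq_addA geq_addC geq_add0 geq_addN
    geq_mulA geq_mulC geq_mul1 geq_mulDl.

(* A [B]-algebra generated by [V] in which all monic polynomials have roots.  *)
Definition gc : comPzRingType := quo gc_setoid.
Definition gcl (t : T) : gc := @class gc_setoid t.

Lemma gclP u v : gcl u = gcl v <-> geq u v. Proof. exact: classP. Qed.
Lemma gclD u v : gcl (Add u v) = gcl u + gcl v. Proof. by rewrite /gcl -classD. Qed.
Lemma gclN u : gcl (Opp u) = - gcl u. Proof. by rewrite /gcl -classN. Qed.
Lemma gclM u v : gcl (Mul u v) = gcl u * gcl v. Proof. by rewrite /gcl -classM. Qed.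
Lemma gcl_surj (z : gc) : exists t, z = gcl t.
Proof. by elim/quo_ind: z => t; exists t. Qed.
Lemma gcl_mh c x n : gcl (tmh c x n) = mh (gcl \o c) (gcl x) n.
Proof. by elim: n => [//|n IH] /=; rewrite gclD gclM IH. Qed.

Fact gcst_zmod : zmod_morphism (fun b => gcl (Cst b)).
Proof.
by move=> a b; rewrite -gclN -gclD; apply/gclP; apply: geq_trans (geq_cstD _ _) _;
  apply: geq_add; [exact: geq_refl|exact: geq_cstN].
Qed.
Fact gcst_monoid : monoid_morphism (fun b => gcl (Cst b)).
Proof. by split=> // a b; rewrite -gclM; apply/gclP/geq_cstM. Qed.
Fact gcst_key : {f : {rmorphism B -> gc} | f =1 (fun b => gcl (Cst b))}.
Proof. by exists (mk_rmorph gcst_zmod gcst_monoid). Qed.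
Definition gcst : {rmorphism B -> gc} := sval gcst_key.
Lemma gcstE b : gcst b = gcl (Cst b). Proof. exact: (svalP gcst_key). Qed.

Lemma gc_good : good gc.
Proof.
move=> n c; have /choice[c' cE] i : exists t, c i = gcl t by exact: gcl_surj.
exists (gcl (Rt n c')); rewrite (_ : c = gcl \o c'); last exact/funext.
by rewrite -gcl_mh -[RHS](rmorph0 gcst) gcstE; apply/gclP/geq_rt.
Qed.

Section Eval.
Context (F : comPzRingType) (k : B -> F) (vv : V -> F) (rt : nat -> (nat -> T) -> (nat -> F) -> F).

(** A root is interpreted from the terms of its coefficients and from their values: [gc_lift] uses
    the values, the finite stages ([gE]) use the terms. *)
Fixpoint gev (t : T) : F := match t with
  | Cst b => k b | Var v => vv v | Opp u => - gev u | Add u v => gev u + gev v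
  | Mul u v => gev u * gev v | Rt n c => rt n c (fun i => gev (c i)) end.

End Eval.

Lemma gev_mh (F : comPzRingType) (k : {rmorphism B -> F}) vv rt c x n :
  gev k vv rt (tmh c x n) = mh (fun i => gev k vv rt (c i)) (gev k vv rt x) n.
Proof. by elim: n => [|n IH] /=; rewrite ?rmorph1 ?IH. Qed.

(** A derivation is finite, so it uses only finitely many root equations [Z], and the derived
    equation holds in every interpretation where these hold. *)
Lemma geq_sound u v : geq u v -> exists Z : seq (nat * (nat -> T)),
  forall (F : comPzRingType) (k : {rmorphism B -> F}) vv rt,
  (forall q, List.In q Z -> mh (fun i => gev k vv rt (q.2 i)) (gev k vv rt (Rt q.1 q.2)) q.1.+1 = 0) ->
  gev k vv rt u = gev k vv rt v.
Proof.
elim=> {u v}; try by move=> *; exists [::] => F k vv rt _ /=; rewrite ?(rmorph0, rmorph1, rmorphD, rmorphM, rmorphN); ring.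
- by move=> u v _ [Z h]; exists Z => F k vv rt r; rewrite h.
- move=> u v w _ [Z h] _ [Z' h']; exists (Z ++ Z') => F k vv rt r.
  by rewrite h ?h' // => q qZ; apply: r; apply/List.in_or_app; [right|left].
- by move=> u v _ [Z h]; exists Z => F k vv rt r /=; rewrite h.
- move=> u u' v v' _ [Z h] _ [Z' h']; exists (Z ++ Z') => F k vv rt r /=.
  by rewrite h ?h' // => q qZ; apply: r; apply/List.in_or_app; [right|left].
- move=> u u' v v' _ [Z h] _ [Z' h']; exists (Z ++ Z') => F k vv rt r /=.
  by rewrite h ?h' // => q qZ; apply: r; apply/List.in_or_app; [right|left].
- move=> n c; exists [:: (n, c)] => F k vv rt r.
  by rewrite gev_mh [RHS]rmorph0; apply: (r (n, c)); left.
Qed.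

(** The roots in [D] are chosen, so the map exists but is not canonical. *)
Lemma gc_lift (D : comPzRingType) (f : {rmorphism B -> D}) (w : V -> D) : good D ->
  exists g : {rmorphism gc -> D}, (forall b, g (gcst b) = f b) /\ forall v, g (gcl (Var v)) = w v.
Proof.
move=> gD; have /choice[rt rtE] (q : nat * (nat -> D)) : exists x, mh q.2 x q.1.+1 = 0.
  exact: gD.
pose e := gev f w (fun n _ c => rt (n, c)).
have ec (u v : gc_setoid) : sr_eq u v -> e u = e v.
  by move=> /geq_sound[Z h]; apply: h => q _; exact: (rtE (q.1, _)).
pose g := @quo_lift gc_setoid D e ec (rmorph1 f) (fun=> erefl) (fun _ _ => erefl)
  (fun _ _ => erefl).
by exists g; split=> [b|v]; rewrite ?gcstE; exact: (@quo_liftE gc_setoid D e ec).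
Qed.

End GoodClosure.

Section GoodStages.
Context (B : comNzRingType) (V : Type).
Local Notation T := (gt B V).

(** Each root is listed after the generators of its coefficients; this is the order in which they
    are adjoined. *)
Fixpoint gens (t : T) : seq T := match t with
  | Cst _ => [::] | Var v => [:: Var v] | Opp u => gens u
  | Add u v | Mul u v => gens u ++ gens v
  | Rt n c => rcons (flatten [seq gens (c i) | i <- iota 0 n.+1]) (Rt n c) end.

Definition subg (t : T) : seq T :=
  if t is Rt n c then flatten [seq gens (c i) | i <- iota 0 n.+1] else [::].

Inductive gwf : seq T -> Prop :=
| gwf0 : gwf [::]
| gwf1 Z v : gwf Z -> gwf (rcons Z (Var v))
| gwf2 Z n c : gwf Z -> {subset subg (Rt n c) <= Z} -> gwf (rcons Z (Rt n c)).

Lemma gwf_cat Z Z' : gwf Z -> gwf Z' -> gwf (Z ++ Z').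
Proof.
move=> wZ; elim=> {Z'} [|Z' v _ IH|Z' n c _ IH h]; first by rewrite cats0.
- by rewrite -rcons_cat; apply: gwf1.
- rewrite -rcons_cat; apply: gwf2 => // u /h; rewrite mem_cat => ->.
  by rewrite orbT.
Qed.

Lemma gwf_flatten (I : Type) (s : seq I) (f : I -> seq T) :
  (forall i, gwf (f i)) -> gwf (flatten [seq f i | i <- s]).
Proof. by move=> h; elim: s => [|i s IH] /=; [exact: gwf0|exact: gwf_cat]. Qed.

Lemma gwf_gens t : gwf (gens t).
Proof.
elim: t => [b|v|u IH|u IH v IH'|u IH v IH'|n c IH].
- exact: gwf0.
- exact: (@gwf1 [::] v gwf0).
- exact: IH.
- exact: gwf_cat.
- exact: gwf_cat.
- change (gwf (rcons (subg (Rt n c)) (Rt n c))).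
  by apply: gwf2 => //; exact: gwf_flatten.
Qed.

Lemma mem_subg n c i : (i < n.+1)%N -> {subset gens (c i) <= subg (Rt n c)}.
Proof.
move=> lt u uc; apply/flattenP; exists (gens (c i)) => //.
by apply/mapP; exists i; rewrite // mem_iota.
Qed.

Lemma gwf_sub Z g : gwf Z -> g \in Z -> {subset subg g <= Z}.
Proof.
elim=> {Z} [//|Z v _ IH|Z n c _ IH h]; rewrite mem_rcons inE => /predU1P[->//|gZ] u us.
- by rewrite mem_rcons inE IH ?orbT.
- by rewrite mem_rcons inE (h _ us) orbT.
- by rewrite mem_rcons inE IH ?orbT.
Qed.

Definition gE (F : comNzRingType) (k : B -> F) (vv : V -> F) (r : nat -> (nat -> T) -> F) :=
  gev k vv (fun n c _ => r n c).

(** [F] arises from [B] by adjoining the generators in [Z] with no equations but their own root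
    equations; [th] compares it with [gc]. The values of [vv] and [r] outside [Z] are arbitrary.
    Without variables each step is finite and contracts ideals, which accounts for the last
    clause. *)
Definition stage (Z : seq T) := exists (F : comNzRingType) (k : {rmorphism B -> F})
    (vv : V -> F) (r : nat -> (nat -> T) -> F) (th : {rmorphism F -> gc B V}),
  [/\ forall b, th (k b) = gcst B V b,
    forall n c, Rt n c \in Z -> mh (fun i => gE k vv r (c i)) (r n c) n.+1 = 0,
    (forall v, Var v \in Z -> th (vv v) = gcl (Var v)) /\
    (forall n c, Rt n c \in Z -> th (r n c) = gcl (Rt n c)),
    aflat k & (V -> False) -> finite_alg k /\ contracted k].

Lemma gE_gcl (F : comNzRingType) (k : {rmorphism B -> F}) vv r
    (th : {rmorphism F -> gc B V}) (Z : seq T) : (forall b, th (k b) = gcst B V b) ->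
  (forall v, Var v \in Z -> th (vv v) = gcl (Var v)) ->
  (forall n c, Rt n c \in Z -> th (r n c) = gcl (Rt n c)) ->
  forall t, {subset gens t <= Z} -> th (gE k vv r t) = gcl t.
Proof.
move=> hk hv hr; elim=> [b|v|u IH|u IH v IH'|u IH v IH'|n c IH] /= sub.
- by rewrite hk gcstE.
- by apply/hv/sub; rewrite inE.
- by rewrite rmorphN IH // gclN.
- by rewrite rmorphD gclD IH ?IH' // => x xu; apply: sub; rewrite mem_cat xu ?orbT.
- by rewrite rmorphM gclM IH ?IH' // => x xu; apply: sub; rewrite mem_cat xu ?orbT.
- by apply/hr/sub; rewrite mem_rcons mem_head.
Qed.

Lemma gE_ext (F F' : comNzRingType) (i : {rmorphism F -> F'}) (k : {rmorphism B -> F})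
    (k' : {rmorphism B -> F'}) vv vv' r r' : (forall b, k' b = i (k b)) ->
  forall t, (forall v, Var v \in gens t -> vv' v = i (vv v)) ->
    (forall n c, Rt n c \in gens t -> r' n c = i (r n c)) ->
  gE k' vv' r' t = i (gE k vv r t).
Proof.
move=> hk; elim=> [b|v|u IH|u IH v IH'|u IH v IH'|n c IH] /= hv hr.
- exact: hk.
- by apply: hv; rewrite inE.
- by rewrite rmorphN IH.
- rewrite rmorphD IH ?IH' // => *; by [apply: hv; rewrite mem_cat; apply/orP; auto|
    apply: hr; rewrite mem_cat; apply/orP; auto].
- rewrite rmorphM IH ?IH' // => *; by [apply: hv; rewrite mem_cat; apply/orP; auto|
    apply: hr; rewrite mem_cat; apply/orP; auto].
- by apply: hr; rewrite mem_rcons mem_head.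
Qed.

(** Induction on [Z] by [adjoin_root] and [adjoin_var]. A generator that already occurs in the list
    is not adjoined again, so the values of earlier terms persist. *)
Lemma stageP Z : gwf Z -> stage Z.
Proof.
elim=> {Z} [|Z v wZ IH|Z n c wZ IH sub].
- exists B, idfun, (fun=> 0), (fun _ _ => 0), (gcst B V); split=> //; first exact: aflat_id.
  split; first by exists 'I_1, (fun=> 1) => z; exists (fun=> z); rewrite big_ord1 mulr1.
  move=> I a [J [x [b [xI e]]]]; rewrite -[a]/(idfun a) e.
  by apply: ideal_sum => j _; apply: idealMr; exact: xI.
- have [F [k [vv [r [th [h1 h2 [h3 h4] h5 _]]]]]] := IH.
  have [vZ|vZ] := boolP (Var v \in Z).
    exists F, k, vv, r, th; split=> // [n c|].
      by rewrite mem_rcons inE => /predU1P[//|]; exact: h2.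
    split=> [w|n c]; rewrite mem_rcons inE => /predU1P[e|]; [|exact: h3| |exact: h4] => //.
    by apply: h3; rewrite e.
  have [g [gC gX]] := poly_lift th (gcl (Var v)).
  pose vv' w := if Var w == Var v :> T then 'X else (vv w)%:P.
  pose k' : {rmorphism B -> {poly F}} := polyC \o k.
  exists {poly F}, k', vv', (fun n c => (r n c)%:P), g; split.
  + by move=> b; rewrite /= gC h1.
  + move=> n c; rewrite mem_rcons inE => /predU1P[//|cZ].
    rewrite (@mh_eq _ _ (polyC \o (fun i => gE k vv r (c i)))); last first.
      move=> i lt; apply: (@gE_ext F _ polyC k k') => // w /(mem_subg lt)/(gwf_sub wZ cZ) wZ'.
      by rewrite /vv'; case: eqP => // e; rewrite -e wZ' in vZ.
    by rewrite -(mh_rmorph (polyC : {rmorphism F -> {poly F}})) h2 // rmorph0.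
  + split=> [w|n c]; rewrite mem_rcons inE.
      by rewrite /vv'; case: eqP => [[->] _|_ /= /h3]; rewrite ?gC.
    by case/predU1P=> // /h4 e; rewrite gC.
  + by apply: (aflat_comp (phi := k) (psi := polyC)) => //; exact: adjoin_var.
  + by move/(_ v).
- have [F [k [vv [r [th [h1 h2 [h3 h4] h5 h6]]]]]] := IH.
  have [cZ|cZ] := boolP (Rt n c \in Z).
    exists F, k, vv, r, th; split=> // [n' c'|].
      by rewrite mem_rcons inE => /predU1P[[-> ->]|]; exact: h2.
    split=> [w|n' c']; rewrite mem_rcons inE => /predU1P[|]; [by []|exact: h3| |exact: h4].
    by move=> [-> ->]; apply: h4.
  have [F' [i [x [x0 xu xf xfin xc]]]] := adjoin_root n (fun i => gE k vv r (c i)).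
  have [|g [gi gx]] := xu _ th (gcl (Rt n c)).
    rewrite -[RHS](rmorph0 (gcst B V)) gcstE; transitivity (gcl (tmh c (Rt n c) n.+1)).
      rewrite gcl_mh; apply: mh_eq => j lt /=; apply: (gE_gcl (Z := Z)) => // u.
      by move/(mem_subg lt)/sub.
    exact/gclP/geq_rt.
  pose r' n' c' := if Rt n' c' == Rt n c then x else i (r n' c').
  pose k' : {rmorphism B -> F'} := i \o k.
  have ext t : {subset gens t <= Z} -> gE k' (i \o vv) r' t = i (gE k vv r t).
    move=> st; apply: gE_ext => // n' c' /st c'Z; rewrite /r'.
    by case: eqP => // e; rewrite -e c'Z in cZ.
  exists F', k', (i \o vv), r', g; split.
  + by move=> b; rewrite /= gi h1.
  + move=> n' c'; rewrite mem_rcons inE; have [[-> ->] _|ne] := eqVneq (Rt n' c') (Rt n c).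
      rewrite [r' n c]/r' eqxx -[RHS]x0; apply: mh_eq => j lt; apply: ext => u.
      by move/(mem_subg lt)/sub.
    rewrite orFb => c'Z; transitivity (i (mh (fun j => gE k vv r (c' j)) (r n' c') n'.+1)); last first.
      by rewrite h2 // rmorph0.
    rewrite [r' n' c']/r' (negbTE ne) [RHS]mh_rmorph; apply: mh_eq => j lt.
    by apply: ext => u /(mem_subg lt)/(gwf_sub wZ c'Z).
  + split=> [w|n' c']; rewrite mem_rcons inE; first by case/predU1P=> // /h3; rewrite /= gi.
    by rewrite /r'; case: eqP => [[-> ->] _|_ /= /h4]; rewrite ?gi.
  + exact: (aflat_comp (phi := k) (psi := i)).
  + move=> /h6[h7 h8]; split; first exact: (finite_comp (f := k) (g := i)).
    exact: (contracted_comp (f := k) (g := i)).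
Qed.

(** Finitely many elements and one linear relation are visible at a finite stage: its generators are
    those of terms for the [z i] and those of the root equations used in a derivation of the
    relation ([geq_sound]). So flatness, finiteness and contraction pass from the stages to [gc]. *)
Lemma gc_stage (I : finType) (a : I -> B) (z : I -> gc B V) (b0 : B) :
  exists (F : comNzRingType) (k : {rmorphism B -> F}) (th : {rmorphism F -> gc B V}) (y : I -> F),
  [/\ forall b, th (k b) = gcst B V b, forall i, th (y i) = z i,
    \sum_i gcst B V (a i) * z i = gcst B V b0 -> \sum_i k (a i) * y i = k b0,
    aflat k & (V -> False) -> finite_alg k /\ contracted k].
Proof.
have /choice[t tE] i : exists t, z i = gcl t by exact: gcl_surj.
pose S := foldr (fun i => Add (Mul (Cst (a i)) (t i))) (Cst 0) (index_enum I).
have SE : gcl S = \sum_i gcst B V (a i) * z i.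
  rewrite /S; elim: (index_enum I) => [|i s IH]; first by rewrite big_nil.
  by rewrite big_cons /= gclD gclM IH gcstE tE.
have [Z0 Z0P] : exists Z0 : seq (nat * (nat -> T)), \sum_i gcst B V (a i) * z i = gcst B V b0 ->
    forall (F : comPzRingType) (k : {rmorphism B -> F}) vv rt,
    (forall q, List.In q Z0 -> mh (fun i => gev k vv rt (q.2 i)) (gev k vv rt (Rt q.1 q.2)) q.1.+1 = 0) ->
    gev k vv rt S = k b0.
  have [e|e] := pselect (\sum_i gcst B V (a i) * z i = gcst B V b0); last by exists [::].
  have /geq_sound[Z0 h] : geq S (Cst b0) by apply/gclP; rewrite SE e -gcstE.
  by exists Z0 => _ F k vv rt /h ->.
pose Z := flatten [seq gens (t i) | i <- index_enum I] ++
  flatten [seq gens (Rt q.1 q.2) | q <- Z0].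
have /stageP[F [k [vv [r [th [h1 h2 [h3 h4] h5 h6]]]]]] : gwf Z.
  by apply: gwf_cat; apply: gwf_flatten => i; exact: gwf_gens.
exists F, k, th, (fun i => gE k vv r (t i)); split=> // [i|e].
  rewrite tE; apply: (gE_gcl (Z := Z)) => // u ut; rewrite mem_cat.
  apply/orP; left; apply/flattenP; exists (gens (t i)) => //.
  by apply: map_f; rewrite mem_index_enum.
rewrite -[RHS](Z0P e F k vv (fun n c _ => r n c)); last first.
  move=> q qZ; apply: h2; rewrite mem_cat; apply/orP; right.
  elim: Z0 qZ {Z0P Z h3 h4} => [//|q' Z0 IH] /= [->|/IH]; rewrite mem_cat.
  - by rewrite mem_rcons mem_head.
  - by move=> ->; rewrite orbT.
rewrite /S; elim: (index_enum I) => [|i s IH]; first by rewrite big_nil /= rmorph0.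
by rewrite big_cons /= IH.
Qed.

Lemma gc_flat : aflat (gcst B V : {rmorphism B -> gc B V}).
Proof.
apply/aflatE => I a z rel; have [F [k [th [y [h1 h2 h3 h4 _]]]]] := gc_stage a z 0.
rewrite !rmorph0 in h3; have [J [c [b' [yE cE]]]] := (aflatE k).1 h4 I a y (h3 rel).
exists J, c, (th \o b'); split=> // i; rewrite -h2 yE rmorph_sum.
by apply: eq_bigr => j _; rewrite rmorphM h1.
Qed.

Lemma gc_finite (V0 : V -> False) (I : finType) (z : I -> gc B V) :
  exists (F : comNzRingType) (k : {rmorphism B -> F}) (th : {rmorphism F -> gc B V}) (y : I -> F),
  [/\ forall b, th (k b) = gcst B V b, forall i, th (y i) = z i & finite_alg k].
Proof.
have [F [k [th [y [h1 h2 _ _ /(_ V0)[h _]]]]]] := gc_stage (fun=> 0) z 0.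
by exists F, k, th, y.
Qed.

Lemma gc_contracted (V0 : V -> False) : contracted (gcst B V : {rmorphism B -> gc B V}).
Proof.
move=> I b [J [x [z [xI zE]]]].
have [F [k [th [y [h1 h2 h3 _ /(_ V0)[_ h]]]]]] := gc_stage x z b.
by apply: (h I b); exists J, x, y; split=> //; rewrite h3.
Qed.

End GoodStages.

(** * Good rings *)

Section Split.
Context (A : comNzRingType).

Lemma mhp_surj n (p : {poly A}) : p \is monic -> size p = n.+1 -> exists c, mhp c n = p.
Proof.
elim: n p => [|n IH] p pm sp.
  exists (fun=> 0); rewrite /mhp /= (size1_polyC (eq_leq sp)).
  by move/monicP: pm; rewrite lead_coefE sp /= => ->.
pose q := \poly_(i < n.+1) p`_i.+1.
have pE : p = q * 'X + (p`_0)%:P.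
  apply/polyP=> -[|i]; rewrite coefD coefMX coefC /= ?add0r // addr0 coef_poly.
  by case: ltnP => // le; rewrite nth_default // sp.
have lq : q`_n = 1 by rewrite coef_poly ltnSn; move/monicP: pm; rewrite lead_coefE sp.
have sq : size q = n.+1.
  apply/eqP; rewrite eqn_leq size_poly /= ltnNge; apply/negP => le.
  by move: lq; rewrite nth_default // => /eqP; rewrite eq_sym oner_eq0.
have [|c cE] := IH q _ sq; first by rewrite monicE lead_coefE sq lq.
exists (fun i => if i == n then p`_0 else c i); rewrite [RHS]pE /mhp /= eqxx -cE.
by congr (_ * _ + _); apply: mh_eq => i lt; rewrite ltn_eqF.
Qed.

Lemma good_root (p : {poly A}) : good A -> p \is monic -> (1 < size p)%N -> exists x, root p x.
Proof.
move=> gA pm; case sp: (size p) => [|[|n]] // _; have [c cE] := mhp_surj pm sp.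
have [x xE] := gA n c; exists x; rewrite /root -cE.
rewrite -[_.[x]]/(horner_eval x (mhp c n.+1)) mhp_horner -[X in _ == X]xE.
apply/eqP; have eX : horner_eval x 'X = x by exact: hornerX.
by rewrite -[in RHS]eX; apply: mh_eq => i _; exact: hornerC.
Qed.

Lemma good_split (p : {poly A}) : good A -> p \is monic ->
  exists rs : seq A, p = \prod_(r <- rs) ('X - r%:P).
Proof.
move=> gA; have [n] := ubnP (size p); elim: n p => // n IH p ltn pm.
case: (ltnP 1 (size p)) => [lt1|le1]; last first.
  have s1 : size p = 1%N by apply/eqP; rewrite eqn_leq le1 size_poly_gt0 monic_neq0.
  exists [::]; rewrite big_nil (size1_polyC le1); move/monicP: pm.
  by rewrite lead_coefE s1 => ->.
have [x /factor_theorem[q pE]] := good_root gA pm lt1.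
have qm : q \is monic by rewrite -(monicMr _ (monicXsubC x)) -pE.
have [|rs qE] := IH q _ qm; last by exists (x :: rs); rewrite big_cons -qE mulrC.
by move: ltn; rewrite pE size_Mmonic ?monicXsubC ?monic_neq0 // size_XsubC addn2.
Qed.

End Split.

Lemma good_surj (A B : comPzRingType) (s : {rmorphism A -> B}) :
  (forall z, exists a, z = s a) -> good A -> good B.
Proof.
move=> ss gA n c; have /choice[b bE] i : exists a, c i = s a by exact: ss.
have [x xE] := gA n b; exists (s x); rewrite -[RHS](rmorph0 s) -xE mh_rmorph.
by apply: mh_eq => i _; rewrite bE.
Qed.

Lemma mset_exp (A : comPzRingType) (M : A -> Prop) u n : mset M -> M u -> M (u ^+ n).
Proof.
by move=> [h k] Mu; elim: n => [|n IH]; rewrite ?expr0 // exprS; apply: k.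
Qed.

Lemma good_loc (A L : comPzRingType) (M : A -> Prop) (psi : {rmorphism A -> L}) :
  mset M -> is_loc M psi -> good A -> good L.
Proof.
move=> MM lM gA n c; have [lu _ _] := lM.
have [u [b [Mu bE]]] := loc_common (fun i : 'I_n.+1 => c i) MM lM.
(* The substitution y = u x multiplies the coefficient c_i by u^(i+1); since c_i u = b_i, this gives
   b_i u^i, which comes from [A]. *)
have [y yE] := gA n (fun i => b (inord i) * u ^+ i).
have [v uv] := lu u Mu; pose x := v * psi y.
exists x; have sc k : (k <= n.+1)%N ->
    psi u ^+ k * mh c x k = mh (psi \o (fun i => b (inord i) * u ^+ i)) (psi y) k.
  elim: k => [|k IH] le /=; first by rewrite mulr1.
  rewrite -IH 1?ltnW // mulrDr; congr (_ + _).
    have -> : psi y = psi u * x by rewrite mulrA uv mul1r.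
    by rewrite exprS; ring.
  have := bE (Ordinal le); rewrite /= => e.
  rewrite (_ : inord k = Ordinal le); last by apply: val_inj; rewrite /= inordK.
  by rewrite rmorphM rmorphXn -e exprS; ring.
apply: (@unit_cancel _ (psi u ^+ n.+1)); first by rewrite -rmorphXn; apply: lu; exact: mset_exp MM Mu.
by rewrite mul0r mulrC sc // -mh_rmorph yE rmorph0.
Qed.

(** * Domains and valuation rings *)

Definition is_domain (D : comPzRingType) :=
  (1 : D) <> 0 /\ forall a b : D, a * b = 0 -> a = 0 \/ b = 0.

Lemma mset_domain (D : comPzRingType) : is_domain D -> mset (fun d : D => d <> 0).
Proof. by move=> [h k]; split=> // x y nx ny /k[]. Qed.

Lemma field_pack (L : comPzRingType) : (1 : L) <> 0 -> (forall x : L, x <> 0 -> isunit x) ->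
  exists F : fieldType, (F : comPzRingType) = L.
Proof.
case: L => L c /= h hu; pose L0 := GRing.ComPzRing.Pack c.
have h' : (1 : L0) != 0 by apply/eqP.
pose L1 : comNzRingType := HB.pack_for comNzRingType L c (GRing.PzSemiRing_isNonZero.Build L0 h').
have /choice[inv0 invP] (x : L1) : exists y : L1, x <> 0 -> y * x = 1.
  have [->|/hu[y e]] := pselect (x = 0); first by exists 0.
  by exists y => _; rewrite mulrC.
pose inv (x : L1) := if x == 0 then 0 else inv0 x.
have mulVf : forall x : L1, x != 0 -> inv x * x = 1.
  by move=> x nx; rewrite /inv (negbTE nx); apply: invP; apply/eqP.
have inv00 : inv 0 = 0 by rewrite /inv eqxx.
by exists (HB.pack_for fieldType L (GRing.ComNzRing.class L1) (GRing.ComNzRing_isField.Build L1 mulVf inv00)).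
Qed.

Lemma frac_field (D : comPzRingType) : is_domain D ->
  exists (L : fieldType) (j : {rmorphism D -> L}), is_loc (fun d => d <> 0) j /\ injective j.
Proof.
move=> dD; have [M1 MM] := mset_domain dD.
have [L [j lj]] := mloc_exists M1 MM; have [lu ls lk] := lj.
have ij x : j x = 0 -> x = 0 by case/lk=> u [nu /dD.2[]].
have [||F eF] := @field_pack L.
- by rewrite -(rmorph1 j) => /ij /dD.1.
- move=> x nx; have [a [u [nu e]]] := ls x; have [v uv] := lu u nu.
  have na : a <> 0.
    move=> a0; apply: nx; apply: (unit_cancel (lu u nu)).
    by rewrite e a0 rmorph0 mul0r.
  by apply: (@isunitMl _ x (j u)); rewrite e; apply: lu.
- subst L; exists F, j; split=> // x y e; apply/eqP; rewrite -subr_eq0; apply/eqP/ij.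
  by rewrite rmorphB e subrr.
Qed.

Definition subring (L : comPzRingType) (V : L -> Prop) :=
  [/\ V 1, forall x y, V x -> V y -> V (x - y) & forall x y, V x -> V y -> V (x * y)].

Section Subring.
Context (L : comPzRingType) (V : L -> Prop) (sV : subring V).

Lemma sub0 : V 0. Proof. by have [h k _] := sV; rewrite -(subrr 1); apply: k. Qed.
Lemma subN x : V x -> V (- x).
Proof. by have [_ k _] := sV => Vx; rewrite -sub0r; apply: k => //; exact: sub0. Qed.
Lemma subD x y : V x -> V y -> V (x + y).
Proof. by have [_ k _] := sV => Vx Vy; rewrite -[y]opprK; apply: k => //; apply: subN. Qed.
Lemma subX x n : V x -> V (x ^+ n).
Proof.
have [h _ k] := sV => Vx; elim: n => [|n IH]; rewrite ?expr0 // exprS; exact: k.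
Qed.
Lemma sub_sum (I : Type) (r : seq I) (P : pred I) (F : I -> L) :
  (forall i, P i -> V (F i)) -> V (\sum_(i <- r | P i) F i).
Proof. by move=> h; apply: big_ind => //; [exact: sub0|exact: subD]. Qed.

End Subring.

Section Valuation.
Context (L : fieldType).
Implicit Types (V : L -> Prop) (x y z : L) (p : {poly L}).

Definition adj V y z := exists p, (forall i, V p`_i) /\ z = p.[y].

Lemma adj_subring V y : subring V -> subring (adj V y).
Proof.
move=> sV; have [h1 hB hM] := sV; split.
- by exists 1; rewrite hornerC; split=> // -[|i]; rewrite coef1 //=; exact: sub0.
- move=> _ _ [p [Vp ->]] [q [Vq ->]]; exists (p - q).
  by rewrite hornerD hornerN; split=> // i; rewrite coefB; apply: hB.
- move=> _ _ [p [Vp ->]] [q [Vq ->]]; exists (p * q).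
  by rewrite hornerM; split=> // i; rewrite coefM; apply: sub_sum => // k _; apply: hM.
Qed.

Lemma adj_sub V y z : subring V -> V z -> adj V y z.
Proof.
move=> sV Vz; exists z%:P; rewrite hornerC; split=> // -[|i]; rewrite coefC //=.
exact: sub0.
Qed.

Lemma adj_gen V y : subring V -> adj V y y.
Proof.
move=> sV; exists 'X; rewrite hornerX; split=> // i; rewrite coefX.
by case: (i == 1)%N; [case: sV|exact: sub0].
Qed.

(** [V] is maximal among the subrings that contain [R0] and miss [x], so [x] lies in V[y] for every
    [y] outside [V]. If both [y] and its inverse were outside, [x] would be a polynomial over [V] in
    each of them, and the two degrees could be lowered in turn until [x] lies in [V]. *)
Lemma valuation_exists (R0 : L -> Prop) x : subring R0 -> x != 0 -> R0 x^-1 -> ~ R0 x ->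
  exists V, [/\ subring V, (forall z, R0 z -> V z), ~ V x &
    forall y, V y \/ (y != 0 /\ V y^-1)].
Proof.
move=> sR x0 Rx nRx.
pose T := {V : L -> Prop | [/\ subring V, forall z, R0 z -> V z & ~ V x]}.
pose t0 : T := exist _ R0 (And3 sR (fun z Rz => Rz) nRx).
pose R : rel T := fun s t => `[< forall z, sval s z -> sval t z >].
have Rr t : R t t by apply/asboolP.
have Rt r s t : R r s -> R s t -> R r t.
  by move=> /asboolP h /asboolP k; apply/asboolP => z /h/k.
have ch (F : set T) : total_on F (fun s t => R s t) ->
    exists t, forall s, F s -> R s t.
  move=> tF; have [[s0 Fs0]|nF] := pselect (exists s, F s); last first.
    by exists t0 => s Fs; case: nF; exists s.
  pose U z := exists s, F s /\ sval s z.
  have dir y z : U y -> U z -> exists s, [/\ F s, sval s y & sval s z].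
    move=> [s [Fs sy]] [t [Ft tz]].
    have [/asboolP st|/asboolP ts] := tF s t Fs Ft.
    - by exists t; split=> //; apply: st.
    - by exists s; split=> //; apply: ts.
  have UT : [/\ subring U, forall z, R0 z -> U z & ~ U x].
    split; [split| |].
    - by exists s0; split=> //; have [[]] := svalP s0.
    - move=> y z Uy Uz; have [s [Fs sy sz]] := dir y z Uy Uz; exists s; split=> //.
      by have [[_ h _] _ _] := svalP s; apply: h.
    - move=> y z Uy Uz; have [s [Fs sy sz]] := dir y z Uy Uz; exists s; split=> //.
      by have [[_ _ h] _ _] := svalP s; apply: h.
    - by move=> z Rz; exists s0; split=> //; have [_ h _] := svalP s0; apply: h.
    - by move=> [s [Fs sx]]; have [_ _] := svalP s.
  by exists (exist _ U UT) => s Fs; apply/asboolP => z sz; exists s.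
have [[V [sV RV nVx]] Vm] := ZL_preorder t0 Rr Rt ch.
exists V; split=> //; have [V1 VB VM] := sV; have nVx' : ~ V x by [].
have adjx y : ~ V y -> adj V y x.
  move=> ny; apply: contrapT => nx; apply: ny.
  have aT : [/\ subring (adj V y), forall z, R0 z -> adj V y z & ~ adj V y x].
    by split=> [||//]; [exact: adj_subring|move=> z /RV Vz; exact: adj_sub].
  have /asboolP := Vm (exist _ (adj V y) aT) (asboolT (fun z => @adj_sub V y z sV)).
  by apply; exact: adj_gen.
have Vxi := RV _ Rx.
(* The inverse of [x] behaves like an element of the maximal ideal of [V]. If u = 1 - v / x had no
   inverse in [V], then [x] would be in V[1/u], so x u^n would be in [V] for some n; by x u^n = x
   u^(n+1) + v u^n the exponent could be brought down to 0. *)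
have unitV v : V v -> 1 - x^-1 * v != 0 /\ V (1 - x^-1 * v)^-1.
  move=> Vv; set u := 1 - _; have nu : u != 0.
    apply/eqP => u0; apply: nVx'; suff -> : x = v by [].
    by apply: (mulfI (invr_neq0 x0)); apply/eqP; rewrite mulVf // -subr_eq0 -/u u0.
  split=> //; apply: contrapT => /adjx[p [Vp xE]].
  have Vu : V u by apply: VB => //; apply: VM.
  have Vxu : V (x * u ^+ size p).
    rewrite {1}xE horner_coef mulr_suml; apply: sub_sum => // i _.
    rewrite exprVn -mulrA; apply: VM => //.
    by rewrite mulrC -expfB //; apply: subX.
  move: Vxu; elim: (size p) => [|n IH]; first by rewrite expr0 mulr1.
  move=> h; apply: IH; have -> : x * u ^+ n = x * u ^+ n.+1 + v * u ^+ n.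
    by rewrite exprS /u; field.
  by apply: subD => //; apply: VM => //; apply: subX.
pose S y n := exists p, [/\ forall i, V p`_i, (size p <= n.+1)%N & x = p.[y]].
have S0 y : ~ S y 0%N.
  move=> [p [Vp /size1_polyC pE xE]]; apply: nVx'.
  by rewrite xE pE hornerC.
(* Let v be the constant term of the expression of [x] in 1/y. Dividing x - v = x u by x u writes 1
   through positive powers of 1/y; multiplied by the leading power of y, this replaces it by lower
   powers. *)
have red y n m : y != 0 -> S y n -> S y^-1 m -> (m <= n)%N -> S y n.-1.
  move=> y0 [p [Vp sp xE]] [q [Vq sq xE']] mn.
  case: n sp mn => [|n] sp mn /=; first by case: (S0 y); exists p.
  have [nu Vu] := unitV _ (Vq 0%N); set u := 1 - _ in nu Vu.
  pose q' j := q`_j * x^-1 * u^-1; have Vq' j : V (q' j) by exact: VM (VM _ _ (Vq j) Vxi) Vu.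
  have e1 : 1 = \sum_(j < m) q' j.+1 * y^-1 ^+ j.+1.
    have := xE'; rewrite (horner_coef_wide _ sq) big_ord_recl /= expr0 mulr1 => e.
    have : x * u = \sum_(j < m) q`_j.+1 * y^-1 ^+ j.+1.
      rewrite /u mulrBr mulr1 mulrA divff // mul1r {1}e addrAC subrr add0r.
      by [].
    move/(congr1 (fun z => z * (x^-1 * u^-1))); rewrite mulrACA !divff // mulr1 => ->.
    by rewrite mulr_suml; apply: eq_bigr => j _; rewrite /q'; ring.
  pose r := \sum_(j < m) q' j.+1 *: 'X^(n.+1 - j.+1).
  have rE : r.[y] = y ^+ n.+1.
    rewrite /r horner_sum -[RHS]mulr1 e1 mulr_sumr; apply: eq_bigr => j _.
    rewrite hornerZ hornerXn mulrCA exprVn expfB_cond // (negbTE y0) add0n.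
    exact: leq_trans (ltn_ord j) mn.
  exists (p - p`_n.+1 *: 'X^(n.+1) + p`_n.+1 *: r); split.
  - move=> i; rewrite coefD coefB !coefZ coefXn; apply: subD => //.
      by apply: VB => //; case: (i == n.+1); rewrite ?mulr1 ?mulr0 //; exact: sub0.
    apply: VM => //; rewrite coef_sum; apply: sub_sum => // j _; rewrite coefZ coefXn.
    by case: (i == _); rewrite ?mulr1 ?mulr0 //; exact: sub0.
  - apply: leq_trans (size_polyD _ _) _; rewrite geq_max; apply/andP; split.
      apply/leq_sizeP => i le; rewrite coefB coefZ coefXn.
      have [->|ne] := eqVneq i n.+1; first by rewrite mulr1 subrr.
      rewrite mulr0 subr0; apply: (leq_sizeP _ _ sp); rewrite ltn_neqAle le andbT.
      by rewrite eq_sym.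
    apply: leq_trans (size_scale_leq _ _) _; apply: (leq_trans (size_sum _ _ _)).
    apply/bigmax_leqP => j _; apply: leq_trans (size_scale_leq _ _) _.
    by rewrite size_polyXn subSS ltnS leq_subr.
  - by rewrite !hornerD hornerN !hornerZ hornerXn rE subrK.
have noS N : forall n m y, (n + m <= N)%N -> y != 0 -> S y n -> S y^-1 m -> False.
  elim: N => [|N IH] n m y le y0 Sn Sm.
    by move: le Sn; rewrite leqn0 addn_eq0 => /andP[/eqP -> _] /S0.
  have [mn|/ltnW nm] := leqP m n.
  - have := red y n m y0 Sn Sm mn; case: n Sn mn le => [/S0//|n] Sn mn le Sn'.
    exact: (IH n m y).
  - have := red y^-1 m n (invr_neq0 y0) Sm; rewrite invrK => /(_ Sn nm).
    case: m Sm nm le => [/S0//|m] Sm nm le Sm'.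
    by apply: (IH n m y) => //; move: le; rewrite addnS.
move=> y; have [Vy|ny] := pselect (V y); [by left|right].
have y0 : y != 0 by apply/eqP => y0; apply: ny; rewrite y0; exact: sub0.
split=> //; apply: contrapT => ny'.
have [p [Vp xE]] := adjx _ ny; have [q [Vq xE']] := adjx _ ny'.
by apply: (noS _ (size p) (size q) y (leqnn _)) => //; [exists p|exists q].
Qed.

End Valuation.

Section ProductOfSubrings.
Context (L : comPzRingType) (Idx : Type) (V : Idx -> L -> Prop).
Hypothesis sV : forall i, subring (V i).

(** The proof that the [V i] are subrings is an argument so that the ring structure can be attached
    to the type. *)
Definition psub (_ : forall i, subring (V i)) := {u : Idx -> L | forall i, V i (u i)}.
Local Notation E := (psub sV).
HB.instance Definition _ := gen_eqMixin E.
HB.instance Definition _ := gen_choiceMixin E.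

Lemma psub_ext (x y : E) : (forall i, sval x i = sval y i) -> x = y.
Proof. by move=> e; apply: sval_inj; apply/funext. Qed.

Let mk (u : Idx -> L) (h : forall i, V i (u i)) : E := exist _ u h.
Let V1 i : V i 1. Proof. by have [] := sV i. Qed.
Let VM i x y : V i x -> V i y -> V i (x * y). Proof. by have [_ _] := sV i; apply. Qed.
Definition psub0 : E := @mk (fun=> 0) (fun i => sub0 (sV i)).
Definition psub1 : E := @mk (fun=> 1) V1.
Definition psubN (x : E) : E := @mk (fun i => - sval x i) (fun i => subN (sV i) (svalP x i)).
Definition psubD (x y : E) : E :=
  @mk (fun i => sval x i + sval y i) (fun i => subD (sV i) (svalP x i) (svalP y i)).
Definition psubM (x y : E) : E :=
  @mk (fun i => sval x i * sval y i) (fun i => VM (svalP x i) (svalP y i)).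

Fact psub_addA : associative psubD.
Proof. by move=> x y z; apply: psub_ext => i /=; rewrite addrA. Qed.
Fact psub_addC : commutative psubD.
Proof. by move=> x y; apply: psub_ext => i /=; rewrite addrC. Qed.
Fact psub_add0 : left_id psub0 psubD.
Proof. by move=> x; apply: psub_ext => i /=; rewrite add0r. Qed.
Fact psub_addN : left_inverse psub0 psubN psubD.
Proof. by move=> x; apply: psub_ext => i /=; rewrite addNr. Qed.
HB.instance Definition _ := GRing.isZmodule.Build E psub_addA psub_addC psub_add0 psub_addN.
Fact psub_mulA : associative psubM.
Proof. by move=> x y z; apply: psub_ext => i /=; rewrite mulrA. Qed.
Fact psub_mulC : commutative psubM.
Proof. by move=> x y; apply: psub_ext => i /=; rewrite mulrC. Qed.
Fact psub_mul1 : left_id psub1 psubM.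
Proof. by move=> x; apply: psub_ext => i /=; rewrite mul1r. Qed.
Fact psub_mulDl : left_distributive psubM psubD.
Proof. by move=> x y z; apply: psub_ext => i /=; rewrite mulrDl. Qed.
HB.instance Definition _ :=
  GRing.Zmodule_isComPzRing.Build E psub_mulA psub_mulC psub_mul1 psub_mulDl.

Lemma psub_sum (I : finType) (F : I -> E) i : sval (\sum_k F k) i = \sum_k sval (F k) i.
Proof. by elim/big_rec2: _ => // k x y _ <-. Qed.

Lemma psub_const (D : comPzRingType) (j : {rmorphism D -> L}) :
  (forall i d, V i (j d)) -> exists f : {rmorphism D -> E}, forall d i, sval (f d) i = j d.
Proof.
move=> h; pose f d := mk (fun i => h i d).
have fz : zmod_morphism f by move=> x y; apply: psub_ext => i; rewrite /= rmorphB.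
have fm : monoid_morphism f.
  by split=> [|x y]; apply: psub_ext => i; rewrite /= ?rmorph1 ?rmorphM.
by exists (mk_rmorph fz fm).
Qed.

End ProductOfSubrings.

Definition bezout (E : comPzRingType) := forall (I : finType) (r : I -> E),
  exists g (s t : I -> E), (forall i, r i = g * s i) /\ \sum_i r i * t i = g.

Definition idem_ann (E : comPzRingType) := forall r : E,
  exists e, r * e = 0 /\ forall c, r * c = 0 -> c = e * c.

(** Let r_i = g s_i with g the sum of the r_i t_i. The relation says that g kills w, the sum of the
    s_i n_i; hence w = e w, where e generates the annihilator of g. Then n_i = (n_i - t_i w) + t_i e
    w is the trivialisation, with [w] as an additional element. *)
Lemma bezout_flat (E B : comPzRingType) (phi : {rmorphism E -> B}) (P : ideal B) :
  bezout E -> idem_ann E -> aflat phi -> aflat_on phi P.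
Proof.
move=> bE aE fphi I r n Pn rel.
have [g [s [t [rE gE]]]] := bE I r; have [e [ge eE]] := aE g.
pose w := \sum_i phi (s i) * n i.
have gw : phi g * w = 0.
  rewrite -[RHS]rel mulr_sumr; apply: eq_bigr => i _.
  by rewrite mulrA -rmorphM -rE.
have wE : w = phi e * w.
  have [J [c [b [-> cE]]]] := aflat_ann fphi gw; rewrite mulr_sumr.
  by apply: eq_bigr => j _; rewrite mulrA -rmorphM -eE.
exists (I + 'I_1)%type,
  (fun i k => match k with inl k => (i == k)%:R - t i * s k | inr _ => t i * e end),
  (fun k => match k with inl k => n k | inr _ => w end); split.
- case=> [k|_]; first exact: Pn.
  by apply: ideal_sum => i _; apply: idealMl.
- move=> i; rewrite big_sumT big_ord1 /=.
  transitivity (n i - phi (t i) * w + phi (t i) * w); first by rewrite subrK.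
  congr (_ + _); last by rewrite {1}wE [RHS]/GRing.scale /= /restriction_scale rmorphM mulrA.
  rewrite /w mulr_sumr -{1}(@sum_delta E (scalar_restriction phi) I n i) -sumrB.
  apply: eq_bigr => k _; rewrite scalerBl; congr (_ - _).
  by rewrite [RHS]/GRing.scale /= /restriction_scale rmorphM mulrA.
- case=> [k|_].
  + under eq_bigr do rewrite mulrBr mulrA; rewrite sumrB -mulr_suml gE.
    rewrite (bigD1 k) //= eqxx mulr1 big1 ?addr0 => [|i /negbTE ->]; last by rewrite mulr0.
    by rewrite -rE subrr.
  + by under eq_bigr do rewrite mulrA; rewrite -mulr_suml gE.
Qed.

(** In a valuation ring a finitely generated ideal is generated by one of its generators, namely one
    that divides the others; it is chosen in each component separately. *)
Lemma psub_bezout (L : fieldType) (Idx : Type) (V : Idx -> L -> Prop)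
    (sV : forall i, subring (V i)) :
  (forall i y, V i y \/ (y != 0 /\ V i y^-1)) -> bezout (psub sV).
Proof.
move=> val I r.
have loc i : exists x : L * (I -> L) * (I -> L), [/\ V i x.1.1, forall k, V i (x.1.2 k),
    forall k, V i (x.2 k), forall k, sval (r k) i = x.1.1 * x.1.2 k
    & \sum_k sval (r k) i * x.2 k = x.1.1].
  have [V1 _ VM] := sV i; have V0 := sub0 (sV i).
  have [[k0 nk0]|h] := pselect (exists k, sval (r k) i <> 0); last first.
    exists (0, fun=> 0, fun=> 0); split=> //= [k|].
      by rewrite mulr0; apply: contrapT => nk; apply: h; exists k.
    by apply: big1 => k' _; rewrite mulr0.
  have [k kP] : exists k, sval (r k) i <> 0 /\ forall k', k' \in enum I ->
      V i (sval (r k') i / sval (r k) i).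
    elim: (enum I) => [|a s [k [nk IH]]]; first by exists k0.
    have [Va|[na Va]] := val i (sval (r a) i / sval (r k) i).
      by exists k; split=> // k'; rewrite inE => /predU1P[->|/IH].
    have na' : sval (r a) i != 0 by apply: contraNneq na => ->; rewrite mul0r.
    exists a; split=> [|k']; first exact/eqP.
    rewrite inE => /predU1P[->|/IH Vk']; first by rewrite divff.
    have -> : sval (r k') i / sval (r a) i =
        (sval (r k') i / sval (r k) i) * (sval (r a) i / sval (r k) i)^-1.
      by move/eqP: nk => nk; field; rewrite na' nk.
    exact: VM.
  have [/eqP nk Vk] := kP.
  exists (sval (r k) i, fun k' => sval (r k') i / sval (r k) i, fun k' => (k' == k)%:R).
  split=> /= [|k'|k'|k'|]; first exact: (svalP (r k)).
  - by apply: Vk; rewrite mem_enum.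
  - by case: (k' == k).
  - by rewrite mulrCA divff // mulr1.
  - rewrite (bigD1 k) //= eqxx mulr1 big1 ?addr0 // => k' /negbTE ->.
    by rewrite mulr0.
have /choice[x xP] := loc.
have gP i : V i (x i).1.1 by have [] := xP i.
have sP k i : V i ((x i).1.2 k) by have [] := xP i.
have tP k i : V i ((x i).2 k) by have [] := xP i.
exists (exist _ _ gP), (fun k => exist _ _ (sP k)), (fun k => exist _ _ (tP k)); split.
- by move=> k; apply: psub_ext => i /=; have [] := xP i.
- by apply: psub_ext => i; rewrite psub_sum /=; have [] := xP i.
Qed.

(** The annihilator of [r] is generated by the indicator of the components in which [r] is zero. *)
Lemma psub_ann (L : fieldType) (Idx : Type) (V : Idx -> L -> Prop)
  (sV : forall i, subring (V i)) : idem_ann (psub sV).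
Proof.
move=> r; have eP i : V i (sval r i == 0)%:R.
  by have [V1 _ _] := sV i; case: (_ == _) => //; exact: (sub0 (sV i)).
exists (exist _ _ eP); split=> [|c rc]; apply: psub_ext => i /=.
  by case: eqP => [->|_]; rewrite ?mul0r ?mulr0.
have /eqP := congr1 (fun z => sval z i) rc; rewrite /= mulf_eq0.
by case: eqP => _ /=; [rewrite mul1r|move/eqP->; rewrite mulr0].
Qed.

(* Normality of [D] is used through valuation rings: [D / s D] embeds in      *)
(* [E / s E] for a product [E] of valuation rings, over which all ideals of a *)
(* flat algebra are flat.                                                     *)
Lemma domain_valuations (D : comPzRingType) s : is_domain D -> good D -> s <> 0 ->
  exists (E : comPzRingType) (f : {rmorphism D -> E}), [/\ bezout E, idem_ann E &
    forall d u, f d = f s * u -> exists d', d = s * d'].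
Proof.
move=> dD gD s0; have [L [j [lj ij]]] := frac_field dD.
have [D' eD] := nz_ring dD.1; subst D.
have s0' : j s != 0 by apply/eqP => e; apply: s0; apply: ij; rewrite e rmorph0.
pose Idx := {d : D' | ~ exists d', d = s * d'}.
have ex (i : Idx) : exists V : L -> Prop, [/\ subring V, forall d, V (j d),
    ~ V (j (sval i) / j s) & forall y, V y \/ (y != 0 /\ V y^-1)].
  case: i => d nd /=; set x := j d / j s.
  have d0 : j d != 0.
    apply/eqP => e; apply: nd; exists 0; apply: ij.
    by rewrite e rmorphM rmorph0 mulr0.
  have x0 : x != 0 by rewrite mulf_neq0 // invr_eq0.
  pose V0 z := exists d, z = j d.
  have sV0 : subring V0.
    split; first by exists 1; rewrite rmorph1.
    - by move=> _ _ [a ->] [b ->]; exists (a - b); rewrite rmorphB.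
    - by move=> _ _ [a ->] [b ->]; exists (a * b); rewrite rmorphM.
  have [||V [sV RV nVx val]] := @valuation_exists L (adj V0 x^-1) x (adj_subring _ sV0) x0.
  - exact: adj_gen.
  (* If x = d / s were in D[1/x], clearing powers of x would make it a root of a monic polynomial
     over [D]. This one splits over [D], so x would lie in [D] and [s] would divide [d]. *)
  - move=> [p [Vp xE]]; have /choice[c cE] k : exists d, p`_k = j d by exact: Vp.
    pose n := size p.
    pose R : {poly D'} := \sum_(k < n) (c k)%:P * 'X^(n - k).
    pose P : {poly D'} := 'X^(n.+1) - R.
    have sz : (size R < size ('X^(n.+1) : {poly D'}))%N.
      rewrite size_polyXn ltnS; apply: (leq_trans (size_sum _ _ _)).
      apply/bigmax_leqP => k _; rewrite mul_polyC.
      apply: leq_trans (size_scale_leq _ _) _; by rewrite size_polyXn ltnS leq_subr.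
    have Pm : P \is monic by rewrite monicE lead_coefDl ?size_polyN // lead_coefXn.
    have [rs PE] := good_split gD Pm.
    have P0 : (map_poly j P).[x] = 0.
      rewrite /P /R rmorphB /= map_polyXn rmorph_sum hornerD hornerN hornerXn /=.
      rewrite exprS {1}xE horner_coef mulr_suml horner_sum -sumrB big1 // => k _.
      rewrite rmorphM /= map_polyC map_polyXn hornerM hornerC hornerXn cE exprVn -mulrA.
      by rewrite [_^-1 * _]mulrC -expfB // subrr.
    move: P0; rewrite PE rmorph_prod horner_prod => /eqP.
    rewrite prodf_seq_eq0 => /hasP[r _]; rewrite /= rmorphB /= map_polyX map_polyC.
    rewrite !hornerE subr_eq0 => /eqP xr; apply: nd; exists r; apply: ij.
    by rewrite rmorphM -xr /x mulrC divfK.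
  - exists V; split=> // d'; apply: RV; apply: adj_sub => //; by exists d'.
have /choice[V VP] := ex.
have sV i : subring (V i) by have [] := VP i.
have [|f fE] := @psub_const L Idx V sV D' j; first by move=> i d; have [_ + _ _] := VP i.
exists (psub sV), f; split; [|exact: psub_ann|].
  by apply: psub_bezout => i y; have [_ _ _] := VP i.
move=> d u e; apply: contrapT => nd; pose i : Idx := exist _ d nd.
have [_ _ nV _] := VP i; apply: nV => /=.
have := congr1 (fun z => sval z i) e; rewrite fE /= fE => ->.
by rewrite mulrAC divff // mul1r; apply: (svalP u).
Qed.

(** * Weakly étale algebras over good domains and good local rings *)

Lemma domain_split (D B : comPzRingType) (phi : {rmorphism D -> B}) s (b c : B) :
  is_domain D -> good D -> wet phi -> s <> 0 -> b + c = phi s -> b * c = 0 ->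
  exists b', b = phi s * b'.
Proof.
move=> dD gD wphi s0 bc bc0; have [fphi _] := wphi.
have [E [f [bE aE fE]]] := domain_valuations dD gD s0.
pose i1 := po1 (tens_rel phi f); pose i2 : {rmorphism E -> tens phi f} := po2 (tens_rel phi f).
have [fi2 pi2] : wet i2 by exact: wet_base.
pose P := ideal_gen2 (principal (i1 c)) (i1 b).
have Pb : P (i1 b) by exists 0, 1; rewrite mul1r add0r; split=> //; exact: ideal0.
have PM (y z : tens phi f) : P z -> P (idfun y * z) by exact: idealMl.
have cb : (idfun : {rmorphism _ -> _}) (i1 c) * i1 b = 0.
  by rewrite /= -rmorphM mulrC bc0 rmorph0.
(* [c] kills [b], and the ideal [P] = (b, c) is flat over [E]; so [b] is a combination of elements
   [n k] of [P] with coefficients [x k] that [c] kills. *)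
have [K [x [n [xc Pn bE']]]] := @pure_flat E _ _ i2 idfun i2 P (i1 c) (i1 b) (fun=> erefl) fi2 (pi2 _) PM
    (bezout_flat (P := P) bE aE fi2) Pb cb.
have /choice[y yE] k : exists y : tens phi f * tens phi f, n k = y.1 * i1 c + y.2 * i1 b.
  by have [z [y [/principalP[z' ->] ->]]] := Pn k; exists (z', y).
(* Of each [n k] only the multiple of [b] survives the product with [x k]. These multiples add up to
   e with c e = 0 and b = e b, whence b = e (b + c) = e s over [E]; divisibility by [s] then
   descends to [B]. *)
apply: (@tens_divisible _ _ _ phi f s b (\sum_k x k * (y k).2)) => //.
pose e := \sum_k x k * (y k).2.
have ec : i1 c * e = 0.
  by rewrite mulr_sumr big1 // => k _; rewrite mulrA xc mul0r.
have eb : i1 b = e * i1 b.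
  rewrite {1}bE' mulr_suml; apply: eq_bigr => k _ /=; rewrite yE mulrDr.
  by rewrite [x k * (_ * i1 c)]mulrCA [x k * i1 c]mulrC xc mulr0 add0r mulrA.
rewrite -tens_comm -bc rmorphD mulrDl; rewrite -/i1 -/e ec addr0 mulrC; exact: eb.
Qed.

Lemma det_kill (H : comPzRingType) n (M : 'M[H]_n) (v : 'I_n -> H) :
  (forall i, \sum_j M i j * v j = 0) -> forall i, \det M * v i = 0.
Proof.
move=> h i; pose V : 'cV_n := \col_j v j.
have MV : M *m V = 0.
  apply/matrixP => a b; rewrite !mxE -[RHS](h a).
  by apply: eq_bigr => j _; rewrite mxE.
have : \adj M *m (M *m V) = 0 by rewrite MV mulmx0.
rewrite mulmxA mul_adj_mx mul_scalar_mx => /matrixP /(_ i ord0).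
by rewrite !mxE.
Qed.

(** Write t as a sum of n terms u_i (x) v_i with n minimal. Trivialising (x (x) 1) t = (1 (x) x) t
    over the field gives matrices s and R with u = s b and R^T v = x s^T v. Minimality gives s a
    right inverse G, so the matrix (R G)^T over L acts on the vector v as multiplication by x. Its
    characteristic polynomial at x kills the v_i, hence the sum of the u_i v_i, which is 1. *)
Lemma pure_algebraic (L : fieldType) (H : comPzRingType) (k : {rmorphism L -> H}) x :
  pure_at k x -> exists p : {poly L}, p \is monic /\
    forall g : {rmorphism {poly L} -> H}, (forall a, g a%:P = k a) -> g 'X = x -> g p = 0.
Proof.
move=> [t [t1 xt]]; pose i1 := po1 (tens_rel k k); pose i2 := po2 (tens_rel k k).
pose S n := `[< exists u v : 'I_n -> H, t = \sum_i i1 (u i) * i2 (v i) >].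
have ex : exists n, S n.
  have [s tE] := po_gen t; exists (size s); apply/asboolP; rewrite tE big_tnth.
  by exists (fun i => (tnth (in_tuple s) i).1), (fun i => (tnth (in_tuple s) i).2).
case: (ex_minnP ex) => n /asboolP[u [v tE]] nmin {ex}.
have fk : aflat k.
  by apply: aflat_field => y /eqP y0; exists y^-1; rewrite divff.
pose bb (q : ('I_n + 'I_n)%type) := match q with inl i => x * u i | inr i => - u i end.
pose cc (q : ('I_n + 'I_n)%type) := match q with inl i => v i | inr i => x * v i end.
have [|J [r [b' [bE rE]]]] := @tens_vanish L H k H k _ bb cc fk.
  rewrite big_sumT /=; move/eqP: xt; rewrite -subr_eq0 => /eqP xt; rewrite -[RHS]xt tE.
  rewrite !mulr_sumr -sumrN; congr (_ + _); apply: eq_bigr => i _.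
  - by rewrite rmorphM mulrA.
  - by rewrite rmorphN rmorphM mulNr mulrCA.
pose m := #|J|; pose s : 'M[L]_(n, m) := \matrix_(i, j) - r (inr i) (enum_val j).
pose R : 'M[L]_(n, m) := \matrix_(i, j) r (inl i) (enum_val j).
pose b (j : 'I_m) := b' (enum_val j).
have reJ (F : J -> H) : \sum_j F j = \sum_(j < m) F (enum_val j).
  by rewrite (reindex (fun j : 'I_m => enum_val j)) //; apply: onW_bij; exact: enum_val_bij.
have uE i : u i = \sum_j k (s i j) * b j.
  have := bE (inr i); rewrite /= => /(congr1 -%R); rewrite opprK reJ => ->.
  by rewrite -sumrN; apply: eq_bigr => j _; rewrite mxE rmorphN mulNr.
have vE j : \sum_i k (R i j) * v i = x * \sum_i k (s i j) * v i.
  have := rE (enum_val j); rewrite big_sumT /= => /eqP; rewrite addr_eq0 => /eqP e.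
  transitivity (\sum_i k (r (inl i) (enum_val j)) * v i).
    by apply: eq_bigr => i _; rewrite mxE.
  rewrite e mulr_sumr -sumrN; apply: eq_bigr => i _.
  by rewrite mxE rmorphN mulNr mulrN; congr (- _); ring.
(* A rank factorization of [s] writes [t] with as many terms as the rank of [s], so minimality makes
   this rank [n]. *)
have /row_freeP[G sG] : row_free s.
  rewrite /row_free eqn_leq rank_leq_row nmin //; apply/asboolP.
  exists (fun l => \sum_j k (row_base s l j) * b j), (fun l => \sum_i k (col_base s i l) * v i).
  rewrite tE; transitivity (\sum_i \sum_l i1 (k (col_base s i l) * \sum_j k (row_base s l j) * b j) * i2 (v i)).
    apply: eq_bigr => i _; rewrite -mulr_suml -rmorph_sum; congr (i1 _ * _).
    rewrite uE -{1}(mulmx_base s).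
    transitivity (\sum_j \sum_l k (col_base s i l) * (k (row_base s l j) * b j)); last first.
      rewrite exchange_big /=; apply: eq_bigr => l _; apply: esym; exact: mulr_sumr.
    apply: eq_bigr => j _; rewrite mxE rmorph_sum mulr_suml.
    by apply: eq_bigr => l _; rewrite rmorphM mulrA.
  rewrite exchange_big /=; apply: eq_bigr => l _; rewrite (rmorph_sum i2) mulr_sumr.
  by apply: eq_bigr => i _; rewrite !rmorphM tens_comm; rewrite -/i2; ring.
pose P := (R *m G)^T; exists (char_poly P); split=> [|g gC gX]; first exact: char_poly_monic.
pose M := map_mx g (char_poly_mx P).
have ME : g (char_poly P) = \det M by rewrite /M det_map_mx.
have kill : forall a, \sum_i M a i * v i = 0.
  move=> a; transitivity (x * v a - \sum_i k (P a i) * v i).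
    have -> : x * v a = \sum_i g ('X *+ (a == i)) * v i.
      rewrite (bigD1 a) //= eqxx mulr1n gX big1 ?addr0 // => i /negbTE.
      by rewrite eq_sym => ->; rewrite mulr0n rmorph0 mul0r.
    rewrite -sumrB; apply: eq_bigr => i _.
    by rewrite !mxE rmorphB gC -mulrBl; congr ((_ - k _) * _); rewrite mxE.
  apply/eqP; rewrite subr_eq0; apply/eqP; apply: esym.
  transitivity (\sum_j k (G j a) * \sum_i k (R i j) * v i).
    under [RHS]eq_bigr do rewrite mulr_sumr; rewrite exchange_big /=.
    apply: eq_bigr => i _; rewrite !mxE rmorph_sum mulr_suml.
    by apply: eq_bigr => j _; rewrite rmorphM; ring.
  under eq_bigr do rewrite vE mulrCA; rewrite -mulr_sumr; congr (x * _).
  under eq_bigr do rewrite mulr_sumr; rewrite exchange_big /=.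
  transitivity (\sum_i k ((s *m G) i a) * v i).
    apply: eq_bigr => i _; rewrite !mxE rmorph_sum mulr_suml.
    by apply: eq_bigr => j _; rewrite rmorphM; ring.
  rewrite sG (bigD1 a) //= mxE eqxx rmorph1 mul1r big1 ?addr0 // => i /negbTE ia.
  by rewrite mxE ia rmorph0 mul0r.
have dv := det_kill kill; rewrite ME -[LHS]mulr1 -t1 tE rmorph_sum mulr_sumr big1 // => i _.
by rewrite rmorphM tens_mu1 tens_mu2 mulrCA dv mulr0.
Qed.

(** Locality without reference to the maximal ideal; in this form it is easily carried to nonzero
    quotients, such as the fibre B (x)_R R / p in [wet_local_bij]. *)
Definition islocal (B : comPzRingType) := (1 : B) <> 0 /\ forall x : B, isunit x \/ isunit (1 - x).

Lemma is_localW (B : comPzRingType) (m : ideal B) : is_local m -> islocal B.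
Proof.
move=> [m1 h]; split=> [e|x]; first by apply: m1; rewrite e; exact: ideal0.
have [mx|/h] := pselect (m x); [right|by left]; apply: h => mx'; apply: m1.
by rewrite -(subrK x 1); apply: idealD.
Qed.

Lemma islocal_sum (B : comPzRingType) (I : finType) (F : I -> B) : islocal B ->
  1 = \sum_i F i -> exists i, isunit (F i).
Proof.
move=> [B1 h] e; have : isunit (\sum_i F i) by rewrite -e; exact: isunit1.
elim: (index_enum I) => [|i s IH]; first by rewrite big_nil => -[y]; rewrite mul0r => /esym.
rewrite big_cons => -[v]; rewrite mulrDl => e1.
have [/isunitMl|] := h (F i * v); first by exists i.
by rewrite -e1 addrAC subrr add0r => /isunitMl/IH.
Qed.

(** Let L be the fraction field of D and H the generic fibre of B, a weakly étale L-algebra.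
    Principal ideals of H are generated by idempotents. By [domain_split] these idempotents lie in
    B, which is local, so they are 0 or 1 and H is a field. Elements of H are algebraic over L by
    [pure_algebraic], and L is good, so H = L. Finally, an element of B that is a fraction over D
    comes from D, as B is flat over D, local, and reflects units. *)
Lemma domain_wet_surj (D B : comPzRingType) (phi : {rmorphism D -> B}) :
  is_domain D -> good D -> wet phi -> islocal B -> (forall d, isunit (phi d) -> isunit d) ->
  forall x, exists d, x = phi d.
Proof.
move=> dD gD wphi lB ud; have [fphi _] := wphi.
have [D1 DM] := mset_domain dD; have [B1 Bl] := lB.
pose N h := exists d, d <> 0 /\ h = phi d.
have MN : mset N.
  split; first by exists 1; rewrite rmorph1.
  move=> _ _ [a [na ->]] [b [nb ->]]; exists (a * b); rewrite rmorphM.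
  by split=> //; exact: DM.
have [H [psi lpsi]] := mloc_exists MN.1 MN.2; have [pu ps pk] := lpsi.
have [L [j [lj ij]]] := frac_field dD; have [ju js jk] := lj.
have [ka kaE] := @loc_lift _ _ _ j H (psi \o phi) lj (fun d nd => pu _ (ex_intro _ d (conj nd erefl))).
have [fka pka] : wet ka by exact: (wet_loc (fun a => esym (kaE a)) MN lpsi (conj D1 DM) lj wphi).
have tf d b : d <> 0 -> phi d * b = 0 -> b = 0.
  by move=> nd; apply: aflat_torsion => // y /dD.2[].
have ip b : psi b = 0 -> b = 0 by case/pk=> _ [[d [nd ->]] /tf]; exact.
have ip2 (b c : B) : psi b = psi c -> b = c.
  by move=> e; apply/eqP; rewrite -subr_eq0; apply/eqP/ip; rewrite rmorphB e subrr.
have upsi d : d <> 0 -> isunit (psi (phi d)) by move=> nd; apply: pu; exists d.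
have fieldH (h : H) : h <> 0 -> isunit h.
  move=> h0; pose pr := quotient_proj (principal h).
  have fl : aflat (pr \o ka : {rmorphism _ -> _}).
    by apply: aflat_field => y /eqP y0; exists y^-1; rewrite divff.
  have prh : pr h * 1 = 0.
    by rewrite mulr1; apply/qproj_eq0/principalP; exists 1; rewrite mul1r.
  (* Flatness of H / h over [H], applied to the class of 1, which [h] kills: it gives [e'] with h e'
     = 0 and 1 - e' = y h, so that y h is an idempotent generating the ideal of [h]. *)
  have [K [c [n' [hc _ oneE]]]] := @pure_flat _ _ _ ka pr (pr \o ka) (fun=> True) h 1 (fun=> erefl)
    fka (pka h) (fun _ _ _ => Logic.I) fl Logic.I prh.
  have /choice[z zE] i : exists z, n' i = pr z by exact: qproj_surj.
  pose e' := \sum_i c i * z i.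
  have he' : h * e' = 0 by rewrite mulr_sumr big1 // => i _; rewrite mulrA hc mul0r.
  have [y yE] : exists y, 1 - e' = y * h.
    apply/principalP/qproj_eq0; rewrite rmorphB rmorph1 {1}oneE rmorph_sum -sumrB big1 // => i _.
    by rewrite rmorphM zE subrr.
  (* The idempotent y h is be / si with [be] in [B], and idempotency reads be (si - be) = 0;
     divisibility of [be] by [si] puts the idempotent in [B]. *)
  have [be [_ [[si [nsi ->]] beE]]] := ps (y * h).
  have sp : be * (phi si - be) = 0.
    apply: ip; rewrite rmorphM rmorphB -beE -yE.
    rewrite (_ : _ * _ = (1 - e') * e' * psi (phi si) ^+ 2); last by ring.
    by rewrite yE -(mulrA y) he' mulr0 mul0r.
  have [|b' bE] := domain_split dD gD wphi nsi _ sp; first by rewrite addrC subrK.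
  have b'E : psi b' = y * h.
    by apply: (unit_cancel (upsi _ nsi)); rewrite beE bE rmorphM mulrC.
  have bb : b' * (1 - b') = 0.
    by apply: ip; rewrite rmorphM rmorphB rmorph1 b'E -yE subKr yE -mulrA he' mulr0.
  have [ub|ub] := Bl b'.
    exists y; rewrite mulrC -b'E -(rmorph1 psi); congr (psi _); apply/eqP.
    rewrite eq_sym -subr_eq0; apply/eqP; apply: (unit_cancel ub).
    by rewrite mulrC bb mul0r.
  case: h0; rewrite -[RHS]he' -[LHS]mulr1; congr (_ * _).
  apply/eqP; rewrite -subr_eq0 yE -b'E; apply/eqP; rewrite -[RHS](rmorph0 psi); congr (psi _).
  by apply: (unit_cancel ub); rewrite bb mul0r.
have H1 : (1 : H) <> 0 by rewrite -(rmorph1 psi) => /ip.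
move=> x; have [p [pm pE]] := pure_algebraic (pka (psi x)).
have [g [gC gX]] := poly_lift ka (psi x).
have [rs rsE] := good_split (good_loc (conj D1 DM) lj gD) pm.
have [l lE] : exists l, psi x = ka l.
  have := pE g gC gX; rewrite rsE {rsE}; elim: rs => [|r rs IH].
    by rewrite big_nil rmorph1 => /H1.
  rewrite big_cons rmorphM rmorphB gX gC => e.
  have [e0|/fieldH u] := pselect (psi x - ka r = 0).
    by exists r; apply/eqP; rewrite -subr_eq0 e0.
  by apply: IH; apply: (unit_cancel u); rewrite mul0r mulrC.
have [r [si [nsi re]]] := js l.
have xs : x * phi si = phi r.
  by apply: ip2; rewrite rmorphM lE -[psi (phi si)]kaE -rmorphM re [LHS]kaE.
(* The relation si x - r = 0 is trivialised. The trivialisation of the factor 1 of [r] has a unit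
   among its terms; the corresponding coefficient is a unit of [D], and dividing by it gives the
   preimage of [x]. *)
have [|J [c [b' [bE cE]]]] := (aflatE phi).1 fphi bool (fun k => if k then si else - r)
    (fun k => if k then x else 1).
  by rewrite big_bool /= mulr1 rmorphN mulrC xs subrr.
have [i /isunitMl/ud[v vE]] := islocal_sum lB (bE false).
exists (c true i * v); apply/eqP; rewrite -subr_eq0; apply/eqP/(tf _ _ nsi).
have := cE i; rewrite big_bool /= mulNr => /eqP; rewrite subr_eq0 => /eqP sc.
by rewrite mulrBr mulrC xs -rmorphM mulrA sc -mulrA vE mulr1 subrr.
Qed.

Lemma quotient_domain (A : comPzRingType) (p : spec A) : is_domain (quotient_ring p).
Proof.
split=> [|a b].
  by rewrite -(rmorph1 (quotient_proj p)) => /qproj_eq0; exact: prime_one.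
have [x ->] := qproj_surj a; have [y ->] := qproj_surj b.
rewrite -rmorphM => /qproj_eq0/(spec_prime p).2[] h; [left|right]; exact/qproj_eq0.
Qed.

(* Olivier's theorem, for local rings in which monic polynomials split. *)
Lemma wet_local_bij (R B : comPzRingType) (phi : {rmorphism R -> B}) (mR : ideal R) (mB : ideal B) :
  good R -> is_local mR -> is_local mB -> wet phi -> (forall r, mR r -> mB (phi r)) ->
  (forall b, exists r, b = phi r) /\ (forall r, phi r = 0 -> r = 0).
Proof.
move=> gR lR lB wphi loc; have [fphi pphi] := wphi.
have ud r : isunit (phi r) -> isunit r.
  move=> ur; have [/loc mr|/lR.2//] := pselect (mR r).
  by case: lB.1; exact: ideal_unit mr.
have lB' := is_localW lB.
split=> [b|r r0]; last first.
  have [|J [c [b' [e cE]]]] := @aflat_ann _ _ phi r 1 fphi; first by rewrite r0 mul0r.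
  have [i /isunitMl/ud[v vE]] := islocal_sum lB' e.
  by rewrite -[r]mulr1 -vE mulrA cE mul0r.
have [t [t1 bt]] := pphi b.
pose i1 := po1 (tens_rel phi phi); pose i2 := po2 (tens_rel phi phi).
(* A prime [Q] cannot contain [t]: for the contraction [p] of [Q], the good domain R / p surjects
   onto the fibre of [B] by [domain_wet_surj], so both copies of [B] agree modulo [Q], and [t]
   becomes its product, 1. *)
have ut : isunit t.
  apply: unit_of_primes => Q Qt.
  pose pi := quotient_proj Q; pose p := spec_preimage (i1 \o phi) Q.
  pose psi := quotient_proj p.
  have [_ pb] : wet (po2 (tens_rel phi psi)) by exact: wet_base.
  have psub r : p r -> mR r by apply: is_local_sub => //; exact: prime_one.
  have [g gE] : exists g : {rmorphism quotient_ring p -> quotient_ring Q},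
      forall r, g (psi r) = pi (i1 (phi r)).
    by apply: (qproj_lift (f := pi \o (i1 \o phi))) => r pr /=; apply/qproj_eq0.
  have [g' g'E] : exists g : {rmorphism quotient_ring p -> quotient_ring mB},
      forall r, g (psi r) = quotient_proj mB (phi r).
    by apply: (qproj_lift (f := quotient_proj mB \o phi)) => r /psub/loc pr /=; apply/qproj_eq0.
  have [h1 [h11 h12]] := @tens_lift _ _ phi _ psi _ (pi \o i1) g (fun r => esym (gE r)).
  have [h2 [h21 h22]] := @tens_lift _ _ phi _ psi _ (pi \o i2) g
    (fun r => etrans (congr1 pi (esym (tens_comm phi phi r))) (esym (gE r))).
  have [h3 [h31 h32]] := @tens_lift _ _ phi _ psi _ (quotient_proj mB) g' (fun r => esym (g'E r)).
  have mB1 : (1 : quotient_ring mB) <> 0.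
    by rewrite -(rmorph1 (quotient_proj mB)) => /qproj_eq0/lB.1.
  have s1 z : exists x, z = po1 (tens_rel phi psi) x.
    elim/po_ind: z => [x|c|z z' [x ->] [x' ->]|z z' [x ->] [x' ->]].
    - by exists x.
    - by have [r ->] := qproj_surj c; exists (phi r); rewrite tens_comm.
    - by exists (x + x'); rewrite rmorphD.
    - by exists (x * x'); rewrite rmorphM.
  have ex x : exists d, x = po2 (tens_rel phi psi) d.
    apply: domain_wet_surj x => //.
    - exact: quotient_domain.
    - by apply: good_surj gR => z; exact: qproj_surj.
    - exact: wet_base.
    - split=> [e|z].
        by apply: mB1; rewrite -(rmorph1 h3) e rmorph0.
      have [x ->] := s1 z; rewrite -(rmorph1 (po1 (tens_rel phi psi))) -rmorphB.
      by have [u|u] := lB'.2 x; [left|right]; exact: isunit_rmorph.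
    - move=> d ud'; have [r rE] := qproj_surj d; subst d.
      rewrite -/psi; apply: isunit_rmorph; apply: lR.2 => /loc mr.
      have [y] := isunit_rmorph h3 ud'; rewrite h32 g'E.
      have -> : quotient_proj mB (phi r) = 0 by exact/qproj_eq0.
      by rewrite mul0r => /esym.
  have eq12 x : pi (i1 x) = pi (i2 x).
    have [d dE] := ex (po1 (tens_rel phi psi) x).
    by rewrite -[LHS]h11 dE h12 -h22 -dE h21.
  have := tens_mu_diag (h := pi) t eq12; rewrite t1 !rmorph1 => e.
  apply: (@prime_one _ Q); apply/qproj_eq0; rewrite rmorph1 -e; exact/qproj_eq0.
(* Now b (x) 1 = 1 (x) b, so [b] is locally a fraction over [R], and by locality one of the
   denominators is a unit. *)
have [J [r [s [b' [oneE rE]]]]] := tens_equalizer fphi (unit_cancel ut bt).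
have [i us] := islocal_sum lB' oneE; have us' := isunitMl us; have [v vE] := ud _ us'.
by exists (r i * v); rewrite rmorphM rE mulrAC -rmorphM vE rmorph1 mul1r.
Qed.

(** * Henselian pairs from good local rings *)

(** The factorization condition for an arbitrary map in place of [quotient_proj], so that both rings
    can be replaced by nonzero ones. *)
Definition hens_lift (A Q : comPzRingType) (pi : {rmorphism A -> Q}) :=
  forall (f : nat -> A) (g0 h0 : nat -> Q),
    monic_poly f -> monic_poly g0 -> monic_poly h0 ->
    pi \o f = poly_mul g0 h0 -> poly_comaximal g0 h0 ->
    exists g h : nat -> A,
      [/\ monic_poly g, monic_poly h, f = poly_mul g h, pi \o g = g0 & pi \o h = h0].

Section PolyFun.
Context (A : comNzRingType).
Implicit Types p q : {poly A}.

Definition cfun p : nat -> A := fun n => p`_n.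

Lemma cfun_inj : injective cfun.
Proof. by move=> p q e; apply/polyP => i; apply: (congr1 (fun f => f i) e). Qed.

Lemma cfun_surj (f : nat -> A) : is_poly f -> exists p, f = cfun p.
Proof.
move=> [d fd]; exists (\poly_(i < d.+1) f i); apply/funext => n.
by rewrite /cfun coef_poly ltnS; case: leqP => // /fd.
Qed.

Lemma cfun_poly p : is_poly (cfun p).
Proof. by exists (size p) => n lt; rewrite /cfun nth_default // ltnW. Qed.

Lemma cfunM p q : poly_mul (cfun p) (cfun q) = cfun (p * q).
Proof. by apply/funext => n; rewrite /cfun coefM. Qed.

Lemma cfun_monic p : monic_poly (cfun p) <-> p \is monic.
Proof.
split=> [[d [pd ph]]|pm].
  have sp : size p = d.+1.
    apply/eqP; rewrite eqn_leq; apply/andP; split; first exact/leq_sizeP.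
    rewrite ltnNge; apply/negP => /leq_sizeP/(_ d (leqnn d)) e.
    by move: pd; rewrite /cfun e => /eqP; rewrite eq_sym oner_eq0.
  by rewrite monicE lead_coefE sp /=; apply/eqP.
exists (size p).-1; split=> [|n lt]; first by move/monicP: pm.
rewrite /cfun nth_default //; move: lt; case: (size p) (size_poly_gt0 p) => //.
Qed.

Lemma monic_poly_fun (f : nat -> A) : monic_poly f -> exists2 p, f = cfun p & p \is monic.
Proof.
move=> fm; have [p fE] : exists p, f = cfun p.
  by apply: cfun_surj; have [d [_ h]] := fm; exists d.
by exists p => //; apply/cfun_monic; rewrite -fE.
Qed.

Lemma cfun_comaximal p q : poly_comaximal (cfun p) (cfun q) <-> exists u v, u * p + v * q = 1.
Proof.
have one : @poly_one A = cfun 1 by apply/funext => -[|n]; rewrite /cfun coef1.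
have add r s : poly_add (cfun r) (cfun s) = cfun (r + s).
  by apply/funext => n; rewrite /cfun coefD.
split=> [[u0 [v0 [/cfun_surj[u ->] /cfun_surj[v ->]]]]|[u [v e]]].
  by rewrite !cfunM add one => /cfun_inj e; exists u, v.
by exists (cfun u), (cfun v); split; [exact: cfun_poly..|rewrite !cfunM add e].
Qed.

End PolyFun.

Lemma hens_liftP (A Q : comNzRingType) (pi : {rmorphism A -> Q}) : hens_lift pi <->
  forall (f : {poly A}) (g0 h0 : {poly Q}), f \is monic -> g0 \is monic -> h0 \is monic ->
    map_poly pi f = g0 * h0 -> (exists u v, u * g0 + v * h0 = 1) ->
    exists g h, [/\ g \is monic, h \is monic, f = g * h, map_poly pi g = g0 & map_poly pi h = h0].
Proof.
have mapE (p : {poly A}) : pi \o cfun p = cfun (map_poly pi p).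
  by apply/funext => n; rewrite /cfun coef_map.
split=> h.
- move=> f g0 h0 /cfun_monic fm /cfun_monic gm /cfun_monic hm e /cfun_comaximal c.
  have [||_ [_ [/monic_poly_fun[g1 -> g1m] /monic_poly_fun[h1 -> h1m]]]] := h _ _ _ fm gm hm.
  + by rewrite mapE cfunM e.
  + by [].
  + by rewrite !mapE cfunM => /cfun_inj -> /cfun_inj <- /cfun_inj <-; exists g1, h1.
- move=> _ _ _ /monic_poly_fun[f -> fm] /monic_poly_fun[g0 -> gm] /monic_poly_fun[h0 -> hm].
  rewrite mapE cfunM => /cfun_inj e /cfun_comaximal c.
  have [g1 [h1 [g1m h1m -> <- <-]]] := h f g0 h0 fm gm hm e c.
  exists (cfun g1), (cfun h1); rewrite !mapE cfunM.
  by split=> //; exact/cfun_monic.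
Qed.

Lemma isunit_horner (A : comNzRingType) (g h : {poly A}) x u v :
  islocal A -> u * g + v * h = 1 -> isunit g.[x] \/ isunit h.[x].
Proof.
move=> lA /(congr1 (fun p => p.[x])); rewrite hornerD !hornerM hornerC => e.
have [] := lA.2 (u.[x] * g.[x]); rewrite ?[u.[x] * _]mulrC; first by move=> /isunitMl; left.
by rewrite -e [g.[x] * _]mulrC addrAC subrr add0r mulrC => /isunitMl; right.
Qed.

(** Induction on the linear factors X - r of [f]. At the image of [r] one of the comaximal [g0] and
    [h0] takes a unit value, since [Q] is local; so the factor divides the other one, and X - r is
    assigned to the lift of that one. *)
Lemma good_hens_lift (A Q : comNzRingType) (pi : {rmorphism A -> Q}) :
  good A -> islocal Q -> hens_lift pi.
Proof.
move=> gA lQ; apply/hens_liftP => f g0 h0 fm; have [rs ->] := good_split gA fm => {fm}.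
elim: rs g0 h0 => [|r rs IH] g0 h0 gm hm.
  rewrite big_nil rmorph1 => e _.
  have sz : (size g0 + size h0).-1 = 1%N by rewrite -size_monicM ?monic_neq0 // -e size_poly1.
  have g1 : g0 = 1.
    have s1 : (size g0 <= 1)%N.
      have := size_poly_gt0 h0; rewrite monic_neq0 //.
      by case: (size h0) sz => // k; rewrite addnS /= => <- _; rewrite leq_addr.
    have gE := size1_polyC s1; move/monicP: gm; rewrite gE lead_coefC => ->.
    exact: polyC1.
  have h1 : h0 = 1 by rewrite e g1 mul1r.
  by exists 1, 1; rewrite g1 h1 !rmorph1 mulr1 !monic1.
rewrite big_cons rmorphM rmorphB /= map_polyX map_polyC /=.
set x := pi r => e [u [v uv]].
have Xm := monicXsubC x; have Xm' := monicXsubC r.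
have mX : map_poly pi ('X - r%:P) = 'X - x%:P by rewrite rmorphB /= map_polyX map_polyC.
have mXE p : map_poly pi (p * ('X - r%:P)) = map_poly pi p * ('X - x%:P).
  by rewrite rmorphM; congr (_ * _); exact: mX.
have gh : g0.[x] * h0.[x] = 0.
  by rewrite -hornerM -e hornerM hornerXsubC subrr mul0r.
have [ug|uh] := isunit_horner x lQ uv.
- have /factor_theorem[h1 hE] : root h0 x.
    by apply/eqP; apply: (unit_cancel ug); rewrite mul0r mulrC.
  have h1m : h1 \is monic by rewrite -(monicMr _ Xm) -hE.
  have [||g [h [g'm h'm -> <- h1E]]] := IH g0 h1 gm h1m.
  + by apply: (monic_lreg Xm); rewrite e hE; ring.
  + by exists u, (v * ('X - x%:P)); rewrite -uv hE; ring.
  exists g, (h * ('X - r%:P)); rewrite mXE monicMr //.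
  by split=> //; [ring|rewrite hE -h1E].
- have /factor_theorem[h1 hE] : root g0 x.
    by apply/eqP; apply: (unit_cancel uh); rewrite mul0r.
  have h1m : h1 \is monic by rewrite -(monicMr _ Xm) -hE.
  have [||g [h [g'm h'm -> h1E <-]]] := IH h1 h0 h1m hm.
  + by apply: (monic_lreg Xm); rewrite e hE; ring.
  + by exists (u * ('X - x%:P)), v; rewrite -uv hE; ring.
  exists (g * ('X - r%:P)), h; rewrite mXE monicMr //.
  by split=> //; [ring|rewrite hE -h1E].
Qed.

Lemma islocal_surj (A B : comPzRingType) (s : {rmorphism A -> B}) : (1 : B) <> 0 ->
  (forall z, exists a, z = s a) -> islocal A -> islocal B.
Proof.
move=> B1 ss [_ lA]; split=> // z; have [a ->] := ss z.
by rewrite -(rmorph1 s) -rmorphB; have [u|u] := lA a; [left|right]; exact: isunit_rmorph.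
Qed.

Lemma good_henselian (A : comPzRingType) (m K : ideal A) :
  good A -> is_local m -> ~ K 1 -> henselian_pair K.
Proof.
move=> gA lm K1; split=> [x Kx n nn|].
  by rewrite (is_local_uniq lm nn); exact: is_local_sub Kx.
have lA := is_localW lm.
have n1 : (1 : quotient_ring K) <> 0 by rewrite -(rmorph1 (quotient_proj K)) => /qproj_eq0.
have lQ := islocal_surj n1 (@qproj_surj _ K) lA.
rewrite -/(hens_lift (quotient_proj K)).
move: (quotient_proj K) lQ n1; move: (quotient_ring K) => Q pi lQ n1.
have [Q' eQ] := nz_ring n1; subst Q; clear K1 K lm m; have [A' eA] := nz_ring lA.1; subst A.
exact: good_hens_lift.
Qed.

Lemma comax_exp (A : comPzRingType) (x y : A) m n :
  (exists a b, a * x + b * y = 1) -> exists a b, a * x ^+ m + b * y ^+ n = 1.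
Proof.
have one (x' y' : A) k : (exists a b, a * x' + b * y' = 1) -> exists a b, a * x' ^+ k + b * y' = 1.
  move=> [a [b e]]; elim: k => [|k [c [d e']]]; first by exists 1, 0; rewrite expr0; ring.
  exists (c * a), (c * x' ^+ k * b + d); rewrite -e' exprS.
  rewrite -[c * x' ^+ k in RHS]mulr1 -e; ring.
move=> h; have [a [b e]] := one x y m h.
have [|c [d e']] := one y (x ^+ m) n; first by exists b, a; rewrite addrC.
by exists d, c; rewrite addrC.
Qed.

Section DetTrick.
Context (A : comNzRingType).

Lemma coef_mhp (c : nat -> A) n i : (i < n)%N -> (mhp c n)`_(n.-1 - i) = c i.
Proof.
elim: n => // n IH; rewrite ltnS leq_eqVlt => /predU1P[->|lt] /=.
  by rewrite subnn /mhp /= coefD coefMX coefC /= add0r.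
rewrite /mhp /= coefD coefMX coefC subn_eq0 leqNgt lt addr0 -/(mhp c n) -[RHS](IH lt).
by congr nth; rewrite predn_sub.
Qed.

Lemma mh_zero (B : comPzRingType) (x : B) n : mh (fun=> 0) x n = x ^+ n.
Proof. by elim: n => [|n IH] /=; rewrite ?expr0 // IH addr0 exprSr. Qed.

Lemma char_poly_ideal (Q : comPzRingType) (pi : {rmorphism A -> Q}) n (c : 'M[A]_n) k :
  (forall i j, pi (c i j) = 0) -> (k < n)%N -> pi (char_poly c)`_k = 0.
Proof.
have [e|n1] := pselect ((1 : Q) = 0); first by move=> _ _; exact: (zero_ring_eq _ _ e).
have [Q' eQ] := nz_ring n1; subst Q => c0 kn.
rewrite -coef_map map_char_poly (_ : map_mx _ _ = 0); last first.
  by apply/matrixP => i j; rewrite !mxE c0.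
rewrite char_poly_trig; last by apply/is_trig_mxP => i j _; rewrite mxE.
under eq_bigr do rewrite mxE subr0; rewrite prodr_const card_ord coefXn.
by rewrite (ltn_eqF kn).
Qed.

End DetTrick.

(** * Integral extensions *)

Definition spanned (A C : comPzRingType) (f : {rmorphism A -> C}) (K : finType) (w : K -> C) x :=
  exists a : K -> A, x = \sum_l f (a l) * w l.

(** Integrality as the determinant trick needs it: finitely many elements stabilise a finitely
    generated submodule that contains 1. In this form it passes to B (x)_A B ([tens_intalg]). *)
Definition intalg (A C : comPzRingType) (f : {rmorphism A -> C}) := forall (I : finType) (z : I -> C),
  exists (K : finType) (w : K -> C), spanned f w 1 /\ forall i k, spanned f w (z i * w k).

Section Spanned.
Context (A C : comPzRingType) (f : {rmorphism A -> C}) (K : finType) (w : K -> C).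

Lemma spanned_sum (I : Type) (r : seq I) (F : I -> C) :
  (forall i, spanned f w (F i)) -> spanned f w (\sum_(i <- r) F i).
Proof.
move=> h; apply: big_ind => [|x y [a ->] [b ->]|//].
  by exists (fun=> 0); rewrite big1 // => l _; rewrite rmorph0 mul0r.
exists (fun l => a l + b l); rewrite -big_split; apply: eq_bigr => l _.
by rewrite rmorphD mulrDl.
Qed.

End Spanned.

(** The Cayley-Hamilton argument: [z] acts on a finitely generated submodule containing 1 by a
    matrix with entries in [I], whose characteristic polynomial has its lower coefficients in
    [I]. *)
Lemma int_det (A : comNzRingType) (C : comPzRingType) (f : {rmorphism A -> C}) (I : ideal A) z :
  intalg f -> ext_mem f I z -> exists N d, (forall i, I (d i)) /\ mh (f \o d) z N = 0.
Proof.
move=> fi [J [a [b [Ia zE]]]]; have [K [w [[e eE] wE]]] := fi J b.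
have /choice[t tE] jk : exists t : K -> A, b jk.1 * w jk.2 = \sum_l f (t l) * w l.
  exact: wE.
pose N := #|K|; pose c : 'M[A]_N := \matrix_(k, l) \sum_j a j * t (j, enum_val k) (enum_val l).
pose v (k : 'I_N) := w (enum_val k).
have reK (F : K -> C) : \sum_l F l = \sum_(l < N) F (enum_val l).
  by rewrite (reindex (fun j : 'I_N => enum_val j)) //; apply: onW_bij; exact: enum_val_bij.
have zv k : z * v k = \sum_l f (c k l) * v l.
  rewrite zE mulr_suml; transitivity (\sum_j \sum_l f (a j * t (j, enum_val k) (enum_val l)) * v l).
    apply: eq_bigr => j _; rewrite -mulrA (tE (j, _)) reK mulr_sumr.
    by apply: eq_bigr => l _; rewrite rmorphM mulrA.
  rewrite exchange_big /=; apply: eq_bigr => l _.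
  by rewrite mxE rmorph_sum mulr_suml.
have [g [gC gX]] := poly_lift f z.
have kill : forall k, \sum_l (map_mx g (char_poly_mx c)) k l * v l = 0.
  move=> k; transitivity (z * v k - \sum_l f (c k l) * v l); last by rewrite zv subrr.
  transitivity (\sum_l (z *+ (k == l) * v l - f (c k l) * v l)).
    by apply: eq_bigr => l _; rewrite !mxE rmorphB gC rmorphMn /= gX mulrBl.
  rewrite sumrB; congr (_ - _); rewrite (bigD1 k) //= eqxx mulr1n big1 ?addr0 // => l /negbTE.
  by rewrite eq_sym => ->; rewrite mulr0n mul0r.
have g0 : g (char_poly c) = 0.
  rewrite /char_poly -det_map_mx -[LHS]mulr1 eE reK mulr_sumr big1 // => l _.
  by rewrite mulrCA [\det _ * _](det_kill kill) mulr0.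
have [d dE] := mhp_surj (char_poly_monic c) (size_char_poly c).
have Id i : (i < N)%N -> I (d i).
  move=> lt; apply/qproj_eq0; rewrite -(coef_mhp d lt) dE.
  apply: (char_poly_ideal (pi := quotient_proj I)) => [k l|].
    apply/qproj_eq0; rewrite mxE; apply: ideal_sum => j _; exact: idealMr.
  by case: (N) lt => // n _; rewrite /= ltnS leq_subr.
(* Coefficients beyond [N] are set to zero so that all of them lie in [I]. *)
exists N, (fun i => if (i < N)%N then d i else 0); split=> [i|].
  by case: ifP => [/Id//|_]; exact: ideal0.
rewrite -[RHS]g0 -dE mhp_horner gX; apply: mh_eq => i lt /=.
by rewrite lt gC.
Qed.

Lemma ext_ideal_closed (A C : comPzRingType) (f : {rmorphism A -> C}) (I : ideal A) :
  exists E : ideal C, forall z, E z <-> ext_mem f I z.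
Proof.
pose S z := ext_mem f I z.
have S0 : S 0 by exists void, (fun _ => 0), (fun _ => 0); split=> [[]|]; rewrite big1 // => -[].
have SD x y : S x -> S y -> S (x + y).
  move=> [J [a [b [Ia ->]]]] [K [c [d [Ic ->]]]].
  exists (J + K)%type, (fun k => match k with inl j => a j | inr j => c j end),
    (fun k => match k with inl j => b j | inr j => d j end).
  by split=> [[]//|]; rewrite big_sumT.
have SM a x : S x -> S (a * x).
  move=> [J [c [b [Ia ->]]]]; exists J, c, (fun j => a * b j); split=> //.
  by rewrite mulr_sumr; apply: eq_bigr => j _; rewrite mulrCA.
by exists (Ideal S0 SD SM).
Qed.

Definition ext_ideal (A C : comPzRingType) (f : {rmorphism A -> C}) (I : ideal A) : ideal C :=
  projT1 (cid (ext_ideal_closed f I)).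
Lemma ext_idealE (A C : comPzRingType) (f : {rmorphism A -> C}) (I : ideal A) z : ext_ideal f I z <-> ext_mem f I z.
Proof. by rewrite /ext_ideal; case: cid. Qed.

Lemma ext_ideal_gen (A C : comPzRingType) (f : {rmorphism A -> C}) (I : ideal A) a : I a -> ext_ideal f I (f a).
Proof.
by move=> Ia; apply/ext_idealE; exists unit, (fun=> a), (fun=> 1); rewrite big_const card_unit /= mulr1 addr0.
Qed.

Lemma ext_ideal_sub (A C : comPzRingType) (f : {rmorphism A -> C}) (I : ideal A) (E : ideal C) :
  (forall a, I a -> E (f a)) -> ext_ideal f I `<=` E.
Proof.
move=> h z /ext_idealE[J [a [b [Ia ->]]]]; apply: ideal_sum => j _.
by apply: idealMr; apply: h.
Qed.

Lemma mh_ideal (C : comPzRingType) (E : ideal C) d x y n :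
  (forall i, E (d i)) -> E (x - y) -> E (mh d x n - y ^+ n).
Proof.
move=> Ed Exy; elim: n => [|n IH] /=; first by rewrite expr0 subrr; exact: ideal0.
have -> : mh d x n * x + d n - y ^+ n.+1 = (mh d x n - y ^+ n) * x + y ^+ n * (x - y) + d n.
  by rewrite exprS; ring.
by apply: idealD => //; apply: idealD; [exact: idealMr|exact: idealMl].
Qed.

(** A multiple [y] of [z] is a root of a monic polynomial with lower coefficients in [I]. Modulo 1 +
    y its value at [y] is its value at -1, which is a sign plus an element of [I], hence a unit of
    [A]; so 1 + y divides a unit. *)
Lemma int_jac (A : comNzRingType) (C : comPzRingType) (f : {rmorphism A -> C}) (I : ideal A) :
  intalg f -> I `<=` @jacobson_radical A -> ext_ideal f I `<=` @jacobson_radical C.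
Proof.
move=> fi IJ z Ez; apply: unit_jac => x; set y := x * z.
have /ext_idealE/(int_det fi)[N [d [Id dE]]] : ext_ideal f I y by exact: idealMl.
have [E EP] : exists E : ideal C, forall u, E u <-> exists v, u = v * (1 + y).
  by exists (principal (1 + y)) => u; exact: principalP.
have E1 : E (y - f (- 1)) by apply/EP; exists 1; rewrite rmorphN rmorph1 opprK addrC mul1r.
have cong n : E (mh (f \o d) y n - f (mh d (- 1) n)).
  elim: n => [|n IH] /=; first by rewrite rmorph1 subrr; exact: ideal0.
  set p := mh _ y n in IH *; set q := mh d _ n in IH *.
  have -> : p * y + f (d n) - f (q * (-1) + d n) = (p - f q) * y + f q * (y - f (- 1)).
    by rewrite rmorphD rmorphM; ring.
  by apply: idealD; [exact: idealMr|exact: idealMl].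
have := cong N; rewrite dE sub0r => /EP[v vE].
have um : isunit (f (mh d (- 1) N)).
  apply: isunit_rmorph; have := mh_ideal N Id (x := - 1) (y := - 1).
  rewrite subrr => /(_ (ideal0 I)); set t := mh _ _ _ => It.
  have [u uE] : isunit (1 + (- 1) ^+ N * (t - (- 1) ^+ N)).
    by apply: jac_unit; apply: IJ; exact: idealMl.
  have e : (- 1) ^+ N * (- 1) ^+ N = 1 :> A by rewrite -expr2 -exprM mulnC exprM sqrrN expr1n expr1n.
  by exists ((- 1) ^+ N * u); rewrite -[RHS]uE mulrBr e; ring.
have [u uE] := um; exists (- (v * u)).
by rewrite mulrN mulrA [_ * v]mulrC -vE mulNr opprK.
Qed.

(* Lying over, for a prime containing the contraction of [c]. *)
Lemma lying_over (A : comNzRingType) (C : comPzRingType) (f : {rmorphism A -> C}) (c : ideal C)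
    (p : spec A) : intalg f -> (forall a, c (f a) -> p a) ->
  exists P : spec C, c `<=` P /\ forall a, P (f a) <-> p a.
Proof.
move=> fi cp.
have [E EP] : exists E : ideal C, forall u, E u <-> exists x y, [/\ c x, ext_ideal f p y & u = x + y].
  pose S u := exists x y, [/\ c x, ext_ideal f p y & u = x + y].
  have S0 : S 0 by exists 0, 0; rewrite addr0; split=> //; exact: ideal0.
  have SD u v : S u -> S v -> S (u + v).
    move=> [x [y [cx Ey ->]]] [x' [y' [cx' Ey' ->]]]; exists (x + x'), (y + y').
    by split; [exact: idealD|exact: idealD|ring].
  have SM a u : S u -> S (a * u).
    move=> [x [y [cx Ey ->]]]; exists (a * x), (a * y).
    by split; [exact: idealMl|exact: idealMl|ring].
  by exists (Ideal S0 SD SM).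
have [|x y [u [nu ->]] [v [nv ->]]|x [u [nu ->]] /EP[x' [y [cx Ey e]]]|P [EPs PM]] :=
    @krull C E (fun x => exists u, ~ p u /\ x = f u).
- by exists 1; rewrite rmorph1; split=> //; exact: prime_one.
- by exists (u * v); rewrite rmorphM; split=> //; exact: prime_mul.
(* If [f u] = x' + y with [u] outside [p], then [y] is a root of a monic polynomial with lower
   coefficients in [p]. Modulo [c] the value at [y] is the value at [u], so u^N would lie in [p]. *)
- have /(int_det fi)[N [d [Id dE]]] : ext_mem f p y by exact/ext_idealE.
  have cong n : c (mh (f \o d) y n - f (mh d u n)).
    elim: n => [|n IH] /=; first by rewrite rmorph1 subrr; exact: ideal0.
    set q := mh _ y n in IH *; set r := mh d _ n in IH *.
    have -> : q * y + f (d n) - f (r * u + d n) = (q - f r) * y - f r * x'.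
      by rewrite rmorphD rmorphM e; ring.
    by apply: idealB; [exact: idealMr|exact: idealMl].
  have := cong N; rewrite dE sub0r => /idealN; rewrite opprK => /cp pm.
  have := mh_ideal N Id (x := u) (y := u); rewrite subrr => /(_ (ideal0 _)) pn.
  by apply/nu/(@primeX _ _ _ N); rewrite -(subKr (mh d u N) (u ^+ N)); apply: idealB.
exists P; split=> [z cz|a].
  by apply: EPs; apply/EP; exists z, 0; rewrite addr0; split=> //; exact: ideal0.
split=> [Pa|pa]; last first.
  apply: EPs; apply/EP; exists 0, (f a); rewrite add0r; split=> //; first exact: ideal0.
  exact: ext_ideal_gen.
by apply: contrapT => na; apply: (PM (f a)) => //; exists a.
Qed.

Lemma gc_intalg (A : comNzRingType) (V : Type) : (V -> False) ->
  intalg (gcst A V : {rmorphism A -> gc A V}).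
Proof.
move=> V0 I z; have [F [k [th [y [h1 h2 [K [w wP]]]]]]] := gc_finite V0 z.
have sp (x : F) : spanned (gcst A V) (th \o w) (th x).
  have [a ->] := wP x; exists a; rewrite rmorph_sum; apply: eq_bigr => l _.
  by rewrite rmorphM h1.
exists K, (th \o w); split=> [|i l /=]; first by rewrite -(rmorph1 th).
by rewrite -h2 -rmorphM.
Qed.

Lemma tens_intalg (A B : comPzRingType) (f : {rmorphism A -> B}) (g : {rmorphism A -> tens f f}) :
  (forall a, g a = po1 (tens_rel f f) (f a)) -> intalg f -> intalg g.
Proof.
move=> gE fi I z.
have /choice[s sE] i : exists s : seq (B * B), z i = \sum_(x <- s) po1 (tens_rel f f) x.1 * po2 (tens_rel f f) x.2.
  exact: po_gen.
pose J : finType := ({i : I & 'I_(size (s i))} * bool)%type.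
pose b (j : J) := let x := tnth (in_tuple (s (tag j.1))) (tagged j.1) in if j.2 then x.1 else x.2.
have [K [w [w1 wE]]] := fi J b.
pose W (q : K * K) := po1 (tens_rel f f) (w q.1) * po2 (tens_rel f f) (w q.2).
have sp x y : spanned f w x -> spanned f w y ->
    spanned g W (po1 (tens_rel f f) x * po2 (tens_rel f f) y).
  move=> [a ->] [c ->]; exists (fun q => a q.1 * c q.2).
  rewrite !rmorph_sum mulr_suml; transitivity (\sum_k \sum_l g (a k * c l) * W (k, l)); last first.
    by rewrite pair_bigA; apply: eq_bigr => -[].
  apply: eq_bigr => k _; rewrite mulr_sumr; apply: eq_bigr => l _.
  by rewrite gE !rmorphM -!tens_comm /W /=; ring.
exists (K * K)%type, W; split=> [|i [k l]].
  have := sp _ _ w1 w1; rewrite !rmorph1 mulr1; exact.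
rewrite sE big_tnth mulr_suml; apply: spanned_sum => j.
have h1 := wE (Tagged (fun i => 'I_(size (s i))) j, true) k.
have h2 := wE (Tagged (fun i => 'I_(size (s i))) j, false) l.
by have := sp _ _ h1 h2; rewrite /b /= !rmorphM mulrACA.
Qed.

Lemma ideal_add_ex (C : comPzRingType) (c e : ideal C) :
  exists E : ideal C, forall u, E u <-> exists x y, [/\ c x, e y & u = x + y].
Proof.
pose S u := exists x y, [/\ c x, e y & u = x + y].
have S0 : S 0 by exists 0, 0; rewrite addr0; split=> //; exact: ideal0.
have SD u v : S u -> S v -> S (u + v).
  move=> [x [y [cx Ey ->]]] [x' [y' [cx' Ey' ->]]]; exists (x + x'), (y + y').
  by split; [exact: idealD|exact: idealD|ring].
have SM a u : S u -> S (a * u).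
  move=> [x [y [cx Ey ->]]]; exists (a * x), (a * y).
  by split; [exact: idealMl|exact: idealMl|ring].
by exists (Ideal S0 SD SM).
Qed.

Definition ideal_add (C : comPzRingType) (c e : ideal C) : ideal C := projT1 (cid (ideal_add_ex c e)).
Lemma ideal_addE (C : comPzRingType) (c e : ideal C) u :
  ideal_add c e u <-> exists x y, [/\ c x, e y & u = x + y].
Proof. by rewrite /ideal_add; case: cid. Qed.
Lemma ideal_addl (C : comPzRingType) (c e : ideal C) : c `<=` ideal_add c e.
Proof. by move=> x cx; apply/ideal_addE; exists x, 0; rewrite addr0; split=> //; exact: ideal0. Qed.
Lemma ideal_addr (C : comPzRingType) (c e : ideal C) : e `<=` ideal_add c e.
Proof. by move=> x cx; apply/ideal_addE; exists 0, x; rewrite add0r; split=> //; exact: ideal0. Qed.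
Lemma ideal_add_sub (C : comPzRingType) (c e q : ideal C) : c `<=` q -> e `<=` q -> ideal_add c e `<=` q.
Proof. by move=> h k u /ideal_addE[x [y [/h qx /k qy ->]]]; exact: idealD. Qed.

Lemma mh_monic (A : comNzRingType) (d : nat -> A) (Y : {poly A}) n :
  Y \is monic -> (1 < size Y)%N -> mh (fun i => (d i)%:P) Y n \is monic.
Proof.
move=> Ym sY; elim: n => [|n IH] /=; first exact: monic1.
rewrite monicE lead_coefDl; first by rewrite -monicE monicMr.
apply: leq_ltn_trans (size_polyC_leq1 _) _; rewrite size_Mmonic ?monic_neq0 //.
by case: (size _) (size_poly_gt0 (mh (fun i => (d i)%:P) Y n)) => [|k _];
  [rewrite monic_neq0|rewrite addSn /= (leq_trans sY) ?leq_addl].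
Qed.

Lemma mh_cong (C : comPzRingType) (E : ideal C) d x y n : E (x - y) -> E (mh d x n - mh d y n).
Proof.
move=> Exy; elim: n => [|n IH] /=; first by rewrite subrr; exact: ideal0.
have -> : mh d x n * x + d n - (mh d y n * y + d n) = (mh d x n - mh d y n) * x + mh d y n * (x - y).
  ring.
by apply: idealD; [exact: idealMr|exact: idealMl].
Qed.

Lemma poly_ext_ideal (A : comNzRingType) (C : comPzRingType) (f : {rmorphism A -> C}) (I : ideal A)
    (g : {rmorphism {poly A} -> C}) (P : {poly A}) :
  (forall a, g a%:P = f a) -> (forall i, I P`_i) -> ext_ideal f I (g P).
Proof.
move=> gC PI; rewrite -[P]coefK poly_def rmorph_sum; apply: ideal_sum => i _.
by rewrite -mul_polyC rmorphM gC; apply: idealMr; exact: ext_ideal_gen.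
Qed.

(* A henselian pair has no idempotents in finite extensions beyond those seen *)
(* in the quotients by primes: V(p + I C) is connected.                       *)
Lemma henselian_connected (A : comNzRingType) (C : comPzRingType) (f : {rmorphism A -> C})
    (I : ideal A) (p : spec C) (W : spec C -> Prop) (T := fun q : spec C => ideal_add p (ext_ideal f I) `<=` q) :
  intalg f -> henselian_pair I ->
  (forall q, T q -> exists u, ~ q u /\ forall q', T q' -> ~ q' u -> (W q' <-> W q)) ->
  forall q q', T q -> T q' -> W q -> W q'.
Proof.
move=> fi [_ hI] lW q0 q1 T0 T1 W0; apply: contrapT => W1; pose c := ideal_add p (ext_ideal f I).
(* [a] and [b] consist of the elements whose basic open set, within V(p + I C), lies in [W] or
   outside [W] respectively; local constancy of [W] makes them comaximal. *)
have [a aE] : exists a : ideal C, forall x, a x <-> forall q, T q -> ~ q x -> W q.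
  pose S x := forall q, T q -> ~ q x -> W q.
  have S0 : S 0 by move=> q _ /(_ (ideal0 _)).
  have SD x y : S x -> S y -> S (x + y).
    move=> Sx Sy q Tq nq; apply: contrapT => nW; apply: nq; apply: idealD.
      by apply: contrapT => /(Sx q Tq).
    by apply: contrapT => /(Sy q Tq).
  have SM b x : S x -> S (b * x) by move=> Sx q Tq nq; apply: Sx => // qx; exact/nq/idealMl.
  by exists (Ideal S0 SD SM).
have [b bE] : exists a : ideal C, forall x, a x <-> forall q, T q -> ~ q x -> ~ W q.
  pose S x := forall q, T q -> ~ q x -> ~ W q.
  have S0 : S 0 by move=> q _ /(_ (ideal0 _)).
  have SD x y : S x -> S y -> S (x + y).
    move=> Sx Sy q Tq nq; apply: contrapT => nW; apply: nq; apply: idealD.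
      by apply: contrapT => /(Sx q Tq).
    by apply: contrapT => /(Sy q Tq).
  have SM d x : S x -> S (d * x) by move=> Sx q Tq nq; apply: Sx => // qx; exact/nq/idealMl.
  by exists (Ideal S0 SD SM).
have /ideal_addE[u [v [au bv uv]]] : ideal_add a b 1.
  apply: ideal_one => Q abQ.
  have TQ : T Q.
    move=> x cx; apply: abQ; apply: ideal_addl; apply/aE => q Tq; case; exact: Tq.
  have [w [nw wE]] := lW Q TQ; have [WQ|nWQ] := pselect (W Q).
    by apply: nw; apply: abQ; apply: ideal_addl; apply/aE => q Tq nq; exact/(wE _ Tq nq).
  by apply: nw; apply: abQ; apply: ideal_addr; apply/bE => q Tq nq /(wE _ Tq nq).
have inT q : T q -> q u \/ q v.
  move=> Tq; have [qu|nu] := pselect (q u); [by left|right].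
  by apply: contrapT => nv; exact: (bE v).1 bv q Tq nv ((aE u).1 au q Tq nu).
have vE : v = 1 - u by rewrite uv addrC addKr.
(* On V(p + I C) one of [u] and v = 1 - u vanishes, so [u] is idempotent modulo p + I C up to a
   nilpotent. *)
have [n cn] : exists n, c ((u ^+ 2 - u) ^+ n).
  apply: nilp_of_primes => q cq; rewrite (_ : _ - _ = - (u * v)); last by rewrite vE; ring.
  by apply: idealN; have [h|h] := inT q cq; [exact: idealMr|exact: idealMl].
have {cn} : c ((u ^+ 2 - u) ^+ n.+1) by rewrite exprS; exact: idealMl.
(* The component [y] in I C is a root of a monic polynomial with lower coefficients in [I]. Composed
   with (X^2 - X)^(n+1), it becomes the polynomial [F] below, with F(u) in [p] and F congruent to
   X^M (X - 1)^M modulo [I]. *)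
move=> /ideal_addE[x [y [px /ext_idealE/(int_det fi)[N [d [Id dE]]] xy]]].
pose M := (n.+1 * N)%N.
suff [cu|cv] : c (u ^+ M) \/ c ((u - 1) ^+ M).
- have q0u : q0 u by apply: primeX (T0 _ cu).
  have nv : ~ q0 v by move=> q0v; apply: (@prime_one _ q0); rewrite uv; exact: idealD.
  by have := (bE v).1 bv q0 T0 nv.
- have q1v : q1 v by rewrite vE -opprB; apply/idealN/primeX/(T1 _ cv).
  have nu : ~ q1 u by move=> q1u; apply: (@prime_one _ q1); rewrite uv; exact: idealD.
  by have := (aE u).1 au q1 T1 nu.
have [I1|nI] := pselect (I 1).
  left; rewrite -[_ ^+ _]mulr1; apply: idealMl; apply: ideal_addr.
  by rewrite -(rmorph1 f); exact: ext_ideal_gen.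
pose Y : {poly A} := ('X^2 - 'X) ^+ n.+1.
have Z0 : 'X^2 - 'X = 'X * ('X - 1%:P) :> {poly A} by rewrite mulrBr mulr1 expr2.
have Ym : Y \is monic by rewrite /Y Z0 monic_exp // monicMl ?monicX // monicXsubC.
have sY : (1 < size Y)%N.
  rewrite /Y exprS Z0 -mulrA -commr_polyX size_mulX ?ltnS ?size_poly_gt0;
    by apply: monic_neq0; rewrite monicMl ?monicXsubC // -Z0 monic_exp // Z0 monicMl ?monicX // monicXsubC.
pose F : {poly A} := mh (fun i => (d i)%:P) Y N; have Fm : F \is monic by exact: mh_monic.
have [g [gC gX]] := poly_lift f u.
have gY : g Y = (u ^+ 2 - u) ^+ n.+1 by rewrite rmorphXn rmorphB rmorphXn /= gX.
have pF : p (g F).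
  rewrite mh_rmorph gY (_ : g \o _ = f \o d); last by apply/funext => i; rewrite /= gC.
  rewrite -[mh _ _ _]subr0 -dE; apply: mh_cong.
  by rewrite xy addrK.
have n1 : (1 : quotient_ring I) <> 0 by rewrite -(rmorph1 (quotient_proj I)) => /qproj_eq0.
(* A lift G H of that factorization is enough: as [p] is prime, it contains G(u) or H(u), and these
   are u^M and (u - 1)^M modulo I C. *)
suff [G [H [FE GE HE]]] : exists G H, [/\ F = G * H, forall i, I (G - 'X^M)`_i
    & forall i, I (H - ('X - 1%:P) ^+ M)`_i].
  move: pF; rewrite FE rmorphM => /(spec_prime p).2[pG|pH]; [left|right].
  - rewrite -(subKr (g G) (u ^+ M)); apply: idealB; first exact: ideal_addl.
    by rewrite -gX -rmorphXn -rmorphB; apply: ideal_addr; exact: poly_ext_ideal GE.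
  - rewrite -(subKr (g H) ((u - 1) ^+ M)); apply: idealB; first exact: ideal_addl.
    rewrite -gX -(rmorph1 f) -gC -rmorphB -rmorphXn -rmorphB.
    by apply: ideal_addr; exact: poly_ext_ideal HE.
have zero x' : I x' <-> quotient_proj I x' = 0 by split=> /qproj_eq0.
have {}hI : hens_lift (quotient_proj I) by exact: hI.
move: (quotient_proj I) zero hI n1; move: (quotient_ring I) => Q pi zero hI n1.
have [Q' eQ] := nz_ring n1; subst Q.
have FE : map_poly pi F = 'X^M * ('X - 1%:P) ^+ M.
  rewrite (mh_rmorph (map_poly pi)) (_ : map_poly pi \o _ = fun=> 0); last first.
    by apply/funext => i; rewrite /= map_polyC /= (zero _).1.
  rewrite mh_zero rmorphXn rmorphB rmorphXn /= map_polyX -exprM -exprMn.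
  by congr (_ ^+ _); rewrite mulrBr mulr1 expr2.
have [|||G [H [_ _ FGH GE HE]]] := (hens_liftP pi).1 hI F ('X^M) (('X - 1%:P) ^+ M) Fm _ _ FE.
- exact: monicXn.
- by rewrite monic_exp // monicXsubC.
- apply: comax_exp; exists 1, (- 1); rewrite mul1r mulN1r opprB addrCA subrr addr0.
  exact: polyC1.
exists G, H; split=> // i; apply/zero.
  by rewrite coefB rmorphB -coef_map GE coefXn rmorph_nat coefXn subrr.
have e : ('X - 1%:P) ^+ M = map_poly pi (('X - 1%:P) ^+ M).
  by rewrite rmorphXn rmorphB /= map_polyX map_polyC; congr ((_ - _%:P) ^+ _); rewrite /= rmorph1.
by rewrite -coef_map rmorphB /= HE [in LHS]e subrr coef0.
Qed.

(** * Germs, morphisms and open immersions *)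

Section Germs.
Context (X : ringed_space).

Lemma germB (x : X) (U : opens X) (Ux : U x) (s t : sec X U) :
  germ Ux (s - t) = germ Ux s - germ Ux t.
Proof.
rewrite /germ -classN -classD; apply/classP.
exists U, (@subset_refl _ _), (fun y Uy => conj Uy Uy); split=> //=.
by rewrite rmorphB [RHS]rmorphD !res_res rmorphN; congr (_ + - _); apply: res_irr.
Qed.

Lemma germ0 (x : X) (U : opens X) (Ux : U x) : germ Ux (0 : sec X U) = 0.
Proof. by have := germB Ux 0 0; rewrite !subrr. Qed.

Lemma germ_irr (x : X) (U : opens X) (Ux Ux' : U x) (s : sec X U) : germ Ux s = germ Ux' s.
Proof. by rewrite (Prop_irrelevance Ux Ux'). Qed.

Lemma germ_sep (U : opens X) (s t : sec X U) :
  (forall x (Ux : U x), germ Ux s = germ Ux t) -> s = t.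
Proof.
move=> h; have loc (z : {x | U x}) : exists W : opens X, exists WU : W `<=` U,
    W (sval z) /\ res WU s = res WU t.
  case: z => x Ux /=; have /germ_eq[W [WU [WV [Wx e]]]] := h x Ux.
  by exists W, WU; rewrite e (res_irr WV WU).
have /choice[W WP] := loc.
have WU z : W z `<=` U by have [] := WP z.
apply: (sec_separated (V := W) (VU := WU)) => [x Ux|z].
  by exists (exist _ x Ux) => //; have [? []] := WP (exist _ x Ux).
by have [h' [_ e]] := WP z; rewrite !(res_irr (WU z) h').
Qed.

Lemma germ_glue (U : opens X) (sg : forall x, U x -> stalk x) :
  (forall x, U x -> exists (V : opens X) (r : sec X V), V x /\
     forall y (Vy : V y) (Uy : U y), sg y Uy = germ Vy r) ->
  exists t : sec X U, forall x (Ux : U x), germ Ux t = sg x Ux.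
Proof.
move=> h; have /choice[W WP] (z : {x | U x}) : exists W : {V : opens X & sec X V},
    projT1 W (sval z) /\ forall y (Vy : projT1 W y) (Uy : U y), sg y Uy = germ Vy (projT2 W).
  by have [V [r [Vx e]]] := h _ (svalP z); exists (existT _ V r).
pose V z := opensI (projT1 (W z)) U.
have VU z : V z `<=` U by move=> x [].
have VW z : V z `<=` projT1 (W z) by move=> x [].
pose s z := res (@VW z) (projT2 (W z)).
have sE z y (Vy : V z y) (Uy : U y) : germ Vy (s z) = sg y Uy.
  by rewrite (germ_res _ (VW z y Vy)) ((WP z).2 y (VW z y Vy)).
have [x Ux|z z' Wi Wj|t tE] := @sec_glue X U _ V VU _ s.
- by exists (exist _ x Ux) => //; split=> //; exact: (WP (exist _ x Ux)).1.
- apply: germ_sep => y Vy; have Uy := VU z y (Wi y Vy).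
  by rewrite (germ_res _ (Wi y Vy)) (germ_res _ (Wj y Vy)) !(sE _ _ _ Uy).
- exists t => x Ux; have Vx : V (exist _ x Ux) x.
    by split=> //; exact: (WP (exist _ x Ux)).1.
  by rewrite -(germ_res (VU (exist _ x Ux)) _ Vx) tE sE.
Qed.

Lemma stalk_map_germ' (T : ringed_space) (g : rs_mor T X) t (U : opens X) (Ut : U (g t)) s :
  stalk_map g t (germ Ut s) = @germ T t (opens_preimage (rs_cts g) U) Ut (rs_sharp g U s).
Proof. exact: stalk_map_germ. Qed.

End Germs.

Lemma open_local (X : topologicalType) (U : set X) :
  (forall x, U x -> exists V : opens X, V x /\ V `<=` U) -> open U.
Proof.
move=> h; rewrite openE => x /h[V [Vx VU]]; rewrite /interior.
by apply: filterS VU _; exact: opens_nbhs.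
Qed.

Lemma local_homP (A B : comPzRingType) (phi : {rmorphism A -> B}) :
  local_ring A -> local_ring B -> local_hom phi <-> forall a, isunit (phi a) -> isunit a.
Proof.
move=> /local_ringP[m lm] /local_ringP[n ln]; split=> [h a ua|h m' n' mm nn a].
  apply: lm.2 => ma; have := h m n (is_local_max lm) (is_local_max ln) a ma.
  by move/(ideal_unit ua)/ln.1.
rewrite (is_local_uniq lm mm) (is_local_uniq ln nn) => ma.
apply: contrapT => /ln.2/h ua; exact: lm.1 (ideal_unit ua ma).
Qed.

Lemma mor_unit (T X : lrs) (g : mor T X) t a : isunit (stalk_map g t a) -> isunit a.
Proof. by apply: (local_homP _ (lrs_local _) (lrs_local _)).1; exact: mor_local. Qed.

(** The stalk maps are compared on germs of a common section, as the stalks at [g t] and [g' t] are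
    different types. *)
Lemma mor_ext (T X : lrs) (g g' : mor T X) : (forall t, g t = g' t) ->
  (forall t (U : opens X) (Ut : U (g t)) (Ut' : U (g' t)) s,
    stalk_map g t (germ Ut s) = stalk_map g' t (germ Ut' s)) -> g = g'.
Proof.
case: g g' => [[g gc gs gr] gl] [[g' gc' gs' gr'] gl'] e h.
have {e} : g = g' by exact/funext.
move=> e; subst g'; have e := Prop_irrelevance gc gc'; subst gc'.
have {h} e : gs = gs'.
  apply: functional_extensionality_dep => U; apply: rmorph_ext => s.
  by apply: germ_sep => t Ut; have := h t U Ut Ut s; rewrite !stalk_map_germ'.
subst gs'; have e := Prop_irrelevance gr gr'; subst gr'.
by rewrite (Prop_irrelevance gl gl').
Qed.

(** The second condition asks that the images of the germs of a section be, locally, the germs of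
    one section; this yields continuity as well as the maps on sections. *)
Lemma mk_mor (T X : lrs) (h : T -> X) (th : forall t, {rmorphism stalk (h t) -> stalk t}) :
  (forall t a, isunit (th t a) -> isunit a) ->
  (forall t (U : opens X) (Ut : U (h t)) (s : sec X U), exists (V : opens T) (r : sec T V), V t /\
     forall t' (Vt : V t'), exists Ut' : U (h t'), th t' (germ Ut' s) = germ Vt r) ->
  exists g : mor T X, (forall t, g t = h t) /\
    forall t (U : opens X) (Ut : U (g t)) (Ut' : U (h t)) s,
      stalk_map g t (germ Ut s) = th t (germ Ut' s).
Proof.
move=> lh H; have hc : continuous h.
  apply/continuousP => U oU; apply: open_local => t Ut.
  have [V [r [Vt rE]]] := H t (Opens oU) Ut 1.
  by exists V; split=> // t' Vt'; have [] := rE t' Vt'.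
have shex (p : {U : opens X & sec X U}) :
    exists r : sec T (opens_preimage hc (projT1 p)), forall t (Ut : opens_preimage hc (projT1 p) t),
      germ Ut r = th t (@germ X (h t) (projT1 p) Ut (projT2 p)).
  case: p => U s /=; apply: germ_glue => t Ut; have [V [r [Vt rE]]] := H t U Ut s.
  exists V, r; split=> // t' Vt' Ut'; have [Ut'' <-] := rE t' Vt'.
  by rewrite (@germ_irr X (h t') U Ut' Ut'').
pose sh p := projT1 (cid (shex p)); have shE p := projT2 (cid (shex p)).
pose sf (U : opens X) (s : sec X U) : sec T (opens_preimage hc U) := sh (existT _ U s).
have sfE U s t (Ut : opens_preimage hc U t) : germ Ut (sf U s) = th t (@germ X (h t) U Ut s).
  exact: (shE (existT _ U s) t Ut).
have sz U : zmod_morphism (sf U).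
  by move=> s s'; apply: germ_sep => t Ut; rewrite germB !sfE germB rmorphB.
have sm U : monoid_morphism (sf U).
  split=> [|s s']; apply: germ_sep => t Ut; first by rewrite sfE !germ_one rmorph1.
  by rewrite -germ_mul !sfE -germ_mul rmorphM.
pose shr U := mk_rmorph (sz U) (sm U).
have shres (V W : opens X) (WV : W `<=` V) (WV' : opens_preimage hc W `<=` opens_preimage hc V) s :
    shr W (res WV s) = res WV' (shr V s).
  apply: germ_sep => t Wt; rewrite (germ_res WV' (WV' t Wt)) /= !sfE.
  by rewrite (germ_res WV (WV' t Wt)).
pose g0 := @RsMor T X h hc shr shres.
have gE t (U : opens X) (Ut : U (h t)) s : stalk_map g0 t (@germ X (g0 t) U Ut s) = th t (germ Ut s).
  by rewrite stalk_map_germ' /= sfE.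
have gl t : local_hom (stalk_map g0 t).
  apply/(local_homP _ (lrs_local _) (lrs_local _)) => a.
  by elim/germ_ind: a => U Ut s; rewrite gE => /lh.
exists (Mor gl); split=> // t U Ut Ut' s.
by rewrite (@germ_irr X (h t) U Ut' Ut); exact: gE.
Qed.

Section OpenImmersion.
Context (T X : lrs) (j : mor T X).

Lemma oi_stalk : open_immersion j -> forall t, bijective (stalk_map j t).
Proof.
move=> [ij oj bj] t.
have inj : injective (stalk_map j t).
  move=> a b e; apply/eqP; rewrite -subr_eq0; apply/eqP; move/eqP: e.
  rewrite -subr_eq0 -rmorphB => /eqP; move: (a - b) => {a b}.
  elim/germ_ind=> U Ut s; rewrite stalk_map_germ'.
  have <- : @germ T t (opens_preimage (rs_cts j) U) Ut 0 = 0 by exact: germ0.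
  move=> /germ_eq[W [WU [WU' [Wt e]]]].
  pose V : opens X := Opens (openI (opens_open U) (oj _ (opens_open W))).
  have VU : V `<=` U by move=> x [].
  have Vr : V `<=` range j by move=> x [_ [y _ <-]]; exists y.
  have Vt : V (j t) by split=> //; exists t.
  rewrite -(germ_res VU Ut Vt); have /bij_inj ib := bj V Vr.
  suff -> : res VU s = 0 by exact: germ0.
  apply: ib; rewrite rmorph0; apply: germ_sep => y Vy.
  rewrite rs_sharpR (@germ_res T y (opens_preimage (rs_cts j) U) _ _ (VU _ Vy)).
  have Wy : W y by case: Vy => _ [z Wz /ij <-].
  rewrite -(@germ_res T y _ _ WU _ Wy) e (@germ_res T y (opens_preimage (rs_cts j) U) _ WU' (VU _ Vy)).
  by rewrite !germ0.
have sur b : exists a, b = stalk_map j t a.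
  elim/germ_ind: b => U Ut s; pose V : opens X := Opens (oj _ (opens_open U)).
  have Vr : V `<=` range j by move=> x [y _ <-]; exists y.
  have VU : opens_preimage (rs_cts j) V `<=` U by move=> y [z Uz /ij <-].
  have [k _ kK] := bj V Vr; have Vt : V (j t) by exists t.
  exists (germ Vt (k (res VU s))); rewrite stalk_map_germ' kK.
  by rewrite (germ_res VU Ut).
have /choice[k kP] := sur; exists k => x; last by rewrite -kP.
by apply: inj; rewrite -kP.
Qed.

Lemma oi_criterion : injective j -> (forall U : set T, open U -> open (j @` U)) ->
  (forall t, bijective (stalk_map j t)) -> open_immersion j.
Proof.
move=> ij oj bj; split=> // V Vr.
have inj : injective (rs_sharp j V).
  move=> s s' e; apply: germ_sep => x Vx; have [t _ tx] := Vr x Vx; subst x.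
  by apply: (bij_inj (bj t)); rewrite !stalk_map_germ' e.
have sur r : exists s, r = rs_sharp j V s.
  (* Says that the stalk map at [t] takes [z] to the germ of [r], where x = j t, without transport
     along this equality. *)
  pose P x (z : stalk x) := forall (U : opens X) (Ux : U x) s, z = germ Ux s ->
    forall t, j t = x -> forall (Ut : U (j t)) (Vt : V (j t)),
    stalk_map j t (germ Ut s) = @germ T t (opens_preimage (rs_cts j) V) Vt r.
  have ex x : exists z, V x -> P x z.
    have [Vx|nV] := pselect (V x); last by exists 0.
    have [t _ tx] := Vr x Vx; subst x.
    have [k _ kK] := bj t; exists (k (@germ T t (opens_preimage (rs_cts j) V) Vx r)) => _.
    move=> U Ut s e t' /ij tt; subst t' => Ut' Vt.
    by rewrite (@germ_irr X (j t) U Ut' Ut) -e kK (@germ_irr T t (opens_preimage (rs_cts j) V) Vt Vx).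
  have [sg sgP] : exists sg : forall x, stalk x, forall x, V x -> P x (sg x).
    by exists (fun x => projT1 (cid (ex x))) => x; case: cid.
  have stE t (Vt : V (j t)) : stalk_map j t (sg (j t)) = @germ T t (opens_preimage (rs_cts j) V) Vt r.
    have := sgP _ Vt; move: (sg (j t)); elim/germ_ind=> U Ut s h.
    exact: (h U Ut s erefl t erefl).
  have [|s sE] := @germ_glue X V (fun x _ => sg x).
    move=> x Vx; have [t _ tx] := Vr x Vx; subst x.
    have := stE t Vx; elim/germ_ind: (sg (j t)) => U Ut s.
    rewrite stalk_map_germ' => /germ_eq[W [WU [WV [Wt e]]]].
    exists (Opens (openI (opens_open U) (oj _ (opens_open W)))), (res (@opensI_l _ U (Opens (oj _ (opens_open W)))) s).
    split=> [|y Vy Vy']; first by split=> //; exists t.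
    have [t' Wt' ty] := Vy.2; subst y; rewrite (germ_res _ Vy.1).
    apply: (bij_inj (bj t')); rewrite (stE t' Vy') stalk_map_germ'.
    by rewrite -(@germ_res T t' _ _ WU _ Wt') e (@germ_res T t' (opens_preimage (rs_cts j) V) _ WV Vy').
  exists s; apply: germ_sep => t Vt; rewrite -(stE t Vt) -(sE _ Vt).
  by rewrite stalk_map_germ'.
have /choice[k kP] := sur; exists k => x; last by rewrite -kP.
by apply: inj; rewrite -kP.
Qed.

End OpenImmersion.

(** * Affine schemes and morphisms out of them *)

Section SpecStalks.
Context (C : comPzRingType).
Implicit Types q : spec C.

Lemma spec_nbhd (V : opens (spec C)) q : V q -> exists e, ~ q e /\ forall q' : spec C, ~ q' e -> V q'.
Proof.
case: V => V [E /= ->] /not_subset_ex[e [Ee ne]]; exists e; split=> // q' nq' h.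
by apply: nq'; apply: h.
Qed.

Lemma locmap_sep c : (forall q, locmap q c = 0) -> c = 0.
Proof.
move=> h; pose S u := u * c = 0.
have S0 : S 0 by rewrite /S mul0r.
have SD x y : S x -> S y -> S (x + y) by rewrite /S mulrDl => -> ->; rewrite addr0.
have SM a x : S x -> S (a * x) by rewrite /S -mulrA => ->; rewrite mulr0.
have : Ideal S0 SD SM 1.
  by apply: ideal_one => q sq; have [u [nu /sq]] := locmap_eq0 (h q).
by rewrite /= /S mul1r.
Qed.

Lemma locmap_inj c c' : (forall q, locmap q c = locmap q c') -> c = c'.
Proof.
move=> h; apply/eqP; rewrite -subr_eq0; apply/eqP/locmap_sep => q.
by rewrite rmorphB h subrr.
Qed.

(* Sections of the structure sheaf over a basic open set are fractions. *)
Lemma frac_glue (g : C) (s : forall q, localization q) :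
  (forall q, ~ q g -> exists a f e, ~ q e /\ forall q', ~ q' e ->
     ~ q' f /\ s q' * locmap q' f = locmap q' a) ->
  exists n c, forall q, ~ q g -> s q * locmap q (g ^+ n) = locmap q c.
Proof.
(* [S] is the ideal of common denominators of [s] on the basic open set of [g]; some power of [g]
   has to lie in it. *)
move=> h; pose S x := exists c, forall q, ~ q g -> s q * locmap q x = locmap q c.
have S0 : S 0 by exists 0 => q _; rewrite rmorph0 mulr0.
have SD x y : S x -> S y -> S (x + y).
  by move=> [c cE] [d dE]; exists (c + d) => q nq; rewrite !rmorphD mulrDr cE ?dE.
have SM a x : S x -> S (a * x).
  by move=> [c cE]; exists (a * c) => q nq; rewrite !rmorphM mulrCA cE.
suff [n [c cE]] : exists n, Ideal S0 SD SM (g ^+ n) by exists n, c.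
apply: nilp_of_primes => q Sq; apply: contrapT => ng.
have [a [f [e [ne H]]]] := h q ng; have [nf _] := H q ne.
(* On D(e) one has s = a / f. [P] collects the elements y such that s f = a holds, after
   multiplication by some power of [e], wherever [g] and y are invertible; once it contains a power
   of [g], some f e^N is a common denominator. *)
pose P y := exists N, forall q', ~ q' g -> ~ q' y ->
  (s q' * locmap q' f - locmap q' a) * locmap q' (e ^+ N) = 0.
have P0 : P 0 by exists 0%N => q' _ /(_ (ideal0 _)).
have le N N' (q' : spec C) : (N <= N')%N -> (s q' * locmap q' f - locmap q' a) * locmap q' (e ^+ N) = 0 ->
    (s q' * locmap q' f - locmap q' a) * locmap q' (e ^+ N') = 0.
  by move=> lt z; rewrite -(subnK lt) exprD rmorphM mulrCA z mulr0.
have PD x y : P x -> P y -> P (x + y).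
  move=> [N NE] [M ME]; exists (maxn N M) => q' ng' nxy.
  have [qx|nx] := pselect (q' x); last by apply: le (NE q' ng' nx); exact: leq_maxl.
  apply: le (ME q' ng' _); first exact: leq_maxr.
  by move=> qy; apply: nxy; exact: idealD.
have PM b x : P x -> P (b * x).
  by move=> [N NE]; exists N => q' ng' nbx; apply: NE => // qx; apply/nbx/idealMl.
have [n [N NE]] : exists n, Ideal P0 PD PM (g ^+ n).
  apply: nilp_of_primes => q' Pq'; apply: contrapT => ng'.
  have [a' [f' [e' [ne' H']]]] := h q' ng'.
  pose w := a' * f - a * f'.
  have [N wN] : exists N, w * (e * e') ^+ N = 0.
    pose An y := w * y = 0.
    have A0 : An 0 by rewrite /An mulr0.
    have AD x y : An x -> An y -> An (x + y) by rewrite /An mulrDr => -> ->; rewrite addr0.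
    have AM b x : An x -> An (b * x) by rewrite /An mulrCA => ->; rewrite mulr0.
    suff [N] : exists N, Ideal A0 AD AM ((e * e') ^+ N) by exists N.
    apply: nilp_of_primes => r Ar; apply: contrapT => nee.
    have [nf1 E1] := H r (fun h => nee (idealMr _ h)).
    have [nf2 E2] := H' r (fun h => nee (idealMl _ h)).
    have : locmap r w = 0 by rewrite rmorphB !rmorphM -E1 -E2; ring.
    by move=> /locmap_eq0[u [nu uw]]; apply/nu/Ar; rewrite /= /An mulrC.
  apply: ne'; apply: Pq'; exists N => r nr ne2; have [nf2 E2] := H' r ne2.
  apply: (unit_cancel (locmap_unit (prime_mul nf2 (@primeXn _ _ _ N ne2)))).
  rewrite mul0r -[RHS](rmorph0 (locmap r)) -wN exprMn !rmorphM rmorphB !rmorphM -E2.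
  by ring.
apply: (prime_mul nf (@primeXn _ _ _ N ne)); apply: Sq.
exists (a * e ^+ N) => r nr; have := NE r nr (@primeXn _ _ _ n nr).
by move/eqP; rewrite mulrBl subr_eq0 -mulrA -!rmorphM => /eqP.
Qed.

Lemma stalk_val_inj (q : spec_rs C) : injective (@stalk_val C q).
Proof.
move=> x y e; apply/eqP; rewrite -subr_eq0; apply/eqP; move/eqP: e; rewrite -subr_eq0 -rmorphB => /eqP.
elim/germ_ind: (x - y) => U Uq s {x y}; rewrite stalk_val_germ.
have [V [a [f [Vq H]]]] := svalP (s : spec_sec U) q Uq; have [nf ->] := H q Uq Vq.
rewrite -(frac0 (@prime_one _ q)) => /frac_eq[u [nu]]; rewrite mulr1 mul0r mulr0 => ua.
rewrite -(germ0 Uq); apply/germ_eq.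
have WU : opensI (opensI U V) (basic_open u) `<=` U by move=> r [[]].
exists (opensI (opensI U V) (basic_open u)), WU, WU; split=> //.
apply: spec_sec_ext => r Wr /=; have [nfr ->] := H r (WU r Wr) (Wr.1.2).
rewrite -(frac0 nfr); apply/frac_eq; exists u; split; first exact: Wr.2.
by rewrite mul0r mulr0 mulrA ua mul0r.
Qed.

Lemma stalk_val_surj (q : spec_rs C) z : exists x : stalk q, stalk_val _ x = z.
Proof.
elim/frac_ind: z => a f nf.
have tP : @locally_fraction C (basic_open f) (fun r nr => @frac C r a f nr).
  by move=> r nr; exists (basic_open f), a, f; split=> // r' nr' _; exists nr'.
exists (@germ (spec_rs C) q (basic_open f) nf (exist _ _ tP)).
by rewrite stalk_val_germ.
Qed.

Lemma stalk_val_bij (q : spec_rs C) : bijective (@stalk_val C q).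
Proof.
have /choice[k kK] := @stalk_val_surj q; exists k => // x.
by apply: stalk_val_inj; rewrite kK.
Qed.

End SpecStalks.

Lemma localization_map_locmap (A B : comPzRingType) (phi : {rmorphism A -> B}) (q : spec B) a :
  localization_map phi q (locmap (spec_preimage phi q) a) = locmap q (phi a).
Proof.
rewrite !locmapE localization_map_frac; apply: frac_eqW.
by rewrite rmorph1.
Qed.

Lemma bij_ex (A B : comPzRingType) (f : {rmorphism A -> B}) : injective f -> (forall b, exists a, f a = b) ->
  exists g : {rmorphism B -> A}, cancel f g /\ cancel g f.
Proof.
move=> fi fs; have /choice[k kK] := fs.
have gz : zmod_morphism k by move=> x y; apply: fi; rewrite rmorphB !kK.
have gm : monoid_morphism k by split=> [|x y]; apply: fi; rewrite kK ?rmorph1 // rmorphM !kK.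
by exists (mk_rmorph gz gm); split=> // x; apply: fi; rewrite /= kK.
Qed.

Section Evaluation.
Context (C : comPzRingType) (X : lrs) (h : mor (spec_lrs C) X).
Implicit Types (q : spec C).

(** Pulled back sections are read in the local ring of [C], where equalities can be checked with
    fractions. *)
Definition ev q (U : opens X) (Uq : U (h q)) (s : sec X U) : localization q :=
  stalk_val _ (stalk_map h q (germ Uq s)).

Lemma ev_irr q (U : opens X) (Uq Uq' : U (h q)) s : ev Uq s = ev Uq' s.
Proof. by rewrite (Prop_irrelevance Uq Uq'). Qed.

Lemma ev_res q (U V : opens X) (VU : V `<=` U) (Uq : U (h q)) (Vq : V (h q)) s :
  ev Vq (res VU s) = ev Uq s.
Proof. by rewrite /ev (germ_res VU Uq). Qed.

Lemma evB q (U : opens X) (Uq : U (h q)) s t : ev Uq (s - t) = ev Uq s - ev Uq t.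
Proof. by rewrite /ev germB !rmorphB. Qed.

Lemma ev1 q (U : opens X) (Uq : U (h q)) : ev Uq 1 = 1.
Proof. by rewrite /ev germ_one !rmorph1. Qed.

Lemma evM q (U : opens X) (Uq : U (h q)) s t : ev Uq (s * t) = ev Uq s * ev Uq t.
Proof. by rewrite /ev -germ_mul !rmorphM. Qed.

Lemma ev_unit q a : isunit (stalk_val _ (stalk_map h q a)) -> isunit a.
Proof.
move=> [v]; have [w <-] := stalk_val_surj v; rewrite -rmorphM -(rmorph1 (@stalk_val C q)).
by move/stalk_val_inj => e; apply: (@mor_unit _ _ h q); exists w.
Qed.

Lemma ev_frac q (U : opens X) (Uq : U (h q)) s : exists a f e, ~ q e /\ forall q', ~ q' e ->
  exists Uq' : U (h q'), ~ q' f /\ ev Uq' s * locmap q' f = locmap q' a.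
Proof.
have [V [a [f [Vq H]]]] := svalP (rs_sharp h U s : spec_sec _) q Uq.
have [e [ne eV]] := @spec_nbhd C (opensI (opens_preimage (rs_cts h) U) V) q (conj Uq Vq).
exists a, f, e; split=> // q' /eV[Uq' Vq']; exists Uq'; have [nf E] := H q' Uq' Vq'; split=> //.
by rewrite /ev stalk_map_germ' stalk_val_germ E locmap_frac.
Qed.

End Evaluation.

Lemma mor_ext_spec (C : comPzRingType) (X : lrs) (h h' : mor (spec_lrs C) X) :
  (forall q, h q = h' q) -> (forall (q : spec C) (U : opens X) (Uq : U (h q)) (Uq' : U (h' q)) s,
    ev Uq s = ev Uq' s) -> h = h'.
Proof.
by move=> e H; apply: mor_ext => // q U Uq Uq' s; apply: stalk_val_inj; exact: (H q U Uq Uq' s).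
Qed.

Lemma mk_mor_spec (C : comPzRingType) (X : lrs) (h : spec C -> X)
    (th : forall q, {rmorphism stalk (h q) -> localization q}) :
  (forall q a, isunit (th q a) -> isunit a) ->
  (forall q (U : opens X) (Uq : U (h q)) s, exists a f e, ~ q e /\ forall q' : spec C, ~ q' e ->
    exists Uq' : U (h q'), ~ q' f /\ th q' (germ Uq' s) * locmap q' f = locmap q' a) ->
  exists g : mor (spec_lrs C) X, (forall q, g q = h q) /\
    forall q (U : opens X) (Uq : U (g q)) (Uq' : U (h q)) s, ev Uq s = th q (germ Uq' s).
Proof.
move=> lh H.
have ex q := bij_ex (@stalk_val_inj C q) (@stalk_val_surj C q).
pose k q := projT1 (cid (ex q)).
have kK q : cancel (k q) (@stalk_val C q) by rewrite /k; case: cid => g [].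
have [||g [gE gth]] := @mk_mor (spec_lrs C) X h (fun q => k q \o th q).
- move=> q a [v e]; apply: (lh q a); exists (stalk_val _ v).
  by rewrite -[th q a](kK q) -rmorphM e rmorph1.
- move=> q U Uq s; have [a [f [e [ne E]]]] := H q U Uq s.
  have tP : @locally_fraction C (opensI (basic_open e) (basic_open f)) (fun r nr => @frac C r a f nr.2).
    move=> r nr; exists (opensI (basic_open e) (basic_open f)), a, f.
    by split=> // r' nr' _; exists nr'.2.
  exists (opensI (basic_open e) (basic_open f)), (exist _ _ tP); split.
    by split=> //; have [Uq1 [nf1 e1]] := E q ne.
  move=> q' nq'; have [Uq' [nf e']] := E q' nq'.1; exists Uq' => /=.
  apply: stalk_val_inj; rewrite kK (frac_unique nf e').
  by rewrite stalk_val_germ /=; apply: frac_eqW.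
exists g; split=> // q U Uq Uq' s; rewrite /ev (gth q U Uq Uq' s) /=.
exact: kK.
Qed.

Lemma mor_compA (W X Y Z : lrs) (f : mor Y Z) (g : mor X Y) (h : mor W X) :
  mor_comp f (mor_comp g h) = mor_comp (mor_comp f g) h.
Proof.
apply: mor_ext => // t U Ut Ut' s.
rewrite (germ_irr Ut' Ut).
rewrite [LHS](@stalk_map_comp _ _ _ f (mor_comp g h) _ _) [RHS](@stalk_map_comp _ _ _ (mor_comp f g) h _ _).
by rewrite (@stalk_map_comp _ _ _ f g _ _) (@stalk_map_comp _ _ _ g h _ _).
Qed.

Lemma mor_comp1 (X Y : lrs) (f : mor X Y) : mor_comp f (mor_id X) = f.
Proof.
apply: mor_ext => // t U Ut Ut' s; rewrite [LHS](@stalk_map_comp _ _ _ f (mor_id X) _ _) (germ_irr Ut' Ut).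
elim/germ_ind: (stalk_map f t _) => V Vt r; rewrite (@stalk_map_germ _ _ (rs_id X) t V Vt r).
exact: germ_res.
Qed.

Lemma mor_1comp (X Y : lrs) (f : mor X Y) : mor_comp (mor_id Y) f = f.
Proof.
apply: mor_ext => // t U Ut Ut' s; rewrite [LHS](@stalk_map_comp _ _ _ (mor_id Y) f _ _) (germ_irr Ut' Ut).
congr (stalk_map f t _).
by rewrite (@stalk_map_germ _ _ (rs_id Y) (f t) U Ut s); exact: germ_res.
Qed.

Section SpecMapEval.
Context (B C : comPzRingType) (phi : {rmorphism B -> C}).

Lemma stalk_val_spec (q : spec_rs C) (z : stalk (spec_fun phi q)) :
  stalk_val _ (stalk_map (spec_map phi) q z) = localization_map phi q (stalk_val _ z).
Proof. by elim/germ_ind: z => U Uq s; rewrite stalk_map_germ' !stalk_val_germ. Qed.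

Lemma ev_spec (X : lrs) (h : mor (spec_lrs B) X) (q : spec C) (U : opens X)
    (Uq : U (h (spec_preimage phi q))) s :
  @ev C X (mor_comp h (spec_map phi)) q U Uq s = localization_map phi q (ev Uq s).
Proof. by rewrite /ev [stalk_map (mor_comp _ _) _ _](@stalk_map_comp _ _ _ h (spec_map phi) _ _) stalk_val_spec. Qed.

Lemma ev_spec_unit (q : spec C) z : isunit (localization_map phi q z) -> isunit z.
Proof.
elim/frac_ind: z => a f nf; rewrite localization_map_frac => u.
apply: (localization_is_local (spec_preimage phi q)).2 => /localization_maxE ma.
have [h _] := localization_is_local q; apply: h; apply: ideal_unit u _.
exact/localization_maxE.
Qed.

End SpecMapEval.

Lemma localization_map_comp (A B C : comPzRingType) (phi : {rmorphism A -> B}) (psi : {rmorphism B -> C})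
    (chi : {rmorphism A -> C}) (q : spec C) (e : forall a, chi a = psi (phi a)) a f nf nf' :
  localization_map psi q (localization_map phi (spec_preimage psi q) (@frac A _ a f nf)) =
  localization_map chi q (@frac A _ a f nf').
Proof. by rewrite !localization_map_frac; apply: frac_eqW; rewrite !e. Qed.

Lemma spec_map_comp (A B C : comPzRingType) (phi : {rmorphism A -> B}) (psi : {rmorphism B -> C}) :
  mor_comp (spec_map phi) (spec_map psi) = spec_map (psi \o phi).
Proof.
have e q : spec_preimage phi (spec_preimage psi q) = spec_preimage (psi \o phi) q by exact: spec_ext.
apply: mor_ext_spec => // q U Uq Uq' s; rewrite ev_spec {1}/ev stalk_map_germ' stalk_val_germ.
rewrite /ev stalk_map_germ' stalk_val_germ.
have [V [a [f [Vq H]]]] := svalP (s : spec_sec U) _ Uq'.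
have Vq' : V (spec_preimage phi (spec_preimage psi q)) by rewrite e.
have [nf E] := H _ Uq Vq'; have [nf' E'] := H _ Uq' Vq.
transitivity (localization_map psi q (localization_map phi (spec_preimage psi q)
  (@frac A (spec_preimage phi (spec_preimage psi q)) a f nf))).
  exact: (congr1 (fun z => localization_map psi q (localization_map phi (spec_preimage psi q) z)) E).
rewrite (@localization_map_comp A B C phi psi (psi \o phi) q (fun=> erefl) a f nf nf').
exact: (congr1 (localization_map (psi \o phi) q) (esym E')).
Qed.

Section LocPrimes.
Context (A L : comPzRingType) (M : A -> Prop) (psi : {rmorphism A -> L}).
Hypotheses (MM : mset M) (lM : is_loc M psi).

Lemma loc_prime (p : spec A) : (forall u, M u -> ~ p u) ->
  exists q : spec L, forall a, q (psi a) <-> p a.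
Proof.
move=> Mp; have [lu ls lk] := lM.
have [|x y [u [nu ->]] [v [nv ->]]|x [u [nu ->]] /ext_idealE[J [a [b [pa e]]]]|q [Eq qM]] :=
    @krull L (ext_ideal psi p) (fun x => exists u, ~ p u /\ x = psi u).
- by exists 1; rewrite rmorph1; split=> //; exact: prime_one.
- by exists (u * v); rewrite rmorphM; split=> //; exact: prime_mul.
- have [w [c [Mw bE]]] := loc_common b MM lM.
  have [t [Mt]] : exists t, M t /\ t * (u * w - \sum_j a j * c j) = 0.
    apply: lk; rewrite rmorphB rmorphM e mulr_suml rmorph_sum -sumrB big1 // => j _.
    by rewrite rmorphM -bE; ring.
  move=> /eqP; rewrite mulrBr subr_eq0 => /eqP e'.
  apply: (prime_mul (Mp _ Mt) (prime_mul nu (Mp _ Mw))); rewrite e'.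
  by apply: idealMl; apply: ideal_sum => j _; apply: idealMr.
- exists q => a; split=> [qa|pa]; last by apply: Eq; exact: ext_ideal_gen.
  by apply: contrapT => na; apply: (qM (psi a)) => //; exists a.
Qed.

Lemma loc_num (q : spec L) z a u : M u -> z * psi u = psi a -> q z <-> q (psi a).
Proof.
move=> Mu e; rewrite -e; split=> [|/(spec_prime q).2[//|qu]]; first exact: idealMr.
by case: (@prime_one _ q); have [lu _ _] := lM; exact: ideal_unit (lu _ Mu) qu.
Qed.

Lemma loc_prime_inj (q q' : spec L) : (forall a, q (psi a) <-> q' (psi a)) -> q = q'.
Proof.
move=> h; apply: spec_ext => z; have [_ ls _] := lM; have [a [u [Mu e]]] := ls z.
by rewrite (loc_num _ Mu e) h -(loc_num _ Mu e).
Qed.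

Lemma loc_stalk_bij (q : spec L) : injective (localization_map psi q) /\
  forall z, exists x, localization_map psi q x = z.
Proof.
have [lu ls lk] := lM; split=> [x y e|z].
  apply/eqP; rewrite -subr_eq0; apply/eqP; move/eqP: e; rewrite -subr_eq0 -rmorphB => /eqP.
  elim/frac_ind: (x - y) => a f nf {x y}; rewrite localization_map_frac.
  rewrite -(frac0 (@prime_one _ q)) => /frac_eq[w [nw]]; rewrite mulr1 mul0r mulr0 => e.
  have [w' [u [Mu e']]] := ls w.
  have [t [Mt te]] : exists t, M t /\ t * (w' * a) = 0.
    by apply: lk; rewrite rmorphM -e' mulrAC e mul0r.
  rewrite -(frac0 nf); apply/frac_eq; exists (t * w'); split.
    move=> h; apply: nw; apply/(loc_num _ Mu e'); move: h; rewrite /= rmorphM.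
    case/(spec_prime q).2 => // qt; case: (@prime_one _ q); exact: ideal_unit (lu _ Mt) qt.
  by rewrite mul0r mulr0 mulrA -(mulrA t) te mul0r.
elim/frac_ind: z => c d nd.
have [u [b [Mu bE]]] := loc_common (fun k : bool => if k then c else d) MM lM.
have nb : ~ q (psi (b false)) by move=> /(loc_num q Mu (bE false)).2.
exists (@frac A (spec_preimage psi q) (b true) (b false) nb).
rewrite localization_map_frac; apply: frac_eqW.
by rewrite -(bE false) -(bE true); ring.
Qed.

Lemma spec_map_loc_inj : injective (spec_map psi).
Proof.
move=> q q' e; apply: loc_prime_inj => a.
by have := congr1 (fun p : spec A => p a) e => /= ->.
Qed.

End LocPrimes.

Lemma bij_of (S T : Type) (f : S -> T) : injective f -> (forall y, exists x, f x = y) -> bijective f.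
Proof. by move=> fi /choice[k kK]; exists k => // x; apply: fi; rewrite kK. Qed.

Lemma spec_map_stalk_bij (A B : comPzRingType) (psi : {rmorphism A -> B}) (q : spec B) :
  bijective (localization_map psi q) <-> bijective (stalk_map (spec_map psi) q).
Proof.
have sv z := @stalk_val_spec _ _ psi q z; split=> -[k kK kK'].
- apply: bij_of => [x y e|y].
    by apply: stalk_val_inj; apply: (can_inj kK); rewrite -!sv e.
  have [x xE] := stalk_val_surj (k (stalk_val _ y)); exists x; apply: stalk_val_inj.
  by rewrite sv xE kK'.
- apply: bij_of => [x y|y].
    have [x' <-] := stalk_val_surj x; have [y' <-] := stalk_val_surj y.
    by rewrite -!sv => /stalk_val_inj/(can_inj kK) ->.
  have [y' <-] := stalk_val_surj y; exists (stalk_val _ (k y')).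
  by rewrite -sv kK'.
Qed.

Lemma oi_comp (X Y Z : lrs) (f : mor Y Z) (g : mor X Y) :
  open_immersion f -> open_immersion g -> open_immersion (mor_comp f g).
Proof.
move=> of' og; have [fi fo _] := of'; have [gi go _] := og; apply: oi_criterion.
- by move=> x y /fi/gi.
- move=> U /go/fo; congr open; apply/seteqP; split=> z.
  + by move=> [_ [x Ux <-] <-]; exists x.
  + by move=> [x Ux <-]; exists (g x) => //; exists x.
- move=> t; apply: (eq_bij (bij_comp (oi_stalk og t) (oi_stalk of' (g t)))) => a.
  exact: (esym (@stalk_map_comp _ _ _ f g t a)).
Qed.

(** * Affine charts *)

Section Charts.
Context (B : comPzRingType) (X : lrs) (j : mor (spec_lrs B) X) (oj : open_immersion j).

Definition rangeo : opens X := Opens (let: And3 _ h _ := oj in h _ (@openT (spec B))).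

Lemma range_rangeo p : rangeo (j p). Proof. by exists p. Qed.

Lemma chart_sec_ex b : exists S : sec X rangeo, forall p (Up : rangeo (j p)), ev Up S = locmap p b.
Proof.
have [ji _ jb] := oj; have [k _ kK] := jb rangeo (fun x h => h).
have tP : @locally_fraction B (opens_preimage (rs_cts j) rangeo) (fun r _ => @frac B r b 1 (@prime_one _ r)).
  by move=> r Ur; exists (opensT _), b, 1; split=> // r' Ur' _; exists (@prime_one _ r').
exists (k (exist _ _ tP)) => p Up.
by rewrite /ev stalk_map_germ' kK stalk_val_germ /= locmapE.
Qed.

Definition chart_sec b := projT1 (cid (chart_sec_ex b)).
Lemma chart_secE b p (Up : rangeo (j p)) : ev Up (chart_sec b) = locmap p b.
Proof. by rewrite /chart_sec; case: cid. Qed.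

Lemma ev_inj p (U : opens X) (Up : U (j p)) s t : ev Up s = ev Up t -> germ Up s = germ Up t.
Proof. by move=> /stalk_val_inj; apply: (bij_inj (oi_stalk oj p)). Qed.

Lemma chart_mono (C : comPzRingType) (f g : {rmorphism B -> C}) :
  mor_comp j (spec_map f) = mor_comp j (spec_map g) -> f = g.
Proof.
move=> e; apply: rmorph_ext => b; apply: locmap_inj => q.
have h (f' : {rmorphism B -> C}) : forall Uq : rangeo (mor_comp j (spec_map f') q),
    @ev C X (mor_comp j (spec_map f')) q _ Uq (chart_sec b) = locmap q (f' b).
  by move=> Uq; rewrite ev_spec chart_secE localization_map_locmap.
have Uq : rangeo (mor_comp j (spec_map f) q) by exact: range_rangeo.
rewrite -(h f Uq); move: Uq; rewrite e => Uq; exact: h.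
Qed.

(** An element [b] of the chart ring is a section on the range of [j]; its pullback to Spec C is an
    element of [C] by [frac_glue] with denominator 1, and this is the image of [b]. *)
Lemma chart_factor (C : comPzRingType) (h : mor (spec_lrs C) X) :
  (forall q, rangeo (h q)) -> exists f : {rmorphism B -> C}, h = mor_comp j (spec_map f).
Proof.
move=> Uh; have [ji _ jb] := oj.
have ex b : exists c : C, forall q, @ev C X h q _ (Uh q) (chart_sec b) = locmap q c.
  have [|n [c cE]] := @frac_glue C 1 (fun q => @ev C X h q _ (Uh q) (chart_sec b)).
    move=> q _; have [a [f [e [ne H]]]] := ev_frac (Uh q) (chart_sec b).
    exists a, f, e; split=> // q' /H[Uq' [nf E]]; split=> //.
    by rewrite (ev_irr (Uh q') Uq').
  exists c => q; rewrite -cE; last exact: prime_one.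
  by rewrite expr1n rmorph1 mulr1.
have /choice[f fE] := ex.
have fz : zmod_morphism f.
  move=> b b'; apply: locmap_inj => q; rewrite -fE rmorphB -!fE -evB.
  rewrite /ev; congr (stalk_val _ (stalk_map h q _)).
  have [p _ pE] := Uh q; move: (Uh q); rewrite -pE => Up.
  by apply: ev_inj; rewrite evB !chart_secE rmorphB.
have fm : monoid_morphism f.
  split=> [|b b']; apply: locmap_inj => q; rewrite -fE ?rmorph1 ?rmorphM -?fE -?evM -?(ev1 (Uh q));
    rewrite /ev; congr (stalk_val _ (stalk_map h q _));
    have [p _ pE] := Uh q; move: (Uh q); rewrite -pE => Up;
    by apply: ev_inj; rewrite ?evM ?ev1 !chart_secE ?rmorphM ?rmorph1.
pose phi := mk_rmorph fz fm; exists phi.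
(* An element lies outside a prime exactly when its value there is a unit, and stalk maps preserve
   and reflect units; so [h q] corresponds to the preimage of [q]. *)
have jE q : h q = mor_comp j (spec_map phi) q.
  have [p _ pE] := Uh q; rewrite -pE; congr (j _); apply: spec_ext => b.
  have u1 : isunit (locmap p b) <-> ~ p b.
    split=> [u pb|]; last exact: locmap_unit.
    have [k _] := localization_is_local p; apply: k; apply: ideal_unit u _.
    exact/localization_max_locmap.
  have u2 : isunit (locmap q (f b)) <-> ~ q (f b).
    split=> [u pb|]; last exact: locmap_unit.
    have [k _] := localization_is_local q; apply: k; apply: ideal_unit u _.
    exact/localization_max_locmap.
  suff e : isunit (locmap p b) <-> isunit (locmap q (f b)).
    by split=> h1; apply: contrapT => h2; [apply/(u1.1 _ h1)/e/u2|apply/(u2.1 _ h1)/e/u1].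
  rewrite -fE; split=> [u|/ev_unit u].
    rewrite /ev; do 2 apply: isunit_rmorph; move: (Uh q); rewrite -pE => Up.
    by apply: (@ev_unit _ _ j p); move: u; rewrite -(chart_secE b Up).
  move: (Uh q) u; rewrite -pE => Up u; rewrite -(chart_secE b Up) /ev.
  by do 2 apply: isunit_rmorph.
apply: mor_ext_spec => // q U Uq Uq' s.
rewrite ev_spec.
have [a [d [nd E]]] : exists a d (nd : ~ spec_preimage phi q d),
    ev (Uq' : U (j (spec_preimage phi q))) s = frac a nd.
  elim/frac_ind: (ev _ _) => a d nd; by exists a, d, nd.
rewrite E localization_map_frac; apply: frac_unique => /=.
rewrite -!fE.
have Vq : opensI U rangeo (h q) by split=> //; exact: Uh.
rewrite -(ev_res (@opensI_l _ U rangeo) Uq Vq) -!(ev_res (@opensI_r _ U rangeo) (Uh q) Vq).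
rewrite -evM /ev; congr (stalk_val _ (stalk_map h q _)).
move: Vq; rewrite (jE q) => Vp.
have E1 : @ev B X j (spec_preimage phi q) _ Vp (res (@opensI_l _ U rangeo) s) = frac a nd.
  by rewrite -E; exact: ev_res.
have E2 b : @ev B X j (spec_preimage phi q) _ Vp (res (@opensI_r _ U rangeo) (chart_sec b)) = locmap _ b.
  by rewrite -(chart_secE b (range_rangeo (spec_preimage phi q))); exact: ev_res.
by apply: (@ev_inj (spec_preimage phi q)); rewrite evM E1 !E2 locmap_frac.
Qed.

Lemma chart_basic (L : comPzRingType) (g : B) (psi : {rmorphism B -> L}) :
  is_loc (fun u => exists n, u = g ^+ n) psi -> open_immersion (mor_comp j (spec_map psi)) /\
  forall p : spec B, ~ p g -> range (mor_comp j (spec_map psi)) (j p).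
Proof.
move=> lM; have MM : mset (fun u => exists n, u = g ^+ n).
  by split=> [|_ _ [n ->] [m ->]]; [exists 0%N|exists (n + m)%N; rewrite exprD].
have [lu ls lk] := lM.
have ex (p : spec B) : ~ p g -> exists q, spec_map psi q = p.
  move=> ng; have [|q qE] := loc_prime MM lM (p := p); first by move=> _ [n ->]; exact: primeXn.
  by exists q; apply: spec_ext.
split=> [|p /ex[q <-]]; last by exists q.
apply: oi_comp => //; apply: oi_criterion.
- exact: spec_map_loc_inj lM.
- move=> U oU; apply: open_local => _ [q Uq <-].
  have [e [ne eU]] := @spec_nbhd L (Opens oU) q Uq.
  have [a [u [[n uE] E]]] := ls e.
  have na : ~ q (psi a) by move=> /(loc_num lM q (ex_intro _ n uE) E).
  have ng : ~ q (psi g).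
    move=> qg; apply: (@prime_one _ q); apply: ideal_unit qg.
    by apply: lu; exists 1%N; rewrite expr1.
  exists (basic_open (a * g)); split=> /=.
    by rewrite rmorphM => /(spec_prime q).2[].
  move=> p np; have [|q' q'E] := ex p; first by move=> pg; apply/np/idealMl.
  subst p; exists q' => //; apply: eU => /(loc_num lM q' (ex_intro _ n uE) E) h.
  by apply: np; rewrite /= rmorphM; exact: idealMr.
- move=> q; apply/spec_map_stalk_bij; have [h1 h2] := loc_stalk_bij MM lM q.
  exact: bij_of.
Qed.

End Charts.

Lemma mloc_pow (B : comPzRingType) (g : B) :
  exists (L : comPzRingType) (psi : {rmorphism B -> L}), is_loc (fun u => exists n, u = g ^+ n) psi.
Proof.
apply: mloc_exists; first by exists 0%N.
by move=> _ _ [n ->] [m ->]; exists (n + m)%N; rewrite exprD.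
Qed.

Lemma small_chart (X : scheme) (x : X) (N : opens X) : N x ->
  exists (B : comPzRingType) (j : mor (spec_lrs B) X) (oj : open_immersion j),
    rangeo oj x /\ rangeo oj `<=` N.
Proof.
move=> Nx; have [B [j [oj [p _ pE]]]] := scheme_affine x; subst x.
have [e [ne eN]] := @spec_nbhd B (opens_preimage (rs_cts j) N) p Nx.
have [L [psi lpsi]] := mloc_pow e; have [oj' rj] := chart_basic oj lpsi.
exists L, (mor_comp j (spec_map psi)), oj'; split; first exact: rj.
move=> _ [q _ <-]; apply: eN => qe; apply: (@prime_one _ q).
by have [lu _ _] := lpsi; apply: (@ideal_unit _ q (psi e) _ qe); apply: lu; exists 1%N; rewrite expr1.
Qed.

Lemma compatible_charts (X Y : scheme) (f : mor X Y) (x : X) :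
  exists (R B : comPzRingType) (phi : {rmorphism R -> B}) (jY : mor (spec_lrs R) Y)
    (jX : mor (spec_lrs B) X) (oY : open_immersion jY) (oX : open_immersion jX),
    rangeo oX x /\ mor_comp f jX = mor_comp jY (spec_map phi).
Proof.
have [R [jY [oY rY]]] := scheme_affine (f x).
have [B [jX [oX [Xx XN]]]] := @small_chart X x (opens_preimage (rs_cts f) (rangeo oY)) rY.
have Uf q : rangeo oY (mor_comp f jX q) by apply: XN; exact: range_rangeo.
have [phi e] := chart_factor Uf.
by exists R, B, phi, jY, jX, oY, oX.
Qed.

(** * Flatness on charts *)

Section FlatTransport.

Lemma aflat_iso (A B A' B' : comPzRingType) (f : {rmorphism A -> B}) (f' : {rmorphism A' -> B'})
    (g : {rmorphism A -> A'}) (h : {rmorphism B -> B'}) :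
  bijective g -> bijective h -> (forall a, h (f a) = f' (g a)) -> aflat f <-> aflat f'.
Proof.
move=> [g' gK g'K] [h' hK h'K] e; split=> /aflatE fl; apply/aflatE => I a b rel.
- have [|J [c [b' [bE cE]]]] := fl I (g' \o a) (h' \o b).
    apply: (can_inj hK); rewrite rmorph0 -[RHS]rel rmorph_sum; apply: eq_bigr => i _.
    by rewrite rmorphM e /= g'K h'K.
  exists J, (fun i k => g (c i k)), (h \o b'); split=> [i|k].
    rewrite -[b i]h'K -[h' (b i)]/((h' \o b) i) bE rmorph_sum; apply: eq_bigr => k _.
    by rewrite rmorphM e.
  have := congr1 g (cE k); rewrite rmorph0 => r0; rewrite -[RHS]r0 rmorph_sum; apply: eq_bigr => i _.
  by rewrite rmorphM /= g'K.
- have [|J [c [b' [bE cE]]]] := fl I (g \o a) (h \o b).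
    have := congr1 h rel; rewrite rmorph0 => r0; rewrite -[RHS]r0 rmorph_sum; apply: eq_bigr => i _.
    by rewrite rmorphM e.
  exists J, (fun i k => g' (c i k)), (h' \o b'); split=> [i|k].
    apply: (can_inj hK); rewrite -[h (b i)]/((h \o b) i) bE rmorph_sum; apply: eq_bigr => k _.
    by rewrite rmorphM e /= g'K h'K.
  apply: (can_inj gK); rewrite rmorph0 -[RHS](cE k) rmorph_sum; apply: eq_bigr => i _.
  by rewrite rmorphM /= g'K.
Qed.

Lemma chart_flat (X Y : lrs) (f : mor X Y) (R B : comPzRingType) (phi : {rmorphism R -> B})
    (jY : mor (spec_lrs R) Y) (jX : mor (spec_lrs B) X) q :
  open_immersion jY -> open_immersion jX -> mor_comp f jX = mor_comp jY (spec_map phi) ->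
  aflat (stalk_map f (jX q)) <-> aflat (localization_map phi q).
Proof.
move=> oY oX e.
transitivity (aflat (stalk_map (mor_comp f jX) q)).
  apply: (@aflat_iso _ _ _ _ _ _ idfun (stalk_map jX q)); first by exists idfun.
  - exact: oi_stalk.
  - by move=> a; exact: (esym (@stalk_map_comp _ _ _ f jX q a)).
rewrite e; transitivity (aflat (stalk_map (spec_map phi) q)).
  apply: (@aflat_iso _ _ _ _ _ _ (stalk_map jY (spec_map phi q)) idfun).
  - exact: oi_stalk.
  - by exists idfun.
  - by move=> a; exact: (@stalk_map_comp _ _ _ jY (spec_map phi) q a).
apply: (@aflat_iso _ _ _ _ _ _ (stalk_val _) (stalk_val _)); try exact: stalk_val_bij.
by move=> a; exact: stalk_val_spec.
Qed.

(* Local form of the equational criterion at a prime. *)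
Definition flat_at (A B : comPzRingType) (phi : {rmorphism A -> B}) (q : spec B) :=
  forall (I : finType) (a : I -> A) (b : I -> B), \sum_i phi (a i) * b i = 0 ->
  exists u (J : finType) (c : I -> J -> A) (b' : J -> B), [/\ ~ q u,
    forall i, u * b i = \sum_j phi (c i j) * b' j & forall j, \sum_i a i * c i j = 0].

(** The elements [u] such that the multiples u b_i are trivialised form an ideal, to which
    [ideal_one] applies. *)
Lemma flat_at_local (A B : comPzRingType) (phi : {rmorphism A -> B}) :
  (forall q, flat_at phi q) -> aflat phi.
Proof.
move=> fl; apply/aflatE => I a b rel.
pose S u := exists (J : finType) (c : I -> J -> A) (b' : J -> B),
  (forall i, u * b i = \sum_j phi (c i j) * b' j) /\ forall j, \sum_i a i * c i j = 0.
have S0 : S 0.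
  exists void, (fun _ _ => 0), (fun _ => 0); split=> [i|[]].
  by rewrite mul0r big1 // => -[].
have SD x y : S x -> S y -> S (x + y).
  move=> [J [c [b' [bE cE]]]] [K [d [e [eE dE]]]].
  exists (J + K)%type, (fun i k => match k with inl k => c i k | inr k => d i k end),
    (fun k => match k with inl k => b' k | inr k => e k end).
  by split=> [i|[k|k]//]; rewrite mulrDl bE eE big_sumT.
have SM v x : S x -> S (v * x).
  move=> [J [c [b' [bE cE]]]]; exists J, c, (fun j => v * b' j); split=> // i.
  by rewrite -mulrA bE mulr_sumr; apply: eq_bigr => j _; rewrite mulrCA.
have [J [c [b' [bE cE]]]] : Ideal S0 SD SM 1.
  apply: ideal_one => q Sq; have [u [J [c [b' [nu bE cE]]]]] := fl q I a b rel.
  by apply/nu/Sq; exists J, c, b'.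
by exists J, c, b'; split=> // i; rewrite -bE mul1r.
Qed.

Lemma flat_atP (A B : comPzRingType) (phi : {rmorphism A -> B}) q :
  aflat (localization_map phi q) <-> flat_at phi q.
Proof.
pose p := spec_preimage phi q.
split=> [fl I a b rel|fl].
  have /aflatE/(_ I a (fun i => locmap q (b i)))[|J [c [b' [bE cE]]]] :
      aflat (localization_map phi q \o locmap p : {rmorphism _ -> _}).
    apply: (aflat_comp (phi := locmap p) (psi := localization_map phi q)) => //.
    exact: aflat_loc (mset_prime p) (locmap_loc p).
    have := congr1 (locmap q) rel; rewrite rmorph0 => r0; rewrite -[RHS]r0 rmorph_sum; apply: eq_bigr => i _.
    by rewrite /= localization_map_locmap rmorphM.
  have [u [d [nu dE]]] := loc_common b' (mset_prime q) (locmap_loc q).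
  have E i : exists v, ~ q v /\ v * (u * b i - \sum_j phi (c i j) * d j) = 0.
    apply: locmap_eq0; rewrite rmorphB rmorphM bE mulr_sumr rmorph_sum -sumrB big1 // => j _.
    by rewrite /= localization_map_locmap rmorphM -dE; ring.
  have /choice[v vP] := E.
  exists (u * \prod_i v i), J, c, (fun j => (\prod_i v i) * d j); split=> // [|i].
    apply: prime_mul => //; apply: (mset_prod (M := fun u => ~ q u)); first exact: mset_prime.
    by move=> i; have [] := vP i.
  have [_ /eqP] := vP i; rewrite mulrBr subr_eq0 => /eqP vE.
  rewrite (bigD1 i) //=; set w := \prod_(_ | _) _.
  transitivity (w * (v i * (u * b i))); first by ring.
  rewrite vE !mulr_sumr; apply: eq_bigr => j _; ring.
apply: (aflat_descend (f := locmap p) (phi := locmap q \o phi) (M := fun u => ~ p u)).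
- by move=> a; rewrite localization_map_locmap.
- exact: mset_prime.
- exact: locmap_loc.
apply/aflatE => I a z rel.
have [u [b [nu bE]]] := loc_common z (mset_prime q) (locmap_loc q).
have [v [nv vE]] : exists v, ~ q v /\ v * \sum_i phi (a i) * b i = 0.
  apply: locmap_eq0; rewrite rmorph_sum -[RHS](mul0r (locmap q u)) -[X in _ = X * _]rel mulr_suml.
  by apply: eq_bigr => i _; rewrite rmorphM -bE /=; ring.
have [|w [J [c [b' [nw b'E cE]]]]] := fl I a (fun i => v * b i).
  by rewrite -[RHS]vE mulr_sumr; apply: eq_bigr => i _; rewrite mulrCA.
have [t tE] := locmap_unit (prime_mul nw (prime_mul nv nu)).
exists J, c, (fun j => locmap q (b' j) * t); split=> // i.
transitivity (locmap q (w * (v * b i)) * t).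
  by rewrite rmorphM rmorphM -bE -[LHS]mulr1 -tE !rmorphM; ring.
rewrite b'E rmorph_sum mulr_suml; apply: eq_bigr => j _.
by rewrite rmorphM /= mulrA.
Qed.

End FlatTransport.

(** * The lifting property implies flatness *)

Lemma quot_prime (A : comPzRingType) (K : ideal A) (p : spec A) : K `<=` p ->
  exists t : spec (quotient_ring K), forall x, t (quotient_proj K x) <-> p x.
Proof.
move=> Kp; pose S z := exists x, z = quotient_proj K x /\ p x.
have SE x : S (quotient_proj K x) <-> p x.
  split=> [[y [e py]]|px]; last by exists x.
  by apply: (idealBD (y := y)) => //; apply: Kp; apply/qproj_eq0; rewrite rmorphB e subrr.
have S0 : S 0 by exists 0; rewrite rmorph0; split=> //; exact: ideal0.
have SD x y : S x -> S y -> S (x + y).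
  by move=> [a [-> pa]] [b [-> pb]]; exists (a + b); rewrite rmorphD; split=> //; exact: idealD.
have SM a x : S x -> S (a * x).
  have [b ->] := qproj_surj a.
  by move=> [c [-> pc]]; exists (b * c); rewrite rmorphM; split=> //; exact: idealMl.
have Sp : prime_ideal (Ideal S0 SD SM).
  split=> [|a b]; first by rewrite /= -(rmorph1 (quotient_proj K)) => /SE; exact: prime_one.
  have [x ->] := qproj_surj a; have [y ->] := qproj_surj b.
  by rewrite /= -rmorphM => /SE/(spec_prime p).2[] h; [left|right]; exact/SE.
by exists (SpecPoint Sp) => x; exact: SE.
Qed.

Lemma spec_of_max (A : comPzRingType) (m : ideal A) : is_local m ->
  exists p : spec A, forall x, p x <-> m x.
Proof. by move=> /is_local_max/maxideal_prime mp; exists (SpecPoint mp). Qed.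

(* An open set containing the closed point of a local scheme is everything. *)
Lemma local_open (A : comPzRingType) (m : ideal A) (p : spec A) (V : opens (spec A)) :
  is_local m -> (forall x, p x <-> m x) -> V p -> forall q, V q.
Proof.
move=> lm pm Vp q; have [e [ne eV]] := spec_nbhd Vp; apply: eV => qe.
by apply: (@prime_one _ q); apply: ideal_unit qe; apply: lm.2 => /pm.
Qed.

Lemma gcst_inj (A : comNzRingType) (V : Type) : (V -> False) -> forall a, gcst A V a = 0 -> a = 0.
Proof.
move=> V0 a e; apply: (gc_contracted V0 (I := ideal_zero A)).
by rewrite e; exists void, (fun _ => 0), (fun _ => 0); split=> [[]|]; rewrite big1 // => -[].
Qed.

(** The good extension [gc B' void] of the chart ring, localized at a prime [n] over [q0], is a
    quotient Q / K of a good local ring [Q] that is flat over the base. The pair is henselian by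
    [good_henselian], and lifting gives [psi] from the chart ring to [Q]. A relation over the base
    is trivialised in [Q], and this is carried back to the chart ring near [q0]. *)
Lemma hlp_flat (X Y : scheme) (f : mor X Y) : henselian_lifting_property f -> flat f.
Proof.
move=> hlp x; apply/aflatP.
have [R0 [B0 [phi [jY [jX [oY [oX [[q0 _ <-] e]]]]]]]] := compatible_charts f x.
apply/(chart_flat q0 oY oX e)/flat_atP => I r b rel.
have B1 : (1 : B0) <> 0 by move=> h; apply: (@prime_one _ q0); rewrite h; exact: ideal0.
have R1 : (1 : R0) <> 0 by move=> h; apply: B1; rewrite -(rmorph1 phi) h rmorph0.
have [B' eB] := nz_ring B1; subst B0; have [R' eR] := nz_ring R1; subst R0.
pose V0 : void -> False := fun v => match v with end.
pose k := gcst B' void; have kint : intalg k by exact: gc_intalg.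
have [n [_ nE]] : exists n : spec (gc B' void), ideal_zero _ `<=` n /\ forall a, n (k a) <-> q0 a.
  by apply: lying_over => // a /(gcst_inj V0) ->; exact: ideal0.
(* A variable for each element of the good extension makes [pi] surjective, while its source is flat
   over the base. *)
have [pi [piR piV]] := @gc_lift R' (gc B' void) _ (k \o phi) idfun (@gc_good _ _).
have pis z : exists y, pi y = z by exists (gcl (@Var R' (gc B' void) z)); rewrite piV.
pose N := spec_preimage pi n; pose Q := localization N; pose rho := locmap N \o gcst R' (gc B' void).
have frho : aflat (rho : {rmorphism _ -> _}).
  apply: (aflat_comp (phi := gcst R' (gc B' void)) (psi := locmap N)) => //; first exact: gc_flat.
  exact: aflat_loc (mset_prime N) (locmap_loc N).
pose tau := localization_map pi n.
have taus z : exists y, z = tau y.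
  elim/frac_ind: z => a u nu; have [a' aE] := pis a; have [u' uE] := pis u.
  have nu' : ~ N u' by rewrite /= uE.
  exists (frac a' nu'); rewrite /tau localization_map_frac; apply: frac_eqW.
  by rewrite aE uE.
pose K := ideal_preimage tau (ideal_zero _).
have K1 : ~ K 1.
  suff : tau 1 <> 0 by []; rewrite rmorph1 => h.
  by apply: (@localization_max1 _ n); rewrite h; exact: ideal0.
have lN := localization_is_local N.
have gQ : good Q by exact: good_loc (mset_prime N) (locmap_loc N) (@gc_good _ _).
have hK := good_henselian gQ lN K1.
have [sg sgE] := surj_lift taus (f := quotient_proj K) (fun p tp => (qproj_eq0 K p).2 tp).
pose beta := sg \o (locmap n \o k).
have trho r' : tau (rho r') = locmap n (k (phi r')).
  by rewrite /tau -[rho r']/(locmap N (gcst R' (gc B' void) r')) localization_map_locmap piR.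
have betaR r' : beta (phi r') = quotient_proj K (rho r').
  by rewrite -sgE trho.
have [|c [[fc ci] _]] := hlp Q K hK (mor_comp jX (spec_map beta)) (mor_comp jY (spec_map rho)).
  rewrite mor_compA e -!mor_compA !spec_map_comp; congr (mor_comp jY (spec_map _)).
  by apply: rmorph_ext => r'; exact: betaR.
have [p pm] := spec_of_max lN.
have [t tE] : exists t : spec (quotient_ring K), forall x, t (quotient_proj K x) <-> p x.
  by apply: quot_prime => y Ky; apply/pm; exact: (is_local_sub lN K1).
(* The closed point of Spec Q goes to the same point as under the given map on Spec (Q / K), hence
   into the chart; the rest follows as [Q] is local. *)
have cr q : rangeo oX (c q).
  have := @local_open Q _ p (opens_preimage (rs_cts c) (rangeo oX)) lN pm; apply.
  have -> : p = spec_map (quotient_proj K) t by apply: spec_ext => y; rewrite -tE.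
  have h := congr1 (fun g : mor (spec_lrs (quotient_ring K)) X => g (t : spec_lrs (quotient_ring K))) ci.
  rewrite -[opens_set _ _]/(rangeo oX (mor_comp c (spec_map (quotient_proj K)) t)) h.
  exact: range_rangeo.
have [psi cE] := chart_factor cr.
have psibeta : (quotient_proj K \o psi : {rmorphism _ -> _}) = (beta : {rmorphism _ -> _}).
  by apply: (chart_mono oX); rewrite -spec_map_comp mor_compA -cE ci.
have psirho r' : psi (phi r') = rho r'.
  suff h : (psi \o phi : {rmorphism R' -> Q}) = (rho : {rmorphism R' -> Q}).
    exact: (congr1 (fun g : {rmorphism R' -> Q} => g r') h).
  by apply: (chart_mono oY); rewrite -fc cE -spec_map_comp !mor_compA e.
have taupsi b' : tau (psi b') = locmap n (k b').
  have [z zE] := taus (locmap n (k b')); rewrite zE.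
  apply/eqP; rewrite -subr_eq0 -rmorphB; apply/eqP.
  suff : K (psi b' - z) by [].
  apply/qproj_eq0; rewrite rmorphB.
  have -> : quotient_proj K (psi b') = beta b'.
    exact: (congr1 (fun g : {rmorphism B' -> quotient_ring K} => g b') psibeta).
  by rewrite /beta /= zE sgE subrr.
have /aflatE/(_ I r (psi \o b))[|J [d [y [yE dE]]]] := frho.
  have := congr1 psi rel; rewrite rmorph0 => r0; rewrite -[RHS]r0 rmorph_sum.
  by apply: eq_bigr => i _; rewrite rmorphM psirho.
(* [s] clears the denominators of the trivialisation in the local ring at [n], and the [v i] turn
   its equations into equations in the extension itself. *)
have [s [z [ns zE]]] := loc_common (fun j => tau (y j)) (mset_prime n) (locmap_loc n).
have /choice[v vP] i : exists v, ~ n v /\ v * (s * k (b i) - \sum_j k (phi (d i j)) * z j) = 0.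
  apply: locmap_eq0; rewrite rmorphB rmorphM -taupsi -[psi (b i)]/((psi \o b) i) yE !rmorph_sum.
  rewrite mulr_sumr -sumrB big1 // => j _.
  by rewrite !rmorphM trho -zE; ring.
pose w := \prod_i v i; pose S := w * s.
have nS : ~ n S.
  apply: prime_mul => //; apply: (mset_prod (M := fun u => ~ n u)); first exact: mset_prime.
  by move=> i; have [] := vP i.
have SE i : k (b i) * S = \sum_j k (phi (d i j)) * (w * z j).
  have [_ /eqP] := vP i; rewrite mulrBr subr_eq0 => /eqP vE.
  rewrite /S /w (bigD1 i) //=; set w' := \prod_(_ | _) _.
  transitivity (w' * (v i * (s * k (b i)))); first by ring.
  by rewrite vE !mulr_sumr; apply: eq_bigr => j _; ring.
have kf : aflat k by exact: gc_flat.
(* The equations form a homogeneous linear system over the chart ring, with the solution S, w z_j in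
   the flat extension. So this solution is a combination of solutions over the chart ring; as [S] is
   outside [n], one of those has its first coordinate outside [q0]. *)
have [|L [c' [m' [_ mE cE']]]] := @eqflat_multi B' (scalar_restriction k) _ kf I (enum I)
    ('I_1 + J)%type (fun i q => match q with inl _ => b i | inr j => - phi (d i j) end)
    (fun q => match q with inl _ => S | inr j => w * z j end) (fun _ => Logic.I).
  move=> i _; rewrite big_sumT big_ord1 /=.
  apply/eqP; rewrite addr_eq0 -sumrN; apply/eqP; rewrite -[LHS]/(k (b i) * S) SE.
  apply: eq_bigr => j _; rewrite -[X in _ = - X]/(k (- phi (d i j)) * (w * z j)).
  by rewrite rmorphN mulNr opprK.
have [l nl] : exists l, ~ q0 (c' (inl ord0) l).
  have SE' : S = \sum_l k (c' (inl ord0) l) * (m' l : gc B' void) := mE (inl ord0).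
  apply: contrapT => h; apply: nS; rewrite SE'; apply: ideal_sum => l _.
  by apply: idealMr; apply/nE; apply: contrapT => nl; apply: h; exists l.
exists (c' (inl ord0) l), J, d, (fun j => c' (inr j) l); split=> // i.
have := cE' i (mem_enum _ i) l; rewrite big_sumT big_ord1 /= => /eqP; rewrite addr_eq0 => /eqP.
rewrite mulrC => ->; rewrite -sumrN; apply: eq_bigr => j _.
by rewrite mulNr opprK.
Qed.

(** * Points of the fibre product *)

(* A point of the fibre product of f1 and f2 is a pair of points over the     *)
(* same point, together with a prime of the tensor product of their stalks    *)
(* lying over both maximal ideals.                                            *)
Section FiberPoints.
Context (X1 X2 Y : lrs) (f1 : mor X1 Y) (f2 : mor X2 Y).

(** Sections of [Y] stand for elements of its stalk, because [f1 x1] and [f2 x2] are different terms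
    and their stalks different types. *)
Definition fpRel (x1 : X1) (x2 : X2) (a1 : stalk x1) (a2 : stalk x2) : Prop :=
  exists (V : opens Y) (s : sec Y V) (h1 : V (f1 x1)) (h2 : V (f2 x2)),
    a1 = stalk_map f1 x1 (germ h1 s) /\ a2 = stalk_map f2 x2 (germ h2 s).

Definition fpK x1 x2 := po (@fpRel x1 x2).
Local Notation i1 x1 x2 := (po1 (@fpRel x1 x2)).
Local Notation i2 x1 x2 := (po2 (@fpRel x1 x2)).

Record fpt := FPt {
  p1 : X1; p2 : X2; peq : f1 p1 = f2 p2; pq : spec (fpK p1 p2);
  pl1 : forall a, ~ isunit a -> pq (i1 p1 p2 a);
  pl2 : forall a, ~ isunit a -> pq (i2 p1 p2 a) }.

HB.instance Definition _ := gen_eqMixin fpt.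
HB.instance Definition _ := gen_choiceMixin fpt.

(** Representatives of functions on the fibre product: finite sums of products of a section on an
    open set of [X1] and one on an open set of [X2]. *)
Definition ps : Type := {U : opens X1 * opens X2 & seq (sec X1 U.1 * sec X2 U.2)}.
Implicit Types (a b c : ps) (p : fpt).

Definition dom a p : Prop := (projT1 a).1 (p1 p) /\ (projT1 a).2 (p2 p).
Definition pval (x1 : X1) (x2 : X2) a (h : (projT1 a).1 x1 /\ (projT1 a).2 x2) : fpK x1 x2 :=
  \sum_(x <- projT2 a) i1 x1 x2 (germ h.1 x.1) * i2 x1 x2 (germ h.2 x.2).
Definition val a p : fpK (p1 p) (p2 p) := if pselect (dom a p) is left h then pval h else 0.

Lemma valE a p (h : dom a p) : val a p = pval h.
Proof. by rewrite /val; case: pselect => // h'; rewrite (Prop_irrelevance h h'). Qed.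

Definition psin (U1 : opens X1) (U2 : opens X2) s t : ps := existT _ (U1, U2) [:: (s, t)].

Lemma val_in (U1 : opens X1) (U2 : opens X2) s t p (h1 : U1 (p1 p)) (h2 : U2 (p2 p)) :
  val (psin s t) p = i1 _ _ (germ h1 s) * i2 _ _ (germ h2 t).
Proof.
rewrite (valE (conj h1 h2 : dom (psin s t) p)) /pval big_seq1.
by congr (i1 _ _ _ * i2 _ _ _); apply: germ_irr.
Qed.

Definition psc : ps := @psin (opensT _) (opensT _) 1 1.
Definition psN1 : ps := @psin (opensT _) (opensT _) (- 1) 1.

Lemma domc p : dom psc p. Proof. by []. Qed.
Lemma valc p : val psc p = 1.
Proof. by rewrite (val_in (1 : sec X1 (opensT _)) (1 : sec X2 (opensT _)) Logic.I Logic.I) !germ_one !rmorph1 mulr1. Qed.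
Lemma valN1 p : val psN1 p = - 1.
Proof.
rewrite (val_in (- 1 : sec X1 (opensT _)) (1 : sec X2 (opensT _)) Logic.I Logic.I) germ_one rmorph1 mulr1.
by rewrite -[- (1 : sec X1 _)]sub0r germB germ0 germ_one sub0r rmorphN rmorph1.
Qed.

Definition psl (U V : opens X1 * opens X2) (s : seq (sec X1 U.1 * sec X2 U.2)) :
    seq (sec X1 (opensI U.1 V.1) * sec X2 (opensI U.2 V.2)) :=
  [seq (res (@opensI_l _ U.1 V.1) x.1, res (@opensI_l _ U.2 V.2) x.2) | x <- s].
Definition psr (U V : opens X1 * opens X2) (s : seq (sec X1 V.1 * sec X2 V.2)) :
    seq (sec X1 (opensI U.1 V.1) * sec X2 (opensI U.2 V.2)) :=
  [seq (res (@opensI_r _ U.1 V.1) x.1, res (@opensI_r _ U.2 V.2) x.2) | x <- s].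

Definition psD a b : ps :=
  let U := projT1 a in let V := projT1 b in
  existT _ (opensI U.1 V.1, opensI U.2 V.2) (psl V (projT2 a) ++ psr U (projT2 b)).
Definition psM a b : ps :=
  let U := projT1 a in let V := projT1 b in
  existT _ (opensI U.1 V.1, opensI U.2 V.2)
    [seq (x.1 * y.1, x.2 * y.2) | x <- psl V (projT2 a), y <- psr U (projT2 b)].

Lemma domD a b p : dom (psD a b) p <-> dom a p /\ dom b p.
Proof. by split=> [[[? ?] [? ?]]|[[? ?] [? ?]]]. Qed.
Lemma domM a b p : dom (psM a b) p <-> dom a p /\ dom b p.
Proof. by split=> [[[? ?] [? ?]]|[[? ?] [? ?]]]. Qed.

Lemma valD a b p : dom a p -> dom b p -> val (psD a b) p = val a p + val b p.
Proof.
move=> ha hb; have hab : dom (psD a b) p by apply/domD.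
rewrite (valE ha) (valE hb) (valE hab) /pval big_cat !big_map /=; congr (_ + _); apply: eq_bigr => x _ /=.
  by rewrite (germ_res _ ha.1) (germ_res _ ha.2).
by rewrite (germ_res _ hb.1) (germ_res _ hb.2).
Qed.

Lemma valM a b p : dom a p -> dom b p -> val (psM a b) p = val a p * val b p.
Proof.
move=> ha hb; have hab : dom (psM a b) p by apply/domM.
rewrite (valE ha) (valE hb) (valE hab) /pval big_flatten big_map /= big_map mulr_suml.
apply: eq_bigr => x _; rewrite !big_map mulr_sumr; apply: eq_bigr => y _ /=.
rewrite -!germ_mul !rmorphM (germ_res _ ha.1) (germ_res _ ha.2) (germ_res _ hb.1) (germ_res _ hb.2).
by rewrite mulrACA.
Qed.

Lemma val_gen p (z : fpK (p1 p) (p2 p)) : exists a, dom a p /\ val a p = z.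
Proof.
elim/po_ind: z => [s|s|x y [a [ha <-]] [b [hb <-]]|x y [a [ha <-]] [b [hb <-]]].
- elim/germ_ind: s => U Ux s; exists (psin s (1 : sec X2 (opensT _))); split; first by split.
  by rewrite (@val_in U (opensT _) s 1 p Ux Logic.I) germ_one rmorph1 mulr1.
- elim/germ_ind: s => U Ux s; exists (psin (1 : sec X1 (opensT _)) s); split; first by split.
  by rewrite (@val_in (opensT _) U 1 s p Logic.I Ux) germ_one rmorph1 mul1r.
- by exists (psD a b); rewrite valD //; split=> //; apply/domD.
- by exists (psM a b); rewrite valM //; split=> //; apply/domM.
Qed.

(** The two primes live in rings that depend on the points, so they are compared through the values
    of the same [ps]. *)
Lemma fpt_ext p p' : p1 p = p1 p' -> p2 p = p2 p' ->
  (forall a, dom a p -> dom a p' -> pq p (val a p) <-> pq p' (val a p')) -> p = p'.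
Proof.
case: p p' => [x1 x2 e q l1 l2] [x1' x2' e' q' l1' l2'] /= e1 e2; subst x1' x2'.
rewrite (Prop_irrelevance e' e) => h {e'}.
pose p := FPt e l1 l2; pose p' := FPt e l1' l2'.
have qq : q = q'.
  apply: spec_ext => z; have [a [ha az]] := @val_gen p z.
  have := h a ha ha; rewrite (valE (ha : dom a p)) (valE (ha : dom a p')).
  by move: az; rewrite (valE ha) => ->.
by subst q'; rewrite (Prop_irrelevance l1 l1') (Prop_irrelevance l2 l2').
Qed.

(* An identity in the tensor product of the stalks at [p] persists nearby:    *)
(* that tensor product maps to the ring of germs at [p] of families of        *)
(* elements of the tensor products at the other points.                       *)
Section Spreading.
Context (p : fpt).

Definition near (P : fpt -> Prop) := exists (U1 : opens X1) (U2 : opens X2),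
  [/\ U1 (p1 p), U2 (p2 p) & forall p', U1 (p1 p') -> U2 (p2 p') -> P p'].

Lemma nearW (P : fpt -> Prop) : (forall p', P p') -> near P.
Proof. by move=> h; exists (opensT _), (opensT _); split. Qed.

Lemma near_and (P Q R : fpt -> Prop) : (forall p', P p' -> Q p' -> R p') -> near P -> near Q -> near R.
Proof.
move=> h [U1 [U2 [u1 u2 uP]]] [V1 [V2 [v1 v2 vQ]]]; exists (opensI U1 V1), (opensI U2 V2); split=> //.
by move=> p' [w1 w1'] [w2 w2']; apply: h; [exact: uP|exact: vQ].
Qed.

Definition fam := forall p', fpK (p1 p') (p2 p').

Definition fam_setoid : setoid_ring.
Proof.
refine (@SetoidRing fam (fun x y => near (fun p' => x p' = y p')) _ _ _
  (fun _ => 0) (fun _ => 1) (fun x p' => - x p') (fun x y p' => x p' + y p') (fun x y p' => x p' * y p')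
  _ _ _ _ _ _ _ _ _ _ _); try by move=> *; apply: nearW => p'; ring.
- by move=> x y h; apply: near_and h (nearW (fun _ => Logic.I)) => p' ->.
- by move=> x y z; apply: near_and => p' -> ->.
- by move=> x y h; apply: near_and h (nearW (fun _ => Logic.I)) => p' ->.
- by move=> x x' y y'; apply: near_and => p' -> ->.
- by move=> x x' y y'; apply: near_and => p' -> ->.
Defined.

Let cl (x : fam) : quo fam_setoid := @class fam_setoid x.

Lemma stalk_fam (X : lrs) (x : X) (r : fpt -> X) (K : forall p', {rmorphism stalk (r p') -> fpK (p1 p') (p2 p')}) :
  (forall U : opens X, U x -> near (fun p' => U (r p'))) ->
  exists g : {rmorphism stalk x -> quo fam_setoid}, forall (U : opens X) (Ux : U x) s (z : fam),
    (forall p' (Up : U (r p')), z p' = K p' (germ Up s)) -> g (germ Ux s) = cl z.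
Proof.
move=> rU; pose F (s : pregerm x) : fam := fun p' =>
  if pselect (pg_dom s (r p')) is left h then K p' (germ h (pg_sec s)) else 0.
have FE s p' (h : pg_dom s (r p')) : F s p' = K p' (germ h (pg_sec s)).
  by rewrite /F; case: pselect => // h'; rewrite (Prop_irrelevance h h').
have nd (s : pregerm x) : near (fun p' => pg_dom s (r p')) by exact: (rU _ (pg_mem s)).
have hc (s t : stalk_setoid x) : sr_eq s t -> cl (F s) = cl (F t).
  move=> [W [Ws [Wt [Wx e]]]]; apply/classP; apply: near_and (rU W Wx) (nearW (fun _ => Logic.I)) => p' Wp _.
  rewrite (FE _ _ (Ws _ Wp)) (FE _ _ (Wt _ Wp)) -(germ_res Ws (Ws _ Wp) Wp) e.
  by rewrite (germ_res Wt (Wt _ Wp)).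
have h1 : cl (F (sr_one (stalk_setoid x))) = 1.
  rewrite -class1; apply/classP; apply: nearW => p'.
  by rewrite (@FE (@PreGerm X x (opensT X) Logic.I 1) p' Logic.I) germ_one rmorph1.
have hN s : cl (F (@sr_opp (stalk_setoid x) s)) = - cl (F s).
  rewrite /cl -classN; apply/classP; apply: near_and (nd s) (nearW (fun _ => Logic.I)) => p' h _.
  by rewrite /= (FE _ _ h) (@FE (sr_opp (s : stalk_setoid x)) _ h) /= -sub0r germB germ0 sub0r rmorphN.
have hD s t : cl (F (@sr_add (stalk_setoid x) s t)) = cl (F s) + cl (F t).
  rewrite /cl -classD; apply/classP; apply: near_and (nd s) (nd t) => p' h k.
  rewrite /= (FE _ _ h) (FE _ _ k) (@FE (@sr_add (stalk_setoid x) s t) _ (conj h k)) /=.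
  by rewrite -[X in germ _ (_ + X)]opprK germB -sub0r germB germ0 sub0r opprK (germ_res _ h) (germ_res _ k) rmorphD.
have hM s t : cl (F (@sr_mul (stalk_setoid x) s t)) = cl (F s) * cl (F t).
  rewrite /cl -classM; apply/classP; apply: near_and (nd s) (nd t) => p' h k.
  rewrite /= (FE _ _ h) (FE _ _ k) (@FE (@sr_mul (stalk_setoid x) s t) _ (conj h k)) /=.
  by rewrite -germ_mul (germ_res _ h) (germ_res _ k) rmorphM.
exists (@quo_lift (stalk_setoid x) _ (fun s => cl (F s)) hc h1 hN hD hM) => U Ux s z zE.
rewrite [LHS](@quo_liftE (stalk_setoid x)); apply/classP.
apply: near_and (rU U Ux) (nearW (fun _ => Logic.I)) => p' Up _.
by rewrite (@FE (PreGerm Ux s) _ Up) (zE _ Up).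
Qed.

Lemma spread0 a : dom a p -> val a p = 0 -> near (fun p' => val a p' = 0).
Proof.
move=> ha a0.
have [|g1 g1E] := @stalk_fam X1 (p1 p) p1 (fun p' => i1 (p1 p') (p2 p')).
  by move=> U Ux; exists U, (opensT _); split.
have [|g2 g2E] := @stalk_fam X2 (p2 p) p2 (fun p' => i2 (p1 p') (p2 p')).
  by move=> U Ux; exists (opensT _), U; split.
have [|g [g1' g2']] := @po_lift _ _ (@fpRel (p1 p) (p2 p)) _ g1 g2.
  move=> _ _ [V [s [h1 [h2 [-> ->]]]]]; rewrite !stalk_map_germ'.
  pose z : fam := fun p' => if pselect (V (f1 (p1 p'))) is left h then
    i1 _ _ (stalk_map f1 (p1 p') (germ h s)) else 0.
  have zE p' (h : V (f1 (p1 p'))) : z p' = i1 _ _ (stalk_map f1 (p1 p') (germ h s)).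
    by rewrite /z; case: pselect => // h'; rewrite (Prop_irrelevance h h').
  rewrite (g1E _ _ _ z) => [|p' Up]; last by rewrite (zE p' Up) stalk_map_germ'.
  rewrite (g2E _ _ _ z) // => p' Up.
  have Up' : V (f1 (p1 p')) by rewrite (peq p').
  rewrite (zE p' Up') -(@stalk_map_germ' Y X2 f2 (p2 p') V Up).
  by apply: po_rel; exists V, s, Up', Up.
have : g (val a p) = cl (val a).
  have [h1 h2] := ha; rewrite (valE ha) /pval rmorph_sum.
  have : near (dom a).
    by exists (projT1 a).1, (projT1 a).2; split=> //; split.
  move=> nda.
  transitivity (cl (fun p' => \sum_(x <- projT2 a)
    (if pselect (dom a p') is left h then i1 _ _ (germ h.1 x.1) * i2 _ _ (germ h.2 x.2) else 0))).
    elim: (projT2 a) => [|x s IH].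
      rewrite big_nil -class0; apply/classP; apply: nearW => p'; by rewrite big_nil.
    rewrite big_cons IH rmorphM g1' g2'.
    pose w1 : fam := fun p' => if pselect ((projT1 a).1 (p1 p')) is left h then i1 _ _ (germ h x.1) else 0.
    pose w2 : fam := fun p' => if pselect ((projT1 a).2 (p2 p')) is left h then i2 _ _ (germ h x.2) else 0.
    rewrite (g1E _ _ _ w1) => [|p' Up]; last first.
      by rewrite /w1; case: pselect => // h; rewrite (Prop_irrelevance h Up).
    rewrite (g2E _ _ _ w2) => [|p' Up]; last first.
      by rewrite /w2; case: pselect => // h; rewrite (Prop_irrelevance h Up).
    rewrite /cl -classM -classD; apply/classP; apply: near_and nda (nearW (fun _ => Logic.I)) => p' da _ /=.
    rewrite big_cons; congr (_ + _); rewrite /w1 /w2.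
    case: (pselect (dom a p')) => // h; have [d1 d2] := h.
    case: pselect => // d1'; case: pselect => // d2'.
    by congr (i1 _ _ _ * i2 _ _ _); apply: germ_irr.
  apply/classP; apply: near_and nda (nearW (fun _ => Logic.I)) => p' da _.
  rewrite (valE da) /pval; apply: eq_bigr => x _.
  by case: pselect => // h; rewrite (Prop_irrelevance h da).
rewrite a0 rmorph0 -class0 => /classP h.
by apply: near_and h (nearW (fun _ => Logic.I)) => p' <-.
Qed.

End Spreading.
End FiberPoints.

Lemma germD (X : ringed_space) (x : X) (U : opens X) (Ux : U x) (s t : sec X U) :
  germ Ux (s + t) = germ Ux s + germ Ux t.
Proof. by rewrite -[t in LHS]opprK germB -sub0r germB germ0 sub0r opprK. Qed.

Lemma frac_addE (A : comPzRingType) (s t a b c d : A) :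
  s * b = a -> t * d = c -> (s + t) * (b * d) = a * d + c * b.
Proof. by move=> <- <-; ring. Qed.

Lemma frac_oppE (A : comPzRingType) (s a b : A) : s * b = a -> - s * b = - a.
Proof. by move=> <-; rewrite mulNr. Qed.

Lemma frac_mulrE (A B : comPzRingType) (f : {rmorphism A -> B}) s a b c :
  s * f b = f a -> s * f (b * c) = f (a * c).
Proof. by move=> e; rewrite !rmorphM mulrA e. Qed.

Lemma frac_mulE (A : comPzRingType) (s t a b c d : A) :
  s * b = a -> t * d = c -> (s * t) * (b * d) = a * c.
Proof. by move=> <- <-; ring. Qed.

(** * The fibre product as a locally ringed space *)

Section FiberSpace.
Context (X1 X2 Y : lrs) (f1 : mor X1 Y) (f2 : mor X2 Y).
Local Notation P := (fpt f1 f2).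
Local Notation L p := (localization (pq p)).
Implicit Types (a b c : ps X1 X2) (p : P).

Definition pD a p : Prop := dom a p /\ ~ pq p (val a p).
Definition fp_open : set_system P := [set W | forall p, W p -> exists a, pD a p /\ forall p', pD a p' -> W p'].

Lemma pDc p : pD (psc X1 X2) p.
Proof. by split=> //; rewrite valc; exact: prime_one. Qed.

Lemma pDM a b p : pD (psM a b) p <-> pD a p /\ pD b p.
Proof.
split=> [[/domM[da db]]|[[da na] [db nb]]].
  by rewrite valM // => n; do 2 split=> //; move=> h; apply: n; [exact: idealMr|exact: idealMl].
by split; [exact/domM|rewrite valM //; exact: prime_mul].
Qed.

Fact fp_openT : fp_open setT.
Proof. by move=> p _; exists (psc X1 X2); split=> //; exact: pDc. Qed.

Fact fp_openI (U V : set P) : fp_open U -> fp_open V -> fp_open (U `&` V).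
Proof.
move=> oU oV p [/oU[a [ap aU]] /oV[b [bp bV]]]; exists (psM a b); split; first exact/pDM.
by move=> p' /pDM[/aU ? /bV].
Qed.

Fact fp_open_bigU (J : Type) (U : J -> set P) : (forall j, fp_open (U j)) -> fp_open (\bigcup_j U j).
Proof.
by move=> oU p [j _ /oU[a [ap aU]]]; exists a; split=> // p' /aU ?; exists j.
Qed.

HB.instance Definition _ := isOpenTopological.Build P fp_openT fp_openI fp_open_bigU.

Fact pD_open a : open ([set p | pD a p] : set P).
Proof. by move=> p ap; exists a. Qed.
Definition pDo a : opens P := Opens (@pD_open a).

Lemma near_pD p (Q : P -> Prop) : near p Q -> exists a, pD a p /\ forall p', pD a p' -> Q p'.
Proof.
move=> [U1 [U2 [u1 u2 uQ]]]; exists (@psin X1 X2 U1 U2 1 1); split=> [|p' [[h1 h2] _]]; last exact: uQ.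
by split=> //; rewrite (val_in _ _ u1 u2) !germ_one !rmorph1 mulr1; exact: prime_one.
Qed.

Fact dom_open a : open ([set p | dom a p] : set P).
Proof.
move=> p da; have [|b [bp bd]] := @near_pD p (dom a); last by exists b.
by exists (projT1 a).1, (projT1 a).2; split; [exact: da.1|exact: da.2|move=> p' h1 h2; split].
Qed.
Definition domo a : opens P := Opens (@dom_open a).

Implicit Types (U V W : opens P).

Definition fp_frac W (s : forall p, W p -> L p) : Prop := forall p, W p -> exists a b,
  [/\ dom a p, pD b p & forall p' (Wp : W p'), dom a p' -> pD b p' ->
    s p' Wp * locmap (pq p') (val b p') = locmap (pq p') (val a p')].

Definition fsec W : Type := {s : forall p, W p -> L p | fp_frac s}.
HB.instance Definition _ W := gen_eqMixin (fsec W).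
HB.instance Definition _ W := gen_choiceMixin (fsec W).

Lemma fsec_ext W (s t : fsec W) : (forall p Wp, sval s p Wp = sval t p Wp) -> s = t.
Proof.
move=> e; apply: sval_inj; apply: functional_extensionality_dep => p.
by apply: functional_extensionality_dep => Up.
Qed.

Lemma fsec_irr W (s : fsec W) p (h h' : W p) : sval s p h = sval s p h'.
Proof. by rewrite (Prop_irrelevance h h'). Qed.

Section Ring.
Context (W : opens P).
Implicit Types s t : fsec W.

Fact fsec1_frac : @fp_frac W (fun p _ => 1).
Proof.
move=> p Wp; exists (psc X1 X2), (psc X1 X2); split=> // [|p' _ _ _]; first exact: pDc.
by rewrite mul1r.
Qed.

Fact fsecD_frac s t : @fp_frac W (fun p Wp => sval s p Wp + sval t p Wp).
Proof.
move=> p Wp; have [a [b [da Db E]]] := svalP s p Wp; have [c [d [dc Dd F]]] := svalP t p Wp.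
exists (psD (psM a d) (psM c b)), (psM b d); split.
- by apply/domD; split; apply/domM; split=> //; [exact: Dd.1|exact: Db.1].
- exact/pDM.
- move=> p' Wp' /domD[/domM[da' dd'] /domM[dc' db']] /pDM[Db' Dd'].
  rewrite valD ?valM //; try exact/domM.
  rewrite rmorphD !rmorphM.
  exact: (frac_addE (E p' Wp' da' Db') (F p' Wp' dc' Dd')).
Qed.

Fact fsecM_frac s t : @fp_frac W (fun p Wp => sval s p Wp * sval t p Wp).
Proof.
move=> p Wp; have [a [b [da Db E]]] := svalP s p Wp; have [c [d [dc Dd F]]] := svalP t p Wp.
exists (psM a c), (psM b d); split; [exact/domM|exact/pDM|].
move=> p' Wp' /domM[da' dc'] /pDM[Db' Dd'].
rewrite !valM //; [|exact: Db'.1|exact: Dd'.1].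
rewrite !rmorphM; exact: (frac_mulE (E p' Wp' da' Db') (F p' Wp' dc' Dd')).
Qed.

Lemma locmap_valN a p : dom a p ->
  locmap (pq p) (val (psM (psN1 X1 X2) a) p) = - locmap (pq p) (val a p).
Proof. by move=> da; rewrite valM // valN1 mulN1r rmorphN. Qed.

Fact fsecN_frac s : @fp_frac W (fun p Wp => - sval s p Wp).
Proof.
move=> p Wp; have [a [b [da Db E]]] := svalP s p Wp.
exists (psM (psN1 X1 X2) a), b; split=> // [|p' Wp' /domM[_ da'] Db']; first exact/domM.
exact: (etrans (frac_oppE (E p' Wp' da' Db')) (esym (locmap_valN da'))).
Qed.

Fact fsec0_frac : @fp_frac W (fun p _ => 0).
Proof.
move=> p Wp; exists (psD (psc X1 X2) (psN1 X1 X2)), (psc X1 X2); split=> //; try exact: pDc; try exact/domD.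
by move=> p' _ _ _; rewrite valD // valc valN1 subrr rmorph0 mul0r.
Qed.

Definition fsec0 : fsec W := exist _ _ fsec0_frac.
Definition fsec1 : fsec W := exist _ _ fsec1_frac.
Definition fsecN s : fsec W := exist _ _ (fsecN_frac s).
Definition fsecD s t : fsec W := exist _ _ (fsecD_frac s t).
Definition fsecM s t : fsec W := exist _ _ (fsecM_frac s t).

Fact fsec_addA : associative fsecD.
Proof. by move=> s t u; apply: fsec_ext => p Up /=; rewrite addrA. Qed.
Fact fsec_addC : commutative fsecD.
Proof. by move=> s t; apply: fsec_ext => p Up /=; rewrite addrC. Qed.
Fact fsec_add0 : left_id fsec0 fsecD.
Proof. by move=> s; apply: fsec_ext => p Up /=; rewrite add0r. Qed.
Fact fsec_addN : left_inverse fsec0 fsecN fsecD.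
Proof. by move=> s; apply: fsec_ext => p Up /=; rewrite addNr. Qed.
HB.instance Definition _ := GRing.isZmodule.Build (fsec W) fsec_addA fsec_addC fsec_add0 fsec_addN.
Fact fsec_mulA : associative fsecM.
Proof. by move=> s t u; apply: fsec_ext => p Up /=; rewrite mulrA. Qed.
Fact fsec_mulC : commutative fsecM.
Proof. by move=> s t; apply: fsec_ext => p Up /=; rewrite mulrC. Qed.
Fact fsec_mul1 : left_id fsec1 fsecM.
Proof. by move=> s; apply: fsec_ext => p Up /=; rewrite mul1r. Qed.
Fact fsec_mulDl : left_distributive fsecM fsecD.
Proof. by move=> s t u; apply: fsec_ext => p Up /=; rewrite mulrDl. Qed.
HB.instance Definition _ :=
  GRing.Zmodule_isComPzRing.Build (fsec W) fsec_mulA fsec_mulC fsec_mul1 fsec_mulDl.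
End Ring.

Section Restriction.
Context (U V : opens P) (VU : V `<=` U).
Fact fres_frac (s : fsec U) : @fp_frac V (fun p Vp => sval s p (VU Vp)).
Proof.
move=> p Vp; have [a [b [da Db E]]] := svalP s p (VU Vp).
by exists a, b; split=> // p' Vp'; exact: E.
Qed.
Definition fres_fun (s : fsec U) : fsec V := exist _ _ (fres_frac s).
Fact fres_zmod : zmod_morphism fres_fun. Proof. by move=> s t; apply: fsec_ext. Qed.
Fact fres_monoid : monoid_morphism fres_fun. Proof. by split=> [|s t]; apply: fsec_ext. Qed.
Definition fres : {rmorphism fsec U -> fsec V} := mk_rmorph fres_zmod fres_monoid.
End Restriction.

Fact fres_id U (UU : U `<=` U) (s : fsec U) : fres UU s = s.
Proof. by apply: fsec_ext => p Up; exact: (fsec_irr s). Qed.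

Fact fres_comp U V W (VU : V `<=` U) (WV : W `<=` V) (WU : W `<=` U) (s : fsec U) :
  fres WV (fres VU s) = fres WU s.
Proof. by apply: fsec_ext => p Up; exact: (fsec_irr s). Qed.

Fact fsec_separated U (J : Type) (V : J -> opens P) (VU : forall j, V j `<=` U) :
  U `<=` \bigcup_j V j -> forall s t : fsec U, (forall j, fres (VU j) s = fres (VU j) t) -> s = t.
Proof.
move=> cov s t e; apply: fsec_ext => p Up; have [j _ Vp] := cov p Up.
have := congr1 (fun r => sval r p Vp) (e j) => /=.
by rewrite (fsec_irr s _ Up) (fsec_irr t _ Up).
Qed.

Fact fsec_glue U (J : Type) (V : J -> opens P) (VU : forall j, V j `<=` U) : U `<=` \bigcup_j V j ->
  forall s : forall j, fsec (V j),
    (forall i j (Wi : opensI (V i) (V j) `<=` V i) (Wj : opensI (V i) (V j) `<=` V j),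
       fres Wi (s i) = fres Wj (s j)) ->
    exists t : fsec U, forall j, fres (VU j) t = s j.
Proof.
move=> cov s compat.
have covj p (Up : U p) : exists j, V j p by have [j _] := cov p Up; exists j.
pose j p Up := projT1 (cid (covj p Up)).
have jP p Up : V (j p Up) p by rewrite /j; case: cid.
have sE i k p (Vi : V i p) (Vk : V k p) : sval (s i) p Vi = sval (s k) p Vk.
  have := compat i k (@opensI_l _ _ _) (@opensI_r _ _ _).
  move=> /(congr1 (fun r => sval r p (conj Vi Vk))) /=.
  by rewrite (fsec_irr _ _ Vi) (fsec_irr _ _ Vk).
have tP : @fp_frac U (fun p Up => sval (s (j p Up)) p (jP p Up)).
  move=> p Up; have [a [b [da Db E]]] := svalP (s (j p Up)) p (jP p Up).
  have [c [cp cV]] := opens_open (V (j p Up)) p (jP p Up).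
  exists (psM a c), (psM b c); split; [apply/domM; split=> //; exact: cp.1|exact/pDM|].
  move=> p' Up' /domM[da' dc'] /pDM[Db' /cV Vp']; rewrite !valM //; last exact: Db'.1.
  rewrite (sE (j p' Up') (j p Up) p' (jP p' Up') Vp').
  exact: (frac_mulrE (f := locmap (pq p')) _ (E p' Vp' da' Db')).
exists (exist _ _ tP) => k; apply: fsec_ext => p Vp; exact: sE.
Qed.

Definition fp_rs : ringed_space :=
  @RingedSpace P (fun U => fsec U) fres fres_id fres_comp fsec_separated fsec_glue.

Section Stalks.
Context (p : fp_rs).

Definition fpg_val (s : pregerm p) : L p := sval (pg_sec s : fsec _) p (pg_mem s).

Fact fpg_congr s t : pregerm_eq s t -> fpg_val s = fpg_val t.
Proof.
move=> [W [Ws [Wt [Wp /(congr1 (fun r : fsec W => sval r p Wp)) /=]]]].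
by rewrite (fsec_irr _ _ (pg_mem s)) (fsec_irr _ _ (pg_mem t)).
Qed.
Fact fpg_1 : fpg_val (sr_one (stalk_setoid p)) = 1. Proof. by []. Qed.
Fact fpg_N s : fpg_val (sr_opp (s : stalk_setoid p)) = - fpg_val s. Proof. by []. Qed.
Fact fpg_D s t : fpg_val (sr_add (s : stalk_setoid p) t) = fpg_val s + fpg_val t.
Proof.
exact: (f_equal2 +%R (@fsec_irr (pg_dom s) (pg_sec s) p _ (pg_mem s)) (@fsec_irr (pg_dom t) (pg_sec t) p _ (pg_mem t))).
Qed.
Fact fpg_M s t : fpg_val (sr_mul (s : stalk_setoid p) t) = fpg_val s * fpg_val t.
Proof.
exact: (f_equal2 *%R (@fsec_irr (pg_dom s) (pg_sec s) p _ (pg_mem s)) (@fsec_irr (pg_dom t) (pg_sec t) p _ (pg_mem t))).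
Qed.

Definition fpv : {rmorphism stalk p -> L p} :=
  @quo_lift (stalk_setoid p) _ fpg_val fpg_congr fpg_1 fpg_N fpg_D fpg_M.

Lemma fpv_germ (U : opens P) (Up : U p) (s : fsec U) : fpv (@germ fp_rs p U Up s) = sval s p Up.
Proof. by rewrite /fpv quo_liftE. Qed.

Fact psec_frac a : @fp_frac (domo a) (fun p' _ => locmap (pq p') (val a p')).
Proof.
move=> p' da; exists a, (psc X1 X2); split=> // [|p'' _ _ _]; first exact: pDc.
by rewrite valc rmorph1 mulr1.
Qed.
Definition psec a : fsec (domo a) := exist _ _ (@psec_frac a).
Definition pgerm a (h : dom a p) : stalk p := @germ fp_rs p (domo a) h (psec a).
Lemma pgermE a (h : dom a p) : fpv (pgerm h) = locmap (pq p) (val a p).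
Proof. by rewrite /pgerm fpv_germ. Qed.

(** Vanishing at [p] spreads to a neighbourhood ([spread0]); this makes [fpv] injective, so that the
    stalk is the local ring of the tensor product of stalks at [pq p]. *)
Lemma pgerm0 a (h : dom a p) : val a p = 0 -> pgerm h = 0.
Proof.
move=> a0; have [b [bp b0]] := near_pD (spread0 h a0).
rewrite /pgerm -(@germ0 fp_rs p (domo a) h); apply/germ_eq.
have WU : opensI (pDo b) (domo a) `<=` domo a by move=> p' [].
exists (opensI (pDo b) (domo a)), WU, WU; split=> //.
by apply: fsec_ext => p' [bp' _] /=; rewrite b0 // rmorph0.
Qed.

Lemma pgermD a b (h : dom a p) (k : dom b p) (hk : dom (psD a b) p) : pgerm hk = pgerm h + pgerm k.
Proof.
have Wa : opensI (domo a) (domo b) `<=` domo a by move=> p' [].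
have Wb : opensI (domo a) (domo b) `<=` domo b by move=> p' [].
have Wab : opensI (domo a) (domo b) `<=` domo (psD a b) by move=> p' [da db]; exact/domD.
have W : opensI (domo a) (domo b) p by split.
rewrite /pgerm -(@germ_res fp_rs p _ _ Wa h W) -(@germ_res fp_rs p _ _ Wb k W) -(@germ_res fp_rs p _ _ Wab hk W).
rewrite -germD; congr germ.
by apply: fsec_ext => p' [da db] /=; rewrite valD // rmorphD.
Qed.

Lemma pgermM a b (h : dom a p) (k : dom b p) (hk : dom (psM a b) p) : pgerm hk = pgerm h * pgerm k.
Proof.
have Wa : opensI (domo a) (domo b) `<=` domo a by move=> p' [].
have Wb : opensI (domo a) (domo b) `<=` domo b by move=> p' [].
have Wab : opensI (domo a) (domo b) `<=` domo (psM a b) by move=> p' [da db]; exact/domM.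
have W : opensI (domo a) (domo b) p by split.
rewrite /pgerm -(@germ_res fp_rs p _ _ Wa h W) -(@germ_res fp_rs p _ _ Wb k W) -(@germ_res fp_rs p _ _ Wab hk W).
rewrite germ_mul; congr germ.
by apply: fsec_ext => p' [da db] /=; rewrite valM // rmorphM.
Qed.

Lemma germ_frac (U : opens P) (Up : U p) (s : fsec U) : exists a b (da : dom a p) (db : dom b p),
  ~ pq p (val b p) /\ @germ fp_rs p U Up s * pgerm db = pgerm da.
Proof.
have [a [b [da Db E]]] := svalP s p Up; exists a, b, da, Db.1; split; first exact: Db.2.
pose W : opens P := opensI (opensI (domo a) (pDo b)) U.
have Wa : W `<=` domo a by move=> p' [[]].
have Wb : W `<=` domo b by move=> p' [[_ []]].
have WU : W `<=` U by move=> p' [].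
have Wp : W p by [].
rewrite /pgerm -(@germ_res fp_rs p _ _ Wa da Wp) -(@germ_res fp_rs p _ _ Wb Db.1 Wp) -(@germ_res fp_rs p _ _ WU Up Wp).
rewrite germ_mul; congr germ; apply: fsec_ext => p' [[da' Db'] Up'] /=.
by rewrite E.
Qed.

Lemma pgerm_unit a (h : dom a p) : ~ pq p (val a p) -> isunit (pgerm h).
Proof.
move=> na; have tP : @fp_frac (pDo a) (fun p' Dp => @frac _ (pq p') 1 (val a p') Dp.2).
  move=> p' Dp; exists (psc X1 X2), a; split=> // p'' Dp'' _ _.
  by rewrite locmap_frac valc.
have W : pDo a p by [].
exists (@germ fp_rs p (pDo a) W (exist _ _ tP)).
have Wa : pDo a `<=` domo a by move=> p' [].
rewrite /pgerm -(@germ_res fp_rs p _ _ Wa h W) germ_mul -(@germ_one fp_rs p _ W); congr germ.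
by apply: fsec_ext => p' Dp /=; rewrite mulrC locmap_frac rmorph1.
Qed.

Lemma fpv_inj : injective fpv.
Proof.
move=> x y e; apply/eqP; rewrite -subr_eq0; apply/eqP; move/eqP: e; rewrite -subr_eq0 -rmorphB => /eqP.
elim/germ_ind: (x - y) => U Up s {x y}; have [a [b [da [db [nb E]]]]] := germ_frac Up s => e.
have : locmap (pq p) (val a p) = 0 by rewrite -(pgermE da) -E rmorphM e mul0r.
move=> /locmap_eq0[u [nu ua]]; have [c [dc cE]] := @val_gen _ _ _ f1 f2 p u.
have hk : dom (psM c a) p by apply/domM.
have : pgerm hk = 0 by apply: pgerm0; rewrite valM // cE.
rewrite (pgermM dc da) -E => z.
have ub : isunit (pgerm dc * pgerm db).
  by apply: isunitM; apply: pgerm_unit => //; rewrite cE.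
by apply: (unit_cancel ub); rewrite mul0r -z; ring.
Qed.

Lemma fpv_surj z : exists x, fpv x = z.
Proof.
elim/frac_ind: z => u v nv; have [a [da aE]] := @val_gen _ _ _ f1 f2 p u; have [b [db bE]] := @val_gen _ _ _ f1 f2 p v.
have [|w wE] := @pgerm_unit b db; first by rewrite bE.
exists (pgerm da * w); apply: frac_unique; rewrite -bE -(pgermE db) -rmorphM -mulrA [w * _]mulrC wE mulr1.
by rewrite pgermE aE.
Qed.

Lemma fp_stalk_local : local_ring (stalk p).
Proof.
apply: (@is_local_ring _ (ideal_preimage fpv (localization_max (pq p)))).
split=> [|x nx].
  suff : ~ localization_max (pq p) (fpv 1) by [].
  by rewrite rmorph1; exact: localization_max1.
have [v vE] := (localization_is_local (pq p)).2 _ nx; have [y yE] := fpv_surj v.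
by exists y; apply: fpv_inj; rewrite rmorphM yE vE rmorph1.
Qed.

End Stalks.

Definition fp_lrs : lrs := Lrs fp_stalk_local.

Definition fpv_inv_ex (p : fp_lrs) := bij_ex (@fpv_inj p) (@fpv_surj p).
Definition fpvi p : {rmorphism L p -> stalk (p : fp_lrs)} := projT1 (cid (fpv_inv_ex p)).
Lemma fpviK p : cancel (@fpvi p) (@fpv p). Proof. by rewrite /fpvi; case: cid => g []. Qed.
Lemma fpvK p : cancel (@fpv p) (@fpvi p). Proof. by rewrite /fpvi; case: cid => g []. Qed.

Lemma locmap_unitP (A : comPzRingType) (q : spec A) (a : A) : isunit (locmap q a) -> ~ q a.
Proof.
move=> u qa; have [k _] := localization_is_local q; apply: k; apply: ideal_unit u _.
exact/localization_max_locmap.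
Qed.

Lemma fpvi_in1 (p : fp_lrs) (U : opens X1) (Up : U (p1 p)) s (d : dom (@psin X1 X2 U (opensT _) s 1) p) :
  fpvi p (locmap (pq p) (po1 (@fpRel _ _ _ f1 f2 (p1 p) (p2 p)) (germ Up s))) = pgerm d.
Proof.
have e : locmap (pq p) (po1 (@fpRel _ _ _ f1 f2 (p1 p) (p2 p)) (germ Up s)) = fpv p (pgerm d).
  rewrite pgermE; congr (locmap _ _); rewrite (@val_in _ _ _ f1 f2 U (opensT _) s 1 p Up Logic.I).
  by rewrite germ_one rmorph1 mulr1.
exact: etrans (congr1 (fpvi p) e) (fpvK (pgerm d)).
Qed.

Lemma fpvi_in2 (p : fp_lrs) (U : opens X2) (Up : U (p2 p)) s (d : dom (@psin X1 X2 (opensT _) U 1 s) p) :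
  fpvi p (locmap (pq p) (po2 (@fpRel _ _ _ f1 f2 (p1 p) (p2 p)) (germ Up s))) = pgerm d.
Proof.
have e : locmap (pq p) (po2 (@fpRel _ _ _ f1 f2 (p1 p) (p2 p)) (germ Up s)) = fpv p (pgerm d).
  rewrite pgermE; congr (locmap _ _); rewrite (@val_in _ _ _ f1 f2 (opensT _) U 1 s p Logic.I Up).
  by rewrite germ_one rmorph1 mul1r.
exact: etrans (congr1 (fpvi p) e) (fpvK (pgerm d)).
Qed.

Lemma fp_pr1_ex : exists g : mor fp_lrs X1, (forall p, g p = p1 p) /\
  forall p (U : opens X1) (Ut : U (g p)) (Ut' : U (p1 p)) s (d : dom (@psin X1 X2 U (opensT _) s 1) p),
    stalk_map g p (germ Ut s) = pgerm d.
Proof.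
have [||g [gE gS]] := @mk_mor fp_lrs X1 (@p1 _ _ _ f1 f2)
    (fun p => fpvi p \o (locmap (pq p) \o po1 (@fpRel _ _ _ f1 f2 (p1 p) (p2 p)))).
- move=> p a [v e]; apply: contrapT => na.
  apply: (@locmap_unitP _ (pq p)) (pl1 na); exists (fpv p v).
  by rewrite -[locmap _ _](@fpviK p) -rmorphM e rmorph1.
- move=> p U Up s; exists (domo (@psin X1 X2 U (opensT _) s 1)), (psec _); split; first by split.
  move=> p' dp'; exists dp'.1; exact: (fpvi_in1 _ dp').
exists g; split=> // p U Ut Ut' s d; rewrite (gS p U Ut Ut' s); exact: fpvi_in1.
Qed.

Lemma fp_pr2_ex : exists g : mor fp_lrs X2, (forall p, g p = p2 p) /\
  forall p (U : opens X2) (Ut : U (g p)) (Ut' : U (p2 p)) s (d : dom (@psin X1 X2 (opensT _) U 1 s) p),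
    stalk_map g p (germ Ut s) = pgerm d.
Proof.
have [||g [gE gS]] := @mk_mor fp_lrs X2 (@p2 _ _ _ f1 f2)
    (fun p => fpvi p \o (locmap (pq p) \o po2 (@fpRel _ _ _ f1 f2 (p1 p) (p2 p)))).
- move=> p a [v e]; apply: contrapT => na.
  apply: (@locmap_unitP _ (pq p)) (pl2 na); exists (fpv p v).
  by rewrite -[locmap _ _](@fpviK p) -rmorphM e rmorph1.
- move=> p U Up s; exists (domo (@psin X1 X2 (opensT _) U 1 s)), (psec _); split; first by split.
  move=> p' dp'; exists dp'.2; exact: (fpvi_in2 _ dp').
exists g; split=> // p U Ut Ut' s d; rewrite (gS p U Ut Ut' s); exact: fpvi_in2.
Qed.

Definition fpr1 := projT1 (cid fp_pr1_ex).
Definition fpr2 := projT1 (cid fp_pr2_ex).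
Lemma fpr1E p : fpr1 p = p1 p. Proof. by rewrite /fpr1; case: cid => g []. Qed.
Lemma fpr2E p : fpr2 p = p2 p. Proof. by rewrite /fpr2; case: cid => g []. Qed.
Lemma fpr1S p (U : opens X1) (Ut : U (fpr1 p)) (Ut' : U (p1 p)) s (d : dom (@psin X1 X2 U (opensT _) s 1) p) :
  stalk_map fpr1 p (germ Ut s) = pgerm d.
Proof. by move: Ut; rewrite /fpr1; case: cid => g [] /= _ h Ut; exact: h. Qed.
Lemma fpr2S p (U : opens X2) (Ut : U (fpr2 p)) (Ut' : U (p2 p)) s (d : dom (@psin X1 X2 (opensT _) U 1 s) p) :
  stalk_map fpr2 p (germ Ut s) = pgerm d.
Proof. by move: Ut; rewrite /fpr2; case: cid => g [] /= _ h Ut; exact: h. Qed.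

Lemma fpr_comm : mor_comp f1 fpr1 = mor_comp f2 fpr2.
Proof.
apply: mor_ext => [p|p U Up Up' s].
  by rewrite /= -/(fpr1 p) -/(fpr2 p) fpr1E fpr2E; exact: peq.
rewrite [LHS](@stalk_map_comp _ _ _ f1 fpr1 p _) [RHS](@stalk_map_comp _ _ _ f2 fpr2 p _).
have h1 : U (f1 (p1 p)) by rewrite -fpr1E.
have h2 : U (f2 (p2 p)) by rewrite -fpr2E.
have E1 := @fpr1S p (opens_preimage (rs_cts f1) U) Up h1 (rs_sharp f1 U s) (conj h1 Logic.I).
have E2 := @fpr2S p (opens_preimage (rs_cts f2) U) Up' h2 (rs_sharp f2 U s) (conj Logic.I h2).
apply: (etrans (congr1 (stalk_map fpr1 p) (@stalk_map_germ' _ _ f1 (fpr1 p) U Up s))).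
apply: (etrans E1); apply: esym.
apply: (etrans (congr1 (stalk_map fpr2 p) (@stalk_map_germ' _ _ f2 (fpr2 p) U Up' s))).
apply: (etrans E2); apply: esym.
apply: fpv_inj; rewrite !pgermE; congr (locmap _ _).
rewrite (@val_in _ _ _ f1 f2 (opens_preimage (rs_cts f1) U) (opensT _) _ 1 p h1 Logic.I).
rewrite (@val_in _ _ _ f1 f2 (opensT _) (opens_preimage (rs_cts f2) U) 1 _ p Logic.I h2).
rewrite !germ_one !rmorph1 mulr1 mul1r; apply: po_rel.
by exists U, s, h1, h2; rewrite !stalk_map_germ'.
Qed.

End FiberSpace.

Lemma stalk_map_eq (T Y : lrs) (g g' : mor T Y) t (V : opens Y) (h : V (g t)) (h' : V (g' t)) s :
  g = g' -> stalk_map g t (germ h s) = stalk_map g' t (germ h' s).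
Proof. by move=> e; subst g'; rewrite (germ_irr h h'). Qed.

Lemma stalk_max_ex (X : lrs) (x : X) : exists q : spec (stalk x), forall z, q z <-> ~ isunit z.
Proof.
have [m lm] := local_ringP (lrs_local x); have [q qm] := spec_of_max lm; exists q => z.
split=> [/qm mz uz|nz]; first exact: lm.1 (ideal_unit uz mz).
by apply/qm; apply: contrapT => /lm.2.
Qed.

Lemma germ_unit_near (X : ringed_space) (x : X) (U : opens X) (Ux : U x) (s : sec X U) :
  isunit (germ Ux s) -> exists (W : opens X) (WU : W `<=` U) (r : sec X W), W x /\ res WU s * r = 1.
Proof.
move=> [v]; elim/germ_ind: v => V Vx r.
pose W := opensI U V; have Wx : W x by [].
rewrite -(germ_res (@opensI_l _ U V) Ux Wx) -(germ_res (@opensI_r _ U V) Vx Wx) germ_mul -(germ_one Wx).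
move=> /germ_eq[W' [W1 [W2 [Wx' e]]]].
exists W', (fun y h => opensI_l (W1 y h)), (res (fun y h => opensI_r (W1 y h)) r); split=> //.
by move: e; rewrite rmorphM rmorph1 !res_res.
Qed.

Lemma localization_lift_unit (A C : comPzRingType) (q : spec A) (g : {rmorphism localization q -> C})
    (w : A -> C) : (forall a, g (locmap q a) = w a) -> (forall a, isunit (w a) -> ~ q a) ->
  forall z, isunit (g z) -> isunit z.
Proof.
move=> gw wq z uz; apply: (localization_is_local q).2; move: uz.
elim/frac_ind: z => a f nf uz /localization_maxE; apply: wq.
rewrite -gw -(locmap_frac a nf) rmorphM; apply: isunitM => //.
by apply: isunit_rmorph; exact: locmap_unit.
Qed.

(** * The universal property of the fibre product *)

Section Universal.
Context (X1 X2 Y : lrs) (f1 : mor X1 Y) (f2 : mor X2 Y).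
Local Notation P := (fp_lrs f1 f2).
Local Notation pr1 := (fpr1 f1 f2).
Local Notation pr2 := (fpr2 f1 f2).
Implicit Types (a b c : ps X1 X2).

Lemma pgerm_sum (p : P) a (da : dom a p) (h1 : (projT1 a).1 (pr1 p)) (h2 : (projT1 a).2 (pr2 p)) :
  pgerm da = \sum_(x <- projT2 a) stalk_map pr1 p (germ h1 x.1) * stalk_map pr2 p (germ h2 x.2).
Proof.
apply: fpv_inj; rewrite pgermE (valE da) /pval !rmorph_sum; apply: eq_bigr => x _.
rewrite (@fpr1S _ _ _ f1 f2 p _ h1 da.1 x.1 (conj da.1 Logic.I)).
rewrite (@fpr2S _ _ _ f1 f2 p _ h2 da.2 x.2 (conj Logic.I da.2)) !rmorphM !pgermE.
rewrite (@val_in _ _ _ f1 f2 _ (opensT _) x.1 1 p da.1 Logic.I) (@val_in _ _ _ f1 f2 (opensT _) _ 1 x.2 p Logic.I da.2).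
by rewrite !germ_one !rmorph1 mulr1 mul1r.
Qed.

Lemma pgerm_unitP (p : P) a (da : dom a p) : isunit (pgerm da) <-> ~ pq p (val a p).
Proof.
split=> [u|]; last exact: pgerm_unit.
by apply: locmap_unitP; rewrite -(pgermE da); exact: isunit_rmorph.
Qed.

Section Mor.
Context (T : lrs).

Lemma mor_pgerm (h : mor T P) t a (da : dom a (h t)) (h1 : (projT1 a).1 (mor_comp pr1 h t))
    (h2 : (projT1 a).2 (mor_comp pr2 h t)) :
  stalk_map h t (pgerm da) = \sum_(x <- projT2 a)
    stalk_map (mor_comp pr1 h) t (germ h1 x.1) * stalk_map (mor_comp pr2 h) t (germ h2 x.2).
Proof.
rewrite (pgerm_sum da h1 h2) rmorph_sum; apply: eq_bigr => x _.
by rewrite rmorphM (@stalk_map_comp _ _ _ pr1 h t) (@stalk_map_comp _ _ _ pr2 h t).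
Qed.

(** The pullback of a [ps] is determined by the two projections ([mor_pgerm]). This determines the
    prime at each point, because pullback reflects units, and then all germs, which are fractions of
    such. *)
Lemma fp_mor_ext (h h' : mor T P) : mor_comp pr1 h = mor_comp pr1 h' ->
  mor_comp pr2 h = mor_comp pr2 h' -> h = h'.
Proof.
move=> e1 e2.
have E t a (da : dom a (h t)) (da' : dom a (h' t)) :
    stalk_map h t (pgerm da) = stalk_map h' t (pgerm da').
  have h1 : (projT1 a).1 (mor_comp pr1 h t) by rewrite /= fpr1E; exact: da.1.
  have h2 : (projT1 a).2 (mor_comp pr2 h t) by rewrite /= fpr2E; exact: da.2.
  have h1' : (projT1 a).1 (mor_comp pr1 h' t) by rewrite /= fpr1E; exact: da'.1.
  have h2' : (projT1 a).2 (mor_comp pr2 h' t) by rewrite /= fpr2E; exact: da'.2.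
  rewrite (mor_pgerm da h1 h2) (mor_pgerm da' h1' h2'); apply: eq_bigr => x _.
  by rewrite (stalk_map_eq h1 h1' _ e1) (stalk_map_eq h2 h2' _ e2).
have pE t : h t = h' t.
  apply: fpt_ext; first by rewrite -!fpr1E; exact: (congr1 (fun g : mor T X1 => g t) e1).
    by rewrite -!fpr2E; exact: (congr1 (fun g : mor T X2 => g t) e2).
  move=> a da da'; suff h0 : ~ pq (h t) (val a (h t)) <-> ~ pq (h' t) (val a (h' t)).
    by split=> q; apply: contrapT => /h0.
  split=> [/(pgerm_unitP da) u|/(pgerm_unitP da') u].
    apply/(pgerm_unitP da'); have := isunit_rmorph (stalk_map h t) u.
    by rewrite (E t a da da'); exact: mor_unit.
  apply/(pgerm_unitP da); have := isunit_rmorph (stalk_map h' t) u.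
  by rewrite -(E t a da da'); exact: mor_unit.
apply: mor_ext => // t U Ut Ut' s.
have [a [b [da [db [nb e]]]]] := germ_frac Ut s.
have [da' [db' [nb' e']]] : exists (da' : dom a (h' t)) (db' : dom b (h' t)),
    ~ pq (h' t) (val b (h' t)) /\ germ Ut' s * pgerm db' = pgerm da'.
  move: (h' t) Ut' (pE t) => p Ut' pp; subst p; exists da, db; split; first exact: nb.
  exact: etrans (congr1 (fun z => z * pgerm db) (germ_irr Ut' Ut s)) e.
have k := etrans (esym (rmorphM (stalk_map h t) (germ Ut s) (pgerm db))) (congr1 (stalk_map h t) e).
have k' := etrans (esym (rmorphM (stalk_map h' t) (germ Ut' s) (pgerm db'))) (congr1 (stalk_map h' t) e').
apply: (unit_cancel (isunit_rmorph (stalk_map h t) (pgerm_unit db nb))).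
exact: etrans k (etrans (E t a da da') (etrans (esym k') (congr1 ( *%R _) (esym (E t b db db'))))).
Qed.

Context (a1 : mor T X1) (a2 : mor T X2).
Hypothesis a12 : mor_comp f1 a1 = mor_comp f2 a2.

Fact fpw_ex t : exists w : {rmorphism fpK f1 f2 (a1 t) (a2 t) -> stalk t},
  (forall x, w (po1 _ x) = stalk_map a1 t x) /\ forall x, w (po2 _ x) = stalk_map a2 t x.
Proof.
apply: po_lift => _ _ [V [s [h1 [h2 [-> ->]]]]].
exact: etrans (esym (@stalk_map_comp _ _ _ f1 a1 t (germ h1 s)))
  (etrans (@stalk_map_eq T Y (mor_comp f1 a1) (mor_comp f2 a2) t V h1 h2 s a12)
    (@stalk_map_comp _ _ _ f2 a2 t (germ h2 s))).
Qed.
Definition fpw t := projT1 (cid (fpw_ex t)).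
Lemma fpw1 t x : fpw t (po1 _ x) = stalk_map a1 t x. Proof. by rewrite /fpw; case: cid => w []. Qed.
Lemma fpw2 t x : fpw t (po2 _ x) = stalk_map a2 t x. Proof. by rewrite /fpw; case: cid => w []. Qed.

Definition fpmax (t : T) := projT1 (cid (stalk_max_ex t)).
Lemma fpmaxP (t : T) z : fpmax t z <-> ~ isunit z. Proof. by rewrite /fpmax; case: cid. Qed.

Fact fpoint_eq t : f1 (a1 t) = f2 (a2 t).
Proof. exact: (congr1 (fun g : mor T Y => g t) a12). Qed.
Fact fpoint1 (t : T) (z : stalk (a1 t)) : ~ isunit z -> spec_preimage (fpw t) (fpmax t) (po1 _ z).
Proof. by move=> na; apply/fpmaxP; rewrite fpw1 => /mor_unit. Qed.
Fact fpoint2 (t : T) (z : stalk (a2 t)) : ~ isunit z -> spec_preimage (fpw t) (fpmax t) (po2 _ z).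
Proof. by move=> na; apply/fpmaxP; rewrite fpw2 => /mor_unit. Qed.
Definition fpoint t : P := FPt (fpoint_eq t) (@fpoint1 t) (@fpoint2 t).

Fact fpl_ex t : exists g : {rmorphism localization (pq (fpoint t)) -> stalk t},
  forall z, g (locmap _ z) = fpw t z.
Proof.
apply: (loc_lift (f := fpw t) (locmap_loc (pq (fpoint t)))) => u nu.
by apply: contrapT => n; apply/nu/fpmaxP.
Qed.
Definition fpl t := projT1 (cid (fpl_ex t)).
Lemma fplE t z : fpl t (locmap _ z) = fpw t z. Proof. by rewrite /fpl; case: cid. Qed.

Definition domT a : opens T :=
  opensI (opens_preimage (rs_cts a1) (projT1 a).1) (opens_preimage (rs_cts a2) (projT1 a).2).

Lemma fpsec_ex a : exists al : sec T (domT a), forall t (h : domT a t), germ h al = fpw t (val a (fpoint t)).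
Proof.
have [al alE] : exists al : sec T (domT a), forall t (h : domT a t) (h1 : (projT1 a).1 (a1 t)) (h2 : (projT1 a).2 (a2 t)),
    germ h al = \sum_(x <- projT2 a) stalk_map a1 t (germ h1 x.1) * stalk_map a2 t (germ h2 x.2).
  elim: (projT2 a) => [|x s [al IH]]; first by exists 0 => t h h1 h2; rewrite germ0 big_nil.
  exists (res (@opensI_l _ (opens_preimage (rs_cts a1) (projT1 a).1) (opens_preimage (rs_cts a2) (projT1 a).2)) (rs_sharp a1 _ x.1) *
    res (@opensI_r _ (opens_preimage (rs_cts a1) (projT1 a).1) (opens_preimage (rs_cts a2) (projT1 a).2)) (rs_sharp a2 _ x.2) + al).
  move=> t h h1 h2; apply: (etrans (germD h _ _)); rewrite big_cons; apply: (f_equal2 +%R); last exact: IH.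
  apply: (etrans (esym (germ_mul h _ _))); apply: (f_equal2 *%R).
    apply: (etrans (@germ_res T t (opens_preimage (rs_cts a1) (projT1 a).1) _ _ h1 h _)); exact: (esym (@stalk_map_germ' _ _ a1 t _ h1 _)).
  apply: (etrans (@germ_res T t (opens_preimage (rs_cts a2) (projT1 a).2) _ _ h2 h _)); exact: (esym (@stalk_map_germ' _ _ a2 t _ h2 _)).
exists al => t h; apply: (etrans (alE t h h.1 h.2)); rewrite (valE (h : dom a (fpoint t))) /pval.
apply: esym; apply: (etrans (rmorph_sum (fpw t) _ _ _)); apply: eq_bigr => x _.
apply: (etrans (rmorphM (fpw t) _ _)); apply: (f_equal2 *%R).
  by rewrite fpw1; congr (stalk_map a1 t _); exact: germ_irr.
by rewrite fpw2; congr (stalk_map a2 t _); exact: germ_irr.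
Qed.

Lemma pD_near a t : pD a (fpoint t) -> exists (W : opens T) (Wd : W `<=` domT a) (r : sec T W), W t /\
  forall t' (Wt : W t'), pD a (fpoint t') /\ germ Wt r * fpw t' (val a (fpoint t')) = 1.
Proof.
move=> [da na]; have [al alE] := fpsec_ex a.
have dT : domT a t by exact: da.
have [|W [Wd [r [Wt e]]]] := @germ_unit_near T t (domT a) dT al.
  by rewrite alE; apply: contrapT => n; apply/na/fpmaxP.
have E t' (Wt' : W t') : germ Wt' r * fpw t' (val a (fpoint t')) = 1.
  by rewrite -(alE t' (Wd _ Wt')) -(germ_res Wd (Wd _ Wt') Wt') germ_mul mulrC e germ_one.
exists W, Wd, r; split=> // t' Wt'; split=> //; split; first exact: Wd Wt'.
by move=> /fpmaxP; apply; exists (germ Wt' r); rewrite mulrC.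
Qed.

(** A point [t] goes to the pair of its images with the prime pulled back from the maximal ideal of
    the stalk at [t]. Sections are locally fractions of [ps]; numerators pull back to sections by
    [fpsec_ex], and denominators become invertible by [pD_near]. *)
Lemma fp_lift_ex : exists h : mor T P, [/\ forall t, h t = fpoint t,
  mor_comp pr1 h = a1 & mor_comp pr2 h = a2].
Proof.
have thg t (U : opens P) (Ut : U (fpoint t)) (s : fsec U) :
    fpl t (fpv _ (@germ (fp_rs f1 f2) _ U Ut s)) = fpl t (sval s _ Ut).
  by rewrite fpv_germ.
have [||h [hE hS]] := @mk_mor T P fpoint (fun t => fpl t \o @fpv _ _ _ f1 f2 (fpoint t)).
- move=> t z uz.
  have uv : isunit (fpv _ z).
    apply: (localization_lift_unit (@fplE t)) uz => a ua pa.
    exact: ((fpmaxP _).1 pa ua).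
  by rewrite -(fpvK z); exact: isunit_rmorph.
- move=> t U Ut s; have [a [b [da Db E]]] := svalP (s : fsec U) _ Ut.
  have [c [Dc cU]] := opens_open U _ Ut.
  have [Wb [Wbd [r [Wbt rE]]]] := pD_near Db; have [Wc [Wcd [rc [Wct cE]]]] := pD_near Dc.
  have [al alE] := fpsec_ex a.
  pose V := opensI (opensI (domT a) Wb) Wc.
  have Va : V `<=` domT a by move=> y [[]].
  have Vb : V `<=` Wb by move=> y [[]].
  exists V, (res Va al * res Vb r); split=> [|t' Vt']; first by do 2 split=> //.
  have Dc' := proj1 (cE t' Vt'.2); have Ut' := cU _ Dc'.
  have [Db' rE'] := rE t' (Vb _ Vt').
  exists Ut'; rewrite -germ_mul (germ_res Va (Va _ Vt')) (germ_res Vb (Vb _ Vt')) alE /=.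
  apply: (@unit_cancel _ (fpw t' (val b (fpoint t')))); first by exists (germ (Vb _ Vt') r); rewrite mulrC.
  by rewrite -mulrA rE' mulr1 thg -!fplE -rmorphM E //; exact: (Va _ Vt').
exists h; split=> //.
- apply: mor_ext => [t|t U Ut Ut' s]; first by rewrite /= fpr1E hE.
  rewrite [LHS](@stalk_map_comp _ _ _ pr1 h t).
  have Ud : U (p1 (h t)) by rewrite hE.
  pose d : dom (@psin X1 X2 U (opensT _) s 1) (h t) := conj Ud Logic.I.
  have d' : dom (@psin X1 X2 U (opensT _) s 1) (fpoint t) by exact: (conj Ut' Logic.I).
  apply: (etrans (congr1 (stalk_map h t) (@fpr1S _ _ _ f1 f2 (h t) U Ut Ud s d))).
  apply: (etrans (hS t (domo f1 f2 (@psin X1 X2 U (opensT _) s 1)) d d' (psec f1 f2 (@psin X1 X2 U (opensT _) s 1)))).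
  apply: (etrans (congr1 (fpl t) (@pgermE _ _ _ f1 f2 (fpoint t) _ d'))); apply: (etrans (fplE _)).
  by rewrite (@val_in _ _ _ f1 f2 U (opensT _) s 1 (fpoint t) Ut' Logic.I) germ_one rmorph1 mulr1 fpw1.
- apply: mor_ext => [t|t U Ut Ut' s]; first by rewrite /= fpr2E hE.
  rewrite [LHS](@stalk_map_comp _ _ _ pr2 h t).
  have Ud : U (p2 (h t)) by rewrite hE.
  pose d : dom (@psin X1 X2 (opensT _) U 1 s) (h t) := conj Logic.I Ud.
  have d' : dom (@psin X1 X2 (opensT _) U 1 s) (fpoint t) by exact: (conj Logic.I Ut').
  apply: (etrans (congr1 (stalk_map h t) (@fpr2S _ _ _ f1 f2 (h t) U Ut Ud s d))).
  apply: (etrans (hS t (domo f1 f2 (@psin X1 X2 (opensT _) U 1 s)) d d' (psec f1 f2 (@psin X1 X2 (opensT _) U 1 s)))).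
  apply: (etrans (congr1 (fpl t) (@pgermE _ _ _ f1 f2 (fpoint t) _ d'))); apply: (etrans (fplE _)).
  by rewrite (@val_in _ _ _ f1 f2 (opensT _) U 1 s (fpoint t) Logic.I Ut') germ_one rmorph1 mul1r fpw2.
Qed.

End Mor.
End Universal.

(** * Charts of the fibre product *)

Section ChartGerms.
Context (B : comPzRingType) (X : lrs) (j : mor (spec_lrs B) X) (oj : open_immersion j).

Lemma chart_germ_ex (q : spec B) : exists g : {rmorphism B -> stalk (j q)},
  forall b, stalk_val _ (stalk_map j q (g b)) = locmap q b.
Proof.
have inj : injective (stalk_val q \o stalk_map j q).
  by move=> x y /stalk_val_inj; apply: (bij_inj (oi_stalk oj q)).
have sur z : exists x, (stalk_val q \o stalk_map j q) x = z.
  have [y <-] := stalk_val_surj z; have [k _ kK] := oi_stalk oj q.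
  by exists (k y); rewrite /= kK.
have [g [_ gK]] := bij_ex inj sur; exists (g \o locmap q) => b.
exact: gK.
Qed.
Definition chart_germ q := projT1 (cid (chart_germ_ex q)).
Lemma chart_germE q b : stalk_val _ (stalk_map j q (chart_germ q b)) = locmap q b.
Proof. by rewrite /chart_germ; case: cid. Qed.

Lemma chart_inj q x y : stalk_val _ (stalk_map j q x) = stalk_val _ (stalk_map j q y) -> x = y.
Proof. by move=> /stalk_val_inj; apply: (bij_inj (oi_stalk oj q)). Qed.

Lemma chart_germ_sec q b (Uq : rangeo oj (j q)) : germ Uq (chart_sec oj b) = chart_germ q b.
Proof. by apply: chart_inj; rewrite chart_germE; exact: chart_secE. Qed.

Lemma chart_germ_frac (q : spec B) z : exists b d : B, ~ q d /\ z * chart_germ q d = chart_germ q b.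
Proof.
have [b [d [nd e]]] : exists b d, ~ q d /\ stalk_val _ (stalk_map j q z) * locmap q d = locmap q b.
  by elim/frac_ind: (stalk_val _ _) => b d nd; exists b, d; rewrite locmap_frac.
exists b, d; split=> //; apply: chart_inj; rewrite chart_germE -e -(chart_germE q d).
by rewrite !rmorphM.
Qed.

Lemma chart_germ_unit (q : spec B) (b : B) : isunit (chart_germ q b) <-> ~ q b.
Proof.
split=> [u|nb].
  apply: locmap_unitP; rewrite -chart_germE; do 2 apply: isunit_rmorph; exact: u.
by apply: (@ev_unit _ _ j q); rewrite chart_germE; exact: locmap_unit.
Qed.

End ChartGerms.

Lemma chart_germ_pull (X Y : lrs) (f : mor X Y) (R B : comPzRingType) (phi : {rmorphism R -> B})
    (jY : mor (spec_lrs R) Y) (jX : mor (spec_lrs B) X) (oY : open_immersion jY) (oX : open_immersion jX)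
    (e : mor_comp f jX = mor_comp jY (spec_map phi)) (q : spec B) r (h : rangeo oY (f (jX q))) :
  stalk_map f (jX q) (germ h (chart_sec oY r)) = chart_germ oX q (phi r).
Proof.
apply: (chart_inj oX); rewrite chart_germE.
have h' : rangeo oY (mor_comp jY (spec_map phi) q) by exact: range_rangeo.
transitivity (@ev _ _ (mor_comp jY (spec_map phi)) q _ h' (chart_sec oY r)).
  rewrite /ev; congr (stalk_val _ _).
  by rewrite -[LHS](@stalk_map_comp _ _ _ f jX q); exact: (@stalk_map_eq _ _ (mor_comp f jX) _ q).
by rewrite ev_spec chart_secE localization_map_locmap.
Qed.

Lemma mulr_shuffle (A : comPzRingType) (g u b m : A) : g * (u * (b * m)) = u * (g * b * m).
Proof. by ring. Qed.

Section FiberCharts.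
Context (X1 X2 Y : lrs) (f1 : mor X1 Y) (f2 : mor X2 Y).
Context (R B1 B2 : comPzRingType) (phi1 : {rmorphism R -> B1}) (phi2 : {rmorphism R -> B2}).
Context (jY : mor (spec_lrs R) Y) (j1 : mor (spec_lrs B1) X1) (j2 : mor (spec_lrs B2) X2).
Context (oY : open_immersion jY) (o1 : open_immersion j1) (o2 : open_immersion j2).
Hypotheses (e1 : mor_comp f1 j1 = mor_comp jY (spec_map phi1))
  (e2 : mor_comp f2 j2 = mor_comp jY (spec_map phi2)).
Local Notation T := (tens phi1 phi2).
Local Notation i1 := (po1 (tens_rel phi1 phi2)).
Local Notation i2 := (po2 (tens_rel phi1 phi2)).
Local Notation P := (fp_lrs f1 f2).

Let a1 : mor (spec_lrs T) X1 := mor_comp j1 (spec_map i1).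
Let a2 : mor (spec_lrs T) X2 := mor_comp j2 (spec_map i2).

Fact fp_chart_comm : mor_comp f1 a1 = mor_comp f2 a2.
Proof.
rewrite /a1 /a2 !mor_compA e1 e2 -!mor_compA !spec_map_comp; congr (mor_comp jY (spec_map _)).
by apply: rmorph_ext => r; exact: tens_comm.
Qed.

Definition tgen (t : T) := projT1 (cid (po_gen t)).
Lemma tgenE t : t = \sum_(x <- tgen t) i1 x.1 * i2 x.2.
Proof. by rewrite /tgen; case: cid. Qed.

Definition pst (t : T) : ps X1 X2 :=
  existT _ (rangeo o1, rangeo o2) [seq (chart_sec o1 x.1, chart_sec o2 x.2) | x <- tgen t].

Lemma pst_dom (p : P) q1 q2 t : p1 p = j1 q1 -> p2 p = j2 q2 -> dom (pst t) p.
Proof. by move=> h1 h2; split; [rewrite h1|rewrite h2] => /=; exact: range_rangeo. Qed.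

Lemma kap (p : P) q1 q2 : p1 p = j1 q1 -> p2 p = j2 q2 ->
  exists k : {rmorphism T -> fpK f1 f2 (p1 p) (p2 p)}, [/\ forall t, val (pst t) p = k t,
    forall z, exists d1 d2 t, [/\ ~ q1 d1, ~ q2 d2 & z * k (i1 d1 * i2 d2) = k t],
    forall b, q1 b <-> pq p (k (i1 b)) & forall c, q2 c <-> pq p (k (i2 c))].
Proof.
case: p => x1 x2 e q l1 l2 /= h1 h2; subst x1 x2; pose p : P := FPt e l1 l2.
have rel r : fpRel f1 f2 (chart_germ o1 q1 (phi1 r)) (chart_germ o2 q2 (phi2 r)).
  have u1 : rangeo oY (f1 (j1 q1)).
    by rewrite -[f1 (j1 q1)]/(mor_comp f1 j1 q1) e1; exact: range_rangeo.
  have u2 : rangeo oY (f2 (j2 q2)).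
    by rewrite -[f2 (j2 q2)]/(mor_comp f2 j2 q2) e2; exact: range_rangeo.
  exists (rangeo oY), (chart_sec oY r), u1, u2.
  by split; apply: esym; [exact: chart_germ_pull e1 q1 r u1|exact: chart_germ_pull e2 q2 r u2].
have [k [k1 k2]] := @tens_lift R B1 phi1 B2 phi2 _ (po1 (@fpRel _ _ _ f1 f2 (j1 q1) (j2 q2)) \o chart_germ o1 q1)
  (po2 (@fpRel _ _ _ f1 f2 (j1 q1) (j2 q2)) \o chart_germ o2 q2) (fun r => po_rel (rel r)).
exists k; split.
- move=> t; have h : dom (pst t) p by exact: (@pst_dom p q1 q2).
  rewrite (valE h) [in RHS](tgenE t) rmorph_sum /pval big_map; apply: eq_bigr => x _.
  apply: (etrans _ (esym (rmorphM k _ _))); rewrite k1 k2 /=.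
  by rewrite (@chart_germ_sec _ _ _ o1 q1 x.1 h.1) (@chart_germ_sec _ _ _ o2 q2 x.2 h.2).
- elim/po_ind => [z|z|x y [d1 [d2 [t [n1 n2 E]]]] [d1' [d2' [t' [n1' n2' E']]]]|x y [d1 [d2 [t [n1 n2 E]]]] [d1' [d2' [t' [n1' n2' E']]]]].
  + have [b [d [nd E]]] := chart_germ_frac o1 z; exists d, 1, (i1 b); split=> //; first exact: prime_one.
    by rewrite !rmorph1 mulr1 !k1 /= -rmorphM E.
  + have [b [d [nd E]]] := chart_germ_frac o2 z; exists 1, d, (i2 b); split=> //; first exact: prime_one.
    by rewrite !rmorph1 mul1r !k2 /= -rmorphM E.
  + exists (d1 * d1'), (d2 * d2'), (t * (i1 d1' * i2 d2') + t' * (i1 d1 * i2 d2)); split; try exact: prime_mul.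
    rewrite (_ : i1 (d1 * d1') * i2 (d2 * d2') = (i1 d1 * i2 d2) * (i1 d1' * i2 d2')); last first.
      by rewrite !rmorphM mulrACA.
    rewrite (rmorphM k (i1 d1 * i2 d2)) (rmorphD k) (rmorphM k t) (rmorphM k t'); exact: frac_addE.
  + exists (d1 * d1'), (d2 * d2'), (t * t'); split; try exact: prime_mul.
    rewrite (_ : i1 (d1 * d1') * i2 (d2 * d2') = (i1 d1 * i2 d2) * (i1 d1' * i2 d2')); last first.
      by rewrite !rmorphM mulrACA.
    rewrite (rmorphM k (i1 d1 * i2 d2)) (rmorphM k t); exact: frac_mulE.
- move=> b; rewrite k1 /=; split=> [qb|h]; first by apply: (l1 _) => /chart_germ_unit.
  apply: contrapT => nb; apply: (@prime_one _ q); apply: ideal_unit h; apply: isunit_rmorph.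
  exact/chart_germ_unit.
- move=> b; rewrite k2 /=; split=> [qb|h]; first by apply: (l2 _) => /chart_germ_unit.
  apply: contrapT => nb; apply: (@prime_one _ q); apply: ideal_unit h; apply: isunit_rmorph.
  exact/chart_germ_unit.
Qed.

(** The morphism is given by the universal property. A point over the two charts is the image of the
    prime of [T] obtained by pulling back [pq p] along the map of [kap]; bijectivity on stalks
    follows by clearing the denominators of [kap]. *)
Lemma fp_chart : exists (h : mor (spec_lrs T) P), open_immersion h /\
  forall p : P, rangeo o1 (p1 p) -> rangeo o2 (p2 p) -> range h p.
Proof.
have [h [_ h1 h2]] := fp_lift_ex fp_chart_comm.
have hp1 Q : p1 (h Q) = j1 (spec_preimage i1 Q).
  by rewrite -fpr1E; exact: (congr1 (fun g : mor (spec_lrs T) X1 => g Q) h1).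
have hp2 Q : p2 (h Q) = j2 (spec_preimage i2 Q).
  by rewrite -fpr2E; exact: (congr1 (fun g : mor (spec_lrs T) X2 => g Q) h2).
have hd (Q : spec T) t : dom (pst t) (h Q) by exact: pst_dom (hp1 Q) (hp2 Q).
have hS (Q : spec T) t : stalk_val _ (stalk_map h Q (pgerm (hd Q t))) = locmap Q t.
  have u1 : rangeo o1 (mor_comp (fpr1 f1 f2) h Q) by rewrite h1; exact: range_rangeo.
  have u2 : rangeo o2 (mor_comp (fpr2 f1 f2) h Q) by rewrite h2; exact: range_rangeo.
  rewrite (mor_pgerm (hd Q t) u1 u2) [in RHS](tgenE t) !rmorph_sum big_map; apply: eq_bigr => x _.
  have v1 : rangeo o1 (a1 Q) by exact: range_rangeo.
  have v2 : rangeo o2 (a2 Q) by exact: range_rangeo.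
  rewrite !rmorphM; apply: (f_equal2 *%R).
  - transitivity (@ev _ _ a1 Q _ v1 (chart_sec o1 x.1)).
      exact: (congr1 (stalk_val Q) (@stalk_map_eq _ _ (mor_comp (fpr1 f1 f2) h) a1 Q _ u1 v1 _ h1)).
    by rewrite ev_spec chart_secE localization_map_locmap.
  - transitivity (@ev _ _ a2 Q _ v2 (chart_sec o2 x.2)).
      exact: (congr1 (stalk_val Q) (@stalk_map_eq _ _ (mor_comp (fpr2 f1 f2) h) a2 Q _ u2 v2 _ h2)).
    by rewrite ev_spec chart_secE localization_map_locmap.
have hD (Q : spec T) t : ~ pq (h Q) (val (pst t) (h Q)) <-> ~ Q t.
  split=> [/(pgerm_unitP (hd Q t)) u|nt].
    by apply: locmap_unitP; rewrite -hS; do 2 apply: isunit_rmorph.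
  apply/(pgerm_unitP (hd Q t)); apply: (@ev_unit _ _ h Q); rewrite hS; exact: locmap_unit.
have hD' (Q : spec T) t : pq (h Q) (val (pst t) (h Q)) <-> Q t.
  by split=> u; apply: contrapT => /hD.
have surj (p : P) : rangeo o1 (p1 p) -> rangeo o2 (p2 p) -> exists Q, h Q = p /\
    forall t, Q t <-> pq p (val (pst t) p).
  move=> [q1 _ /esym E1] [q2 _ /esym E2]; have [k [kE kf k1 k2]] := kap E1 E2.
  pose Q := spec_preimage k (pq p); exists Q.
  have QE t : Q t <-> pq p (val (pst t) p) by rewrite kE.
  have s1 : spec_preimage i1 Q = q1 by apply: spec_ext => b; rewrite k1.
  have s2 : spec_preimage i2 Q = q2 by apply: spec_ext => b; rewrite k2.
  have P1 : p1 (h Q) = p1 p by rewrite E1 -s1 hp1.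
  have P2 : p2 (h Q) = p2 p by rewrite E2 -s2 hp2.
  split=> //; apply: fpt_ext => // a da da'.
  have [d1 [d2 [t [n1 n2 E]]]] := kf (val a p); rewrite -!kE in E.
  have E' : val a (h Q) * val (pst (i1 d1 * i2 d2)) (h Q) = val (pst t) (h Q).
    move: (h Q) P1 P2 => p' P1 P2; move: E; clear -P1 P2.
    case: p p' P1 P2 => [x1 x2 e q l1 l2] [x1' x2' e' q' l1' l2'] /= P1 P2; subst x1' x2'.
    by rewrite (Prop_irrelevance e' e).
  have Qm : ~ Q (i1 d1 * i2 d2).
    by apply: prime_mul; [rewrite -s1 in n1|rewrite -s2 in n2].
  split=> m.
  - have : Q t by apply/hD'; rewrite -E'; exact: idealMr.
    by move/QE; rewrite -E => /(spec_prime (pq p)).2[//|/QE].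
  - have : Q t by apply/QE; rewrite -E; exact: idealMr.
    by move/hD'; rewrite -E' => /(spec_prime (pq (h Q))).2[//|/hD'].
exists h; split; last by move=> p u1 u2; have [Q [<- _]] := surj p u1 u2; exists Q.
apply: oi_criterion.
- move=> Q Q' e; apply: spec_ext => t; rewrite -(hD' Q) -(hD' Q') e; exact: iff_refl.
- move=> U oU; apply: open_local => _ [Q UQ <-]; have [z [nz zU]] := @spec_nbhd T (Opens oU) Q UQ.
  exists (pDo f1 f2 (pst z)); split=> [|p [[u1 u2] nd]]; first by split=> //; exact/hD.
  by have [Q' [Qp QE]] := surj p u1 u2; exists Q' => //; apply: zU => /QE.
- move=> Q; apply: bij_of => [x y /eqP|z].
    rewrite -subr_eq0 -rmorphB => /eqP w; apply/eqP; rewrite -subr_eq0; apply/eqP; move: w.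
    elim/germ_ind: (x - y) => U UQ s {x y} s0.
    have [a [b [da [db [nb E]]]]] := germ_frac UQ s.
    have [k [kE kf k1 k2]] := kap (hp1 Q) (hp2 Q).
    have [d1 [d2 [t [n1 n2 E']]]] := kf (val a (h Q)).
    set m := i1 d1 * i2 d2 in E'.
    have Qm : ~ Q m by exact: prime_mul.
    have E2' : pgerm da * pgerm (hd Q m) = pgerm (hd Q t).
      by apply: fpv_inj; rewrite rmorphM !pgermE -rmorphM !kE E'.
    have : stalk_val _ (stalk_map h Q (pgerm (hd Q t))) = 0.
      by rewrite -E2' -E !(rmorphM (stalk_map h Q)) s0 !mul0r rmorph0.
    rewrite hS => /locmap_eq0[u [nu ut]].
    have z0 : pgerm (hd Q u) * pgerm (hd Q t) = 0.
      by apply: fpv_inj; rewrite rmorphM !pgermE -rmorphM !kE -rmorphM ut !rmorph0.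
    have un (v : T) : ~ Q v -> isunit (pgerm (hd Q v)) by move=> nv; apply/pgerm_unitP/hD.
    have uu : isunit (pgerm (hd Q u) * (pgerm db * pgerm (hd Q m))).
      by apply: isunitM; [exact: un|apply: isunitM; [exact/pgerm_unitP|exact: un]].
    apply: (unit_cancel uu); rewrite mul0r -[RHS]z0 -E2' -E.
    exact: mulr_shuffle.
  have [a [u [nu E]]] : exists a u, ~ Q u /\ stalk_val Q z * locmap Q u = locmap Q a.
    by elim/frac_ind: (stalk_val Q z) => a u nu; exists a, u; rewrite locmap_frac.
  have [v vE] : isunit (pgerm (hd Q u)) by apply/pgerm_unitP/hD.
  exists (pgerm (hd Q a) * v); apply: stalk_val_inj; apply: (unit_cancel (locmap_unit nu)).
  rewrite E -(hS Q u) -(hS Q a) -rmorphM -(rmorphM (stalk_map h Q)) -mulrA [v * _]mulrC vE mulr1.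
  by [].
Qed.

End FiberCharts.

Lemma fp_affine (X1 X2 Y : scheme) (f1 : mor X1 Y) (f2 : mor X2 Y) (p : fp_lrs f1 f2) :
  exists (A : comPzRingType) (j : mor (spec_lrs A) (fp_lrs f1 f2)), open_immersion j /\ range j p.
Proof.
have [R [jY [oY rY]]] := scheme_affine (f1 (p1 p)).
have chart (X : scheme) (f : mor X Y) x : rangeo oY (f x) -> exists (B : comPzRingType)
    (phi : {rmorphism R -> B}) (j : mor (spec_lrs B) X) (o : open_immersion j),
    rangeo o x /\ mor_comp f j = mor_comp jY (spec_map phi).
  move=> Yx; have [B [j [o [Xx XN]]]] := @small_chart X x (opens_preimage (rs_cts f) (rangeo oY)) Yx.
  have Uf q : rangeo oY (mor_comp f j q) by apply: XN; exact: range_rangeo.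
  by have [phi e] := chart_factor Uf; exists B, phi, j, o.
have [B1 [phi1 [j1 [o1 [r1 e1]]]]] := chart X1 f1 (p1 p) rY.
have rY2 : rangeo oY (f2 (p2 p)) by rewrite -peq.
have [B2 [phi2 [j2 [o2 [r2 e2]]]]] := chart X2 f2 (p2 p) rY2.
have [h [oh rh]] := fp_chart oY o1 o2 e1 e2.
by exists (tens phi1 phi2), h; split=> //; exact: rh.
Qed.

Definition fp_scheme (X1 X2 Y : scheme) (f1 : mor X1 Y) (f2 : mor X2 Y) : scheme :=
  Scheme (@fp_affine X1 X2 Y f1 f2).

Lemma fp_is_fiber_product (X1 X2 Y : scheme) (f1 : mor X1 Y) (f2 : mor X2 Y) :
  @is_fiber_product X1 X2 Y (fp_scheme f1 f2) f1 f2 (fpr1 f1 f2) (fpr2 f1 f2).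
Proof.
split=> [|T a a' e]; first exact: fpr_comm.
have [h [_ h1 h2]] := fp_lift_ex e; exists h; split=> // h' [h1' h2'].
by apply: fp_mor_ext; rewrite ?h1 ?h2 ?h1' ?h2'.
Qed.

(** A map to the fibre product is a pair of lifts for [f] of the same data, and these coincide by
    uniqueness; so the diagonal has the lifting property too, and [hlp_flat] applies to it. *)
Lemma hlp_weakly_etale (X Y : scheme) (f : mor X Y) : henselian_lifting_property f -> weakly_etale f.
Proof.
move=> hf; split; first exact: hlp_flat.
have [fc fu] := fp_is_fiber_product f f.
have [D [[D1 D2] _]] := fu X (mor_id X) (mor_id X) erefl.
exists (fp_scheme f f), (fpr1 f f), (fpr2 f f), D; split; [exact: fp_is_fiber_product|exact: D1|exact: D2|].
apply: (@hlp_flat X (fp_scheme f f) D) => A I hI i a b e.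
pose b1 := mor_comp (fpr1 f f) b; pose b2 := mor_comp (fpr2 f f) b.
have b1i : mor_comp b1 i = a by rewrite /b1 -mor_compA -[X in mor_comp _ X]e mor_compA D1 mor_1comp.
have b2i : mor_comp b2 i = a by rewrite /b2 -mor_compA -[X in mor_comp _ X]e mor_compA D2 mor_1comp.
have fb : mor_comp f b2 = mor_comp f b1 by rewrite /b1 /b2 !mor_compA fc.
have [|c [_ cu]] := hf A I hI a (mor_comp f b1); first by rewrite -mor_compA b1i.
have b12 : b1 = b2 by rewrite -(cu b1) // -(cu b2).
exists b1; split=> [|c' [Dc' _]]; last by rewrite /b1 -Dc' mor_compA D1 mor_1comp.
split=> //; apply: fp_mor_ext; first by rewrite mor_compA D1 mor_1comp.
by rewrite mor_compA D2 mor_1comp b12.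
Qed.

(** * Weakly étale morphisms on charts *)

Lemma flat_local_inj (A B : comPzRingType) (phi : {rmorphism A -> B}) : aflat phi -> islocal B ->
  (forall a, isunit (phi a) -> isunit a) -> injective phi.
Proof.
move=> fphi lB ud x y e; apply/eqP; rewrite -subr_eq0; apply/eqP.
have [|J [c [b' [oneE cE]]]] := @aflat_ann _ _ phi (x - y) 1 fphi.
  by rewrite rmorphB e subrr mul0r.
have [i /isunitMl/ud[v vE]] := islocal_sum lB oneE.
by rewrite -[x - y]mulr1 -vE mulrA cE mul0r.
Qed.

Definition wet_charts (X Y : scheme) (f : mor X Y) :=
  forall (R B : comPzRingType) (phi : {rmorphism R -> B}) (jY : mor (spec_lrs R) Y)
    (jX : mor (spec_lrs B) X), open_immersion jY -> open_immersion jX ->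
    mor_comp f jX = mor_comp jY (spec_map phi) -> wet phi.

Lemma mor_spec_id (C : comPzRingType) (Z : lrs) (h : mor (spec_lrs C) Z) :
  mor_comp h (spec_map idfun) = h.
Proof.
apply: mor_ext_spec => [q|q U Uq Uq' s]; first by apply: (congr1 h); exact: spec_ext.
apply: (etrans (@ev_spec C C idfun Z h q U Uq s)).
have [a [u [d [nd H]]]] := ev_frac Uq' s.
have nd' : ~ (spec_preimage idfun q : spec C) d by exact: nd.
have [U1 [nu E]] := H _ nd; have [U2 [nu' E']] := H _ nd'.
have e1 : @ev C Z h (spec_preimage idfun q) U Uq s = ev U2 s by exact: ev_irr.
have e2 : ev Uq' s = ev U1 s by exact: ev_irr.
rewrite e2; apply: (unit_cancel (locmap_unit nu)); rewrite E.
apply: (etrans (congr1 (fun z => localization_map idfun q z * locmap q u) e1)).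
apply: (etrans (congr1 (fun z => localization_map idfun q (ev U2 s) * z) (esym (@localization_map_locmap _ _ idfun q u)))).
apply: (etrans (esym (rmorphM (localization_map idfun q) _ _))).
apply: (etrans (congr1 (localization_map idfun q) E')).
exact: localization_map_locmap.
Qed.

(** At a prime [Q] on the diagonal, b (x) 1 and 1 (x) b agree in the local ring: the two projections
    agree after the diagonal, whose stalk maps are flat and local, hence injective. So the
    annihilator of the difference is comaximal with the kernel of the multiplication, and the
    component of 1 in it is the required [t]. *)
Lemma weakly_etale_charts (X Y : scheme) (f : mor X Y) : weakly_etale f -> wet_charts f.
Proof.
move=> [ff [P [pr1 [pr2 [D [[fc fu] D1 D2 fD]]]]]] R B phi jY jX oY oX e.
split; first by apply: flat_at_local => q; apply/flat_atP/(chart_flat q oY oX e)/aflatP/ff.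
move=> b; pose i1 := po1 (tens_rel phi phi); pose i2 := po2 (tens_rel phi phi).
pose c1 : mor (Spec (tens phi phi)) X := mor_comp jX (spec_map i1).
pose c2 : mor (Spec (tens phi phi)) X := mor_comp jX (spec_map i2).
have c12 : mor_comp f c1 = mor_comp f c2.
  rewrite /c1 /c2 !mor_compA e -!mor_compA !spec_map_comp; congr (mor_comp jY (spec_map _)).
  by apply: rmorph_ext => r; exact: tens_comm.
have [h [[h1 h2] _]] := fu _ _ _ c12.
pose mu := tens_mu phi.
have hmu : mor_comp h (spec_map mu) = mor_comp D jX.
  have [k [_ ku]] := fu (Spec B) jX jX erefl.
  have J1 : mor_comp jX (spec_map idfun) = jX := mor_spec_id jX.
  have m1 : (mu \o i1 : {rmorphism _ -> _}) = idfun by apply: rmorph_ext => x; exact: tens_mu1.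
  have m2 : (mu \o i2 : {rmorphism _ -> _}) = idfun by apply: rmorph_ext => x; exact: tens_mu2.
  have E1 : mor_comp pr1 (mor_comp h (spec_map mu)) = jX.
    rewrite mor_compA h1 /c1 -mor_compA spec_map_comp m1; exact: J1.
  have E2 : mor_comp pr2 (mor_comp h (spec_map mu)) = jX.
    rewrite mor_compA h2 /c2 -mor_compA spec_map_comp m2; exact: J1.
  have E3 : mor_comp pr1 (mor_comp D jX) = jX by rewrite mor_compA D1 mor_1comp.
  have E4 : mor_comp pr2 (mor_comp D jX) = jX by rewrite mor_compA D2 mor_1comp.
  exact: (etrans (esym (ku (mor_comp h (spec_map mu)) (conj E1 E2))) (ku (mor_comp D jX) (conj E3 E4))).
pose x0 (Q : spec (tens phi phi)) : spec B := spec_preimage i1 Q.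
pose S t := (i1 b - i2 b) * t = 0.
have S0 : S 0 by rewrite /S mulr0.
have SD u v : S u -> S v -> S (u + v) by rewrite /S mulrDr => -> ->; rewrite addr0.
have SM a u : S u -> S (a * u) by rewrite /S mulrCA => ->; rewrite mulr0.
pose J := ideal_preimage mu (ideal_zero B).
have /ideal_addE[t [k [St Jk tk]]] : ideal_add (Ideal S0 SD SM) J 1.
  apply: ideal_one => Q SQ.
  have JQ z : J z -> Q z by move=> Jz; apply: SQ; exact: ideal_addr.
  have QE : spec_map mu (x0 Q) = Q.
    apply: spec_ext => z; rewrite /x0 /=.
    have Jz : Q (i1 (mu z) - z).
      apply: JQ; suff : mu (i1 (mu z) - z) = 0 by [].
      by rewrite rmorphB tens_mu1 subrr.
    split=> [Qz|Qz]; first by rewrite -(subKr (i1 (mu z)) z); apply: idealB.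
    by rewrite -(subrK z (i1 (mu z))); apply: idealD.
  have hQ : h Q = D (jX (x0 Q)).
    by rewrite -{1}QE; exact: (congr1 (fun g : mor (spec_lrs B) P => g (x0 Q)) hmu).
  have same (U : opens X) (s : sec X U) (x : X) : forall p, p = D x -> forall (u1 : U (pr1 p)) (u2 : U (pr2 p)),
      stalk_map pr1 p (germ u1 s) = stalk_map pr2 p (germ u2 s).
    move=> _ -> u1 u2; have [m lm] := local_ringP (lrs_local x).
    apply: (@flat_local_inj _ _ (stalk_map D x)); first exact/aflatP/fD.
    - exact: is_localW lm.
    - by move=> a; exact: mor_unit.
    rewrite -[LHS](@stalk_map_comp _ _ _ pr1 D x) -[RHS](@stalk_map_comp _ _ _ pr2 D x).
    exact: (@stalk_map_eq X X (mor_comp pr1 D) (mor_comp pr2 D) x U u1 u2 s (etrans D1 (esym D2))).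
  have v1 : rangeo oX (c1 Q) by exact: range_rangeo.
  have v2 : rangeo oX (c2 Q) by exact: range_rangeo.
  have u1 : rangeo oX (pr1 (h Q)) by rewrite -[pr1 _]/(mor_comp pr1 h Q) h1.
  have u2 : rangeo oX (pr2 (h Q)) by rewrite -[pr2 _]/(mor_comp pr2 h Q) h2.
  have E : locmap Q (i1 b) = locmap Q (i2 b).
    transitivity (@ev _ X c1 Q _ v1 (chart_sec oX b)).
      by rewrite ev_spec chart_secE localization_map_locmap.
    transitivity (@ev _ X c2 Q _ v2 (chart_sec oX b)); last first.
      by rewrite ev_spec chart_secE localization_map_locmap.
    apply: (congr1 (stalk_val Q)).
    apply: (etrans (@stalk_map_eq _ X c1 (mor_comp pr1 h) Q _ v1 u1 _ (esym h1))).
    apply: (etrans (@stalk_map_comp _ _ _ pr1 h Q _)).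
    apply: (etrans (congr1 (stalk_map h Q) (@same _ (chart_sec oX b) _ _ hQ u1 u2))).
    apply: (etrans (esym (@stalk_map_comp _ _ _ pr2 h Q _))).
    exact: (@stalk_map_eq _ X (mor_comp pr2 h) c2 Q _ u2 v2 _ h2).
  have /locmap_eq0[u [nu uE]] : locmap Q (i1 b - i2 b) = 0 by rewrite rmorphB E subrr.
  by apply/nu/SQ; apply: ideal_addl; rewrite /= /S mulrC.
have mk : mu k = 0 by [].
exists t; split; first by have := congr1 mu tk; rewrite rmorphD mk addr0 rmorph1.
by apply/eqP; rewrite -subr_eq0 -mulrBl; apply/eqP.
Qed.

(** * Uniqueness of lifts *)

Section LocalUniqueness.
Context (X Y : scheme) (f : mor X Y) (wf : wet_charts f).

(** [g] and [g'] combine to a map [G] on the tensor product. Modulo [I] they agree, so [G z] is 1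
    modulo [I], a unit of the local ring; cancelling it from the image of (b (x) 1) z = (1 (x) b) z
    gives [g b] = [g' b]. *)
Lemma local_uniq (Q : comPzRingType) (m I : ideal Q) (h h' : mor (spec_lrs Q) X) :
  is_local m -> ~ I 1 -> mor_comp f h = mor_comp f h' ->
  mor_comp h (spec_map (quotient_proj I)) = mor_comp h' (spec_map (quotient_proj I)) -> h = h'.
Proof.
move=> lm I1 fh hI; have [p pm] := spec_of_max lm.
have [t tE] : exists t : spec (quotient_ring I), forall x, t (quotient_proj I x) <-> p x.
  by apply: quot_prime => y Iy; apply/pm; exact: (is_local_sub lm I1).
have pE : p = spec_map (quotient_proj I) t by apply: spec_ext => y; rewrite -tE.
have [R [B [phi [jY [jX [oY [oX [rX e]]]]]]]] := compatible_charts f (h p).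
have rX' : rangeo oX (h' p).
  have E : h p = h' p.
    by rewrite pE; exact: (congr1 (fun g : mor (spec_lrs (quotient_ring I)) X => g t) hI).
  by rewrite -E.
have [g gE] := @chart_factor _ _ _ oX Q h (@local_open Q m p (opens_preimage (rs_cts h) (rangeo oX)) lm pm rX).
have [g' g'E] := @chart_factor _ _ _ oX Q h' (@local_open Q m p (opens_preimage (rs_cts h') (rangeo oX)) lm pm rX').
have gphi r : g (phi r) = g' (phi r).
  have E : (g \o phi : {rmorphism R -> Q}) = g' \o phi.
    by apply: (chart_mono oY); rewrite -!spec_map_comp !mor_compA -e -!mor_compA -gE -g'E.
  exact: (congr1 (fun k : {rmorphism R -> Q} => k r) E).
have gI b : quotient_proj I (g b) = quotient_proj I (g' b).
  have E : (quotient_proj I \o g : {rmorphism B -> _}) = quotient_proj I \o g'.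
    by apply: (chart_mono oX); rewrite -!spec_map_comp !mor_compA -gE -g'E.
  exact: (congr1 (fun k : {rmorphism B -> quotient_ring I} => k b) E).
rewrite gE g'E; congr (mor_comp jX (spec_map _)); apply: rmorph_ext => b.
have [_ pu] := wf oY oX e; have [z [z1 bz]] := pu b.
have [G [G1 G2]] := @tens_lift _ _ phi _ phi _ g g' gphi.
have Gz : quotient_proj I (G z) = 1.
  rewrite -[LHS]/((quotient_proj I \o G) z) (tens_mu_diag (h := quotient_proj I \o G) z) => [|x /=].
    by rewrite z1 !rmorph1.
  by rewrite G1 G2 gI.
have uz : isunit (G z).
  apply: lm.2 => mz; apply: lm.1; rewrite -(subrK (G z) 1); apply: idealD => //.
  by apply: (is_local_sub lm I1); apply/qproj_eq0; rewrite rmorphB rmorph1 Gz subrr.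
by apply: (unit_cancel uz); rewrite -G1 -G2 -!rmorphM bz.
Qed.

Lemma mor_ext_local (C : comPzRingType) (Z : lrs) (h h' : mor (spec_lrs C) Z) :
  (forall m : spec C, maximal_ideal m ->
    mor_comp h (spec_map (locmap m)) = mor_comp h' (spec_map (locmap m))) -> h = h'.
Proof.
move=> H; have loc (q : spec C) : exists (m : spec C) (q' : spec (localization m)),
    maximal_ideal m /\ spec_map (locmap m) q' = q.
  have [m [mm qm]] := maxideal_exists (@prime_one _ q).
  pose m' := SpecPoint (maxideal_prime mm).
  have [|q' q'E] := loc_prime (mset_prime m') (locmap_loc m') (p := q).
    by move=> u nu qu; apply: nu; exact: qm.
  by exists m', q'; split=> //; exact: spec_ext.
have E (q : spec C) : h q = h' q.
  have [m [q' [mm <-]]] := loc q.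
  exact: (congr1 (fun g : mor (spec_lrs (localization m)) Z => g q') (H m mm)).
apply: mor_ext_spec => // q U Uq Uq' s; have [m [q' [mm qE]]] := loc q; subst q.
have [inj _] := loc_stalk_bij (mset_prime m) (locmap_loc m) q'; apply: inj.
rewrite -[LHS](@ev_spec _ _ (locmap m) Z h q') -[RHS](@ev_spec _ _ (locmap m) Z h' q').
exact: (congr1 (stalk_val q') (@stalk_map_eq _ _ (mor_comp h (spec_map (locmap m))) (mor_comp h' (spec_map (locmap m))) q' U Uq Uq' s (H m mm))).
Qed.

(** Being in the radical, [I] stays proper after localization at a maximal ideal, where [local_uniq]
    applies. *)
Lemma global_uniq (C : comPzRingType) (I : ideal C) (h h' : mor (spec_lrs C) X) :
  I `<=` @jacobson_radical C -> mor_comp f h = mor_comp f h' ->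
  mor_comp h (spec_map (quotient_proj I)) = mor_comp h' (spec_map (quotient_proj I)) -> h = h'.
Proof.
move=> IJ fh hI; apply: mor_ext_local => m mm.
pose K := ext_ideal (locmap m) I.
have K1 : ~ K 1.
  move=> K1; apply: (@localization_max1 _ m); apply: (ext_ideal_sub _ K1) => a Ia.
  by apply/localization_max_locmap; exact: IJ.
apply: (@local_uniq _ (localization_max m) K) => //.
- exact: localization_is_local.
- by rewrite !mor_compA fh.
have [g gE] : exists g : {rmorphism quotient_ring I -> quotient_ring K},
    forall x, g (quotient_proj I x) = quotient_proj K (locmap m x).
  by apply: (qproj_lift (f := quotient_proj K \o locmap m)) => x Ix; apply/qproj_eq0; exact: ext_ideal_gen.
rewrite -!mor_compA !spec_map_comp.
have -> : (quotient_proj K \o locmap m : {rmorphism _ -> _}) = g \o quotient_proj I.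
  by apply: rmorph_ext => x; rewrite /= gE.
by rewrite -!spec_map_comp !mor_compA hI.
Qed.

End LocalUniqueness.


Section SpecComp.
Context (A B C : comPzRingType) (Z : lrs).

Lemma mor_comp_spec (h : mor (spec_lrs A) Z) (u : {rmorphism A -> B}) (v : {rmorphism B -> C}) :
  mor_comp (mor_comp h (spec_map u)) (spec_map v) = mor_comp h (spec_map (v \o u)).
Proof. by rewrite -mor_compA spec_map_comp. Qed.

Lemma spec_map_eq (h : mor (spec_lrs A) Z) (u v : {rmorphism A -> B}) :
  u =1 v -> mor_comp h (spec_map u) = mor_comp h (spec_map v).
Proof. by move=> e; rewrite (rmorph_ext e). Qed.

End SpecComp.

Lemma mset_pow (A : comPzRingType) (g : A) : mset (fun u => exists n, u = g ^+ n).
Proof.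
split; first by exists 0%N; rewrite expr0.
by move=> _ _ [m ->] [n ->]; exists (m + n)%N; rewrite exprD.
Qed.

Lemma prime_pow (A : comPzRingType) (p : spec A) g n : ~ p g -> ~ p (g ^+ n).
Proof.
move=> pg; elim: n => [|n IH]; first by rewrite expr0; exact: prime_one.
by rewrite exprS => /(spec_prime p).2[].
Qed.

Lemma localization_max_unit (A : comPzRingType) (p : spec A) z :
  isunit z <-> ~ localization_max p z.
Proof.
have [k u] := localization_is_local p; split=> [uz mz|/u//].
exact: k (ideal_unit uz mz).
Qed.

(** * Sections of a weakly étale algebra at the primes containing J *)

Section WetChart.
Context (S R B C : comPzRingType) (J : ideal S) (g : S) (sg : {rmorphism S -> C})
  (r : {rmorphism R -> C}) (phi : {rmorphism R -> B}).
Local Notation CJ := (quotient_ring (ext_ideal sg J)).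
Local Notation pr := (quotient_proj (ext_ideal sg J)).
Context (beta : {rmorphism B -> CJ}).
Hypotheses (gS : good S) (lsg : is_loc (fun u => exists n, u = g ^+ n) sg) (wphi : wet phi).
Hypothesis betaE : forall x, beta (phi x) = pr (r x).
Local Notation T := (tens phi r).
Local Notation i1 := (po1 (tens_rel phi r)).
Local Notation i2 := (po2 (tens_rel phi r)).

(** Through [om] the prime [q] determines a prime [n] of [T]. The local ring of [T] at [n] is weakly
    étale over the good local ring of [C] under it, which is that of [S] at [q]; by [wet_local_bij]
    all three coincide, and [eta] is the resulting map. The last clause presents each element of [T]
    near [n] as a fraction over [S]. *)
Lemma wet_point (om : {rmorphism T -> CJ}) (om2 : forall c, om (i2 c) = pr c) (q : spec S) :
  J `<=` q -> ~ q g ->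
  exists (eta : {rmorphism T -> localization q}) (t : spec CJ),
  [/\ forall x, t (pr (sg x)) <-> q x,
      forall x, eta (i2 (sg x)) = locmap q x,
      forall x, isunit (eta x) <-> ~ t (om x)
    & forall x, exists (u s0 : S) (w : T), [/\ ~ q u, isunit (eta w) & w * (i2 (sg u) * x - i2 (sg s0)) = 0]].
Proof.
move=> Jq gq.
have [|qC qCE] := loc_prime (mset_pow g) lsg (p := q).
  by move=> _ [n ->]; exact: prime_pow.
have [|t tE] := @quot_prime _ (ext_ideal sg J) qC.
  by apply: ext_ideal_sub => x Jx; apply/qCE; exact: Jq.
pose n : spec T := spec_preimage om t.
have n2 c : spec_preimage i2 n c <-> qC c.
  by rewrite -[spec_preimage i2 n c]/(t (om (i2 c))) om2 tE.
have tq x : t (pr (sg x)) <-> q x by rewrite tE qCE.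
have qE : q = spec_preimage sg (spec_preimage i2 n).
  by apply: spec_ext => x; rewrite -qCE -n2.
pose L1 := localization_map i2 n.
have gC : good (localization (spec_preimage i2 n)).
  by apply: (good_loc (mset_prime _) (locmap_loc _)); exact: (good_loc (mset_pow g) lsg gS).
have wL : wet L1.
  apply: (@wet_loc _ _ _ _ i2 _ (locmap n) _ (locmap (spec_preimage i2 n)) L1 _ (mset_prime n) (locmap_loc n) (mset_prime _) (locmap_loc _)).
    by move=> x; exact: (esym (localization_map_locmap _ _ _)).
  exact: wet_base.
have [s1 k1] := wet_local_bij gC (localization_is_local _) (localization_is_local n) wL
  (fun z mz => contrapT (fun nm => (localization_max_unit z).1 (@ev_spec_unit _ _ i2 n z ((localization_max_unit _).2 nm)) mz)).
move: Jq gq qCE tq; rewrite {}qE => {q} Jq gq qCE tq.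
pose L2 := localization_map sg (spec_preimage i2 n).
have [inj2 s2] := loc_stalk_bij (mset_pow g) lsg (spec_preimage i2 n).
pose F : {rmorphism localization (spec_preimage sg (spec_preimage i2 n)) -> localization n} := L1 \o L2.
have FE x : F (locmap _ x) = locmap n (i2 (sg x)).
  apply: (etrans (congr1 L1 (localization_map_locmap _ _ _))).
  exact: localization_map_locmap.
have injF : injective F.
  move=> x y e; apply: inj2; apply/eqP; rewrite -subr_eq0; apply/eqP; apply: k1.
  rewrite rmorphB; apply/eqP; rewrite subr_eq0; apply/eqP; exact: e.
have surF z : exists x, F x = z.
  by have [y ->] := s1 z; have [x <-] := s2 y; exists x.
have [G [FG GF]] := bij_ex injF surF.
pose eta : {rmorphism T -> localization (spec_preimage sg (spec_preimage i2 n))} := G \o locmap n.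
have Feta x : F (eta x) = locmap n x by exact: GF.
have etan x : isunit (eta x) <-> ~ n x.
  split=> [u|nx]; last exact: (isunit_rmorph G (locmap_unit nx)).
  by apply: locmap_unitP; rewrite -Feta; exact: (isunit_rmorph F u).
have etaE x : eta (i2 (sg x)) = locmap _ x by apply: injF; rewrite Feta FE.
exists eta, t; split=> // x.
have [_ fr _] := locmap_loc (spec_preimage sg (spec_preimage i2 n)).
have [s0 [u [nu e]]] := fr (eta x); exists u, s0.
have /locmap_eq0[w [nw wE]] : locmap n (i2 (sg u) * x - i2 (sg s0)) = 0.
  rewrite -Feta rmorphB rmorphM !etaE mulrC e subrr; exact: rmorph0.
by exists w; split=> //; apply/etan.
Qed.

(** The maps of [wet_point], with what is needed to vary [q]. The invertibility of an element is an
    open condition on [q]; a prime of [T] all of whose elements fail to be units somewhere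
    specialises to the point of one single [q], because the primes in question come from the
    quotient [CJ] of [T]; and [eta] reduces to [beta] modulo [J]. *)
Lemma wet_chart : exists eta : forall q : spec S, J `<=` q -> ~ q g -> {rmorphism T -> localization q},
  [/\ forall (q : spec S) Jq gq (x : S), eta q Jq gq (i2 (sg x)) = locmap q x,
      forall (q : spec S) Jq gq (x : T), exists (u s0 : S) (w : T),
        [/\ ~ q u, isunit (eta q Jq gq w) & w * (i2 (sg u) * x - i2 (sg s0)) = 0],
      forall w : T, exists s : S, forall (q : spec S) Jq gq, isunit (eta q Jq gq w) <-> ~ q s,
      forall P : spec T, (forall x : T, P x -> ~ forall (q : spec S) Jq gq, isunit (eta q Jq gq x)) ->
        exists (q : spec S) Jq gq, forall x : T, P x -> ~ isunit (eta q Jq gq x)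
    & forall (q : spec S) Jq gq, exists k : {rmorphism CJ -> quotient_ring (ext_ideal (locmap q) J)},
        (forall x : S, k (pr (sg x)) = quotient_proj _ (locmap q x)) /\
        forall x : B, k (beta x) = quotient_proj _ (eta q Jq gq (i1 x))].
Proof.
have [om [om1 om2]] := @tens_lift _ _ phi _ r _ beta pr betaE.
have ex (q : spec S) Jq gq := wet_point om2 (q := q) Jq gq.
pose eta (q : spec S) Jq gq := projT1 (cid (ex q Jq gq)).
have etaP (q : spec S) Jq gq : exists t : spec CJ,
  [/\ forall x, t (pr (sg x)) <-> q x,
      forall x, eta q Jq gq (i2 (sg x)) = locmap q x,
      forall x, isunit (eta q Jq gq x) <-> ~ t (om x)
    & forall x, exists (u s0 : S) (w : T), [/\ ~ q u, isunit (eta q Jq gq w) & w * (i2 (sg u) * x - i2 (sg s0)) = 0]].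
  by rewrite /eta; case: cid.
have num (w : T) : exists (c : C) (a0 : S) (n : nat), [/\ om w = pr c, c * sg (g ^+ n) = sg a0
    & forall t : spec CJ, ~ t (pr (sg g)) -> (t (om w) <-> t (pr (sg a0)))].
  have [c cE] := qproj_surj (om w); have [_ fr _] := lsg.
  have [a0 [_ [[n ->] e]]] := fr c; exists c, a0, n; split=> // t tg; rewrite cE -e rmorphM.
  split=> [|/(spec_prime t).2[//|]]; first exact: idealMr.
  by rewrite rmorphXn rmorphXn => /(prime_pow tg).
have unitw (q : spec S) Jq gq w (c : C) (a0 : S) : om w = pr c -> (exists n, c * sg (g ^+ n) = sg a0) ->
    isunit (eta q Jq gq w) -> ~ q a0.
  move=> cE [n e]; have [t [tq _ tu _]] := etaP q Jq gq.
  move=> /tu ntw qa; apply: ntw; rewrite cE.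
  have /(spec_prime t).2[//|] : t (pr c * pr (sg (g ^+ n))).
    by rewrite -rmorphM e; apply/tq.
  by rewrite rmorphXn rmorphXn => /prime_pow[] /tq.
exists eta; split.
- by move=> q Jq gq; have [t []] := etaP q Jq gq.
- by move=> q Jq gq; have [t []] := etaP q Jq gq.
- move=> w; have [c [a0 [n [cE e H]]]] := num w; exists a0 => q Jq gq.
  have [t [tq _ tu _]] := etaP q Jq gq; rewrite tu H ?tq //.
- move=> P PE.
  pose K z := exists2 x, P x & z = om x.
  have K0 : K 0 by exists 0; rewrite ?rmorph0 //; exact: ideal0.
  have KD u v : K u -> K v -> K (u + v).
    by move=> [x Px ->] [y Py ->]; exists (x + y); rewrite ?rmorphD //; exact: idealD.
  have KM u v : K v -> K (u * v).
    move=> [y Py ->]; have [c ->] := qproj_surj u; exists (i2 c * y); first exact: idealMl.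
    by rewrite rmorphM om2.
  have K1 : ~ Ideal K0 KD KM 1.
    move=> [x Px e]; apply: (PE x Px) => q Jq gq; have [t [_ _ tu _]] := etaP q Jq gq.
    by apply/tu; rewrite -e; exact: prime_one.
  have [m [mm Km]] := maxideal_exists K1; pose t0 := SpecPoint (maxideal_prime mm).
  pose q : spec S := spec_preimage (pr \o sg) t0.
  have Jq : J `<=` q.
    move=> x Jx; have /qproj_eq0 e : ext_ideal sg J (sg x) by exact: ext_ideal_gen.
    by rewrite /q /= e; exact: (ideal0 m).
  have gq : ~ q g.
    move=> qg; have [un _ _] := lsg; have [|y e] := un g; first by exists 1%N; rewrite expr1.
    have : t0 (pr (sg g)) by exact: qg.
    move=> /(idealMr (pr y)); rewrite -rmorphM e rmorph1; exact: prime_one.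
  exists q, Jq, gq => x Px /=; have [t [tq _ tu _]] := etaP q Jq gq.
  move=> /tu; apply; have [c [a0 [n [cE e H]]]] := num x.
  apply/H; first by move=> /tq.
  apply/tq; have : t0 (om x) by apply: Km; exists x.
  by move=> /(H t0 gq).
- move=> q Jq gq; have [t [tq etaE tu fr]] := etaP q Jq gq.
  have [|v vE] := loc_lift (f := locmap q) lsg.
    by move=> _ [n ->]; apply: locmap_unit; exact: prime_pow.
  pose pK := quotient_proj (ext_ideal (locmap q) J).
  have [|k kE] := qproj_lift (I := ext_ideal sg J) (f := pK \o v).
    move=> x; have sub : ext_ideal sg J `<=` ideal_preimage v (ext_ideal (locmap q) J).
      by apply: ext_ideal_sub => y Jy; rewrite /= vE; exact: ext_ideal_gen.
    by move=> /sub Kx; apply/qproj_eq0.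
  have kS x : k (pr (sg x)) = pK (locmap q x) by rewrite kE /= vE.
  exists k; split=> // x.
  have [u [s0 [w [nu uw e]]]] := fr (i1 x).
  have uu : isunit (pK (locmap q u)) by apply: isunit_rmorph; exact: locmap_unit.
  have [c [a0 [n [cE eca H]]]] := num w.
  have na0 : ~ q a0 by apply: (unitw q Jq gq w c a0 cE) => //; exists n.
  have ukw : isunit (k (om w)).
    rewrite cE kE /=; apply: isunit_rmorph; apply: (@isunitMl _ _ (v (sg (g ^+ n)))).
    by rewrite -rmorphM eca vE; exact: locmap_unit.
  have upw : isunit (pK (eta q Jq gq w)) by exact: isunit_rmorph.
  apply: (unit_cancel uu).
  have E1 : k (om (i2 (sg u) * i1 x - i2 (sg s0))) = 0.
    apply: (unit_cancel ukw); rewrite mul0r -!rmorphM mulrC e; by rewrite !rmorph0.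
  have E2 : pK (eta q Jq gq (i2 (sg u) * i1 x - i2 (sg s0))) = 0.
    apply: (unit_cancel upw); rewrite mul0r -!rmorphM mulrC e; by rewrite !rmorph0.
  move: E1 E2; rewrite !rmorphB !rmorphM !om2 om1 !etaE !kS mulrC.
  by move=> /eqP; rewrite subr_eq0 => /eqP -> /eqP; rewrite subr_eq0 mulrC => /eqP ->.
Qed.

End WetChart.

Lemma spec_qc (C : comPzRingType) (I : Type) (D : I -> spec C -> Prop) :
  (forall q : spec C, exists i x, ~ q x /\ forall q' : spec C, ~ q' x -> D i q') ->
  exists (T : finType) (F : T -> I), forall q, exists k, D (F k) q.
Proof.
move=> H.
pose K x := exists (T : finType) (F : T -> I), forall q : spec C, ~ q x -> exists k, D (F k) q.
have K0 : K 0.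
  by exists void, (fun v : void => match v with end) => q []; exact: ideal0.
have KD x y : K x -> K y -> K (x + y).
  move=> [T1 [F1 H1]] [T2 [F2 H2]].
  exists (T1 + T2)%type, (fun k => match k with inl a => F1 a | inr b => F2 b end) => q nq.
  have [qx|nx] := pselect (q x); last by have [k Dk] := H1 q nx; exists (inl k).
  have [qy|ny] := pselect (q y); last by have [k Dk] := H2 q ny; exists (inr k).
  by case: nq; exact: idealD.
have KM x y : K y -> K (x * y).
  move=> [T [F HF]]; exists T, F => q nq; apply: HF => qy; apply: nq; exact: idealMl.
have /= [T [F HF]] : Ideal K0 KD KM 1.
  apply: ideal_one => q Kq; have [i [x [nx Dx]]] := H q; apply/nx/Kq.
  by exists unit, (fun=> i) => q' /Dx Di; exists tt.
by exists T, F => q; apply: HF; exact: prime_one.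
Qed.

(** * Values at the closed point of a local spectrum *)

Section ClosedPoint.
Context (S : comPzRingType) (p : spec S).

Definition closed_pt : spec (localization p) :=
  projT1 (cid (spec_of_max (localization_is_local p))).

Lemma closed_ptE z : closed_pt z <-> localization_max p z.
Proof. by rewrite /closed_pt; case: cid. Qed.

Lemma closed_pt_unit z : isunit z <-> ~ closed_pt z.
Proof. by rewrite localization_max_unit closed_ptE. Qed.

Lemma closed_pt_locmap x : closed_pt (locmap p x) <-> p x.
Proof. by rewrite closed_ptE localization_max_locmap. Qed.

Lemma unloc_ex : exists g : {rmorphism localization closed_pt -> localization p},
  cancel (locmap closed_pt) g /\ cancel g (locmap closed_pt).
Proof.
have inj : injective (locmap closed_pt).
  move=> x y e; have /locmap_eq0[u [/closed_pt_unit uu e']] : locmap closed_pt (x - y) = 0.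
    by rewrite rmorphB e subrr.
  apply/eqP; rewrite -subr_eq0; apply/eqP; apply: (unit_cancel uu).
  by rewrite mul0r mulrC.
have [|g [gK gV]] := bij_ex inj; last by exists g.
move=> z; have [_ fr _] := locmap_loc closed_pt; have [a [u [/closed_pt_unit uu e]]] := fr z.
have [v uv] := uu; exists (a * v); apply: (unit_cancel (isunit_rmorph (locmap closed_pt) uu)).
by rewrite e -rmorphM -mulrA (mulrC v) uv mulr1.
Qed.

Definition unloc := projT1 (cid unloc_ex).

Lemma unlocK : cancel (locmap closed_pt) unloc.
Proof. by rewrite /unloc; case: cid => g []. Qed.

Lemma unlocV : cancel unloc (locmap closed_pt).
Proof. by rewrite /unloc; case: cid => g []. Qed.

Context (Z : lrs) (H : mor (spec_lrs (localization p)) Z).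

(** A value at the closed point lies in the local ring there; [unloc] brings it back to
    [localization p] itself. *)
Definition val_at : {rmorphism stalk (H closed_pt) -> localization p} :=
  unloc \o (@stalk_val _ closed_pt \o stalk_map H closed_pt).

Lemma val_at_unit z : isunit (val_at z) -> isunit z.
Proof.
move=> u; apply: (@ev_unit _ _ H closed_pt).
have -> : stalk_val _ (stalk_map H closed_pt z) = locmap closed_pt (val_at z) by rewrite [RHS]unlocV.
exact: isunit_rmorph.
Qed.

End ClosedPoint.

(** One fraction c / d, valid on the basic open set of [e], gives the value of [s] under all
    morphisms from local spectra through [j] that make [e] invertible; the value depends on the
    images of [c] and [d] alone. *)
Lemma sec_frac (B : comPzRingType) (Z : lrs) (j : mor (spec_lrs B) Z) (y : spec B)
    (U : opens Z) (Uy : U (j y)) (s : sec Z U) :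
  exists c d e : B, [/\ ~ y e, forall y' : spec B, ~ y' e ->
      exists U' : U (j y'), ~ y' d /\ ev U' s * locmap y' d = locmap y' c &
    forall (S : comPzRingType) (p : spec S) (th : {rmorphism B -> localization p}) (H : mor (spec_lrs (localization p)) Z),
    H = mor_comp j (spec_map th) -> isunit (th e) ->
    [/\ isunit (th d), U (H (closed_pt p)) &
        forall U' : U (H (closed_pt p)), val_at H (germ U' s) * th d = th c]].
Proof.
have [c [d [e [ne E]]]] := ev_frac Uy s; exists c, d, e; split=> // S p th _ -> ue.
have [|U1 [nd E1]] := E (spec_preimage th (closed_pt p)); first exact/closed_pt_unit.
split=> [||U']; [exact/closed_pt_unit | exact: U1 |].
have e1 : @ev _ Z (mor_comp j (spec_map th)) (closed_pt p) U U' s = localization_map th (closed_pt p) (ev U1 s).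
  apply: (etrans (ev_spec _ _)); apply: congr1; exact: ev_irr.
apply: (can_inj (@unlocK S p)); apply: (etrans (rmorphM (locmap (closed_pt p)) _ _)).
apply: (etrans (congr1 (fun z => z * locmap (closed_pt p) (th d)) (unlocV _))).
apply: (etrans (congr1 (fun z => z * locmap (closed_pt p) (th d)) e1)).
apply: (etrans (congr1 (fun z => localization_map th (closed_pt p) (ev U1 s) * z) (esym (localization_map_locmap th _ d)))).
apply: (etrans (esym (rmorphM (localization_map th (closed_pt p)) _ _))).
apply: (etrans (congr1 (localization_map th (closed_pt p)) E1)).
exact: localization_map_locmap.
Qed.

Lemma val_chart_sec (S B : comPzRingType) (Z : lrs) (j : mor (spec_lrs B) Z) (oj : open_immersion j)
    (p : spec S) (th : {rmorphism B -> localization p})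
    (H : mor (spec_lrs (localization p)) Z) (U : rangeo oj (H (closed_pt p))) (b : B) :
  H = mor_comp j (spec_map th) -> val_at H (germ U (chart_sec oj b)) = th b.
Proof.
move=> E; subst H; apply: (etrans _ (unlocK (th b))).
apply: (congr1 (unloc p)); apply: (etrans (ev_spec _ _)).
apply: (etrans (congr1 (localization_map th (closed_pt p)) (@chart_secE B Z j oj b (spec_preimage th (closed_pt p)) U))).
exact: localization_map_locmap.
Qed.

(** * Lifts over the local rings of a good ring *)

Section Lift.
Context (X Y : scheme) (f : mor X Y) (wf : wet_charts f).
Context (S : comPzRingType) (J : ideal S) (gS : good S).
Context (a : mor (spec_lrs (quotient_ring J)) X) (b : mor (spec_lrs S) Y).
Hypothesis ab : mor_comp f a = mor_comp b (spec_map (quotient_proj J)).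

(** The map from S / J to the quotient of the local ring is determined by its condition, and is
    quantified over to avoid a choice. *)
Definition is_lift (q : spec S) (h : mor (spec_lrs (localization q)) X) :=
  mor_comp f h = mor_comp b (spec_map (locmap q)) /\
  forall k : {rmorphism quotient_ring J -> quotient_ring (ext_ideal (locmap q) J)},
    (forall x, k (quotient_proj J x) = quotient_proj _ (locmap q x)) ->
    mor_comp h (spec_map (quotient_proj (ext_ideal (locmap q) J))) = mor_comp a (spec_map k).

Lemma lift_uniq (q : spec S) (h h' : mor (spec_lrs (localization q)) X) : J `<=` q -> @is_lift q h -> @is_lift q h' -> h = h'.
Proof.
move=> Jq [fh ah] [fh' ah'].
apply: (local_uniq wf (I := ext_ideal (locmap q) J) (localization_is_local q)).
- have sub : ext_ideal (locmap q) J `<=` localization_max q.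
    by apply: ext_ideal_sub => x /Jq qx; apply/localization_max_locmap.
  by move=> /sub; apply: (localization_is_local q).1.
- by rewrite fh fh'.
- have [|k kE] := qproj_lift (I := J) (f := quotient_proj (ext_ideal (locmap q) J) \o locmap q).
    by move=> x Jx; apply/qproj_eq0; exact: ext_ideal_gen.
  by rewrite (ah k kE) (ah' k kE).
Qed.

Definition chart_pts (g : S) := {q : spec S | J `<=` q /\ ~ q g}.

(** The lifts at all [q] in V(J) outside V(lc_g), given by one ring map [lc_i] followed by maps
    [lc_eta q] to the local rings. The fields keep of [wet_chart] what compactness arguments use:
    elements of [lc_T] are locally fractions over [S], their invertibility is open in [q], and
    suitable primes specialise to the point of some [q]. *)
Record lift_chart := LiftChart {
  lc_g : S;
  lc_B : comPzRingType;
  lc_j : mor (spec_lrs lc_B) X;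
  lc_oj : open_immersion lc_j;
  lc_T : comPzRingType;
  lc_e : {rmorphism S -> lc_T};
  lc_i : {rmorphism lc_B -> lc_T};
  lc_eta : forall q : chart_pts lc_g, {rmorphism lc_T -> localization (sval q)};
  lc_etaE : forall q x, lc_eta q (lc_e x) = locmap (sval q) x;
  lc_frac : forall (q : chart_pts lc_g) (x : lc_T), exists (u s0 : S) (w : lc_T),
    [/\ ~ sval q u, isunit (lc_eta q w) & w * (lc_e u * x - lc_e s0) = 0];
  lc_unit : forall w : lc_T, exists s : S, forall q : chart_pts lc_g, isunit (lc_eta q w) <-> ~ sval q s;
  lc_lift : forall q : chart_pts lc_g, is_lift (mor_comp lc_j (spec_map (lc_eta q \o lc_i)));
  lc_prime : forall P : spec lc_T, (forall x : lc_T, P x -> ~ forall q : chart_pts lc_g, isunit (lc_eta q x)) ->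
    exists q : chart_pts lc_g, forall x : lc_T, P x -> ~ isunit (lc_eta q x) }.

(** After inverting g1 g2, [b] lands in a chart of [Y] and [a] in a compatible chart of [X]; then
    [wet_chart] applies. *)
Lemma lift_chart_ex (q0 : spec S) : J `<=` q0 -> exists k : lift_chart, ~ q0 (lc_g k).
Proof.
move=> Jq0; have [t0 t0E] := quot_prime Jq0.
have q0E : q0 = spec_map (quotient_proj J) t0 by apply: spec_ext => x; rewrite -t0E.
have [R [B [phi [jY [jX [oY [oX [rX e]]]]]]]] := compatible_charts f (a t0).
have bq0 : rangeo oY (b q0).
  have -> : b q0 = f (a t0).
    by rewrite q0E; exact: (esym (congr1 (fun g : mor (spec_lrs (quotient_ring J)) Y => g t0) ab)).
  have [y _ <-] := rX; exists (spec_preimage phi y) => //.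
  exact: (esym (congr1 (fun g : mor (spec_lrs B) Y => g y) e)).
have [g1 [n1 H1]] := @spec_nbhd S (opens_preimage (rs_cts b) (rangeo oY)) q0 bq0.
have [z [nz H2]] := @spec_nbhd _ (opens_preimage (rs_cts a) (rangeo oX)) t0 rX.
have [g2 zE] := qproj_surj z; subst z.
have n2 : ~ q0 g2 by move=> /t0E.
have n12 : ~ q0 (g1 * g2) by move=> /(spec_prime q0).2[].
have [C [sg lsg]] := mloc_pow (g1 * g2).
have sgu : isunit (sg (g1 * g2)) by have [un _ _] := lsg; apply: un; exists 1%N; rewrite expr1.
have nsg (q : spec C) x : isunit (sg x) -> ~ q (sg x).
  by move=> u qx; apply: (@prime_one _ q); exact: ideal_unit u qx.
have sg1 : isunit (sg g1) by move: sgu; rewrite rmorphM => /isunitMl.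
have sg2 : isunit (sg g2) by move: sgu; rewrite mulrC rmorphM => /isunitMl.
have [|r rE] := @chart_factor _ _ _ oY C (mor_comp b (spec_map sg)).
  by move=> q; apply: (H1 (spec_preimage sg q)); exact: nsg.
pose pC := quotient_proj (ext_ideal sg J).
have [|tau tauE] := qproj_lift (I := J) (f := pC \o sg).
  by move=> x Jx; apply/qproj_eq0; exact: ext_ideal_gen.
have [|beta bE] := @chart_factor _ _ _ oX _ (mor_comp a (spec_map tau)).
  move=> t; apply: (H2 (spec_preimage tau t)).
  have -> : spec_preimage tau t (quotient_proj J g2) <-> (spec_preimage pC t : spec C) (sg g2).
    by rewrite -[spec_preimage tau t _]/(t (tau _)) tauE.
  exact: nsg.
have betaE x : beta (phi x) = pC (r x).
  have E : (beta \o phi : {rmorphism R -> _}) = pC \o r; last first.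
    exact: (congr1 (fun k : {rmorphism R -> quotient_ring (ext_ideal sg J)} => k x) E).
  apply: (chart_mono oY); rewrite -!mor_comp_spec -e -mor_compA -bE mor_compA ab -rE !mor_comp_spec.
  by apply: spec_map_eq => y; exact: tauE.
have [eta [etaE fr un pri red]] := wet_chart gS lsg (wf oY oX e) betaE.
pose T := tens phi r; pose e' : {rmorphism S -> T} := po2 (tens_rel phi r) \o sg.
pose i' : {rmorphism B -> T} := po1 (tens_rel phi r).
pose et (q : chart_pts (g1 * g2)) : {rmorphism T -> localization (sval q)} :=
  eta (sval q) (svalP q).1 (svalP q).2.
have p1 (q : chart_pts (g1 * g2)) x : et q (e' x) = locmap (sval q) x by exact: (etaE (sval q) _ _ x).
have p2 (q : chart_pts (g1 * g2)) (x : T) : exists (u s0 : S) (w : T),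
    [/\ ~ sval q u, isunit (et q w) & w * (e' u * x - e' s0) = 0].
  exact: (fr (sval q) (svalP q).1 (svalP q).2 x).
have p3 (w : T) : exists s : S, forall q : chart_pts (g1 * g2), isunit (et q w) <-> ~ sval q s.
  by have [s sE] := un w; exists s => q; exact: (sE (sval q) (svalP q).1 (svalP q).2).
have p4 (q : chart_pts (g1 * g2)) : is_lift (mor_comp jX (spec_map (et q \o i'))).
  have [k' [k'1 k'2]] := red (sval q) (svalP q).1 (svalP q).2; split.
    rewrite mor_compA e !mor_comp_spec.
    have -> : mor_comp jY (spec_map ((et q \o i') \o phi)) =
        mor_comp jY (spec_map ((et q \o po2 (tens_rel phi r)) \o r)).
      by apply: spec_map_eq => x; exact: (congr1 (et q) (tens_comm phi r x)).
    by rewrite -mor_comp_spec -rE mor_comp_spec; apply: spec_map_eq => x; exact: (p1 q x).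
  move=> k kE.
  have -> : mor_comp a (spec_map k) = mor_comp (mor_comp a (spec_map tau)) (spec_map k').
    rewrite mor_comp_spec; apply: spec_map_eq => z; have [x ->] := qproj_surj z.
    by rewrite kE -k'1; exact: (congr1 k' (esym (tauE x))).
  rewrite bE !mor_comp_spec; apply: spec_map_eq => x; exact: (esym (k'2 x)).
have p5 (P : spec T) : (forall x : T, P x -> ~ forall q : chart_pts (g1 * g2), isunit (et q x)) ->
    exists q : chart_pts (g1 * g2), forall x : T, P x -> ~ isunit (et q x).
  move=> PE; have [|q [Jq [gq H]]] := pri P.
    by move=> x /PE nx ux; apply: nx => q; exact: ux.
  exists (exist _ q (conj Jq gq)) => x /H nu; rewrite /et /=.
  by rewrite (Prop_irrelevance (proj1 _) Jq) (Prop_irrelevance (proj2 _) gq).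
by exists (@LiftChart (g1 * g2) B jX oX T e' i' et p1 p2 p3 p4 p5).
Qed.

Definition isres (p q : spec S) (H : mor (spec_lrs (localization p)) X) :=
  exists h (rho : {rmorphism localization q -> localization p}),
    [/\ @is_lift q h, forall x, rho (locmap q x) = locmap p x & H = mor_comp h (spec_map rho)].

Arguments isres : clear implicits.

Lemma isres_uniq (p q : spec S) H H' : J `<=` q -> isres p q H -> isres p q H' -> H = H'.
Proof.
move=> Jq [h [rho [hl rE ->]]] [h' [rho' [hl' rE' ->]]].
rewrite (lift_uniq Jq hl hl'); congr (mor_comp h' (spec_map _)).
by apply: (loc_uniq (locmap_loc q)) => x; rewrite rE rE'.
Qed.

Definition cres (k : lift_chart) (q : chart_pts (lc_g k)) (p : spec S)
    (th : {rmorphism lc_T k -> localization p}) :=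
  exists rho : {rmorphism localization (sval q) -> localization p},
    (forall x, rho (locmap _ x) = locmap p x) /\ forall x, th x = rho (lc_eta q x).
Arguments cres : clear implicits.

Lemma cres_ex (k : lift_chart) (q : chart_pts (lc_g k)) (p : spec S) : p `<=` sval q -> exists th, cres k q p th.
Proof.
move=> pq; have [|rho rE] := loc_lift (f := locmap p) (locmap_loc (sval q)).
  by move=> u nu; apply: locmap_unit => /pq.
by exists (rho \o lc_eta q), rho.
Qed.

Lemma cres_isres (k : lift_chart) (q : chart_pts (lc_g k)) (p : spec S) th : cres k q p th ->
  isres p (sval q) (mor_comp (lc_j k) (spec_map (th \o lc_i k))).
Proof.
move=> [rho [rE thE]]; exists (mor_comp (lc_j k) (spec_map (lc_eta q \o lc_i k))), rho.
split=> //; first exact: lc_lift.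
by rewrite mor_comp_spec; apply: spec_map_eq => x; exact: thE.
Qed.

Lemma cres_e (k : lift_chart) (q : chart_pts (lc_g k)) (p : spec S) th x : cres k q p th -> th (lc_e k x) = locmap p x.
Proof. by move=> [rho [rE ->]]; rewrite lc_etaE. Qed.

Lemma cres_unit (k : lift_chart) (q : chart_pts (lc_g k)) (p : spec S) th x : cres k q p th -> isunit (lc_eta q x) -> isunit (th x).
Proof. by move=> [rho [rE ->]]; exact: isunit_rmorph. Qed.

(** Near [q] the element [x] is the fraction s0 / u0, so its image in the local ring at [p] is the
    same for all nearby [q']. *)
Lemma cres_const (k : lift_chart) (q : chart_pts (lc_g k)) (p : spec S) x : p `<=` sval q -> exists u, ~ sval q u /\
  exists z : localization p, forall (q' : chart_pts (lc_g k)) th, ~ sval q' u -> cres k q' p th -> th x = z.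
Proof.
move=> pq; have [u0 [s0 [w [nu uw e]]]] := lc_frac q x; have [s sE] := lc_unit w.
exists (u0 * s); split; first by move=> /(spec_prime (sval q)).2[//|]; apply/sE.
have [th0 c0] := cres_ex pq; exists (th0 x).
have key (q' : chart_pts (lc_g k)) th : ~ sval q' (u0 * s) -> cres k q' p th -> th x * locmap p u0 = locmap p s0 /\ isunit (locmap p u0).
  move=> nq' c; have uw' : isunit (th w).
    by apply: (cres_unit c); apply/sE => qs; apply: nq'; exact: idealMl.
  split; last first.
    have [rho [rE _]] := c; rewrite -rE; apply: isunit_rmorph; apply: locmap_unit => qu.
    by apply: nq'; exact: idealMr.
  apply: (unit_cancel uw'); rewrite -(cres_e u0 c) -(cres_e s0 c) mulrC -(mulrC (th w)).
  apply/eqP; rewrite -subr_eq0 -mulrBr (mulrC (th x)) -rmorphM -rmorphB -rmorphM e.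
  by rewrite rmorph0.
move=> q' th nq' c; have [E u] := key q' th nq' c.
have nq0 : ~ sval q (u0 * s) by move=> /(spec_prime (sval q)).2[//|]; apply/sE.
by have [E0 _] := key q th0 nq0 c0; apply: (unit_cancel u); rewrite E E0.
Qed.

Lemma chart_cover : exists (I : finType) (F : I -> option lift_chart), forall q : spec S, J `<=` q ->
  exists i k, F i = Some k /\ ~ q (lc_g k).
Proof.
(* [None] stands for the complement of V(J). *)
have [|I [F HF]] := @spec_qc S (option lift_chart)
    (fun o (q : spec S) => if o is Some k then ~ q (lc_g k) else ~ J `<=` q).
  move=> q; have [Jq|nJ] := pselect (J `<=` (q : spec S)).
    by have [k nk] := lift_chart_ex Jq; exists (Some k), (lc_g k).
  have [x Jx nx] : exists2 x, J x & ~ q x.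
    by apply: contrapT => nx; apply: nJ => x Jx; apply: contrapT => nqx; apply: nx; exists x.
  by exists None, x; split=> // q' nq' Jq'; exact/nq'/Jq'.
exists I, F => q Jq; have [i] := HF q; case E : (F i) => [k|] // nk.
by exists i, k.
Qed.

End Lift.

Lemma isunit_eq (A : comPzRingType) (x y : A) : x = y -> isunit x -> isunit y.
Proof. by move=> ->. Qed.

(** * Independence of the prime containing J *)

Section Lift.
Context (X Y : scheme) (f : mor X Y) (wf : wet_charts f).
Context (S : comPzRingType) (J : ideal S) (gS : good S).
Context (a : mor (spec_lrs (quotient_ring J)) X) (b : mor (spec_lrs S) Y).
Hypothesis ab : mor_comp f a = mor_comp b (spec_map (quotient_proj J)).
Local Notation lift_chart := (lift_chart f a b).
Local Notation res p q H := (@isres X Y f S J a b p q H).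

Lemma res_chart (p q : spec S) (k : lift_chart) (pq : p `<=` q) (Jq : J `<=` q) (gq : ~ q (lc_g k)) :
  exists th, cres (k := k) (exist _ q (conj Jq gq)) (p := p) th /\
    res p q (mor_comp (lc_j k) (spec_map (th \o lc_i k))).
Proof.
have [th c] := @cres_ex _ _ f S J a b k (exist _ q (conj Jq gq)) p pq.
by exists th; split=> //; exact: (cres_isres c).
Qed.

Section Constancy.
Context (p : spec S).
Local Notation m := (closed_pt p).
Let T (q : spec S) := p `<=` q /\ J `<=` q.
Hypothesis conn : forall W : spec S -> Prop,
  (forall q, T q -> exists u, ~ q u /\ forall q', T q' -> ~ q' u -> (W q' <-> W q)) ->
  forall q q', T q -> T q' -> W q -> W q'.

Definition res_in (D : opens X) (q : spec S) := exists H, res p q H /\ D (H m).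

Lemma chart_near (q : spec S) (k : lift_chart) (I : finType) (x : I -> lc_T k) (Tq : T q) (gq : ~ q (lc_g k)) :
  exists u, ~ q u /\ exists z : I -> localization p, forall (q' : spec S) (Jq' : J `<=` q') (gq' : ~ q' (lc_g k)) th,
    ~ q' u -> cres (k := k) (exist _ q' (conj Jq' gq')) (p := p) th -> forall i, th (x i) = z i.
Proof.
have ex i := @cres_const _ _ f S J a b k (exist _ q (conj Tq.2 gq)) p (x i) Tq.1.
have /choice[u uE] := ex.
have /choice[z zE] : forall i, exists z : localization p, forall (q' : chart_pts J (lc_g k)) th, ~ sval q' (u i) -> cres (k := k) q' (p := p) th -> th (x i) = z.
  by move=> i; have [] := uE i.
exists (\prod_i u i); split.
  by apply: (mset_prod _ _ (mset_prime q)) => i; have [] := uE i.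
exists z => q' Jq' gq' th nu c i; apply: (zE i _ _ _ c) => /= qu; apply: nu.
by rewrite (bigD1 i) //=; exact: idealMr.
Qed.

Lemma res_in_chart (D : opens X) (q : spec S) (k : lift_chart) (Jq : J `<=` q) (gq : ~ q (lc_g k))
    (th : {rmorphism lc_T k -> localization p}) :
  cres (k := k) (exist _ q (conj Jq gq)) (p := p) th ->
  res_in D q <-> D (lc_j k (spec_preimage (th \o lc_i k) m)).
Proof.
move=> c; have r := cres_isres c; split=> [[H [rH DH]]|Dy]; last first.
  by exists (mor_comp (lc_j k) (spec_map (th \o lc_i k))).
by have E := isres_uniq wf Jq rH r; subst H.
Qed.

(** The restriction to the local ring at [p] is locally constant in [q], which varies in a connected
    set. The difficulty is that the charts used at different [q] have different ranges in [X]. So a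
    single affine open set D is found first that contains the images of the closed point for all
    [q]; then the restrictions are ring maps out of the ring of D, and the image of each element is
    locally constant. *)
Lemma res_const q1 q2 H1 H2 : T q1 -> T q2 -> res p q1 H1 -> res p q2 H2 -> H1 = H2.
Proof.
move=> T1 T2 r1 r2; have [I [F HF]] := chart_cover wf gS ab.
pose inU (o : option lift_chart) q := if o is Some k then res_in (rangeo (lc_oj k)) q else False.
pose M q : pred I := fun i => `[< inU (F i) q >].
(* [qs] is chosen so that the image of the closed point lies in as many of the finitely many chart
   ranges as possible; D is then a neighbourhood of that image inside all of these ranges. *)
have [qs Tqs mx] : exists2 qs, T qs & forall q, T q -> (#|M q| <= #|M qs|)%N.
  pose P n := `[< exists2 q, T q & #|M q| = n >].
  have ex : exists n, P n by exists #|M q1|; apply/asboolP; exists q1.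
  have bd n : P n -> (n <= #|I|)%N by move=> /asboolP[q _ <-]; exact: max_card.
  case: (ex_maxnP ex bd) => n /asboolP[qs Tqs <-] mx; exists qs => // q Tq.
  by apply: mx; apply/asboolP; exists q.
have [i0 [ks [Fs gs]]] := HF qs Tqs.2.
have [ths [cs rs]] := res_chart Tqs.1 Tqs.2 gs.
pose ys : spec (lc_B ks) := spec_preimage (ths \o lc_i ks) m.
have /choice[e eE] : forall i, exists e : lc_B ks, ~ ys e /\ forall k, F i = Some k -> M qs i ->
    forall y : spec (lc_B ks), ~ y e -> rangeo (lc_oj k) (lc_j ks y).
  move=> i; have [Mi|nM] := boolP (M qs i); last by exists 1; split=> //; exact: prime_one.
  have := asboolW Mi; rewrite /inU; case Fi : (F i) => [k|] // Hk.
  have [e [ne E]] := @spec_nbhd _ (opens_preimage (rs_cts (lc_j ks)) (rangeo (lc_oj k))) ys ((res_in_chart _ cs).1 Hk).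
  by exists e; split=> // k' [<-] _.
pose be := \prod_i e i.
have nbe : ~ ys be by apply: (mset_prod _ _ (mset_prime ys)) => i; have [] := eE i.
have [BD [psi lpsi]] := mloc_pow be.
have [oD rD] := chart_basic (lc_oj ks) lpsi.
set jD := mor_comp (lc_j ks) (spec_map psi) in oD rD.
have Dsub i k x : F i = Some k -> M qs i -> rangeo oD x -> rangeo (lc_oj k) x.
  move=> Fi Mi [z _ <-]; apply: ((eE i).2 k Fi Mi (spec_preimage psi z)) => ze.
  have [un _ _] := lpsi; apply: (@prime_one _ z); apply: (ideal_unit (un be _)); first by exists 1%N; rewrite expr1.
  by rewrite /be (bigD1 i) //= rmorphM; exact: idealMr.
have W0 : res_in (rangeo oD) qs by apply/(res_in_chart _ cs); exact: rD.
have prodN (q : spec S) x y : ~ q (x * y) -> ~ q x /\ ~ q y.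
  by move=> n; split=> qx; apply: n; [exact: idealMr|exact: idealMl].
have prodN' (q : spec S) x y : ~ q x -> ~ q y -> ~ q (x * y) by move=> nx ny /(spec_prime q).2[].
have loc q : T q -> exists u, ~ q u /\ forall q', T q' -> ~ q' u -> (res_in (rangeo oD) q' <-> res_in (rangeo oD) q).
  move=> Tq; have [i [k [Fi gq]]] := HF q Tq.2.
  have [th [c r]] := res_chart Tq.1 Tq.2 gq.
  pose y : spec (lc_B k) := spec_preimage (th \o lc_i k) m.
  have yE be' : isunit (th (lc_i k be')) <-> ~ y be' by exact: closed_pt_unit.
  have [Dy|nDy] := pselect (rangeo oD (lc_j k y)).
    have [be' [nb E]] := @spec_nbhd _ (opens_preimage (rs_cts (lc_j k)) (rangeo oD)) y Dy.
    have [u [nu [z zE]]] := chart_near (fun _ : unit => lc_i k be') Tq gq.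
    exists (u * lc_g k); split=> [|q' Tq' /prodN[nu' ng']]; first exact: prodN'.
    have [th' [c' r']] := res_chart Tq'.1 Tq'.2 ng'.
    split=> _; first exact/(res_in_chart _ c).
    apply/(res_in_chart _ c'); apply: E; apply/closed_pt_unit.
    apply: (isunit_eq _ ((yE be').2 nb)).
    exact: (etrans (zE _ _ _ _ nu c tt) (esym (zE _ _ _ _ nu' c' tt))).
  (* Here D lies in the range of the chart at [q], and is a finite union of basic open sets of it by
     quasi-compactness. Whether these contain the image point is decided by finitely many elements,
     which are locally constant in [q]. *)
  have [Mi|nMi] := boolP (M qs i).
    have [|gD gDE] := @chart_factor _ _ _ (lc_oj k) BD jD.
      by move=> z; apply: (Dsub i k _ Fi Mi); exact: range_rangeo.
    have jE z : lc_j k (spec_preimage gD z) = jD z.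
      exact: (esym (congr1 (fun g : mor (spec_lrs BD) X => g z) gDE)).
    have [|K [bs bsE]] := @spec_qc BD {be' : lc_B k | forall y : spec (lc_B k), ~ y be' -> rangeo oD (lc_j k y)}
        (fun be' (z : spec BD) => ~ z (gD (sval be'))).
      move=> z; have Dz : rangeo oD (lc_j k (spec_preimage gD z)) by rewrite jE; exact: range_rangeo.
      have [be' [nb E]] := @spec_nbhd _ (opens_preimage (rs_cts (lc_j k)) (rangeo oD)) (spec_preimage gD z) Dz.
      by exists (exist _ be' E), (gD be').
    have [u [nu [z zE]]] := chart_near (fun t : K => lc_i k (sval (bs t))) Tq gq.
    exists (u * lc_g k); split=> [|q' Tq' /prodN[nu' ng']]; first exact: prodN'.
    have [th' [c' r']] := res_chart Tq'.1 Tq'.2 ng'.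
    split=> [/(res_in_chart _ c')[w _ wE]|/(res_in_chart _ c)//].
    case: nDy; have [inj _ _] := lc_oj k.
    have y'E : spec_preimage gD w = spec_preimage (th' \o lc_i k) m by apply: inj; rewrite jE.
    have [t nt] := bsE w; apply: (svalP (bs t)); apply/yE.
    have ut : isunit (th' (lc_i k (sval (bs t)))).
      apply/closed_pt_unit => h; apply: nt.
      have h' : (spec_preimage (th' \o lc_i k) m : spec (lc_B k)) (sval (bs t)) by exact: h.
      by rewrite -y'E in h'.
    apply: (isunit_eq _ ut).
    exact: (etrans (zE _ _ _ _ nu' c' t) (esym (zE _ _ _ _ nu c t))).
  (* In the remaining case a [q'] near [q] with its image in D would lie in all ranges counted for
     [qs] and in range [i] besides, against maximality. *)
  exists (lc_g k); split=> // q' Tq' ng'; split=> [[H [rH DH]]|/(res_in_chart _ c)//].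
  exfalso; have := mx q' Tq'; rewrite leqNgt => /negP; apply; apply: proper_card.
  apply/properP; split.
    apply/fintype.subsetP => l Ml; have Ml' : M qs l by exact: Ml.
    have : inU (F l) qs by exact: asboolW Ml'.
    case Fl : (F l) => [k'|] // _; apply/asboolP; rewrite Fl; exists H; split=> //.
    exact: (Dsub l k' _ Fl Ml').
  exists i => //; apply/asboolP; rewrite Fi.
  have [th' [c' r']] := res_chart Tq'.1 Tq'.2 ng'.
  by apply/(res_in_chart _ c'); exact: range_rangeo.
have Wall q : T q -> res_in (rangeo oD) q by move=> Tq; exact: (conn loc Tqs Tq W0).
have fac q H : T q -> res p q H -> exists ps : {rmorphism BD -> localization p}, H = mor_comp jD (spec_map ps).
  move=> Tq r; have [H' [r' DH]] := Wall q Tq.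
  have E := isres_uniq wf Tq.2 r r'; subst H'.
  apply: (chart_factor (oj := oD)).
  exact: (@local_open _ _ (closed_pt p) (opens_preimage (rs_cts H) (rangeo oD)) (localization_is_local p) (@closed_ptE _ p) DH).
have [ps1 E1] := fac q1 H1 T1 r1; have [ps2 E2] := fac q2 H2 T2 r2.
rewrite E1 E2; apply: spec_map_eq => al.
(* In the chart at [q] the section [al] is a fraction; its numerator and denominator have locally
   constant images, hence so does [al]. *)
pose W q := exists ps : {rmorphism BD -> localization p}, res p q (mor_comp jD (spec_map ps)) /\ ps al = ps1 al.
have locW q : T q -> exists u, ~ q u /\ forall q', T q' -> ~ q' u -> (W q' <-> W q).
  move=> Tq; have [i [k [Fi gq]]] := HF q Tq.2.
  have [th [c r]] := res_chart Tq.1 Tq.2 gq.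
  pose y : spec (lc_B k) := spec_preimage (th \o lc_i k) m.
  have Dy : rangeo oD (lc_j k y) by exact: (res_in_chart _ c).1 (Wall q Tq).
  have [cc [d [ee [ne _ E]]]] := @sec_frac _ _ (lc_j k) y _ Dy (chart_sec oD al).
  have [u [nu [z zE]]] := chart_near (fun o : option bool => lc_i k (if o is Some b0 then if b0 then cc else d else ee)) Tq gq.
  have uee : isunit (z None).
    by rewrite -(zE _ _ _ _ nu c None); exact/closed_pt_unit.
  have key q' ps : T q' -> ~ q' (u * lc_g k) -> res p q' (mor_comp jD (spec_map ps)) ->
      ps al * z (Some false) = z (Some true) /\ isunit (z (Some false)).
    move=> Tq' /prodN[nu' ng'] rp; have [th' [c' r']] := res_chart Tq'.1 Tq'.2 ng'.
    have EH := isres_uniq wf Tq'.2 rp r'.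
    have ue' : isunit ((th' \o lc_i k) ee).
      exact: (isunit_eq (esym (zE _ _ _ _ nu' c' None)) uee).
    have [ud U' vE] := E _ p _ _ EH ue'.
    rewrite -(zE _ _ _ _ nu' c' (Some false)) -(zE _ _ _ _ nu' c' (Some true)); split=> //.
    have V := val_chart_sec (oj := oD) U' al erefl.
    exact: (etrans (congr1 (fun t => t * th' (lc_i k d)) (esym V)) (vE U')).
  exists (u * lc_g k); have nuq : ~ q (u * lc_g k) by exact: prodN'.
  split=> // q' Tq' nq'.
  have transfer q3 q4 : T q3 -> T q4 -> ~ q3 (u * lc_g k) -> ~ q4 (u * lc_g k) -> W q3 -> W q4.
    move=> T3 T4 n3 n4 [ps [rp psE]]; have [H [rH _]] := Wall q4 T4.
    have [ps4 E4] := fac q4 H T4 rH; subst H; exists ps4; split=> //; rewrite -psE.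
    have [e3 u3] := key q3 ps T3 n3 rp; have [e4 _] := key q4 ps4 T4 n4 rH.
    by apply: (unit_cancel u3); rewrite e3 e4.
  by split; apply: transfer.
have [ps [rp psE]] : W q2.
  by apply: (conn locW T1 T2); exists ps1; split=> //; rewrite -E1.
rewrite -psE; congr (_ al); apply: (congr1 (fun g : {rmorphism BD -> localization p} => g : BD -> _)).
by apply: (chart_mono oD); rewrite -E2; exact: (isres_uniq wf T2.2 rp r2).
Qed.

End Constancy.
End Lift.

Lemma val_at_res (S0 S : comPzRingType) (p0 : spec S0) (p : spec S) (Z : lrs) (H : mor (spec_lrs (localization p0)) Z)
    (rho : {rmorphism localization p0 -> localization p}) (U : opens Z) (U0 : U (H (closed_pt p0))) (s : sec Z U)
    (H' : mor (spec_lrs (localization p)) Z) : H' = mor_comp H (spec_map rho) ->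
  exists U' : U (H' (closed_pt p)), val_at H' (germ U' s) = rho (val_at H (germ U0 s)).
Proof.
move=> EH; have [c [d [e [ne _ E]]]] := @sec_frac _ _ H (closed_pt p0) U U0 s.
have ue : isunit e by exact/closed_pt_unit.
have [ud0 _ v0] := E _ p0 idfun H (esym (mor_spec_id H)) ue.
have [ud U' v] := E _ p rho H' EH (isunit_rmorph rho ue).
exists U'; apply: (unit_cancel ud); rewrite v; apply: (etrans (congr1 rho (esym (v0 U0)))).
exact: rmorphM.
Qed.

(** * Gluing the lifts over a good ring *)

Section Glue.
Context (X Y : scheme) (f : mor X Y) (wf : wet_charts f).
Context (S : comPzRingType) (J : ideal S) (gS : good S).
Context (a : mor (spec_lrs (quotient_ring J)) X) (b : mor (spec_lrs S) Y).
Hypothesis ab : mor_comp f a = mor_comp b (spec_map (quotient_proj J)).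
Hypothesis JJ : J `<=` @jacobson_radical S.
Hypothesis conn : forall (p : spec S) (W : spec S -> Prop),
  (forall q : spec S, p `<=` q /\ J `<=` q -> exists u, ~ q u /\
     forall q' : spec S, p `<=` q' /\ J `<=` q' -> ~ q' u -> (W q' <-> W q)) ->
  forall q q' : spec S, p `<=` q /\ J `<=` q -> p `<=` q' /\ J `<=` q' -> W q -> W q'.
Local Notation lift_chart := (lift_chart f a b).
Local Notation res p q H := (@isres X Y f S J a b p q H).

Lemma above (p : spec S) : exists q : spec S, p `<=` q /\ J `<=` q.
Proof.
have [m [mm pm]] := maxideal_exists (@prime_one _ p).
by exists (SpecPoint (maxideal_prime mm)); split=> // x /JJ; apply.
Qed.

Lemma res_ex (p : spec S) : exists H, forall q : spec S, p `<=` q -> J `<=` q -> res p q H.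
Proof.
have [q [pq Jq]] := above p; have [k gq] := lift_chart_ex wf gS ab Jq.
have [th [c r]] := res_chart pq Jq gq; exists (mor_comp (lc_j k) (spec_map (th \o lc_i k))) => q' pq' Jq'.
have [k' gq'] := lift_chart_ex wf gS ab Jq'.
have [th' [c' r']] := res_chart pq' Jq' gq'.
by rewrite (res_const wf gS ab (@conn p) (conj pq Jq) (conj pq' Jq') r r').
Qed.

Definition germ_mor p := projT1 (cid (res_ex p)).
Local Notation G := germ_mor.

Lemma germ_morP (p q : spec S) : p `<=` q -> J `<=` q -> res p q (G p).
Proof. exact: (projT2 (cid (res_ex p)) q). Qed.

Lemma germ_morE (p q : spec S) H : p `<=` q -> J `<=` q -> res p q H -> G p = H.
Proof. by move=> pq Jq; apply: (isres_uniq wf Jq); exact: germ_morP. Qed.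

Lemma germ_mor_res (p p0 : spec S) (rho : {rmorphism localization p0 -> localization p}) :
  p `<=` p0 -> (forall x, rho (locmap p0 x) = locmap p x) -> G p = mor_comp (G p0) (spec_map rho).
Proof.
move=> pp rE; have [q [pq Jq]] := above p0.
apply: (germ_morE (q := q)) => //; first by move=> x /pp /pq.
have [h [r0 [hl r0E ->]]] := germ_morP pq Jq; exists h, (rho \o r0); split=> //.
  by move=> x; rewrite /= r0E.
by rewrite mor_comp_spec.
Qed.

Lemma germ_mor_base (p : spec S) : mor_comp f (G p) = mor_comp b (spec_map (locmap p)).
Proof.
have [q [pq Jq]] := above p; have [h [r0 [[hl _] r0E ->]]] := germ_morP pq Jq.
by rewrite mor_compA hl mor_comp_spec; apply: spec_map_eq.
Qed.

Lemma germ_mor_lift (q : spec S) : J `<=` q -> @is_lift X Y f S J a b q (G q).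
Proof.
move=> Jq; have [k gq] := lift_chart_ex wf gS ab Jq.
pose Q : chart_pts J (lc_g k) := exist _ q (conj Jq gq).
have L := lc_lift Q; set h := mor_comp _ _ in L.
have r : res q q h by exists h, idfun; split=> //; rewrite mor_spec_id.
by rewrite (germ_morE (fun _ t => t) Jq r).
Qed.

Lemma loc_sum_unit (p : spec S) (x y : localization p) : isunit (x + y) -> isunit x \/ isunit y.
Proof.
move=> u; apply: contrapT => n; have /closed_pt_unit := u; apply.
by apply: idealD; apply: contrapT => /closed_pt_unit h; apply: n; [left|right].
Qed.

Section Spread.
Context (p0 : spec S) (U : opens X) (U0 : U (G p0 (closed_pt p0))) (s : sec X U) (c d : S).
Hypothesis nd : ~ p0 d.
Hypothesis valE : val_at (G p0) (germ U0 s) * locmap p0 d = locmap p0 c.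

Let spread (p : spec S) := ~ p d /\
  exists U' : U (G p (closed_pt p)), val_at (G p) (germ U' s) * locmap p d = locmap p c.

Lemma spread_below (p : spec S) : p `<=` p0 -> spread p.
Proof.
move=> pp; split=> [/pp//|].
have [|rho rE] := loc_lift (f := locmap p) (locmap_loc p0).
  by move=> u nu; apply: locmap_unit => /pp.
have [U' vE] := val_at_res U0 s (germ_mor_res pp rE).
exists U'; rewrite vE -rE -[RHS]rE -valE; exact: (esym (rmorphM rho _ _)).
Qed.

(** A compactness argument on the spectrum of [lc_T k]. If no neighbourhood of [p0] worked, [krull]
    would give a prime [P] at which the equation cannot spread; but [P] lies over a prime inside
    [p0], where the equation holds by [spread_below], and there it already holds after
    multiplication by an element outside [P]. *)
Lemma chart_spread (k : lift_chart) : exists x, ~ p0 x /\ forall p q : spec S, p `<=` q -> J `<=` q ->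
  ~ q (lc_g k) -> ~ p x -> spread p.
Proof.
apply: contrapT => nex.
(* [j] is the ideal of elements on whose basic open set the equation spreads; below, [M] is
   generated by the elements of [S] outside [p0] and the elements invertible at every [q] of the
   chart. *)
pose j (y : lc_T k) := forall (q : chart_pts J (lc_g k)) (p : spec S) th, p `<=` sval q ->
  cres q (p := p) th -> isunit (th y) -> spread p.
have j0 : j 0.
  move=> q p th pq cq; rewrite rmorph0 => /closed_pt_unit n.
  by case: n; exact: (ideal0 (closed_pt p)).
have jD x y : j x -> j y -> j (x + y).
  move=> jx jy q p th pq cq; rewrite rmorphD => /loc_sum_unit[]; [exact: (jx q p th pq cq)|exact: (jy q p th pq cq)].
have jM x y : j y -> j (x * y).
  move=> jy q p th pq cq; rewrite rmorphM mulrC => /isunitMl; exact: (jy q p th pq cq).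
pose M y := exists (x : S) (v : lc_T k), [/\ ~ p0 x, forall q, isunit (lc_eta q v) & y = lc_e k x * v].
have u1 (A : comPzRingType) : isunit (1 : A) by exists 1; rewrite mulr1.
have M1 : M 1 by exists 1, 1; split; [exact: prime_one|move=> q; rewrite rmorph1; exact: u1|rewrite rmorph1 mulr1].
have MM x y : M x -> M y -> M (x * y).
  move=> [x1 [v1 [n1 H1 ->]]] [x2 [v2 [n2 H2 ->]]]; exists (x1 * x2), (v1 * v2); split.
  - by move=> /(spec_prime p0).2[].
  - by move=> q; rewrite rmorphM; apply: isunitM.
  - by rewrite rmorphM mulrACA.
have Mj x : M x -> ~ Ideal j0 jD jM x.
  move=> [x1 [v [n1 Hv ->]]] jx; apply: nex; exists x1; split=> // p q pq Jq gq npx.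
  have [th [cq r]] := res_chart pq Jq gq.
  apply: (jx _ p th _ cq) => //; rewrite rmorphM (cres_e x1 cq); apply: isunitM; first exact: locmap_unit.
  exact: (cres_unit cq).
have [P [jP MP]] := krull M1 MM Mj.
(* [P] misses [M], so by [lc_prime] it specialises to the point of some [q]; its contraction [p] to
   [S] lies in [p0] and in that [q]. *)
have [|q qP] := lc_prime (l := k) (P := P).
  by move=> x Px ux; apply: (MP x) => //; exists 1, x; split; [exact: prime_one| |rewrite rmorph1 mul1r].
pose p : spec S := spec_preimage (lc_e k) P.
have pp0 : p `<=` p0.
  move=> x px; apply: contrapT => nx; apply: (MP (lc_e k x)) => //; exists x, 1; split=> //; last by rewrite mulr1.
  by move=> q'; rewrite rmorph1.
have pq : p `<=` sval q.
  move=> x px; apply: contrapT => nx; apply: (qP _ px); rewrite lc_etaE; exact: locmap_unit.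
have [th cq] := cres_ex pq.
have PN x : ~ P x <-> isunit (th x).
  have [u [s0 [w [nu uw e]]]] := lc_frac q x.
  have nPw : ~ P w by move=> /qP.
  have uw' := cres_unit cq uw.
  have E : th x * locmap p u = locmap p s0.
    apply: (unit_cancel uw'); rewrite -(cres_e u cq) -(cres_e s0 cq) mulrC -(mulrC (th w)).
    by apply/eqP; rewrite -subr_eq0 -mulrBr (mulrC (th x)) -rmorphM -rmorphB -rmorphM e rmorph0.
  have npu : ~ p u by move=> /pq.
  have PE : P (lc_e k u * x - lc_e k s0).
    by have /(spec_prime P).2[//|] : P (w * (lc_e k u * x - lc_e k s0)) by rewrite e; exact: ideal0.
  have Ps : P x <-> p s0.
    split=> [Px|ps].
      have : P (lc_e k u * x - (lc_e k u * x - lc_e k s0)) by apply: idealB => //; exact: idealMl.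
      by rewrite subKr.
    have : P (lc_e k u * x - lc_e k s0 + lc_e k s0) by apply: idealD.
    by rewrite subrK => /(spec_prime P).2[].
  split=> [nx|ux /Ps ps].
    by apply: (@isunitMl _ _ (locmap p u)); rewrite E; apply: locmap_unit => /Ps.
  have /locmap_unitP : isunit (locmap p s0); last by apply.
  by rewrite -E; apply: isunitM => //; exact: locmap_unit.
have [_ [U' vE]] := spread_below pp0.
have GE := germ_morE pq (svalP q).1 (cres_isres cq).
have Uy : U (lc_j k (spec_preimage (th \o lc_i k) (closed_pt p))).
  by move: (U'); rewrite GE.
have [ga [de [ep [nep _ E]]]] := @sec_frac _ _ (lc_j k) _ U Uy s.
have uep : isunit ((th \o lc_i k) ep) by exact/closed_pt_unit.
have [ude _ vE'] := E _ p _ _ GE uep.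
pose z := lc_e k d * lc_i k ga - lc_e k c * lc_i k de.
have thz : th z = 0.
  rewrite rmorphB !rmorphM (cres_e d cq) (cres_e c cq) -vE; apply/eqP; rewrite subr_eq0; apply/eqP.
  rewrite -[th (lc_i k ga)](vE' U') mulrCA mulrA; congr (_ * _).
have [u1' [s1 [w1 [nu1 uw1 e1]]]] := lc_frac q z.
have ths1 : locmap p s1 = 0.
  rewrite -(cres_e s1 cq); apply: (unit_cancel (cres_unit cq uw1)); rewrite mul0r mulrC.
  have := congr1 th e1; rewrite rmorph0 rmorphM rmorphB rmorphM thz mulr0 sub0r mulrN.
  by move=> /eqP; rewrite oppr_eq0 => /eqP.
have [u2 [nu2 u2E]] := locmap_eq0 ths1.
pose y := w1 * lc_e k (u1' * u2).
have yz : y * z = 0.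
  have : lc_e k u2 * (w1 * (lc_e k u1' * z - lc_e k s1)) = 0 by rewrite e1 mulr0.
  rewrite mulrBr mulrBr => /eqP; rewrite subr_eq0 => /eqP.
  have -> : lc_e k u2 * (w1 * lc_e k s1) = 0 by rewrite mulrCA -rmorphM u2E rmorph0 mulr0.
  by rewrite /y rmorphM => <-; ring.
have nY : ~ P (y * (lc_e k d * lc_i k ep)).
  move=> /(spec_prime P).2[/(spec_prime P).2[/qP //|]|/(spec_prime P).2[/pp0 //|]].
    by rewrite rmorphM => /(spec_prime P).2[/pq|].
  by apply/PN.
(* The product of [y], [d] and [ep] lies outside [P], but in [j]: where it is invertible, y z = 0
   gives z = 0, which is the equation c / d = ga / de. *)
apply/nY/jP => q' p' th' pq' cq' uY0.
have uY : isunit (th' y * (th' (lc_e k d) * th' (lc_i k ep))) by rewrite -!rmorphM.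
have uy : isunit (th' y) by exact: isunitMl uY.
have [ud' uep'] : isunit (th' (lc_e k d)) /\ isunit (th' (lc_i k ep)).
  move: uY; rewrite mulrC => /isunitMl ud; split; first exact: isunitMl ud.
  by move: ud; rewrite mulrC => /isunitMl.
rewrite (cres_e d cq') in ud'; split; first exact: locmap_unitP.
have [ude' U1 v1] := E _ p' _ _ (germ_morE pq' (svalP q').1 (cres_isres cq')) uep'.
exists U1; apply: (unit_cancel ude').
have : th' z = 0.
  by apply: (unit_cancel uy); rewrite mul0r mulrC -rmorphM yz rmorph0.
rewrite rmorphB !rmorphM (cres_e d cq') (cres_e c cq') => /eqP; rewrite subr_eq0 => /eqP e2.
by apply: (etrans _ e2); rewrite mulrAC mulrC; congr (_ * _); exact: v1.
Qed.

Lemma germ_spread : exists e, ~ p0 e /\ forall p : spec S, ~ p e -> spread p.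
Proof.
have [I [F HF]] := chart_cover wf gS ab.
have /choice[x xE] : forall i, exists x, ~ p0 x /\ forall k, F i = Some k -> forall p q : spec S, p `<=` q -> J `<=` q ->
    ~ q (lc_g k) -> ~ p x -> spread p.
  move=> i; case: (F i) => [k|]; last by exists 1; split=> //; exact: prime_one.
  by have [x [nx H]] := chart_spread k; exists x; split=> // k' [<-].
exists (\prod_i x i); split; first by apply: (mset_prod _ _ (mset_prime p0)) => i; have [] := xE i.
move=> p np; have [q [pq Jq]] := above p; have [i [k [Fi gq]]] := HF q Jq.
apply: ((xE i).2 k Fi p q) => // px; apply: np.
by rewrite (bigD1 i) //=; exact: idealMr.
Qed.

End Spread.

(** Values at closed points define the morphism by [mk_mor_spec], its local condition being
    [germ_spread]. Its restriction to each local ring is the germ [G p] ([gloc]), so both identities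
    can be checked on germs, where they hold by construction. *)
Lemma lift_good : exists g : mor (spec_lrs S) X, mor_comp f g = b /\ mor_comp g (spec_map (quotient_proj J)) = a.
Proof.
have [| |g [gE gv]] := @mk_mor_spec S X (fun p => G p (closed_pt p)) (fun p => val_at (G p)).
- by move=> p z; exact: val_at_unit.
- move=> p U Up s; have [_ fr _] := locmap_loc p; have [c [d [nd vE]]] := fr (val_at (G p) (germ Up s)).
  have [e [ne H]] := germ_spread nd vE; exists c, d, e; split=> // q /H[nq [U' E]].
  by exists U'.
(* A point [y] of the local spectrum corresponds to a prime inside [p], whose germ is the
   restriction of [G p] by [germ_mor_res]. *)
have gloc (p : spec S) : mor_comp g (spec_map (locmap p)) = G p.
  have rhoP (y : spec (localization p)) : exists rho : {rmorphism localization p -> localization (spec_preimage (locmap p) y)},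
      [/\ G (spec_preimage (locmap p) y) = mor_comp (G p) (spec_map rho),
          forall x, localization_map (locmap p) y (rho x) = locmap y x &
          spec_preimage rho (closed_pt _) = y].
    have sub : spec_preimage (locmap p) y `<=` p.
      move=> x yx; apply: contrapT => nx; apply: (@prime_one _ y); apply: (ideal_unit (locmap_unit nx)); exact: yx.
    have [|rho rE] := loc_lift (f := locmap (spec_preimage (locmap p) y)) (locmap_loc p).
      by move=> u nu; apply: locmap_unit => /sub.
    have E : (localization_map (locmap p) y \o rho : {rmorphism _ -> _}) = locmap y.
      apply: (loc_uniq (locmap_loc p)) => x.
      apply: (etrans (congr1 (localization_map (locmap p) y) (rE x))).
      exact: localization_map_locmap.
    have E' x : localization_map (locmap p) y (rho x) = locmap y x.
      exact: (congr1 (fun h : {rmorphism localization p -> localization y} => h x) E).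
    exists rho; split=> //; first exact: germ_mor_res.
    apply: spec_ext => x; split=> h; apply: contrapT => n.
      have : closed_pt (spec_preimage (locmap p) y) (rho x) by exact: h.
      apply/closed_pt_unit; apply: (@ev_spec_unit _ _ (locmap p) y).
      apply: (isunit_eq (esym (E' x))); exact: locmap_unit.
    have /closed_pt_unit u : ~ closed_pt (spec_preimage (locmap p) y) (rho x) by exact: n.
    apply: (@locmap_unitP _ y x _ h); apply: (isunit_eq (E' x)); exact: isunit_rmorph.
  apply: mor_ext_spec => [y|y U Uy Uy' s]; have [rho [GE rE yE]] := rhoP y.
    apply: (etrans (gE (spec_preimage (locmap p) y))); rewrite GE.
    by apply: (congr1 (G p)); exact: yE.
  apply: (etrans (@ev_spec _ _ (locmap p) X g y U Uy s)).
  have [c [d [e [ne E1 E2]]]] := @sec_frac _ _ (G p) y U Uy' s.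
  have [U1 [nd1 e1]] := E1 y ne.
  have ure : isunit (rho e).
    apply: (@ev_spec_unit _ _ (locmap p) y); apply: (isunit_eq (esym (rE e))); exact: locmap_unit.
  have [ud U2 v2] := E2 _ _ rho _ GE ure.
  apply: (unit_cancel (locmap_unit nd1)); apply: (etrans _ (esym (etrans (congr1 (fun t => t * locmap y d) (ev_irr Uy' U1 s)) e1))).
  have e3 := gv (spec_preimage (locmap p) y) U Uy U2 s.
  apply: (etrans (congr1 (fun t => localization_map (locmap p) y t * locmap y d) e3)).
  apply: (etrans (congr1 (fun t => localization_map (locmap p) y (val_at (G _) (germ U2 s)) * t) (esym (rE d)))).
  apply: (etrans (esym (rmorphM (localization_map (locmap p) y) _ _))).
  exact: (etrans (congr1 (localization_map (locmap p) y) (v2 U2)) (rE c)).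
exists g; split.
  by apply: mor_ext_local => m _; rewrite -mor_compA gloc; exact: germ_mor_base.
apply: mor_ext_local => t _.
pose q : spec S := spec_preimage (quotient_proj J) t.
have Jq : J `<=` q by move=> x /qproj_eq0 e; rewrite /q /= e; exact: ideal0.
pose lm := localization_map (quotient_proj J) t.
have lmE x : lm (locmap q x) = locmap t (quotient_proj J x) by exact: localization_map_locmap.
have [_ hl] := germ_mor_lift Jq.
have [|k kE] := qproj_lift (I := J) (f := quotient_proj (ext_ideal (locmap q) J) \o locmap q).
  by move=> x Jx; apply/qproj_eq0; exact: ext_ideal_gen.
have [|k2 k2E] := qproj_lift (I := ext_ideal (locmap q) J) (f := lm).
  have sub : ext_ideal (locmap q) J `<=` ideal_preimage lm (ideal_zero _).
    apply: ext_ideal_sub => x /qproj_eq0 e; apply: (etrans (lmE x)); rewrite e; exact: rmorph0.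
  by move=> x /sub.
have -> : mor_comp (mor_comp g (spec_map (quotient_proj J))) (spec_map (locmap t)) = mor_comp (G q) (spec_map lm).
  by rewrite -gloc !mor_comp_spec; apply: spec_map_eq => x; exact: (esym (lmE x)).
have -> : mor_comp (G q) (spec_map lm) = mor_comp (mor_comp (G q) (spec_map (quotient_proj (ext_ideal (locmap q) J)))) (spec_map k2).
  by rewrite mor_comp_spec; apply: spec_map_eq => x; exact: (esym (k2E x)).
rewrite (hl k kE) mor_comp_spec; apply: spec_map_eq => z; have [x ->] := qproj_surj z.
apply: (etrans (congr1 k2 (kE x))); apply: (etrans (k2E _)); exact: lmE.
Qed.

End Glue.

(** * Faithfully flat descent of morphisms *)

Lemma residue_field (A : comPzRingType) (p : spec A) : exists (k : comPzRingType) (r : {rmorphism A -> k}),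
  [/\ forall x, r x = 0 <-> p x, forall z : k, z <> 0 -> isunit z, (1 : k) <> 0
    & forall (D : comPzRingType) (h : {rmorphism A -> D}), (forall x, p x -> h x = 0) ->
        (forall x, ~ p x -> isunit (h x)) -> exists h' : {rmorphism k -> D}, forall x, h' (r x) = h x].
Proof.
have [l1 lu] := localization_is_local p.
pose r : {rmorphism A -> quotient_ring (localization_max p)} := quotient_proj (localization_max p) \o locmap p.
have r0 x : r x = 0 <-> p x by apply: (iff_trans (qproj_eq0 _ _)); exact: localization_max_locmap.
exists (quotient_ring (localization_max p)), r; split=> //.
- move=> z nz; have [x xE] := qproj_surj z; rewrite xE; apply: isunit_rmorph; apply: lu => mx.
  by apply: nz; rewrite xE; apply/qproj_eq0.
- by rewrite -(rmorph1 r) => /r0; exact: prime_one.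
- move=> D h h0 hu; have [h1 h1E] := loc_lift (locmap_loc p) hu.
  have [|h' h'E] := qproj_lift (I := localization_max p) (f := h1); last first.
    by exists h' => x; rewrite -h1E; exact: h'E.
  move=> z mz; have [_ fr _] := locmap_loc p; have [x [u [nu e]]] := fr z.
  have px : p x by apply/localization_max_locmap; rewrite -e; exact: idealMr.
  apply: (unit_cancel (hu u nu)); rewrite mul0r -h1E -rmorphM e h1E; exact: h0.
Qed.

(** The tensor product of the residue fields at [P] and [Q] over the residue field of their common
    contraction is nonzero, by flatness over a field; any of its maximal ideals gives [R]. *)
Lemma tens_spec (A S : comPzRingType) (f : {rmorphism A -> S}) (P Q : spec S) :
  (forall x, P (f x) <-> Q (f x)) ->
  exists R : spec (tens f f), spec_preimage (po1 (tens_rel f f)) R = P /\ spec_preimage (po2 (tens_rel f f)) R = Q.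
Proof.
move=> PQ; have [k [r [r0 ku k1 kl]]] := residue_field (spec_preimage f P).
have [k' [r' [r0' ku' k1' _]]] := residue_field P; have [k'' [r'' [r0'' ku'' k1'' _]]] := residue_field Q.
have unz (K : comPzRingType) (x : K) : (1 : K) <> 0 -> isunit x -> x <> 0.
  by move=> n1 [y e] x0; apply: n1; rewrite -e x0 mul0r.
have [||h' h'E] := kl _ (r' \o f).
- by move=> x px; apply/r0'.
- by move=> x npx; apply: ku' => /r0'.
have [||h'' h''E] := kl _ (r'' \o f).
- by move=> x px; apply/r0''; apply/PQ.
- by move=> x npx; apply: ku'' => /r0'' /PQ.
have fl : aflat h' by exact: aflat_field.
have D1 : (1 : tens h' h'') <> 0.
  move=> e; have [|J [c [b' [oneE cE]]]] := @tens_vanish _ _ h' _ h'' unit (fun=> 1) (fun=> 1) fl.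
    by apply: (etrans (esym (mulr1 _))); rewrite e; exact: mulr0.
  apply: k1'; rewrite (oneE tt) big1 // => j _; suff -> : c tt j = 0 by rewrite rmorph0 mul0r.
  apply: contrapT => /ku u; apply: (unz _ _ k1'' (isunit_rmorph h'' u)).
  by have := cE j; rewrite (big_pred1 tt) ?mulr1 // => -[].
have [m [mm _]] := maxideal_exists (c := ideal_zero (tens h' h'')) D1.
pose R0 := SpecPoint (maxideal_prime mm).
have [|t [t1 t2]] := @tens_lift _ _ f _ f _ (po1 (tens_rel h' h'') \o r') (po2 (tens_rel h' h'') \o r'').
  by move=> x /=; rewrite -[r' _]/((r' \o f) x) -[r'' _]/((r'' \o f) x) -h'E -h''E tens_comm.
have fieldpt (K : comPzRingType) (y : spec K) : (forall z : K, z <> 0 -> isunit z) -> forall z, y z <-> z = 0.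
  move=> Ku z; split=> [yz|->]; last exact: ideal0.
  by apply: contrapT => /Ku u; apply: (@prime_one _ y); exact: ideal_unit u yz.
exists (spec_preimage t R0); split; apply: spec_ext => x.
- rewrite -r0' -(fieldpt _ (spec_preimage (po1 (tens_rel h' h'')) R0) ku').
  by rewrite -[X in X <-> _]/(R0 (t _)) t1.
- rewrite -r0'' -(fieldpt _ (spec_preimage (po2 (tens_rel h' h'')) R0) ku'').
  by rewrite -[X in X <-> _]/(R0 (t _)) t2.
Qed.

Lemma factor_inj (A B C : comPzRingType) (f : {rmorphism A -> B}) (g : {rmorphism C -> B}) :
  (forall x, f x = 0 -> x = 0) -> (forall c, exists x, f x = g c) ->
  exists h : {rmorphism C -> A}, forall c, f (h c) = g c.
Proof.
move=> f0 /choice[h hE].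
have inj x y : f x = f y -> x = y.
  by move=> e; apply/eqP; rewrite -subr_eq0; apply/eqP/f0; rewrite rmorphB e subrr.
have hz : zmod_morphism h by move=> x y; apply: inj; rewrite rmorphB !hE rmorphB.
have hm : monoid_morphism h.
  by split=> [|x y]; apply: inj; rewrite ?rmorph1 ?rmorphM !hE ?rmorph1 ?rmorphM.
by exists (mk_rmorph hz hm).
Qed.

Lemma val_at_locmap (S : comPzRingType) (p : spec S) (Z : lrs) (g : mor (spec_lrs S) Z)
    (H : mor (spec_lrs (localization p)) Z) (U : opens Z) (U1 : U (H (closed_pt p))) (U2 : U (g p)) (s : sec Z U) :
  H = mor_comp g (spec_map (locmap p)) -> val_at H (germ U1 s) = ev U2 s.
Proof.
move=> E; have [c [d [e [ne E1 E2]]]] := @sec_frac _ _ g p U U2 s.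
have [U3 [nd e1]] := E1 p ne; have [ud _ v] := E2 _ p (locmap p) _ E (locmap_unit ne).
apply: (unit_cancel ud); rewrite (v U1) -e1; apply: (congr1 (fun t => t * locmap p d)); exact: ev_irr.
Qed.

Section Descent.
Context (A S : comPzRingType) (io : {rmorphism A -> S}).
Hypotheses (fio : aflat io) (io0 : forall x, io x = 0 -> x = 0).
Hypothesis over : forall (c : ideal S) (p : spec A), (forall x, c (io x) -> p x) ->
  exists P : spec S, c `<=` P /\ forall x, P (io x) <-> p x.
Context (X : scheme) (g : mor (spec_lrs S) X).
Hypothesis gg : mor_comp g (spec_map (po1 (tens_rel io io))) = mor_comp g (spec_map (po2 (tens_rel io io))).

Lemma over_pt (p : spec A) : exists P : spec S, forall x, P (io x) <-> p x.
Proof.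
have [|P [_ PE]] := over (c := ideal_zero S) (p := p); last by exists P.
by move=> x /io0 ->; exact: ideal0.
Qed.

Lemma descent_pt (P Q : spec S) : (forall x, P (io x) <-> Q (io x)) -> g P = g Q.
Proof.
move=> /tens_spec[R [<- <-]].
exact: (congr1 (fun h : mor (spec_lrs (tens io io)) X => h R) gg).
Qed.

Definition descends (p : spec A) (H : mor (spec_lrs (localization p)) X) :=
  forall (P : spec S) (rho : {rmorphism localization p -> localization P}),
    (forall x, rho (locmap p x) = locmap P (io x)) -> mor_comp H (spec_map rho) = mor_comp g (spec_map (locmap P)).

(** Injectivity: an element [v] outside [P] that kills [io x] is, by flatness, a combination of
    elements of [A] that kill [x], and one of these lies outside [p]. *)
Lemma local_map (p : spec A) (P : spec S) : (forall x, P (io x) <-> p x) ->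
  exists rho : {rmorphism localization p -> localization P},
    [/\ forall x, rho (locmap p x) = locmap P (io x), forall z, rho z = 0 -> z = 0
      & forall z, closed_pt P (rho z) <-> closed_pt p z].
Proof.
move=> PE; have [|rho rE] := loc_lift (f := locmap P \o io) (locmap_loc p).
  by move=> u nu; apply: locmap_unit => /PE.
exists rho; split=> // z; have [_ fr _] := locmap_loc p; have [x [u [nu e]]] := fr z.
  move=> z0; apply: (unit_cancel (locmap_unit nu)); rewrite mul0r e.
  have /locmap_eq0[v [nv vE]] : locmap P (io x) = 0 by rewrite -[LHS]rE -e rmorphM z0 mul0r.
  have [|J [c [b' [vE' cE]]]] := @aflat_ann _ _ io x v fio; first by rewrite mulrC.
  have [j nj] : exists j, ~ P (io (c j)).
    apply: contrapT => n; apply: nv; rewrite vE'.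
    apply: (big_ind (fun y => P y)) => [|y y'|j _]; [exact: ideal0|exact: idealD|].
    by apply: idealMr; apply: contrapT => nj; apply: n; exists j.
  have npc : ~ p (c j) by move=> /PE.
  apply: (unit_cancel (locmap_unit npc)); rewrite mul0r -rmorphM cE; exact: rmorph0.
have uu : isunit (rho (locmap p u)) by apply: isunit_rmorph; exact: locmap_unit.
split=> h; apply: contrapT => /closed_pt_unit uz.
  by have /closed_pt_unit := isunit_rmorph rho uz; apply.
have px : p x by apply/closed_pt_locmap; rewrite -e; exact: idealMr.
have : isunit (rho z * rho (locmap p u)) by exact: isunitM.
by rewrite -rmorphM e rE => /locmap_unitP; apply; apply/PE.
Qed.

Lemma descends_eq (p : spec A) H H' : @descends p H -> @descends p H' ->
  H (closed_pt p) = H' (closed_pt p) /\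
  forall (U : opens X) (U1 : U (H (closed_pt p))) (U2 : U (H' (closed_pt p))) (s : sec X U), val_at H (germ U1 s) = val_at H' (germ U2 s).
Proof.
move=> dH dH'; have [P PE] := over_pt p; have [rho [rE r0 rc]] := local_map PE.
have E := etrans (dH P rho rE) (esym (dH' P rho rE)); split.
  have <- : spec_preimage rho (closed_pt P) = closed_pt p by apply: spec_ext => z; exact: rc.
  exact: (congr1 (fun h : mor (spec_lrs (localization P)) X => h (closed_pt P)) E).
move=> U U1 U2 s; apply/eqP; rewrite -subr_eq0; apply/eqP; apply: r0; rewrite rmorphB.
have [U1' <-] := val_at_res U1 s (erefl (mor_comp H (spec_map rho))).
have [U2' <-] := val_at_res U2 s E.
by rewrite (Prop_irrelevance U1' U2') subrr.
Qed.

(** On a neighbourhood of [p0] the morphism [g] lands in a single chart, so it is a ring map [ps]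
    into a localization of [S]. The two maps to the tensor square agree on its values, so these are
    fractions over the localization of [A], hence elements of it by faithful flatness. *)
Lemma descend_near (p0 : spec A) : exists (a0 : A) (A' : comPzRingType) (lam : {rmorphism A -> A'})
    (h : mor (spec_lrs A') X),
  [/\ ~ p0 a0, is_loc (fun u => exists n, u = a0 ^+ n) lam &
    forall (p : spec A) (th : {rmorphism A' -> localization p}), ~ p a0 -> (forall x, th (lam x) = locmap p x) ->
      @descends p (mor_comp h (spec_map th))].
Proof.
have [P0 P0E] := over_pt p0.
have [B [j [oj [rj _]]]] := @small_chart X (g P0) (opensT X) I.
pose V (P : spec S) := rangeo oj (g P).
pose c x := forall P : spec S, ~ V P -> P x.
have c0 : c 0 by move=> P _; exact: ideal0.
have cD x y : c x -> c y -> c (x + y) by move=> cx cy P nV; apply: idealD; [exact: cx|exact: cy].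
have cM x y : c y -> c (x * y) by move=> cy P nV; apply: idealMl; exact: cy.
(* Otherwise some prime over [p0] would contain all functions that vanish outside the preimage of
   the chart, although [g] sends it to the same point as [P0], which is in the chart. *)
have [a0 na0 ca0] : exists2 a0, ~ p0 a0 & c (io a0).
  apply: contrapT => n; have [|P [cP PE]] := over (c := Ideal c0 cD cM) (p := p0).
    by move=> x cx; apply: contrapT => nx; apply: n; exists x.
  have VP : V P by rewrite /V (@descent_pt P P0) // => x; rewrite PE P0E.
  have [e [ne H]] := @spec_nbhd S (opens_preimage (rs_cts g) (rangeo oj)) P VP.
  by apply: ne; apply: cP => Q nV; apply: contrapT => nQ; apply: nV; exact: H.
have [A' [lam llam]] := mloc_pow a0; have [S' [sg lsg]] := mloc_pow (io a0).
have [|io' io'E] := loc_lift (f := sg \o io) llam.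
  by move=> _ [n ->]; have [un _ _] := lsg; apply: un; exists n; rewrite rmorphXn.
have fio' : aflat io'.
  apply: (@aflat_descend _ _ _ _ lam (sg \o io) io' _ (mset_pow a0) llam).
    by move=> x; rewrite io'E.
  exact: (aflat_comp (fun x => erefl ((sg \o io) x)) fio (aflat_loc (mset_pow (io a0)) lsg)).
have io'0 z : io' z = 0 -> z = 0.
  move=> z0; have [un fr ke] := llam; have [x [_ [[n ->] e]]] := fr z.
  have un' : isunit (lam (a0 ^+ n)) by apply: un; exists n.
  apply: (unit_cancel un'); rewrite mul0r e.
  have [_ _ ke'] := lsg; have [|_ [[k ->] e']] := ke' (io x).
    by have := congr1 io' e; rewrite rmorphM z0 mul0r io'E.
  have e0 : a0 ^+ k * x = 0 by apply: io0; rewrite rmorphM rmorphXn.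
  have uk : isunit (lam (a0 ^+ k)) by apply: un; exists k.
  by apply: (unit_cancel uk); rewrite mul0r mulrC -rmorphM e0 rmorph0.
have [|ps psE] := @chart_factor _ _ _ oj S' (mor_comp g (spec_map sg)).
  move=> Q; apply: contrapT => nV; have [un _ _] := lsg.
  apply: (@prime_one _ Q); apply: (ideal_unit (un (io a0) _)); first by exists 1%N; rewrite expr1.
  exact: (ca0 (spec_preimage sg Q) nV).
pose q1 := po1 (tens_rel io' io'); pose q2 := po2 (tens_rel io' io').
have [|t [t1 t2]] := @tens_lift _ _ io _ io _ (q1 \o sg) (q2 \o sg).
  by move=> x; rewrite /= -[sg _]/((sg \o io) x) -io'E; exact: tens_comm.
have qE : (q1 \o ps : {rmorphism B -> _}) = q2 \o ps.
  apply: (chart_mono oj); rewrite -!mor_comp_spec -psE !mor_comp_spec.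
  rewrite (spec_map_eq g (u := q1 \o sg) (v := t \o po1 (tens_rel io io))); last by move=> x; exact: (esym (t1 x)).
  rewrite (spec_map_eq g (u := q2 \o sg) (v := t \o po2 (tens_rel io io))); last by move=> x; exact: (esym (t2 x)).
  by rewrite -!mor_comp_spec gg.
have [|ps' ps'E] := factor_inj (f := io') (g := ps) io'0.
  move=> b; have [|J [r [s [b' [oneE rE]]]]] := @tens_equalizer _ _ io' (ps b) fio'.
    exact: (congr1 (fun k : {rmorphism B -> tens io' io'} => k b) qE).
  (* The denominators [s j] generate the unit ideal of [A']: a prime containing them all would lie
     under one of [S'], where they generate the unit ideal. A partition of unity then combines the
     fractions. *)
  pose K z := exists c : J -> A', z = \sum_j c j * s j.
  have K0 : K 0 by exists (fun=> 0); rewrite big1 // => i _; rewrite mul0r.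
  have KD x y : K x -> K y -> K (x + y).
    by move=> [c1 ->] [c2 ->]; exists (fun i => c1 i + c2 i); rewrite -big_split; apply: eq_bigr => i _; rewrite mulrDl.
  have KM x y : K y -> K (x * y).
    by move=> [c1 ->]; exists (fun i => x * c1 i); rewrite mulr_sumr; apply: eq_bigr => i _; rewrite mulrA.
  have [c1 c1E] : Ideal K0 KD KM 1.
    apply: ideal_one => p' Kp'; have [P PE] := over_pt (spec_preimage lam p').
    have npa : ~ P (io a0).
      move=> /PE pa; have [un _ _] := llam; apply: (@prime_one _ p'); apply: (ideal_unit (un a0 _) pa).
      by exists 1%N; rewrite expr1.
    have [|P' P'E] := loc_prime (mset_pow (io a0)) lsg (p := P).
      by move=> _ [n ->]; exact: prime_pow.
    apply: (@prime_one _ P'); rewrite oneE.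
    apply: (big_ind (fun y => P' y)) => [|y y'|i _]; [exact: ideal0|exact: idealD|].
    apply: idealMr; have [un fr _] := llam; have [x [_ [[n ->] e]]] := fr (s i).
    have un' : isunit (io' (lam (a0 ^+ n))) by apply: isunit_rmorph; apply: un; exists n.
    have px : p' (lam x).
      rewrite -e; apply: idealMr; apply: Kp'; exists (fun k => (k == i)%:R).
      by rewrite (bigD1 i) //= eqxx mul1r big1 ?addr0 // => k /negPf ->; rewrite mul0r.
    have : P' (io' (s i) * io' (lam (a0 ^+ n))).
      by rewrite -rmorphM e io'E; apply/P'E/PE.
    move=> /(spec_prime P').2[//|] h; case: (@prime_one _ P'); exact: ideal_unit un' h.
  exists (\sum_j c1 j * r j).
  rewrite -[ps b]mul1r -(rmorph1 io') c1E !rmorph_sum mulr_suml; apply: eq_bigr => i _.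
  by rewrite !rmorphM rE mulrA.
exists a0, A', lam, (mor_comp j (spec_map ps')); split=> // p th np thE P rho rE.
have npa : ~ P (io a0).
  move=> h; apply: (@locmap_unitP _ P (io a0) _ h); rewrite -rE; apply: isunit_rmorph; exact: locmap_unit.
have [|et etE] := loc_lift (f := locmap P) lsg.
  by move=> _ [n ->]; apply: locmap_unit; exact: prime_pow.
have E : (rho \o th : {rmorphism A' -> _}) = et \o io'.
  apply: (loc_uniq llam) => x; apply: (etrans (congr1 rho (thE x))); rewrite rE.
  by rewrite -etE; exact: (congr1 et (esym (io'E x))).
transitivity (mor_comp j (spec_map (et \o ps))).
  rewrite !mor_comp_spec; apply: spec_map_eq => x.
  apply: (etrans (congr1 (fun k : {rmorphism A' -> localization P} => k (ps' x)) E)).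
  exact: (congr1 et (ps'E x)).
by rewrite -mor_comp_spec -psE mor_comp_spec; apply: spec_map_eq => x; exact: etE.
Qed.

Lemma lam_lift (a0 : A) (A' : comPzRingType) (lam : {rmorphism A -> A'}) (p : spec A) :
  is_loc (fun u => exists n, u = a0 ^+ n) lam -> ~ p a0 ->
  exists th : {rmorphism A' -> localization p}, forall x, th (lam x) = locmap p x.
Proof. by move=> ll np; apply: (loc_lift ll) => _ [n ->]; apply: locmap_unit; exact: prime_pow. Qed.

(** Two local solutions have the same values, since local rings of [A] embed in those of [S]
    ([descends_eq]); so the local solutions glue by [mk_mor_spec]. *)
Lemma descent : exists c : mor (spec_lrs A) X, mor_comp c (spec_map io) = g.
Proof.
have ex p : exists H, @descends p H.
  have [a0 [A' [lam [h [na0 ll D]]]]] := descend_near p; have [th thE] := lam_lift ll na0.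
  by exists (mor_comp h (spec_map th)); exact: D.
pose H p := projT1 (cid (ex p)); have HP p : descends (H p) := projT2 (cid (ex p)).
have sh (R : comPzRingType) (v x y z : R) : v * (x * y * z) = v * x * z * y by ring.
have [||c [cE cv]] := @mk_mor_spec A X (fun p => H p (closed_pt p)) (fun p => val_at (H p)).
- by move=> p z; exact: val_at_unit.
- move=> p0 U U0 s; have [a0 [A' [lam [h [na0 ll D]]]]] := descend_near p0.
  have [th0 th0E] := lam_lift ll na0; have d0 := D p0 th0 na0 th0E.
  have Uh : U (h (spec_preimage th0 (closed_pt p0))).
    by have [E _] := descends_eq (HP p0) d0; move: (U0); rewrite E.
  have [c [d [e [ne _ E]]]] := @sec_frac _ _ h _ U Uh s.
  have [un fr _] := ll.
  have [c0 [_ [[n1 ->] e1]]] := fr c; have [d0' [_ [[n2 ->] e2]]] := fr d; have [e0 [_ [[n3 ->] e3]]] := fr e.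
  have ne0 : ~ p0 e0.
    move=> pe; apply: ne; have u3 : isunit (lam (a0 ^+ n3)) by apply: un; exists n3.
    have : (spec_preimage th0 (closed_pt p0) : spec A') (e * lam (a0 ^+ n3)).
      have : closed_pt p0 (th0 (lam e0)) by rewrite th0E; apply/closed_pt_locmap.
      by rewrite -e3.
    move=> /(spec_prime (spec_preimage th0 (closed_pt p0))).2[//|h3].
    by case: (@prime_one _ (spec_preimage th0 (closed_pt p0))); exact: ideal_unit u3 h3.
  exists (c0 * a0 ^+ n2), (d0' * a0 ^+ n1), (e0 * a0); split; first by move=> /(spec_prime p0).2[].
  move=> p np; have npa : ~ p a0 by move=> h1; apply: np; exact: idealMl.
  have npe : ~ p e0 by move=> h1; apply: np; exact: idealMr.
  have [th thE] := lam_lift ll npa; have dp := D p th npa thE.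
  have eqn x y n : x * lam (a0 ^+ n) = lam y -> th x * locmap p (a0 ^+ n) = locmap p y.
    by move=> exy; rewrite -!thE -rmorphM exy.
  have ue : isunit (th e).
    by apply: (@isunitMl _ _ (locmap p (a0 ^+ n3))); rewrite (eqn _ _ _ e3); exact: locmap_unit.
  have [ud U1 v] := E _ p th _ erefl ue.
  have [Ept Ev] := descends_eq (HP p) dp.
  have U' : U (H p (closed_pt p)) by rewrite Ept.
  exists U'; rewrite (Ev U U' U1 s); split.
    move=> /(spec_prime p).2[pd|/(prime_pow npa)//].
    by apply: (@locmap_unitP _ p d0' _ pd); rewrite -(eqn _ _ _ e2); apply: isunitM => //; apply: locmap_unit; exact: prime_pow.
  rewrite !rmorphM -(eqn _ _ _ e1) -(eqn _ _ _ e2) -(v U1).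
  exact: sh.
exists c; apply: mor_ext_spec => [P|P U U1 U2 s].
  pose p := spec_preimage io P.
  have rE x : localization_map io P (locmap p x) = locmap P (io x) by exact: localization_map_locmap.
  have PE x : P (io x) <-> p x by [].
  have [rho [r1 _ rc]] := local_map PE.
  apply: (etrans (cE p)).
  have <- : spec_preimage rho (closed_pt P) = closed_pt p by apply: spec_ext => z; exact: rc.
  apply: (etrans (congr1 (fun h : mor (spec_lrs (localization P)) X => h (closed_pt P)) (HP p P rho r1))).
  by apply: (congr1 g); apply: spec_ext => x; exact: closed_pt_locmap.
pose p := spec_preimage io P.
have rE x : localization_map io P (locmap p x) = locmap P (io x) by exact: localization_map_locmap.
have U0 : U (H p (closed_pt p)) by rewrite -(cE p); exact: U1.
apply: (etrans (@ev_spec _ _ io X c P U U1 s)).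
apply: (etrans (congr1 (localization_map io P) (cv p U U1 U0 s))).
have [U3 <-] := val_at_res U0 s (erefl (mor_comp (H p) (spec_map (localization_map io P)))).
exact: val_at_locmap (HP p P _ rE).
Qed.

End Descent.

(** * Existence of lifts along a henselian pair *)

Lemma flat_epi (A S : comPzRingType) (io : {rmorphism A -> S}) (Z : lrs) (h h' : mor (spec_lrs A) Z) :
  aflat io -> (forall p : spec A, exists P : spec S, forall x, P (io x) <-> p x) ->
  mor_comp h (spec_map io) = mor_comp h' (spec_map io) -> h = h'.
Proof.
move=> fio over e.
have pt (p : spec A) : exists P : spec S, p = spec_preimage io P.
  by have [P PE] := over p; exists P; apply: spec_ext => x; rewrite -PE.
apply: mor_ext_spec => [p|p U U1 U2 s]; have [P pE] := pt p; subst p.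
  exact: (congr1 (fun k : mor (spec_lrs S) Z => k P) e).
have [rho [rE r0 _]] := local_map (p := spec_preimage io P) (P := P) fio (fun x => conj id id).
have E : rho = localization_map io P.
  apply: (loc_uniq (locmap_loc (spec_preimage io P))) => x; apply: (etrans (rE x)).
  exact: (esym (localization_map_locmap io P x)).
subst rho; apply/eqP; rewrite -subr_eq0; apply/eqP; apply: r0; rewrite rmorphB; apply/eqP; rewrite subr_eq0; apply/eqP.
apply: (etrans (esym (@ev_spec _ _ io Z h P U U1 s))); apply: (etrans _ (@ev_spec _ _ io Z h' P U U2 s)).
exact: (congr1 (stalk_val P) (@stalk_map_eq _ _ (mor_comp h (spec_map io)) (mor_comp h' (spec_map io)) P U U1 U2 s e)).
Qed.

(** The quotient of [S] by I S is the base change of [S] to A / I. *)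
Lemma aflat_quotient (A S : comPzRingType) (io : {rmorphism A -> S}) (I : ideal A)
    (k : {rmorphism quotient_ring I -> quotient_ring (ext_ideal io I)}) :
  (forall x, k (quotient_proj I x) = quotient_proj _ (io x)) -> aflat io -> aflat k.
Proof.
move=> kE fio; pose i1 := po1 (tens_rel io (quotient_proj I)); pose i2 := po2 (tens_rel io (quotient_proj I)).
have [|t [t1 t2]] := @tens_lift _ _ io _ (quotient_proj I) _ (quotient_proj (ext_ideal io I)) k.
  by move=> x; rewrite kE.
have [|t' t'E] := qproj_lift (I := ext_ideal io I) (f := i1).
  have sub : ext_ideal io I `<=` ideal_preimage i1 (ideal_zero _).
    apply: ext_ideal_sub => x /qproj_eq0 e; apply: (etrans (tens_comm io (quotient_proj I) x)).
    by rewrite e rmorph0.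
  by move=> x /sub.
have tK : cancel t t'.
  move=> z; apply: (@po_uniq _ _ _ _ (t' \o t) idfun _ _ z) => [s|y].
    exact: (etrans (congr1 t' (t1 s)) (t'E s)).
  have [x ->] := qproj_surj y.
  apply: (etrans (congr1 t' (etrans (t2 _) (kE x)))); apply: (etrans (t'E _)).
  exact: tens_comm.
have tV : cancel t' t.
  move=> z; have [s ->] := qproj_surj z; exact: (etrans (congr1 t (t'E s)) (t1 s)).
have bt : bijective t by exists t'.
have bi : bijective (idfun : {rmorphism quotient_ring I -> quotient_ring I}) by exists id.
exact: (aflat_iso bi bt t2).1 (aflat_base fio).
Qed.

(** Over the good extension [S] the lift exists by [lift_good]. Its two pullbacks to the tensor
    square agree by [global_uniq], because that ring is integral over [A] and so the extension of
    [I] stays in the radical ([int_jac]). [descent] then gives a lift over [A], whose two identities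
    are checked after the faithfully flat extensions by [flat_epi]. *)
Lemma wet_henselian_lifting (X Y : scheme) (f : mor X Y) : wet_charts f -> henselian_lifting_property f.
Proof.
move=> wf A I hI i a b ab.
suff [c [c1 c2]] : exists c : mor (Spec A) X, mor_comp f c = b /\ mor_comp c i = a.
  exists c; split=> // c' [c'1 c'2]; apply: (global_uniq wf hI.1); first by rewrite c1 c'1.
  by rewrite -/i c2 c'2.
(* The good extension is formed over nonzero rings; over the zero ring the spectrum is empty. *)
have [z|nz] := pselect ((1 : A) = 0).
  have ne (q : spec A) : False by apply: (@prime_one _ q); rewrite z; exact: ideal0.
  have [||c _] := @mk_mor_spec A X (fun q => False_rect _ (ne q)) (fun q => False_rect _ (ne q)).
  - by move=> q; case: (ne q).
  - by move=> q; case: (ne q).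
  exists c; split; apply: mor_ext_spec => q; case: (ne _).
  - exact: q.
  - exact: q.
  - exact: (spec_preimage (quotient_proj I) q).
  - exact: (spec_preimage (quotient_proj I) q).
have [A' e] := nz_ring nz; subst A.
have V0 : void -> False by case.
pose S : comPzRingType := gc A' void; pose io : {rmorphism A' -> S} := gcst A' void.
have int : intalg io by exact: gc_intalg.
have fio : aflat io by exact: gc_flat.
have io0 x : io x = 0 -> x = 0 by exact: gcst_inj.
have over (c : ideal S) (p : spec A') : (forall x, c (io x) -> p x) ->
    exists P : spec S, c `<=` P /\ forall x, P (io x) <-> p x.
  exact: lying_over.
pose J := ext_ideal io I.
have JJ : J `<=` @jacobson_radical S by apply: int_jac => //; exact: hI.1.
have conn (p : spec S) (W : spec S -> Prop) :
  (forall q : spec S, p `<=` q /\ J `<=` q -> exists u, ~ q u /\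
     forall q' : spec S, p `<=` q' /\ J `<=` q' -> ~ q' u -> (W q' <-> W q)) ->
  forall q q' : spec S, p `<=` q /\ J `<=` q -> p `<=` q' /\ J `<=` q' -> W q -> W q'.
  have TE (q : spec S) : ideal_add p J `<=` q <-> p `<=` q /\ J `<=` q.
    split=> [h|[h1 h2]]; last exact: ideal_add_sub.
    by split=> x hx; apply: h; [exact: ideal_addl|exact: ideal_addr].
  move=> H q q' /TE Tq /TE Tq'.
  apply: (@henselian_connected A' S io I p W int hI) => // q1 /TE /H[u [nu uE]].
  by exists u; split=> // q2 /TE; exact: uE.
have [|kap kapE] := qproj_lift (I := I) (f := quotient_proj J \o io).
  by move=> x Ix; apply/qproj_eq0; exact: ext_ideal_gen.
have [|g [g1 g2]] := lift_good wf (@gc_good A' void : good S) (a := mor_comp a (spec_map kap)) (b := mor_comp b (spec_map io)) _ JJ conn.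
  by rewrite mor_compA ab /i !mor_comp_spec; apply: spec_map_eq => x; exact: kapE.
pose p1 := po1 (tens_rel io io); pose p2 := po2 (tens_rel io io).
have comm x : p1 (io x) = p2 (io x) by exact: tens_comm.
pose K := ext_ideal (p1 \o io) I.
have gg : mor_comp g (spec_map p1) = mor_comp g (spec_map p2).
  apply: (global_uniq wf (I := K)).
  - by apply: int_jac; [exact: (tens_intalg (f := io))|exact: hI.1].
  - by rewrite !mor_compA g1 !mor_comp_spec; apply: spec_map_eq => x; exact: comm.
  have fac (u : {rmorphism S -> tens io io}) : (forall x, u (io x) = p1 (io x)) ->
      exists v : {rmorphism quotient_ring J -> quotient_ring K}, forall x, v (quotient_proj J x) = quotient_proj K (u x).
    move=> uE; apply: (qproj_lift (f := quotient_proj K \o u)).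
    have sub : J `<=` ideal_preimage u K.
      by apply: ext_ideal_sub => x Ix; rewrite /= uE; exact: (ext_ideal_gen (p1 \o io)).
    by move=> x /sub Kx; apply/qproj_eq0.
  have key (u : {rmorphism S -> tens io io}) (v : {rmorphism quotient_ring J -> quotient_ring K}) :
      (forall x, v (quotient_proj J x) = quotient_proj K (u x)) ->
      mor_comp (mor_comp g (spec_map u)) (spec_map (quotient_proj K)) = mor_comp a (spec_map (v \o kap)).
    move=> vE; rewrite -mor_comp_spec -g2 !mor_comp_spec; apply: spec_map_eq => x; exact: (esym (vE x)).
  have [v1 v1E] := fac p1 (fun x => erefl _); have [v2 v2E] := fac p2 (fun x => esym (comm x)).
  rewrite (key p1 v1 v1E) (key p2 v2 v2E); apply: spec_map_eq => y; have [x ->] := qproj_surj y.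
  rewrite -[LHS]/(v1 (kap _)) -[RHS]/(v2 (kap _)) kapE v1E v2E; exact: (congr1 (quotient_proj K) (comm x)).
have [c cE] := descent fio io0 over gg; exists c; split.
  apply: (flat_epi fio (over_pt io0 over)); rewrite -mor_compA cE; exact: g1.
apply: (flat_epi (aflat_quotient kapE fio)).
  move=> t; have [P PE] := over_pt io0 over (spec_preimage (quotient_proj I) t).
  have JP : J `<=` P.
    apply: ext_ideal_sub => x Ix; apply/PE; have /qproj_eq0 e := Ix.
    by rewrite -[spec_preimage _ _ _]/(t (quotient_proj I x)) e; exact: ideal0.
  have [t' t'E] := quot_prime JP; exists t' => y; have [x ->] := qproj_surj y.
  rewrite kapE; apply: (iff_trans (t'E _)); exact: PE.
rewrite -g2 -cE /i !mor_comp_spec; apply: spec_map_eq => x; exact: kapE.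
Qed.

Theorem theorem1 (X Y : scheme) (f : mor X Y) :
  henselian_lifting_property f <-> weakly_etale f.
Proof.
split; first exact: hlp_weakly_etale.
by move=> /weakly_etale_charts; exact: wet_henselian_lifting.
Qed.
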